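(* Consider an i-MCMC algorithm $(X^{(l)})_{l\ge0}$ with occupation measures $\eta^{(k)}_n=\frac1{n+1}\sum_{p=0}^n\delta_{X^{(k)}_p}$ satisfying the regularity conditions (R1), (R2), (R3) given in the context. Let $(w^{(l)})_{l\ge0}\in\mathcal{W}^{\mathbb{N}}$ be a collection of weight array functions. Then the flow of weighted random fields $(V^{(l)}_n)_{l\ge0}$, where $V_n^{(l)}$ is the random field on $\mathcal{B}(S^{(l)})$ $$V^{(l)}_n:=\sum_{0\le p\le n}w^{(l)}_n(p)\,\delta^{(l)}_p,\qquad \delta^{(l)}_p:=\delta_{X^{(l)}_p}-\Phi^{(l)}\big(\eta^{(l-1)}_{p-1}\big),$$ (with the convention $\delta^{(l)}_0=\delta_{X^{(l)}_0}-\nu^{(l)}$), converges in law, as $n\to\infty$ and in the sense of finite dimensional distributions, to a sequence of independent and centered Gaussian fields $(V^{(l)})_{l\ge0}$ with covariance functions $$\mathbb{E}\big(V^{(l)}(f)V^{(l)}(g)\big)=\pi^{(l)}\left[C^{(l)}(f,g)\right],\qquad f,g\in\mathcal{B}(S^{(l)}),$$ where, writing $M=M^{(l)}_{\pi^{(l-1)}}$ and $P=P^{(l)}_{\pi^{(l-1)}}$ for its resolvent operator, $$C^{(l)}(f,g)(x):=M\big[(P(f)-MP(f)(x))\,(P(g)-MP(g)(x))\big](x).$$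
   Context: Notation. For a measurable space $E$: $\mathcal{P}(E)$ is the set of probability measures, $\mathcal{B}(E)$ the Banach space of bounded measurable real functions with the sup norm $\|\cdot\|$, $\mathcal{B}_1(E)$ its closed unit ball, $\mu(f)=\int f\,d\mu$. A bounded integral operator $M$ from $E$ into $F$ acts as $M(f)(x)=\int M(x,dy)f(y)$ and dually on signed measures by $(\mu M)(f)=\mu(M(f))$. $\mathrm{osc}(f)=\sup_{x,y}|f(x)-f(y)|$ and the Dobrushin coefficient is $\beta(M)=\sup\{\mathrm{osc}(M(f)):\mathrm{osc}(f)\le1\}$. An integral operator from a function space $\mathcal{B}(S)$ into a function space $\mathcal{H}$ is a kernel $\Gamma(f,dg)$ giving for each $f\in\mathcal{B}(S)$ a nonnegative measure on functions $g\in\mathcal{H}$. Setting. $(S^{(l)})_{l\ge0}$ are measurable spaces, $\pi^{(l)}\in\mathcal{P}(S^{(l)})$, and $\Phi^{(l)}:\mathcal{P}(S^{(l-1)})\to\mathcal{P}(S^{(l)})$, $l\ge1$, satisfy $\Phi^{(l)}(\pi^{(l-1)})=\pi^{(l)}$; by convention $\Phi^{(0)}(\mu)=\pi^{(0)}$. For $l\ge1$ and $\mu\in\mathcal{P}(S^{(l-1)})$, $M^{(l)}_\mu$ is a Markov transition on $S^{(l)}$ with $\Phi^{(l)}(\mu)M^{(l)}_\mu=\Phi^{(l)}(\mu)$; $M^{(0)}_\mu=M^{(0)}$ is a fixed Markov transition on $S^{(0)}$ with $\pi^{(0)}M^{(0)}=\pi^{(0)}$. $\nu^{(l)}\in\mathcal{P}(S^{(l)})$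 are initial distributions. i-MCMC algorithm. $X^{(0)}=(X^{(0)}_n)_{n\ge0}$ is a Markov chain with $X^{(0)}_0\sim\nu^{(0)}$ and transition $M^{(0)}$. For $k\ge1$, given the lower-level processes $X^{(0)},\dots,X^{(k-1)}$, $X^{(k)}=(X^{(k)}_n)_{n\ge0}$ is a time-inhomogeneous Markov chain with $X^{(k)}_0\sim\nu^{(k)}$ and transition $M^{(k)}_{\eta^{(k-1)}_n}$ from time $n$ to time $n+1$. Regularity conditions. (R1) For every $l\ge0$ and $\mu,\eta\in\mathcal{P}(S^{(l)})$, $\Phi^{(l+1)}(\mu)-\Phi^{(l+1)}(\eta)=(\mu-\eta)D_{l+1}+\Xi_l(\mu,\eta)$, where $D_{l+1}$ is a bounded integral operator from $S^{(l)}$ into $S^{(l+1)}$ that may depend on $\eta$, and $\Xi_l(\mu,\eta)$ is a signed measure on $S^{(l+1)}$ with $|\Xi_l(\mu,\eta)(f)|\le\int|(\mu-\eta)^{\otimes2}(g)|\,\widehat\Xi_l(f,dg)$ for all $f\in\mathcal{B}(S^{(l+1)})$, for some integral operator $\widehat\Xi_l$ from $\mathcal{B}(S^{(l+1)})$ into the set $\mathcal{T}_2(S^{(l)})$ of tensor product functions $g=\sum_{i\in I}a_i(h^1_i\otimes h^2_i)$, $I\subset\mathbb{N}$, $h_i^1,h_i^2\in\mathcal{B}(S^{(l)})$, $a_i\in\mathbb{R}$, with $|g|:=\sum_{i\in I}|a_i|\|h^1_i\|\|h^2_i\|<\infty$, and $\sup_{f\in\mathcal{B}_1(S^{(l+1)})}\int|g|\,\widehat\Xi_l(f,dg)<\infty$.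 (R2) For every $l\ge0$ there is an integer $n_l\geq 1$ with $\sup_{\mu\in\mathcal{P}(S^{(l-1)})}\beta((M^{(l)}_\mu)^{n_l})<1$ (for $l=0$: $\beta((M^{(0)})^{n_0})<1$). (R3) For every $l\ge1$, $f\in\mathcal{B}(S^{(l)})$, $\mu,\nu\in\mathcal{P}(S^{(l-1)})$: $\|[M^{(l)}_\mu-M^{(l)}_\nu](f)\|\le\int|[\mu-\nu](g)|\,\Gamma_{l,\mu}(f,dg)$ for integral operators $\Gamma_{l,\mu}$ from $\mathcal{B}(S^{(l)})$ into $\mathcal{B}(S^{(l-1)})$ with $\sup_\mu\int\Gamma_{l,\mu}(f,dg)\|g\|\le\Lambda_l\|f\|$ and $\Lambda_l<\infty$. Resolvent. $P^{(l)}_\mu(f):=\sum_{n\ge0}\left[(M^{(l)}_\mu)^n-\Phi^{(l)}(\mu)\right](f)$, an absolutely convergent series under (R2) (for $l=0$ use $M^{(0)}$ and $\pi^{(0)}$). Weights. $\mathcal{W}$ is the set of nonnegative arrays $w=(w_n(p))_{0\le p\le n,\,n\ge0}$, non-increasing in $p$, such that $\sum_{n\ge0}w_n(0)^m<\infty$ for some $m\ge1$; for every $\epsilon\in[0,1]$ the limit $\varpi(\epsilon):=\lim_{n\to\infty}\sum_{0\le p\le\lfloor\epsilon n\rfloor}w_n(p)^2$ exists and is finite; and $\varpi(\epsilon_0)\to0$ as $\epsilon_0\to0+$, $\varpi(\epsilon_1)\to1$ as $\epsilon_1\to1-$.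
   Formalization: The measures Γ(f,dg) (and the one in (R1)) are taken on families of functions for which (g,x)↦g(x) and the norm of g are measurable, which the text leaves implicit and without which the claim can fail; the random transitions are assumed measurable in the sample. *)

(* Defs.v *)
From HB Require Import structures.
From mathcomp Require Import all_boot all_order all_algebra.
From mathcomp Require Import all_classical all_reals all_analysis measurable_realfun.

Set Implicit Arguments.
Unset Strict Implicit.
Unset Printing Implicit Defensive.

Import Order.TTheory GRing.Theory Num.Theory.
Import numFieldNormedType.Exports.

Local Open Scope classical_set_scope.
Local Open Scope ring_scope.

(** * Bounded measurable functions and integral operators *)

(** The space B(E). *)
Record bmfun {d} (E : measurableType d) (R : realType) := BMFun {
  bmfun_fun :> {mfun E >-> R};
  bmfun_bounded : bounded_fun (bmfun_fun : E -> R) }.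

(** [supnorm] and [osc] take values in [\bar R], so that no boundedness proof
    is needed to give them a meaning. *)
Definition supnorm {R : realType} {E : Type} (f : E -> R) : \bar R :=
  ereal_sup [set `|f x|%:E | x in [set: E]].

Definition osc {R : realType} {E : Type} (f : E -> R) : \bar R :=
  ereal_sup [set `|f u.1 - f u.2|%:E | u in [set: E * E]].

Definition kop {d d'} {E : measurableType d} {F : measurableType d'}
    {R : realType} (K : E -> {measure set F -> \bar R}) (f : F -> R) : E -> R :=
  fun x => \int[K x]_y f y.

Definition dobrushin {d d'} {E : measurableType d} {F : measurableType d'}
    {R : realType} (T : (F -> R) -> E -> R) : \bar R :=
  ereal_sup [set osc (T f) | f in [set f : bmfun F R | (osc f <= 1)%E]].

(** The integral against a signed measure is that against its Jordan
    decomposition; it does not depend on the Hahn decomposition chosen. *)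
Definition charge_int {d} {E : measurableType d} {R : realType}
    (nu : {charge set E -> \bar R}) (f : E -> R) : R :=
  let: exist _ hP := cid (Hahn_decomposition nu) in
  let: exist _ hN := cid hP in
  \int[jordan_pos hN]_x f x - \int[jordan_neg hN]_x f x.

Definition charge_kop {d d'} {E : measurableType d} {F : measurableType d'}
    {R : realType} (D : E -> {charge set F -> \bar R}) (f : F -> R) : E -> R :=
  fun x => charge_int (D x) f.

(** The kernels of bounded integral operators are signed. *)
Definition bounded_integral_operator {d d'} {E : measurableType d}
    {F : measurableType d'} {R : realType}
    (D : E -> {charge set F -> \bar R}) : Prop :=
  forall f : bmfun F R,
    measurable_fun [set: E] (charge_kop D f) /\ bounded_fun (charge_kop D f).

(** * Measures on sets of functions *)

(** A nonnegative measure [dg] on B(E) is given by a measure [fm_meas] on a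
    measurable space of parameters [t] and a family of functions [g_t], i.e.
    [\int F(g) dg] is [\int F(g_t) fm_meas(dt)].  This covers every sigma-algebra
    on B(E) for which the evaluation [(g, x) |-> g x] and the norm are
    measurable (parameters are then the functions themselves).  Joint
    measurability of the evaluation is what lets [dg] be exchanged with
    integration over [x]. *)
Record fun_measure {d} (E : measurableType d) (R : realType) := FunMeasure {
  fm_disp : measure_display;
  fm_param : measurableType fm_disp;
  fm_meas : {measure set fm_param -> \bar R};
  fm_fun : fm_param -> bmfun E R;
  fm_fun_measurable :
    measurable_fun [set: fm_param * E] (fun u => fm_fun u.1 u.2);
  fm_norm_measurable :
    measurable_fun [set: fm_param] (fun t => supnorm (fm_fun t)) }.

(** Tensor product functions [\sum_(i in I) a_i (h1_i \otimes h2_i)] with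
    summable norm, as presentations: the norm depends on the presentation. *)
Record tensor2 {d} (E : measurableType d) (R : realType) := Tensor2 {
  t2_idx : set nat;
  t2_coef : nat -> R;
  t2_left : nat -> bmfun E R;
  t2_right : nat -> bmfun E R;
  t2_summable : (\esum_(i in t2_idx) (`|t2_coef i|%:E *
                   supnorm (t2_left i) * supnorm (t2_right i)) < +oo)%E }.

Definition t2_norm {d} {E : measurableType d} {R : realType}
    (g : tensor2 E R) : \bar R :=
  (\esum_(i in t2_idx g) (`|t2_coef g i|%:E *
     supnorm (t2_left g i) * supnorm (t2_right g i)))%E.

Definition t2_val {d} {E : measurableType d} {R : realType}
    (g : tensor2 E R) (u : E * E) : R :=
  limn (series (fun i => if i \in t2_idx g then
    t2_coef g i * (t2_left g i u.1 * t2_right g i u.2) else 0)).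

(** Measures on T_2(E), presented in the same way as [fun_measure]. *)
Record tensor_measure {d} (E : measurableType d) (R : realType) :=
    TensorMeasure {
  tm_disp : measure_display;
  tm_param : measurableType tm_disp;
  tm_meas : {measure set tm_param -> \bar R};
  tm_fun : tm_param -> tensor2 E R;
  tm_fun_measurable :
    measurable_fun [set: tm_param * (E * E)] (fun u => t2_val (tm_fun u.1) u.2);
  tm_norm_measurable :
    measurable_fun [set: tm_param] (fun t => t2_norm (tm_fun t)) }.

(** [(mu - eta)^{\otimes 2}(g)] *)
Definition diff_tensor2 {d} {E : measurableType d} {R : realType}
    (mu eta : probability E R) (g : E * E -> R) : R :=
  \int[(mu \x mu)%E]_u g u - \int[(mu \x eta)%E]_u g u
  - \int[(eta \x mu)%E]_u g u + \int[(eta \x eta)%E]_u g u.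

(** * Occupation measures *)

Section empirical.
Context {d} {E : measurableType d} {R : realType}.
Variables (x : nat -> E) (n : nat).

Definition empirical : set E -> \bar R :=
  mscale (n.+1%:R^-1)%:nng (msum (fun p => \d_(x p)) n.+1).

HB.instance Definition _ := Measure.on empirical.

Let empirical_setT : empirical [set: E] = 1%E.
Proof.
transitivity ((n.+1%:R^-1)%:E * \sum_(k < n.+1) \d_(x k) [set: E] : \bar R)%E.
  by [].
under eq_bigr do rewrite diracT.
rewrite sumEFin sumr_const card_ord.
by rewrite -EFinM mulVf// pnatr_eq0.
Qed.

HB.instance Definition _ :=
  Measure_isProbability.Build _ _ _ empirical empirical_setT.
End empirical.

(** * Interacting MCMC models *)

Section imcmc.
Context {R : realType} {d : nat -> measure_display}
        {S : forall l, measurableType (d l)}.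

(** [Phi k] and [M k] are the maps of level [k.+1], driven by laws on [S k].
    For a sequence [mu] of laws on the levels, [level_Phi] and [level_M] give
    Phi^(l) and M^(l) at [mu (l - 1)], with the convention at level 0. *)
Definition level_Phi (pi0 : probability (S 0%N) R)
    (Phi : forall k, probability (S k) R -> probability (S k.+1) R)
    (mu : forall k, probability (S k) R) (l : nat) : probability (S l) R :=
  match l with 0 => pi0 | k.+1 => Phi k (mu k) end.

Definition level_M (M0 : R.-pker (S 0%N) ~> (S 0%N))
    (M : forall k, probability (S k) R -> R.-pker (S k.+1) ~> (S k.+1))
    (mu : forall k, probability (S k) R) (l : nat) : R.-pker (S l) ~> (S l) :=
  match l with 0 => M0 | k.+1 => M k (mu k) end.

Definition invariant_law {d'} {E : measurableType d'}
    (mu : probability E R) (K : R.-pker E ~> E) : Prop :=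
  forall A, measurable A -> (\int[mu]_x K x A)%E = mu A.

Section regularity.
Variable Phi : forall k, probability (S k) R -> probability (S k.+1) R.
Variable M0 : R.-pker (S 0%N) ~> (S 0%N).
Variable M : forall k, probability (S k) R -> R.-pker (S k.+1) ~> (S k.+1).

Definition R1 : Prop := forall l,
  exists (D : probability (S l) R -> S l -> {charge set (S l.+1) -> \bar R})
    (Xi : probability (S l) R -> probability (S l) R ->
          {charge set (S l.+1) -> \bar R})
    (hXi : bmfun (S l.+1) R -> tensor_measure (S l) R),
  [/\ forall eta, bounded_integral_operator (D eta),
      forall mu eta (f : bmfun (S l.+1) R),
        \int[Phi mu]_x f x - \int[Phi eta]_x f x =
        (\int[mu]_x charge_kop (D eta) f x - \int[eta]_x charge_kop (D eta) f x)
        + charge_int (Xi mu eta) f,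
      forall mu eta (f : bmfun (S l.+1) R),
        (`|charge_int (Xi mu eta) f|%:E <=
         \int[tm_meas (hXi f)]_t
           `|diff_tensor2 mu eta (t2_val (tm_fun t))|%:E)%E
    & (ereal_sup [set \int[tm_meas (hXi f)]_t t2_norm (tm_fun t) |
         f in [set f : bmfun (S l.+1) R | supnorm f <= 1]] < +oo)%E].

Definition R2 : Prop :=
  (exists n, (1 <= n)%N /\ (dobrushin (iter n (kop M0)) < 1)%E) /\
  forall k, exists n, (1 <= n)%N /\
    (ereal_sup [set dobrushin (iter n (kop (M mu))) |
       mu in [set: probability (S k) R]] < 1)%E.

Definition R3 : Prop := forall k,
  exists (Lambda : R)
    (Gamma : probability (S k) R -> bmfun (S k.+1) R -> fun_measure (S k) R),
  (forall (f : bmfun (S k.+1) R) mu nu,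
     (supnorm (fun x => kop (M mu) f x - kop (M nu) f x)%R <=
      \int[fm_meas (Gamma mu f)]_t
        `|\int[mu]_x fm_fun t x - \int[nu]_x fm_fun t x|%:E)%E) /\
  (forall f : bmfun (S k.+1) R,
     (ereal_sup [set \int[fm_meas (Gamma mu f)]_t supnorm (fm_fun t) |
        mu in [set: probability (S k) R]] <= Lambda%:E * supnorm f)%E).
End regularity.

Section process.
Context {dO : measure_display} {Omega : measurableType dO}.
Variable P : probability Omega R.
Variable X : forall l, nat -> {RV P >-> S l}.

Definition occupation (n : nat) (omega : Omega) (k : nat) :
    probability (S k) R :=
  empirical (fun p => X k p omega) n.

(** The sigma-algebra generated by the variables [X l p] with [I l p]. *)
Definition sigma_of (I : nat -> nat -> Prop) : set (set Omega) :=
  <<s [set A | exists l p (B : set (S l)),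
         [/\ I l p, measurable B & A = X l p @^-1` B] ]>>.

(** Given all the levels below [k], X^(k) is a Markov chain with initial law
    [nu k] and transition M^(k) at the current occupation measure of the level
    below.  The first clause says that these transitions are measurable in the
    sample defining the occupation measure, so that the chain makes sense. *)
Definition is_imcmc (nu : forall l, probability (S l) R)
    (M0 : R.-pker (S 0%N) ~> (S 0%N))
    (M : forall k, probability (S k) R -> R.-pker (S k.+1) ~> (S k.+1)) : Prop :=
  [/\ forall k n (A : set (S k.+1)), measurable A ->
        measurable_fun [set: n.+1.-tuple (S k) * S k.+1]
          (fun u => M k (empirical (fun p => nth point u.1 p) n) u.2 A),
      forall k (A : set (S k)) (G : set Omega), measurable A ->
        sigma_of (fun l _ => (l < k)%N) G ->
        P (G `&` X k 0%N @^-1` A) = (P G * nu k A)%E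
    & forall k n (A : set (S k)) (G : set Omega), measurable A ->
        sigma_of (fun l p => (l < k)%N \/ (l = k /\ (p <= n)%N)) G ->
        P (G `&` X k n.+1 @^-1` A) =
        (\int[P]_(omega in G)
           level_M M0 M (occupation n omega) k (X k n omega) A)%E].

Variables (nu : forall l, probability (S l) R) (pi0 : probability (S 0%N) R).
Variable Phi : forall k, probability (S k) R -> probability (S k.+1) R.

Definition local_error (l p : nat) (f : S l -> R) (omega : Omega) : R :=
  f (X l p omega) -
  match p with
  | 0 => \int[nu l]_x f x
  | q.+1 => \int[level_Phi pi0 Phi (occupation q omega) l]_x f x
  end.

Definition weighted_field (w : nat -> nat -> nat -> R) (n l : nat)
    (f : S l -> R) (omega : Omega) : R :=
  \sum_(0 <= p < n.+1) w l n p * local_error p f omega.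
End process.
End imcmc.

(** * Weights *)

(** [w n p] stands for w_n(p); only its values for [p <= n] matter. *)
Definition weights {R : realType} (w : nat -> nat -> R) : Prop :=
  [/\ forall n p, (p <= n)%N -> 0 <= w n p,
      forall n p q, (p <= q <= n)%N -> w n q <= w n p,
      exists m, (1 <= m)%N /\ cvgn (series (fun n => w n 0%N ^+ m))
    & exists varpi : R -> R,
      [/\ forall eps, 0 <= eps <= 1 ->
            \sum_(0 <= p < (Num.truncn (eps * n%:R)).+1) w n p ^+ 2
              @[n --> \oo] --> varpi eps,
          varpi eps @[eps --> 0^'+] --> (0 : R)
        & varpi eps @[eps --> 1^'-] --> (1 : R)]].

(** * Limiting covariance *)

Section covariance.
Context {d} {E : measurableType d} {R : realType}.

(** [mu] is the invariant law of [K] here. *)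
Definition resolvent (K : R.-pker E ~> E) (mu : probability E R)
    (f : E -> R) (x : E) : R :=
  limn (series (fun n => iter n (kop K) f x - \int[mu]_y f y)).

Definition local_covariance (K : R.-pker E ~> E) (mu : probability E R)
    (f g : E -> R) (x : E) : R :=
  let Pf := resolvent K mu f in
  let Pg := resolvent K mu g in
  kop K (fun y => (Pf y - kop K Pf x) * (Pg y - kop K Pg x)) x.
End covariance.

(** * Gaussian fields and independence *)

Section gaussian.
Context {d} {Omega : measurableType d} {R : realType}.
Variable P : probability Omega R.

(** Dirac masses are the Gaussian laws of variance 0; [normal_prob] is only
    meant for a nonzero standard deviation. *)
Definition gaussian_rv (Y : Omega -> R) : Prop :=
  exists m s : R, forall A : set R, measurable A ->
    P (Y @^-1` A) = (if s == 0 then \d_m A else normal_prob m s A).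

Definition centered_gaussian_field {I : Type} (V : I -> {RV P >-> R}) : Prop :=
  (forall n (a : 'I_n -> R) (f : 'I_n -> I),
     gaussian_rv (fun omega => \sum_(i < n) a i * V (f i) omega)) /\
  (forall f, 'E_P[V f] = 0)%E.

Definition independent_fields {I : nat -> Type}
    (V : forall l, I l -> {RV P >-> R}) : Prop :=
  forall n (A : nat -> set Omega),
    (forall l, (l < n)%N ->
       <<s [set G | exists (f : I l) (B : set R),
              measurable B /\ G = V l f @^-1` B] >> (A l)) ->
    P (\bigcap_(l in [set l | (l < n)%N]) A l) = (\prod_(l < n) P (A l))%E.
End gaussian.

(** Convergence in law of finite dimensional distributions, for sequences of
    families of real random variables indexed by [I]. *)
Definition fdd_cvg {R : realType} {I : Type}
    {d} {Omega : measurableType d} (P : probability Omega R)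
    (Vn : nat -> I -> Omega -> R)
    {d'} {Omega' : measurableType d'} (P' : probability Omega' R)
    (V : I -> Omega' -> R) : Prop :=
  forall m (f : 'I_m -> I) (phi : 'rV[R]_m -> R),
    continuous phi -> bounded_fun phi ->
    'E_P[fun omega => phi (\row_i Vn n (f i) omega)]%E @[n --> \oo] -->
    'E_P'[fun omega => phi (\row_i V (f i) omega)]%E.

(* Main.v *)
Require Import Defs.
From HB Require Import structures.
From mathcomp Require Import all_boot all_order all_algebra.
From mathcomp Require Import all_classical all_reals all_analysis measurable_realfun.
From mathcomp Require Import ring lra.

(** Solving the Poisson equation of the frozen kernels M^(l)_(eta_p) writes the
    local errors of level l as martingale increments, up to a telescoping term
    and the variation of the kernels in time, which is O(1/p) by (R3); both are
    negligible after weighting.  The conditional variances converge by a law of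
    large numbers along the levels: (R3) turns the convergence of the occupation
    measures of level l - 1 into that of the kernels of level l.  Compensating
    cos (U + martingale) by the exponential of the conditional variance then
    gives a central limit theorem at level l that is uniform over the variables
    U of the lower levels, so the joint characteristic functions factor by
    induction on the levels.

    The limit fields live on the Loeb space of the ultrapower of Omega: V^(l)(f)
    is the standard part of the sequence V^(l)_n(f), and its characteristic
    functions are the limits just computed, so that Fourier uniqueness gives
    Gaussianity and independence.  Kolmogorov's extension theorem is thereby
    avoided, which matters as the index set B(S^(l)) is uncountable. *)

Set Implicit Arguments.
Unset Strict Implicit.
Unset Printing Implicit Defensive.

Import Order.TTheory GRing.Theory Num.Theory.
Import numFieldNormedType.Exports.

Local Open Scope classical_set_scope.
Local Open Scope ring_scope.

(** Characteristic functions are kept real: [cos (a + t * Y)] with a free phase [a] carries both the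
    cosine and the sine transform, a centered Gaussian law shows as a factor in front of [cos a],
    and independence as multiplicativity of these factors.

    Convergence of the kernels is available for one fixed test function at a time, not in operator
    norm. The perturbation estimates therefore let the difference of two kernels act only on
    resolvents of one of them; in the limit this is the fixed kernel at the limit law.

    The third order terms of the expansion vanish because the largest weight [w n 0] tends to 0
    while the sum of the squared weights tends to 1.

    The fields are not bounded uniformly in [n]. Their standard part is taken after compression into
    (-1, 1), and bounded second moments make the points at infinity negligible. The same moments
    give the tightness that Fourier convergence needs; the approximating trigonometric polynomials
    obey the bound of the test function everywhere, so that mass outside a large box contributes
    little. *)

Lemma cvgnP {R : realType} (u : nat -> R) (l : R) :
  u n @[n --> \oo] --> l <->
  forall e : R, 0 < e -> exists N, forall n, (N <= n)%N -> `|u n - l| <= e.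
Proof.
split.
  move=> /cvgrPdist_le h e e0; have [N _ hN] := h e e0.
  by exists N => n Nn; rewrite distrC; exact: hN.
move=> h; apply/cvgrPdist_le => e e0; have [N hN] := h e e0.
by exists N => // n Nn /=; rewrite distrC; exact: hN.
Qed.

Lemma cvgn_le {R : realType} (u v : nat -> R) (l : R) :
  (forall n, `|u n - l| <= v n) -> v n @[n --> \oo] --> (0 : R) ->
  u n @[n --> \oo] --> l.
Proof.
move=> h /cvgnP hv; apply/cvgnP => e e0; have [N hN] := hv e e0.
exists N => n /hN; rewrite subr0 => hn.
by rewrite (le_trans (h n))// (le_trans _ hn)// ler_norm.
Qed.

Lemma cvgn_norm_le {R : realType} (u : nat -> R) (l c : R) :
  u n @[n --> \oo] --> l -> (forall n, `|u n| <= c) -> `|l| <= c.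
Proof.
move=> /cvgnP ul hc; apply/ler_addgt0Pr => e e0.
have [n hn] := ul e e0; have := hn n (leqnn _); have := hc n.
by rewrite !ler_norml => /andP[h1 h2] /andP[h3 h4]; apply/andP; split; lra.
Qed.

Lemma cvg_invS {R : realType} : n.+1%:R^-1 @[n --> \oo] --> (0 : R).
Proof. exact: cvg_harmonic. Qed.

(** * Bounded measurable functions and their integrals *)

Definition bm {d} {T : measurableType d} {R : realType} (f : T -> R) : Prop :=
  measurable_fun setT f /\ exists c : R, forall x, `|f x| <= c.

Section bm_closure.
Context {d} {T : measurableType d} {R : realType}.
Implicit Types f g : T -> R.

Lemma bm_meas f : bm f -> measurable_fun setT f. Proof. by case. Qed.

Lemma bm_bound f : bm f -> exists2 c : R, 0 <= c & forall x, `|f x| <= c.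
Proof.
move=> [_ [c hc]]; exists c => //.
exact: le_trans (normr_ge0 _) (hc point).
Qed.

Lemma bmP f c : measurable_fun setT f -> (forall x, `|f x| <= c) -> bm f.
Proof. by move=> mf hc; split=> //; exists c. Qed.

Lemma bm_cst (r : R) : bm (fun _ : T => r).
Proof. by apply: (@bmP _ `|r|). Qed.

Lemma bmD f g : bm f -> bm g -> bm (fun x => f x + g x).
Proof.
move=> [mf [a ha]] [mg [b hb]]; apply: (@bmP _ (a + b)).
  exact: measurable_funD.
by move=> x; rewrite (le_trans (ler_normD _ _))// lerD.
Qed.

Lemma bmM f g : bm f -> bm g -> bm (fun x => f x * g x).
Proof.
move=> [mf [a ha]] [mg [b hb]]; apply: (@bmP _ (a * b)).
  exact: measurable_funM.
by move=> x; rewrite normrM ler_pM.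
Qed.

Lemma bmZ r f : bm f -> bm (fun x => r * f x).
Proof. by move=> hf; apply: bmM => //; exact: bm_cst. Qed.

Lemma bmN f : bm f -> bm (fun x => - f x).
Proof.
move=> hf; have := bmZ (-1) hf; congr bm; apply/funext => x.
by rewrite mulN1r.
Qed.

Lemma bmB f g : bm f -> bm g -> bm (fun x => f x - g x).
Proof. by move=> hf hg; apply: bmD => //; exact: bmN. Qed.

Lemma bm_sum (I : Type) (s : seq I) (p : pred I) (h : I -> T -> R) :
  (forall i, bm (h i)) -> bm (fun x => \sum_(i <- s | p i) h i x).
Proof.
move=> hh; elim: s => [|i s IH].
  by under eq_fun do rewrite big_nil; exact: bm_cst.
under eq_fun do rewrite big_cons.
by case: (p i) => //; exact: bmD.
Qed.

Lemma bmX f n : bm f -> bm (fun x => f x ^+ n).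
Proof.
move=> hf; elim: n => [|n IH].
  by under eq_fun do rewrite expr0; exact: bm_cst.
by under eq_fun do rewrite exprS; exact: bmM.
Qed.

Lemma bm_norm f : bm f -> bm (fun x => `|f x|).
Proof.
move=> [mf [c hc]]; apply: (@bmP _ c); last by move=> x; rewrite normr_id.
exact: measurableT_comp.
Qed.

Lemma bm_cos f : measurable_fun setT f -> bm (fun x => cos (f x)).
Proof.
move=> mf; apply: (@bmP _ 1).
  by apply: (measurableT_comp _ mf); apply: continuous_measurable_fun; exact: continuous_cos.
by move=> x; rewrite ler_norml cos_le1 cos_geN1.
Qed.

Lemma bm_sin f : measurable_fun setT f -> bm (fun x => sin (f x)).
Proof.
move=> mf; apply: (@bmP _ 1).
  by apply: (measurableT_comp _ mf); apply: continuous_measurable_fun; exact: continuous_sin.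
by move=> x; rewrite ler_norml sin_le1 sin_geN1.
Qed.

Lemma bm_expR f c : measurable_fun setT f -> (forall x, f x <= c) ->
  bm (fun x => expR (f x)).
Proof.
move=> mf hc; apply: (@bmP _ (expR c)).
  by apply: (measurableT_comp _ mf); exact: measurable_expR.
by move=> x; rewrite ger0_norm ?expR_ge0// ler_expR.
Qed.

Lemma bm_lim (h : nat -> T -> R) f c : (forall n, measurable_fun setT (h n)) ->
  (forall x, (h n x) @[n --> \oo] --> f x) -> (forall x, `|f x| <= c) -> bm f.
Proof.
move=> mh hf hc; apply: (@bmP _ c) => //.
by apply: (@measurable_fun_cvg _ _ _ setT h) => // x _; exact: hf.
Qed.

End bm_closure.

Lemma bm_comp {d d'} {T : measurableType d} {T' : measurableType d'}
    {R : realType} (u : T' -> T) (f : T -> R) :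
  measurable_fun setT u -> bm f -> bm (fun x => f (u x)).
Proof.
move=> mu [mf [c hc]]; apply: (@bmP _ _ _ _ c) => //.
exact: measurableT_comp.
Qed.


Lemma bound_bounded_fun {T : Type} {R : realType} (f : T -> R) (c : R) :
  (forall x, `|f x| <= c) -> bounded_fun f.
Proof.
move=> hc; exists c; split; first exact: num_real.
by move=> y cy x _; exact: le_trans (hc x) (ltW cy).
Qed.

Lemma bounded_fun_bound {T : Type} {R : realType} (f : T -> R) :
  bounded_fun f -> exists c : R, forall x, `|f x| <= c.
Proof.
by move=> [M [_ hM]]; exists (M + 1) => x; apply: hM; rewrite // ltrDl.
Qed.

Section bm_bmfun.
Context {d} {T : measurableType d} {R : realType}.

Lemma bmfun_bm (f : bmfun T R) : bm f.
Proof.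
split; first exact: measurable_funPT.
exact: bounded_fun_bound (bmfun_bounded f).
Qed.

(** The way back to the bundled type, over which (R2) and (R3) quantify. *)
Lemma bm_bmfun (f : T -> R) : bm f -> exists g : bmfun T R, bmfun_fun g = f :> (T -> R).
Proof.
move=> [mf [c hc]].
pose m := isMeasurableFun.Build _ _ _ _ f mf.
pose g : {mfun T >-> R} := HB.pack f m.
have bg : bounded_fun (g : T -> R).
  exact: bound_bounded_fun hc.
by exists (BMFun bg).
Qed.
End bm_bmfun.

Section bm_integral.
Context {d} {T : measurableType d} {R : realType}.
Variable mu : {measure set T -> \bar R}.
Hypothesis mu1 : mu setT = 1%E.
Implicit Types f g : T -> R.

(** Measures of mass 1 are taken as plain measures, so that the same lemmas serve the values of
    kernels, product measures, Dirac masses and Loeb measures. *)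
Lemma bm_integrable f : bm f -> mu.-integrable setT (EFin \o f).
Proof.
move=> [mf [c hc]]; apply: measurable_bounded_integrable => //.
  by rewrite mu1 ltry.
exact: bound_bounded_fun hc.
Qed.

Lemma bm_EFin f : bm f -> (\int[mu]_x (f x)%:E)%E = (\int[mu]_x f x)%:E.
Proof. by move=> hf; rewrite /Rintegral fineK//; apply: integrable_fin_num => //; exact: bm_integrable. Qed.

Lemma bmI_cst r : \int[mu]_x (fun _ => r) x = r.
Proof. by rewrite Rintegral_cst// mu1 mulr1. Qed.

Lemma bmID f g : bm f -> bm g ->
  \int[mu]_x (f x + g x) = \int[mu]_x f x + \int[mu]_x g x.
Proof. by move=> hf hg; rewrite RintegralD//; exact: bm_integrable. Qed.

Lemma bmIB f g : bm f -> bm g ->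
  \int[mu]_x (f x - g x) = \int[mu]_x f x - \int[mu]_x g x.
Proof. by move=> hf hg; rewrite RintegralB//; exact: bm_integrable. Qed.

Lemma bmIZ r f : bm f -> \int[mu]_x (r * f x) = r * \int[mu]_x f x.
Proof. by move=> hf; rewrite RintegralZl//; exact: bm_integrable. Qed.

Lemma bmI_sum (I : Type) (s : seq I) (h : I -> T -> R) : (forall i, bm (h i)) ->
  \int[mu]_x (\sum_(i <- s) h i x) = \sum_(i <- s) \int[mu]_x h i x.
Proof.
move=> hh; elim: s => [|i s IH].
  by under eq_Rintegral do rewrite big_nil; rewrite bmI_cst big_nil.
under eq_Rintegral do rewrite big_cons.
by rewrite big_cons -IH bmID//; exact: bm_sum.
Qed.

Lemma bmI_le f g : bm f -> bm g -> (forall x, f x <= g x) ->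
  \int[mu]_x f x <= \int[mu]_x g x.
Proof. by move=> hf hg fg; apply: le_Rintegral => //; exact: bm_integrable. Qed.

Lemma bmI_norm f : bm f -> `|\int[mu]_x f x| <= \int[mu]_x `|f x|.
Proof. by move=> hf; apply: le_normr_Rintegral => //; exact: bm_integrable. Qed.

Lemma bmI_norm_le f g : bm f -> bm g -> (forall x, `|f x| <= g x) ->
  `|\int[mu]_x f x| <= \int[mu]_x g x.
Proof.
move=> hf hg fg; apply: le_trans (bmI_norm hf) _.
by apply: bmI_le => //; exact: bm_norm.
Qed.

Lemma bmI_bound f c : bm f -> (forall x, `|f x| <= c) -> `|\int[mu]_x f x| <= c.
Proof.
move=> hf hc; rewrite -[c]bmI_cst; apply: bmI_norm_le => //; exact: bm_cst.
Qed.

Lemma bmI_dist f g c : bm f -> bm g -> (forall x, `|f x - g x| <= c) ->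
  `|\int[mu]_x f x - \int[mu]_x g x| <= c.
Proof.
by move=> hf hg hc; rewrite -bmIB//; apply: bmI_bound => //; exact: bmB.
Qed.

Lemma bmI_cvg (h : nat -> T -> R) f (c : R) : (forall n, bm (h n)) ->
  (forall x, (h n x) @[n --> \oo] --> f x) ->
  (forall n x, `|h n x| <= c) ->
  (\int[mu]_x h n x) @[n --> \oo] --> \int[mu]_x f x.
Proof.
move=> bh hf hc.
have mf : measurable_fun setT f.
  by apply: (@measurable_fun_cvg _ _ _ setT h) => // n; case: (bh n).
have mh n : measurable_fun setT (EFin \o h n).
  by apply/measurable_EFinP; case: (bh n).
have [] := @dominated_convergence _ _ _ mu setT measurableT
  (fun n => EFin \o h n) (EFin \o f) (EFin \o cst c) mh.
- exact/measurable_EFinP.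
- by apply: aeW => x _; apply/fine_cvgP; split; [exact: nearW|exact: hf].
- by apply: bm_integrable; exact: bm_cst.
- by apply: aeW => x n _ /=; rewrite lee_fin.
move=> fi _ cv; apply: fine_cvg.
rewrite /Rintegral fineK; last exact: integrable_fin_num.
exact: cv.
Qed.
End bm_integral.

(** * Taylor bounds for sine, cosine and the exponential *)

Section trig_bounds.
Context {R : realType}.
Implicit Types x y s t : R.

Lemma derive_ge0_le (f df : R -> R) : (forall x, is_derive x 1 f (df x)) ->
  (forall x, 0 <= x -> 0 <= df x) -> forall x, 0 <= x -> f 0 <= f x.
Proof.
move=> fd d0 x x0.
have cf : {within `[0, x], continuous f}.
  apply: derivable_within_continuous => y _.
  by have [] := fd y.
have [c c01 e] := MVT_segment x0 (fun y _ => fd y) cf.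
rewrite -subr_ge0 e subr0 mulr_ge0// d0//.
by move: c01; rewrite in_itv/= => /andP[].
Qed.

(** The four one-sided bounds that start here follow from one another: the difference of the two
    sides vanishes at 0 and its derivative is the difference in the preceding bound, beginning with
    [1 - cos]. *)
Lemma sin_le_id x : 0 <= x -> sin x <= x.
Proof.
move=> x0; rewrite -subr_ge0.
have hd y : is_derive y 1 (fun y => y - sin y) (1 - cos y).
  by apply: is_derive_eq.
have := derive_ge0_le hd _ x0.
rewrite sin0 subr0; apply.
by move=> y _; rewrite subr_ge0 cos_le1.
Qed.

Lemma cos_ge_quad x : 0 <= x -> 1 - x ^+ 2 / 2 <= cos x.
Proof.
move=> x0; rewrite -subr_ge0.
have hd y : is_derive y 1 (fun y => cos y - (1 - y ^+ 2 / 2)) (y - sin y).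
  by apply: is_derive_eq; rewrite /GRing.scale/=; field.
have := derive_ge0_le hd _ x0.
rewrite cos0 expr0n/= mul0r subr0 subrr; apply.
by move=> y y0; rewrite subr_ge0 sin_le_id.
Qed.

Lemma sin_ge_cubic x : 0 <= x -> x - x ^+ 3 / 6 <= sin x.
Proof.
move=> x0; rewrite -subr_ge0.
have hd y : is_derive y 1 (fun y => sin y - (y - y ^+ 3 / 6))
    (cos y - (1 - y ^+ 2 / 2)).
  by apply: is_derive_eq; rewrite /GRing.scale/=; field.
have := derive_ge0_le hd _ x0.
rewrite sin0 expr0n/= mul0r subr0 subrr; apply.
by move=> y y0; rewrite subr_ge0 cos_ge_quad.
Qed.

Lemma cos_le_quartic x : 0 <= x -> cos x <= 1 - x ^+ 2 / 2 + x ^+ 4 / 24.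
Proof.
move=> x0; rewrite -subr_ge0.
have hd y : is_derive y 1 (fun y => (1 - y ^+ 2 / 2 + y ^+ 4 / 24) - cos y)
    (sin y - (y - y ^+ 3 / 6)).
  by apply: is_derive_eq; rewrite /GRing.scale/=; field.
have := derive_ge0_le hd _ x0.
rewrite cos0 !expr0n/= !mul0r subr0 addr0 subrr; apply.
by move=> y y0; rewrite subr_ge0 sin_ge_cubic.
Qed.

Lemma sin_taylor s : `|sin s - s| <= `|s| ^+ 3 / 6.
Proof.
wlog s0 : s / 0 <= s => [hw|].
  have [/hw//|/ltW s0] := leP 0 s.
  by have := hw (- s); rewrite sinN -opprD !normrN; apply; rewrite oppr_ge0.
rewrite (ger0_norm s0) ler_norml.
by have := sin_le_id s0; have := sin_ge_cubic s0; set c := _ / 6;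
  have : 0 <= c by [rewrite /c divr_ge0// exprn_ge0]; lra.
Qed.

Lemma cos_taylor s : `|cos s - (1 - s ^+ 2 / 2)| <= `|s| ^+ 4 / 24.
Proof.
wlog s0 : s / 0 <= s => [hw|].
  have [/hw//|/ltW s0] := leP 0 s.
  by have := hw (- s); rewrite cosN sqrrN !normrN; apply; rewrite oppr_ge0.
rewrite (ger0_norm s0) ler_norml.
by have := cos_ge_quad s0; have := cos_le_quartic s0; set c := _ / 24;
  have : 0 <= c by [rewrite /c divr_ge0// exprn_ge0]; lra.
Qed.

Lemma norm_sin_le s : `|sin s| <= `|s|.
Proof.
wlog s0 : s / 0 <= s => [hw|].
  have [/hw//|/ltW s0] := leP 0 s.
  by have := hw (- s); rewrite sinN !normrN; apply; rewrite oppr_ge0.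
rewrite (ger0_norm s0) ler_norml sin_le_id// andbT.
(* The lower bound [- s <= sin s] comes from the cubic bound up to 1 and from [-1 <= sin s]
   beyond. *)
have [s1|s1] := leP s 1; last by have := sin_geN1 s; lra.
have := sin_ge_cubic s0; have : s ^+ 3 <= 1 * s.
  by rewrite exprS mulrC ler_wpM2r// expr_le1.
by lra.
Qed.

Lemma cos_lip x y : `|cos x - cos y| <= `|x - y|.
Proof.
rewrite (_ : cos x - cos y = - (2 * (sin ((x + y) / 2) * sin ((x - y) / 2)))).
  rewrite normrN !normrM (ger0_norm (ler0n _ 2)).
  have h1 : `|sin ((x + y) / 2)| <= 1 by rewrite ler_norml sin_geN1 sin_le1.
  have h2 := norm_sin_le ((x - y) / 2).
  rewrite normrM (ger0_norm (_ : 0 <= 2^-1)) ?invr_ge0// in h2.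
  by have := ler_pM (normr_ge0 _) (normr_ge0 _) h1 h2; lra.
have -> : cos x = cos ((x + y) / 2 + (x - y) / 2) by congr cos; field.
have -> : cos y = cos ((x + y) / 2 - (x - y) / 2) by congr cos; field.
by rewrite cosD cosB; ring.
Qed.

(** Convexity: the graph of [expR] lies above its tangent at [x]. *)
Lemma expR_sub_le x y : expR x - expR y <= expR x * (x - y).
Proof.
have := expR_ge1Dx (y - x); rewrite expRD expRN => h.
have e0 := expR_gt0 x; have := ler_wpM2l (ltW e0) h.
by rewrite mulrCA divff ?gt_eqF// mulr1; lra.
Qed.

Lemma expR_lip x y m : x <= m -> y <= m ->
  `|expR x - expR y| <= expR m * `|x - y|.
Proof.
wlog yx : x y / y <= x => [hw xm ym|xm ym].
  have [/hw|/ltW/hw] := leP y x; first exact.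
  by rewrite distrC [`|x - y|]distrC; exact.
rewrite !ger0_norm ?subr_ge0 ?ler_expR//; apply: le_trans (expR_sub_le x y) _.
by rewrite ler_wpM2r ?subr_ge0 ?ler_expR.
Qed.

(** Measures how well the compensator [expR t] cancels the factor [1 - t] that conditioning
    produces. The product lies between [(1 + t) * (1 - t)] and [expR t * expR (- t)]. *)
Lemma expR_1subt t : 0 <= t <= 1 -> `|expR t * (1 - t) - 1| <= t ^+ 2.
Proof.
move=> /andP[t0 t1]; rewrite ler_norml.
have h1 := ler_wpM2r (_ : 0 <= 1 - t) (expR_ge1Dx t).
have h2 := ler_wpM2l (expR_ge0 t) (expR_ge1Dx (- t)).
rewrite -expRD subrr expR0 in h2.
have {}h1 := h1 _; rewrite subr_ge0 in h1; have {}h1 := h1 t1.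
by apply/andP; split; nra.
Qed.
End trig_bounds.

(** The sum is the integer part of [y], counted as the number of thresholds 1, ..., m that [y]
    reaches. *)
Lemma count_floor {R : realType} (m : nat) (y : R) : 0 <= y <= m%:R ->
  y - 1 <= \sum_(j < m) (j.+1%:R <= y)%R%:R <= y.
Proof.
elim: m y => [|m IH] y.
  by rewrite big_ord0 => /andP[y0 y0']; rewrite y0 subr_le0 (le_trans y0' ler01).
rewrite big_ord_recr /= => /andP[y0 ym].
have [ym'|ym'] := leP y m%:R.
  rewrite (_ : (_ <= y)%R = false) ?addr0; first by apply: IH; rewrite y0.
  by apply/negbTE; rewrite -ltNge (le_lt_trans ym')// ltr_nat.
rewrite (eq_bigr (fun=> 1)); last first.
  move=> i _; rewrite (_ : (_ <= y)%R = true)//.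
  by rewrite (le_trans _ (ltW ym'))// ler_nat.
rewrite sumr_const card_ord.
have [h|h] := leP m.+1%:R y; rewrite /= ?addr0 -?natr1; lra.
Qed.

(** Rounding [x] down to the grid of mesh [1 / (n + 1)], written through superlevel indicators. The
    error is uniform in [x], which is what carries identities from sets to functions. *)
Lemma layer_cake {R : realType} (n : nat) (x : R) : 0 <= x <= 1 ->
  `|x - n.+1%:R^-1 * \sum_(j < n.+1) (j.+1%:R / n.+1%:R <= x)%R%:R| <= n.+1%:R^-1.
Proof.
move=> /andP[x0 x1].
have n0 : (0 : R) < n.+1%:R by rewrite ltr0n.
have hx : 0 <= n.+1%:R * x <= n.+1%:R.
  by rewrite mulr_ge0 ?(ltW n0)//= ler_piMr// ltW.
have := count_floor hx.
under eq_bigr do rewrite mulrC -ler_pdivrMr//.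
set s := \sum_(_ < _) _ => /andP[h1 h2].
rewrite -(@ler_pM2l _ n.+1%:R)// divff ?gt_eqF//.
rewrite -[X in X * _](gtr0_norm n0) -normrM mulrBr mulrA divff ?gt_eqF// mul1r.
by rewrite ler_norml; apply/andP; split; lra.
Qed.

Lemma measurable_superlevel {d} {T : measurableType d} {R : realType}
    (f : T -> R) (c : R) :
  measurable_fun setT f -> measurable [set x | c <= f x].
Proof.
move=> mf; rewrite (_ : [set _ | _] = setT `&` f @^-1` `[c, +oo[).
  exact: mf.
by rewrite setTI; apply/seteqP; split=> x /=; rewrite in_itv/= andbT.
Qed.

Lemma fin_num_mass1 {d} {T : measurableType d} {R : realType}
    (mu : {measure set T -> \bar R}) (A : set T) : mu setT = 1%E ->
  measurable A -> mu A \is a fin_num.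
Proof.
move=> mu1 mA; rewrite ge0_fin_numE// (le_lt_trans _ (ltry 1))// -mu1.
by apply: le_measure; rewrite ?inE.
Qed.

Lemma Rint_indic {d} {T : measurableType d} {R : realType}
    (mu : {measure set T -> \bar R}) (A : set T) : measurable A ->
  \int[mu]_x (\1_A x : R) = fine (mu A).
Proof. by move=> mA; rewrite /Rintegral integral_indic// setIT. Qed.

Lemma indic_iff {T1 T2 : Type} {R : realType} (A : set T1) (B : set T2) x y :
  (A x <-> B y) -> \1_A x = \1_B y :> R.
Proof.
move=> AB; rewrite !indicE; have -> : (x \in A) = (y \in B); last by [].
by apply/idP/idP => /set_mem h; apply/mem_set/AB.
Qed.

(** * A monotone class theorem for functionals *)

Section functional.
Context {d} {T : measurableType d} {R : realType}.

(** Integrals seen through linearity and bounded convergence only. Composites such as integrals of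
    kernel operators or of sections satisfy this directly, without the underlying measure being
    constructed. *)
Definition bm_functional (I : (T -> R) -> R) : Prop :=
  [/\ forall f g, bm f -> bm g -> I (fun x => f x + g x) = I f + I g,
      forall r f, bm f -> I (fun x => r * f x) = r * I f
    & forall (h : nat -> T -> R) (f : T -> R) (c : R), (forall n, bm (h n)) ->
        (forall x, h n x @[n --> \oo] --> f x) -> (forall n x, `|h n x| <= c) ->
        I (h n) @[n --> \oo] --> I f].

Lemma bm_functional_int (mu : {measure set T -> \bar R}) : mu setT = 1%E ->
  bm_functional (fun f => \int[mu]_x f x).
Proof.
move=> mu1; split; [exact: bmID|exact: bmIZ|exact: bmI_cvg].
Qed.

Lemma bm_indic (A : set T) : measurable A -> bm (\1_A : T -> R).
Proof.
move=> mA; apply: (@bmP _ _ _ _ 1); first exact: measurable_indic.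
by move=> x; rewrite indicE; case: (_ \in _); rewrite ?normr1 ?normr0.
Qed.

Lemma cvg_indic_bigcup (F : (set T)^nat) x : nondecreasing_seq F ->
  (\1_(F n) x : R) @[n --> \oo] --> (\1_(\bigcup_i F i) x : R).
Proof.
move=> ndF; rewrite [X in _ --> X]indicE.
have [xF|xF] := boolP (x \in _).
  move/set_mem: xF => [n _ Fn]; apply: cvg_near_cst; exists n => // m /= nm.
  rewrite indicE mem_set//.
  by have := ndF _ _ nm; rewrite subsetEset; exact.
apply: cvg_near_cst; apply: nearW => n; rewrite indicE memNset// => Fn.
by move/negP: xF; apply; rewrite inE; exists n.
Qed.

(** The sets on whose indicators the functionals agree form a lambda-system containing the pi-system
    [G]. The layer-cake approximation extends the agreement to functions with values in [0, 1], and
    an affine change of scale to bounded ones. *)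
Lemma bm_functional_unique (I J : (T -> R) -> R) (G : set (set T)) :
  bm_functional I -> bm_functional J ->
  (measurable = <<s G >>) -> setI_closed G ->
  I (fun=> 1) = J (fun=> 1) ->
  (forall A, G A -> I \1_A = J \1_A) ->
  forall f, bm f -> I f = J f.
Proof.
move=> [ID IZ IC] [JD JZ JC] mG GI IJ1 IJG.
have IB f g : bm f -> bm g -> I (fun x => f x - g x) = I f - I g.
  move=> hf hg; rewrite (_ : (fun x => _) = (fun x => f x + -1 * g x)).
    by rewrite ID ?IZ ?mulN1r//; exact: bmZ.
  by apply/funext => x; rewrite mulN1r.
have JB f g : bm f -> bm g -> J (fun x => f x - g x) = J f - J g.
  move=> hf hg; rewrite (_ : (fun x => _) = (fun x => f x + -1 * g x)).
    by rewrite JD ?JZ ?mulN1r//; exact: bmZ.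
  by apply/funext => x; rewrite mulN1r.
have IJA A : measurable A -> I \1_A = J \1_A.
  suff : <<s G >> `<=` [set A | measurable A /\ I \1_A = J \1_A].
    by rewrite -mG => /(_ A) h mA; have [] := h mA.
  apply: lambda_system_subset => //; last first.
  - by move=> B GB; split; [rewrite mG; exact: sub_sigma_algebra|exact: IJG].
  split=> //=.
  - split=> //; rewrite indicT; exact: IJ1.
  - move=> A1 B BA [mA hA] [mB hB]; split; first exact: measurableD.
    rewrite (_ : \1_(A1 `\` B) = (fun x => \1_A1 x - \1_B x : R)).
      by rewrite IB ?JB ?hA ?hB//; exact: bm_indic.
    apply/funext => x; rewrite !indicE.
    have [xB|xB] := boolP (x \in B).
      rewrite (mem_set (BA _ (set_mem xB))) memNset ?subrr//.
      by move=> [_]; apply; exact: set_mem.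
    rewrite subr0; congr (nat_of_bool _)%:R; apply/idP/idP => /set_mem.
      by move=> [Ax _]; exact: mem_set.
    by move=> Ax; apply: mem_set; split => // Bx; move: xB; rewrite mem_set.
  - move=> F ndF hF; split.
      by apply: bigcupT_measurable => i; case: (hF i).
    have h1 := @IC (fun n => \1_(F n)) \1_(\bigcup_i F i) 1.
    have h2 := @JC (fun n => \1_(F n)) \1_(\bigcup_i F i) 1.
    have bF n : bm (\1_(F n) : T -> R) by apply: bm_indic; case: (hF n).
    have cF x := @cvg_indic_bigcup F x ndF.
    have F1 n x : `|\1_(F n) x : R| <= 1.
      by rewrite indicE; case: (_ \in _); rewrite ?normr1 ?normr0.
    have {}h1 := h1 bF cF F1; have {}h2 := h2 bF cF F1.
    apply: (cvg_unique _ h1) => //.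
    rewrite (_ : (fun n => I _) = (fun n => J \1_(F n)))//.
    by apply/funext => n; case: (hF n).
have IJ01 (f : T -> R) : measurable_fun setT f -> (forall x, 0 <= f x <= 1) -> I f = J f.
  move=> mf f01.
  pose h (n : nat) (x : T) : R := n.+1%:R^-1 *
    \sum_(j < n.+1) \1_[set x | j.+1%:R / n.+1%:R <= f x] x.
  have mset (c : R) : measurable [set x | c <= f x].
    exact: measurable_superlevel.
  have bset (c : R) : bm (\1_[set x | c <= f x] : T -> R) by exact: bm_indic.
  have bh n : bm (h n) by apply: bmZ; apply: bm_sum => j; exact: bset.
  have fh x n : `|f x - h n x| <= n.+1%:R^-1.
    rewrite /h (eq_bigr (fun j : 'I_n.+1 => (j.+1%:R / n.+1%:R <= f x)%R%:R)).
      exact: layer_cake.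
    by move=> j _; rewrite indicE; congr (nat_of_bool _)%:R; apply/idP/idP;
      rewrite inE.
  have ch x : h n x @[n --> \oo] --> f x.
    apply: cvgn_le (@cvg_invS R) => n; rewrite distrC; exact: fh.
  have hb n x : `|h n x| <= 2.
    have := fh x n; have /andP[f0 f1] := f01 x.
    have : n.+1%:R^-1 <= 1 :> R by rewrite invf_le1 ?ler1n.
    move: (h n x) (_^-1) => y r; rewrite !ler_norml => n1 /andP[h1 h2].
    by apply/andP; split; lra.
  have Isum (K : (T -> R) -> R) : bm_functional K -> forall n,
      K (h n) = n.+1%:R^-1 *
        \sum_(j < n.+1) K \1_[set x | j.+1%:R / n.+1%:R <= f x].
    move=> [KD KZ _] n; rewrite KZ; last by apply: bm_sum.
    congr (_ * _).
    elim: (index_enum _) => [|i s IH].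
      under eq_fun do rewrite big_nil.
      rewrite big_nil (_ : (fun=> 0) = (fun x : T => 0 * 0 : R)).
        by rewrite (KZ 0 (fun=> 0)) ?mul0r//; exact: bm_cst.
      by apply/funext => x; rewrite mul0r.
    rewrite big_cons -IH; under eq_fun do rewrite big_cons.
    by rewrite KD//; exact: bm_sum.
  have h1 := IC h f 2 bh ch hb; have h2 := JC h f 2 bh ch hb.
  apply: (cvg_unique _ h1) => //.
  rewrite (_ : (fun n => I _) = (fun n => J (h n)))//.
  apply/funext => n; rewrite !Isum//; congr (_ * _); apply: eq_bigr => j _.
  exact: IJA.
move=> f bf; have [c c0 hc] := bm_bound bf; have [mf _] := bf.
(* The extra 1 keeps the scaling factor nonzero when the bound [c] is 0. *)
pose a := c + 1; have a0 : 0 < a by rewrite /a; lra.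
pose g x := (2 * a)^-1 * (f x + a).
have bg : bm g by apply: bmZ; apply: bmD => //; exact: bm_cst.
have fg : f = (fun x => (2 * a) * g x + (- a) * 1).
  by apply/funext => x; rewrite /g mulrA divff ?mulf_neq0 ?gt_eqF//; lra.
have g01 x : 0 <= g x <= 1.
  have := hc x; rewrite ler_norml => /andP[h1 h2].
  have fa : 0 <= f x + a <= 2 * a by apply/andP; split; rewrite /a; lra.
  have a2 : 0 < 2 * a by rewrite mulr_gt0.
  rewrite /g [_^-1 * _]mulrC divr_ge0 ?(ltW a2)//=; last by case/andP: fa.
  by rewrite ler_pdivrMr// mul1r; case/andP: fa.
have b1 : bm (fun _ : T => 1 : R) by exact: bm_cst.
rewrite fg ID ?JD; try by [exact: bmZ|exact: bmZ].
congr (_ + _).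
  by rewrite IZ// JZ// IJ01//; exact: bm_meas.
transitivity (- a * I (fun=> 1)); first exact: IZ.
by rewrite IJ1; symmetry; exact: JZ.
Qed.

End functional.

Section kernel_integral.
Context {d d'} {X : measurableType d} {Y : measurableType d'} {R : realType}.

(** The kernel is a bare family of measures because its argument is often random, as in
    [K n o (X n o)]. *)
Lemma bm_kernel_int (k : X -> {measure set Y -> \bar R}) (f : X * Y -> R) :
  (forall A, measurable A -> measurable_fun setT (k ^~ A)) ->
  (forall x, k x setT = 1%E) -> bm f ->
  bm (fun x => \int[k x]_y f (x, y)).
Proof.
move=> mk k1 bf; have [c c0 hc] := bm_bound bf.
have bx x : bm (fun y => f (x, y)).
  exact: (bm_comp (u := pair x) (measurable_pair1 x) bf).
apply: (@bmP _ _ _ _ c); last first.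
  by move=> x; exact: (bmI_bound (k1 x) (bx x) (fun y => hc (x, y))).
pose m1 := isKernel.Build _ _ X Y R k mk.
pose k' : R.-ker X ~> Y := HB.pack k m1.
pose m2 := Kernel_isProbability.Build _ _ X Y R k' k1.
pose k'' : R.-pker X ~> Y := HB.pack k m1 m2.
(* Adding the bound makes the integrand nonnegative, as the measurability theorem for kernel
   integrals requires. *)
have bc : bm (fun u : X * Y => f u + c) by apply: bmD => //; exact: bm_cst.
have h := @measurable_fun_integral_finite_kernel _ _ X Y R
  (fun u => (f u + c)%:E) k''.
have {}h := h _ _.
rewrite (_ : (fun x => _) = (fun x => fine (\int[k x]_y (f (x, y) + c)%:E) - c)).
  apply: measurable_funB; last exact: measurable_cst.
  apply: (measurableT_comp (f := fine)) => //.
  apply: h => [z|].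
    by have := hc z; rewrite lee_fin ler_norml => /andP[h1 h2]; lra.
  by apply/measurable_EFinP; exact: bm_meas.
apply/funext => x; rewrite -[X in _ = X - c]/(\int[k x]_y (f (x, y) + c)).
rewrite bmID ?(k1 x)//; last exact: bm_cst.
by rewrite (bmI_cst (k1 x)); lra.
Qed.
End kernel_integral.

(** * Poisson equations and perturbation of kernels *)

Section kop_theory.
Context {d} {E : measurableType d} {R : realType}.
Implicit Types (K : R.-pker E ~> E) (f g : E -> R) (mu : probability E R).

Let prK K x : K x setT = 1%E. Proof. exact: prob_kernel. Qed.
Let pr1 mu : mu setT = 1%E. Proof. exact: probability_setT. Qed.
Local Hint Extern 0 (_ [set: _] = 1%E) =>
  solve [exact: pr1|exact: prK] : core.

Lemma kop_bm K f : bm f -> bm (kop K f).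
Proof.
move=> bf; apply: (@bm_kernel_int _ _ _ _ _ (K : E -> {measure set E -> \bar R})
  (fun u => f u.2)) => //.
- by move=> A mA; exact: measurable_kernel.
- exact: (bm_comp (u := snd) measurable_snd bf).
Qed.

Lemma iter_kop_bm K f n : bm f -> bm (iter n (kop K) f).
Proof. by move=> bf; elim: n => //= n; exact: kop_bm. Qed.

Lemma kop_bound K f (c : R) : bm f -> (forall x, `|f x| <= c) ->
  forall x, `|kop K f x| <= c.
Proof. by move=> bf hc x; apply: bmI_bound. Qed.

Lemma kopD K f g x : bm f -> bm g ->
  kop K (fun y => f y + g y) x = kop K f x + kop K g x.
Proof. by move=> bf bg; rewrite /kop bmID. Qed.

Lemma kopB K f g x : bm f -> bm g ->
  kop K (fun y => f y - g y) x = kop K f x - kop K g x.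
Proof. by move=> bf bg; rewrite /kop bmIB. Qed.

Lemma kop_variance K g x : bm g ->
  \int[K x]_y (g y - kop K g x) ^+ 2 =
  kop K (fun y => g y ^+ 2) x - kop K g x ^+ 2.
Proof.
move=> bg; set q := kop K g x.
transitivity (\int[K x]_y ((g y ^+ 2 + (- (2 * q)) * g y) + q ^+ 2)).
  by apply: eq_Rintegral => y _; ring.
rewrite bmID//; [|by apply: bmD; [exact: bmX|exact: bmZ]|exact: bm_cst].
rewrite bmID//; [|exact: bmX|exact: bmZ].
rewrite bmIZ// bmI_cst// /kop.
have -> : \int[K x]_y g y = q by [].
by ring.
Qed.

Lemma kop_cst K (c : R) x : kop K (fun=> c) x = c.
Proof. by rewrite /kop bmI_cst. Qed.

Lemma iter_kopB K f g n x : bm f -> bm g ->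
  iter n (kop K) (fun y => f y - g y) x =
  iter n (kop K) f x - iter n (kop K) g x.
Proof.
move=> bf bg; elim: n x => //= n IH x.
rewrite (_ : iter n _ (fun y => _) =
  (fun y => iter n (kop K) f y - iter n (kop K) g y)); last exact/funext.
by rewrite kopB//; exact: iter_kop_bm.
Qed.

Lemma iter_kopZ K f (r : R) n x : bm f ->
  iter n (kop K) (fun y => r * f y) x = r * iter n (kop K) f x.
Proof.
move=> bf; elim: n x => //= n IH x.
rewrite (_ : iter n _ (fun y => _) =
  (fun y => r * iter n (kop K) f y)); last exact/funext.
by rewrite /kop bmIZ//; exact: iter_kop_bm.
Qed.

Lemma kop_osc K f (c : R) : bm f -> (forall x y, `|f x - f y| <= c) ->
  forall x y, `|kop K f x - kop K f y| <= c.
Proof.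
move=> bf hc.
suff H x y : kop K f x - kop K f y <= c.
  by move=> x y; rewrite ler_norml H andbT lerNl opprB H.
rewrite lerBlDr -[X in _ <= X](bmI_cst (prK K x)); apply: bmI_le => //.
  exact: bm_cst.
move=> z; rewrite addrC -lerBlDr -[X in X <= _](bmI_cst (prK K y)).
apply: bmI_le => // [|w]; first exact: bm_cst.
by have := hc z w; rewrite ler_norml => /andP[h1 h2]; lra.
Qed.

Lemma int_osc mu f (c : R) : bm f -> (forall x y, `|f x - f y| <= c) ->
  forall x, `|f x - \int[mu]_y f y| <= c.
Proof.
move=> bf hc x; rewrite -[f x](bmI_cst (pr1 mu)); apply: bmI_dist => //.
exact: bm_cst.
Qed.

Lemma invariant_int mu K f : invariant_law mu K -> bm f ->
  \int[mu]_x kop K f x = \int[mu]_x f x.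
Proof.
move=> inv.
move: f; apply: (bm_functional_unique
  (I := fun f => \int[mu]_x kop K f x) (J := fun f => \int[mu]_x f x)
  (G := measurable)) => //.
- split.
  + move=> f1 f2 b1 b2; rewrite -bmID//; try exact: kop_bm.
    by apply: eq_Rintegral => x _; rewrite kopD.
  + move=> r f1 b1; rewrite -bmIZ//; last exact: kop_bm.
    by apply: eq_Rintegral => x _; rewrite /kop bmIZ.
  + move=> h f1 c bh hf hc; apply: (@bmI_cvg _ _ _ _ _ _ _ c) => //.
    * by move=> n; exact: kop_bm.
    * move=> x; apply: (@bmI_cvg _ _ _ _ _ _ _ c) => //.
    * by move=> n x; exact: kop_bound.
- exact: bm_functional_int.
- by rewrite (sigma_algebra_id (@sigma_algebra_measurable _ E)).
- by move=> A B mA mB; exact: measurableI.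
- by under eq_Rintegral do rewrite kop_cst.
- move=> A mA; transitivity (fine (mu A)); last by rewrite Rint_indic.
  rewrite -(inv _ mA) /Rintegral; congr fine.
  apply: eq_integral => x _; rewrite /kop Rint_indic// fineK//.
  exact: fin_num_mass1.
Qed.

Lemma iter_invariant_int mu K f n : invariant_law mu K -> bm f ->
  \int[mu]_x iter n (kop K) f x = \int[mu]_x f x.
Proof.
move=> inv bf; elim: n => //= n IH.
by rewrite invariant_int//; exact: iter_kop_bm.
Qed.

(** The Dobrushin condition in real terms: [c] is any upper bound of the oscillation, so that no
    supremum has to be handled. *)
Definition contracts K (N : nat) (b : R) : Prop :=
  forall f, bm f -> forall c : R, (forall x y, `|f x - f y| <= c) ->
  forall x y, `|iter N (kop K) f x - iter N (kop K) f y| <= b * c.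

Lemma dobrushin_contracts K N (b : R) : 0 <= b < 1 ->
  (dobrushin (iter N (kop K)) <= b%:E)%E -> contracts K N b.
Proof.
move=> /andP[b0 b1] hb.
have pos f : bm f -> forall c : R, 0 < c -> (forall x y, `|f x - f y| <= c) ->
  forall x y, `|iter N (kop K) f x - iter N (kop K) f y| <= b * c.
  move=> bf c c0 hc x y.
  have [g gE] := bm_bmfun (bmZ c^-1 bf).
  have og : (osc g <= 1)%E.
    apply: ge_ereal_sup => _ [u _ <-]; rewrite lee_fin gE -mulrBr normrM.
    by rewrite gtr0_norm ?invr_gt0// mulrC ler_pdivrMr// mul1r.
  have := le_trans _ hb => /(_ (osc (iter N (kop K) g))).
  have h1 : (osc (iter N (kop K) g) <= dobrushin (iter N (kop K)))%E.
    by apply: ereal_sup_ubound; exists g.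
  move=> /(_ h1) h2.
  have : (`|iter N (kop K) g x - iter N (kop K) g y|%:E <= b%:E)%E.
    by apply: le_trans h2; apply: ereal_sup_ubound; exists (x, y).
  rewrite lee_fin gE !iter_kopZ// -mulrBr normrM gtr0_norm ?invr_gt0//.
  by rewrite mulrC ler_pdivrMr.
(* Normalizing the oscillation to 1 divides by [c]; a bound [c] that may be 0 is first enlarged by
   [e]. *)
move=> f bf c hc x y; apply/ler_addgt0Pr => e e0.
have c0 : 0 <= c by apply: le_trans (hc x y).
apply: le_trans (pos f bf (c + e) _ _ x y) _; first lra.
  by move=> x' y'; rewrite (le_trans (hc _ _))// lerDl ltW.
by rewrite mulrDr lerD2l ger_pMl// ltW.
Qed.

Section resolvent.
Variables (N : nat) (b : R).
Hypotheses (N0 : (0 < N)%N) (b01 : 0 <= b < 1).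

Let C : R := N%:R / (1 - b).

(** A geometric series in which every power of [b] occurs [N] times, hence the constant
    [N / (1 - b)]. Shifting the summation index by [N] gives [D <= N + b * D] for the partial sum
    [D]. *)
Lemma sum_contraction (J : nat) : \sum_(0 <= j < J) b ^+ (j %/ N) <= C.
Proof.
have /andP[b0 b1] := b01; rewrite /C ler_pdivlMr ?subr_gt0//.
set D := \sum_(0 <= j < J) _.
have h : \sum_(0 <= j < J + N) b ^+ (j %/ N) = N%:R + b * D.
  rewrite addnC (@big_cat_nat _ _ _ N)//= ?leq_addr//; congr (_ + _).
    rewrite big_nat (eq_bigr (fun=> 1)); last first.
      by move=> j /andP[_ jN]; rewrite divn_small.
    by rewrite -big_nat sumr_const_nat subn0.
  rewrite -{1}[N]add0n big_addn addKn mulr_sumr; apply: eq_bigr => j _.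
  by rewrite divnDr ?dvdnn// divnn N0 addn1 exprS.
have : D <= \sum_(0 <= j < J + N) b ^+ (j %/ N).
  rewrite [leRHS](@big_cat_nat _ _ _ J)//= ?leq_addr// lerDl.
  by apply: sumr_ge0 => j _; exact: exprn_ge0.
by rewrite h mulrBr mulr1 [D * b]mulrC; lra.
Qed.

Let C0 : 0 <= C.
Proof.
by apply: le_trans (sum_contraction 0); rewrite big_nil.
Qed.

(** Only whole blocks of [N] steps contract; the [n %% N] remaining steps do not expand the
    oscillation. *)
Lemma iter_contracts K f (c : R) n : contracts K N b -> bm f ->
  (forall x y, `|f x - f y| <= c) ->
  forall x y, `|iter n (kop K) f x - iter n (kop K) f y| <= b ^+ (n %/ N) * c.
Proof.
move=> hK bf hc; rewrite {1 2}(divn_eq n N) addnC.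
have {hc} : forall x y, `|iter (n %% N) (kop K) f x - iter (n %% N) (kop K) f y| <= c.
  elim: (n %% N)%N => //= m IH; apply: kop_osc => //; exact: iter_kop_bm.
rewrite addnC iterD.
have : bm (iter (n %% N)%N (kop K) f) by exact: iter_kop_bm.
move: (iter (n %% N) _ _) => g bg hg.
elim: (n %/ N)%N => [|q IH]; first by rewrite expr0 mul1r.
rewrite mulSn iterD exprS -mulrA; apply: hK => //; exact: iter_kop_bm.
Qed.

Section fixed.
Variables (K : R.-pker E ~> E) (mu : probability E R).
Hypotheses (hK : contracts K N b) (inv : invariant_law mu K).

Let a f x n : R := iter n (kop K) f x - \int[mu]_y f y.

(** By invariance the mean of [f] is also that of its [n]-th iterate, and no function is farther
    from its mean than its oscillation. *)
Lemma iter_mean_bound f (c : R) n x : bm f -> (forall x y, `|f x - f y| <= c) ->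
  `|iter n (kop K) f x - \int[mu]_y f y| <= b ^+ (n %/ N) * c.
Proof.
move=> bf hc; rewrite -(iter_invariant_int n inv bf).
by apply: int_osc; [exact: iter_kop_bm|exact: iter_contracts].
Qed.

Lemma bm_osc f : bm f -> exists2 c : R, 0 <= c & forall x y, `|f x - f y| <= c.
Proof.
move=> bf; have [c c0 hc] := bm_bound bf; exists (c + c); first lra.
by move=> x y; rewrite (le_trans (ler_normB _ _))// lerD.
Qed.

Let partial_bound f (c : R) n x : bm f -> (forall x y, `|f x - f y| <= c) ->
  `|series (a f x) n| <= C * c.
Proof.
move=> bf hc; rewrite /series/=.
have c0 : 0 <= c by apply: le_trans (hc x x).
apply: le_trans (ler_norm_sum _ _ _) _.
apply: le_trans (_ : \sum_(0 <= j < n) b ^+ (j %/ N) * c <= _).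
  by apply: ler_sum => j _; exact: iter_mean_bound.
by rewrite -mulr_suml ler_wpM2r// sum_contraction.
Qed.

Lemma resolvent_cvg f x : bm f ->
  series (fun n => iter n (kop K) f x - \int[mu]_y f y) n @[n --> \oo]
    --> resolvent K mu f x.
Proof.
move=> bf; have [c c0 hc] := bm_osc bf.
apply: (normed_cvg (u_ := a f x)).
apply: nondecreasing_is_cvgn.
  by apply: nondecreasing_series => n _ _ /=; exact: normr_ge0.
exists (C * c) => _ [n _ <-]; rewrite /series/=.
apply: le_trans (_ : \sum_(0 <= j < n) b ^+ (j %/ N) * c <= _).
  by apply: ler_sum => j _; exact: iter_mean_bound.
by rewrite -mulr_suml ler_wpM2r// sum_contraction.
Qed.

Lemma resolvent_bound f (c : R) x : bm f -> (forall x y, `|f x - f y| <= c) ->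
  `|resolvent K mu f x| <= C * c.
Proof.
move=> bf hc; have := @cvgn_norm_le R (series (a f x)) (resolvent K mu f x) (C * c).
apply; first exact: resolvent_cvg.
by move=> n; exact: partial_bound.
Qed.

Let series_bm f n : bm f -> bm (fun x => series (a f x) n).
Proof.
move=> bf; apply: bm_sum => j; apply: bmB; last exact: bm_cst.
exact: iter_kop_bm.
Qed.

Lemma resolvent_bm f : bm f -> bm (resolvent K mu f).
Proof.
move=> bf; have [c c0 hc] := bm_osc bf.
apply: (@bm_lim _ _ _ (fun n x => series (a f x) n) _ (C * c)).
- by move=> n; apply: bm_meas; exact: series_bm.
- by move=> x; exact: resolvent_cvg.
- by move=> x; exact: resolvent_bound.
Qed.

(** Applying the kernel to a partial sum of the series gives the next partial sum without its first
    term; dominated convergence passes to the limit. *)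
Lemma resolvent_poisson f x : bm f ->
  resolvent K mu f x - kop K (resolvent K mu f) x = f x - \int[mu]_y f y.
Proof.
move=> bf; have [c c0 hc] := bm_osc bf.
have h1 : kop K (fun y => series (a f y) n) x @[n --> \oo] -->
          kop K (resolvent K mu f) x.
  apply: (@bmI_cvg _ _ _ _ _ _ _ (C * c)) => //.
  - by move=> n; exact: series_bm.
  - by move=> y; exact: resolvent_cvg.
  - by move=> n y; exact: partial_bound.
have h2 : series (a f x) n.+1 - (f x - \int[mu]_y f y) @[n --> \oo] -->
    resolvent K mu f x - (f x - \int[mu]_y f y).
  apply: cvgB; last exact: cvg_cst.
  by rewrite cvg_shiftS; exact: resolvent_cvg.
suff e : (fun n => kop K (fun y => series (a f y) n) x) =
    (fun n => series (a f x) n.+1 - (f x - \int[mu]_y f y)).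
  by rewrite e in h1; rewrite (cvg_unique _ h1 h2)//; ring.
apply/funext => n; rewrite /kop /series/= bmI_sum//; last first.
  by move=> j; apply: bmB; [exact: iter_kop_bm|exact: bm_cst].
rewrite big_nat_recl// {2}/a /= addrAC subrr add0r.
apply: eq_bigr => j _; rewrite bmIB//; last exact: bm_cst.
- by rewrite bmI_cst.
- exact: iter_kop_bm.
Qed.

(** The normalization that singles out one solution of the Poisson equation among those that differ
    by a constant. *)
Lemma resolvent_mean f : bm f -> \int[mu]_x resolvent K mu f x = 0.
Proof.
move=> bf; have [c c0 hc] := bm_osc bf.
have h1 : \int[mu]_y series (a f y) n @[n --> \oo] -->
          \int[mu]_x (resolvent K mu f) x.
  apply: (@bmI_cvg _ _ _ _ _ _ _ (C * c)) => //.
  - by move=> n; exact: series_bm.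
  - by move=> y; exact: resolvent_cvg.
  - by move=> n y; exact: partial_bound.
apply: (cvg_unique _ h1) => //; rewrite (_ : (fun n => _) = fun=> 0).
  exact: cvg_cst.
apply/funext => n; rewrite /series/= bmI_sum//; last first.
  by move=> j; apply: bmB; [exact: iter_kop_bm|exact: bm_cst].
apply: big1_seq => j _; rewrite bmIB//; last exact: bm_cst.
- by rewrite bmI_cst// iter_invariant_int// subrr.
- exact: iter_kop_bm.
Qed.

Lemma iter_kop_cvg f x : bm f ->
  iter n (kop K) f x @[n --> \oo] --> \int[mu]_y f y.
Proof.
move=> bf; have /cvg_series_cvg_0 h : cvgn (series (a f x)).
  by apply/cvg_ex; exists (resolvent K mu f x); exact: resolvent_cvg.
rewrite -[X in _ --> X]add0r.
rewrite (_ : (fun n => _) = (fun n => a f x n + \int[mu]_y f y)).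
  by apply: cvgD; [exact: h|exact: cvg_cst].
by apply/funext => n; rewrite /a subrK.
Qed.

(** The series telescopes to [u] minus its iterates, which tend to the mean. This bounds any [u] up
    to a constant by its image under identity minus kernel. *)
Lemma resolvent_coboundary u x : bm u ->
  resolvent K mu (fun y => u y - kop K u y) x = u x - \int[mu]_y u y.
Proof.
move=> bu; have bv : bm (fun y => u y - kop K u y).
  by apply: bmB => //; exact: kop_bm.
apply: (cvg_unique _ (resolvent_cvg (x := x) bv)) => //.
rewrite (_ : (fun n => _) = (fun n => u x - iter n (kop K) u x)).
  by apply: cvgB; [exact: cvg_cst|exact: iter_kop_cvg].
apply/funext => n; rewrite /series/= bmIB//; last exact: kop_bm.
rewrite invariant_int// subrr.
elim: n => [|n IH]; first by rewrite big_geq// subrr.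
rewrite big_nat_recr//= IH subr0 iter_kopB//; last exact: kop_bm.
by rewrite -iterSr /=; ring.
Qed.

End fixed.

Section perturbation.
Variables (K1 K2 : R.-pker E ~> E) (mu1 mu2 : probability E R).
Hypotheses (hK1 : contracts K1 N b) (inv1 : invariant_law mu1 K1).
Hypotheses (hK2 : contracts K2 N b) (inv2 : invariant_law mu2 K2).

(** The Poisson equation of the second kernel, integrated against the invariant
    law of the first, expresses the difference of the invariant laws through the
    difference of the kernels. *)
Lemma invariant_perturbation f (e : R) : bm f ->
  (forall x, `|kop K1 (resolvent K2 mu2 f) x - kop K2 (resolvent K2 mu2 f) x|
     <= e) ->
  `|\int[mu1]_x f x - \int[mu2]_x f x| <= e.
Proof.
move=> bf; have bg : bm (resolvent K2 mu2 f) by exact: resolvent_bm.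
have p x := resolvent_poisson hK2 inv2 x bf.
move: (resolvent K2 mu2 f) bg p => g bg p he.
rewrite (_ : _ - _ = \int[mu1]_x (kop K1 g x - kop K2 g x)).
  by apply: bmI_bound => //; apply: bmB; exact: kop_bm.
have b1 := kop_bm K1 bg; have b2 := kop_bm K2 bg.
rewrite bmIB// (invariant_int inv1 bg) -bmIB//.
under [RHS]eq_Rintegral do rewrite p.
by rewrite bmIB ?bmI_cst//; exact: bm_cst.
Qed.

(** The difference [u] of the two resolvents satisfies a Poisson equation for [K1] with right-hand
    side at most [2 * e1], of oscillation at most [4 * e1]; this controls [u] up to its mean under
    [mu1]. As both resolvents are centered, that mean is the difference of the two means of [g],
    which the resolvent [h] of [g] bounds by [e2]. *)
Lemma resolvent_perturbation f (e1 e2 : R) (bf : bm f) :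
  let g := resolvent K2 mu2 f in let h := resolvent K2 mu2 g in
  (forall x, `|kop K1 g x - kop K2 g x| <= e1) ->
  (forall x, `|kop K1 h x - kop K2 h x| <= e2) ->
  forall x, `|resolvent K1 mu1 f x - g x| <= C * (4 * e1) + e2.
Proof.
move=> g h he1 he2 x.
have hm := invariant_perturbation bf he1.
have bg : bm g by exact: resolvent_bm.
have hg := invariant_perturbation bg he2.
have p2 y := resolvent_poisson hK2 inv2 y bf.
have m2 := resolvent_mean hK2 inv2 bf.
rewrite -/g in p2 m2.
have br : bm (resolvent K1 mu1 f) by exact: resolvent_bm.
have p1 y := resolvent_poisson hK1 inv1 y bf.
have m1 := resolvent_mean hK1 inv1 bf.
clear he2 h; move: (resolvent K1 mu1 f) br p1 m1 => r br p1 m1.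
move: g bg he1 hg p2 m2 => g bg he1 hg p2 m2.
pose u y := r y - g y.
have bu : bm u by exact: bmB.
have hb y : `|u y - kop K1 u y| <= 2 * e1.
  rewrite /u kopB// (_ : _ - _ = (\int[mu2]_x f x - \int[mu1]_x f x) +
                                 (kop K1 g y - kop K2 g y)).
    rewrite (le_trans (ler_normD _ _))// (_ : 2 * e1 = e1 + e1); last lra.
    by rewrite lerD// distrC.
  move: (p1 y) (p2 y); move: (r y) (g y) (f y) (kop K1 r y) (kop K1 g y).
  move: (kop K2 g y) (\int[mu1]_x f x) (\int[mu2]_x f x).
  by move=> x1 x2 x3 x4 x5 x6 x7 x8 h1 h2; move: h1 h2; lra.
have h1 : `|u x - \int[mu1]_y u y| <= C * (4 * e1).
  rewrite -(resolvent_coboundary hK1 inv1 x bu); apply: resolvent_bound => //.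
    by apply: bmB => //; exact: kop_bm.
  move=> y z; rewrite (le_trans (ler_normB _ _))//.
  rewrite (_ : 4 * e1 = 2 * e1 + 2 * e1); last lra.
  exact: lerD.
have h2 : \int[mu1]_y u y = \int[mu2]_y g y - \int[mu1]_y g y.
  by rewrite bmIB// m1 m2.
rewrite h2 -/(u x) in h1 *.
rewrite -(subrK (\int[mu2]_y g y - \int[mu1]_y g y) (u x)).
by rewrite (le_trans (ler_normD _ _))// lerD// distrC.
Qed.
End perturbation.
End resolvent.
End kop_theory.

(** * Convergence to zero in upper mean *)

Section outer_limit.
Context {d} {Omega : measurableType d} {R : realType}.
Variable P : probability Omega R.

Let P1 : P setT = 1%E. Proof. exact: probability_setT. Qed.

(** Convergence to 0 of the upper integrals of [|u n|]; the [u n] of interest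
    are suprema over the state space, which need not be measurable. *)
Definition ocvg0 (u : nat -> Omega -> R) : Prop :=
  forall e : R, 0 < e -> exists N, forall n, (N <= n)%N ->
    exists B, [/\ bm B, forall o, `|u n o| <= B o & \int[P]_o B o <= e].

Lemma ocvg0_le (u v : nat -> Omega -> R) : ocvg0 v ->
  (forall n o, `|u n o| <= `|v n o|) -> ocvg0 u.
Proof.
move=> hv uv e e0; have [N hN] := hv e e0; exists N => n /hN[B [bB h1 h2]].
by exists B; split=> // o; rewrite (le_trans (uv n o)).
Qed.

Lemma ocvg0D (u v : nat -> Omega -> R) : ocvg0 u -> ocvg0 v ->
  ocvg0 (fun n o => u n o + v n o).
Proof.
move=> hu hv e e0; have e2 : 0 < e / 2 by rewrite divr_gt0.
have [N1 h1] := hu _ e2; have [N2 h2] := hv _ e2.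
exists (maxn N1 N2) => n; rewrite geq_max => /andP[/h1[B1 [b1 c1 d1]] /h2[B2 [b2 c2 d2]]].
exists (fun o => B1 o + B2 o); split; first exact: bmD.
  by move=> o; rewrite (le_trans (ler_normD _ _))// lerD.
by rewrite (bmID P1)//; lra.
Qed.

Lemma ocvg0Z (r : R) (u : nat -> Omega -> R) : ocvg0 u ->
  ocvg0 (fun n o => r * u n o).
Proof.
move=> hu e e0; pose s := `|r| + 1.
have s0 : 0 < s by rewrite /s ltr_wpDl.
have [N hN] := hu (e / s) (divr_gt0 e0 s0).
exists N => n /hN[B [bB h1 h2]]; exists (fun o => s * B o); split.
- exact: bmZ.
- move=> o; rewrite normrM ler_pM// /s; lra.
- by rewrite (bmIZ P1)// mulrC -ler_pdivlMr.
Qed.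

Lemma ocvg0_cst (u : nat -> R) : u n @[n --> \oo] --> (0 : R) ->
  ocvg0 (fun n _ => u n).
Proof.
move=> /cvgnP hu e e0; have [N hN] := hu e e0; exists N => n /hN.
rewrite subr0 => h; exists (fun=> e); split=> //; first exact: bm_cst.
by rewrite bmI_cst.
Qed.

Lemma ocvg0_int (u : nat -> Omega -> R) : (forall n, bm (u n)) ->
  ocvg0 u -> \int[P]_o `|u n o| @[n --> \oo] --> (0 : R).
Proof.
move=> bu hu; apply/cvgnP => e e0; have [N hN] := hu e e0.
exists N => n /hN[B [bB h1 h2]]; rewrite subr0.
apply: le_trans h2; apply: (bmI_norm_le P1) => //; first exact: bm_norm.
by move=> o; rewrite normr_id.
Qed.

(** Squares control the first moment through [2 |x| <= x^2 / e + e]. *)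
Lemma ocvg0_sq (u : nat -> Omega -> R) : (forall n, bm (u n)) ->
  \int[P]_o (u n o) ^+ 2 @[n --> \oo] --> (0 : R) -> ocvg0 u.
Proof.
move=> bu /cvgnP h e e0; have [N hN] := h (e * e) (mulr_gt0 e0 e0).
exists N => n /hN; rewrite subr0 => hn.
exists (fun o => (2 * e)^-1 * u n o ^+ 2 + e / 2); split.
- by apply: bmD; [apply: bmZ; exact: bmX|exact: bm_cst].
- move=> o; rewrite -(@ler_pM2l _ (2 * e)) ?mulr_gt0// mulrDr mulrA.
  rewrite divff ?mulf_neq0 ?gt_eqF// mul1r -real_normK ?num_real//.
  have := sqr_ge0 (`|u n o| - e); rewrite sqrrB => h1.
  rewrite (_ : 2 * e * (e / 2) = e ^+ 2); last by field.
  by rewrite mulr2n in h1; lra.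
- rewrite (bmID P1); [|apply: bmZ; exact: bmX|exact: bm_cst].
  rewrite (bmIZ P1 _ (bmX 2 (bu n))).
  rewrite (bmI_cst P1).
  suff : (2 * e)^-1 * \int[P]_x u n x ^+ 2 <= e / 2 by lra.
  rewrite mulrC ler_pdivrMr ?mulr_gt0//.
  rewrite (_ : e / 2 * (2 * e) = e * e); last by field.
  exact: le_trans (ler_norm _) hn.
Qed.
End outer_limit.

(** * Weight arrays *)

Section weight_arrays.
Context {R : realType}.
Implicit Types (a w : nat -> nat -> R) (C : R).

(** The conditions of the Toeplitz lemma. They are met by the squares of an array of the class W and
    by the uniform weights of the occupation measures. *)
Definition warray a C : Prop :=
  [/\ forall n p, (p <= n)%N -> 0 <= a n p,
      forall n p q, (p <= q <= n)%N -> a n q <= a n p,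
      forall n, \sum_(0 <= p < n.+1) a n p <= C
    & a n 0%N @[n --> \oo] --> (0 : R)].

Lemma warray_uniform : warray (fun n _ => n.+1%:R^-1) 1.
Proof.
split=> //; last exact: cvg_invS.
move=> n; by rewrite sumr_const_nat subn0 -[leLHS]mulr_natl mulfV// pnatr_eq0.
Qed.

Lemma warray_ge0 a C : warray a C -> 0 <= C.
Proof.
move=> [a0 _ aC _]; apply: le_trans (aC 0%N).
by rewrite big_nat1 a0.
Qed.

Lemma half_share (x e : R) : 0 <= x -> 0 < e -> x * (e / (2 * (x + 1))) <= e / 2.
Proof.
move=> x0 e0; have x1 : 0 < x + 1 by rewrite ltr_wpDl.
rewrite (_ : x * _ = (x * e / 2) / (x + 1)); last by field; rewrite gt_eqF.
rewrite ler_pdivrMr//; nra.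
Qed.

(** The finitely many early terms have weights below [a n 0], which tends to 0; the later ones have
    small means and total weight at most [C]. *)
Lemma toeplitz {d} {Omega : measurableType d} (P : probability Omega R)
    a C (u : nat -> Omega -> R) (c : R) : warray a C -> ocvg0 P u ->
  (forall n o, `|u n o| <= c) ->
  ocvg0 P (fun n o => \sum_(0 <= p < n.+1) a n p * `|u p o|).
Proof.
move=> wa hu hc e e0; have P1 := probability_setT P; have C0 := warray_ge0 wa; have [a0 an aC az] := wa.
have c0 : 0 <= c by apply: le_trans (hc 0%N point).
have e' : 0 < e / (2 * (C + 1)) by rewrite divr_gt0// mulr_gt0// ltr_wpDl.
have [N hN] := hu _ e'.
(* Each term gets a measurable majorant of its own, the trivial bound [c] before rank [N]. *)
have hB p : exists B : Omega -> R, [/\ bm B, forall o, `|u p o| <= B o &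
    \int[P]_o B o <= if (p < N)%N then c else e / (2 * (C + 1))].
  case: ltnP => [pN|/hN//].
  by exists (fun=> c); split=> //; [exact: bm_cst|rewrite (bmI_cst P1)].
have [B hB'] := choice hB.
have bB p : bm (B p) by case: (hB' p).
have uB p o : `|u p o| <= B p o by case: (hB' p).
have d0 : 0 < e / (2 * (N%:R * c + 1)).
  by rewrite divr_gt0// mulr_gt0// ltr_wpDl// mulr_ge0.
move/cvgnP: az => /(_ _ d0)[N' hN'].
exists (maxn N' N) => n; rewrite geq_max => /andP[/hN' + Nn].
rewrite subr0 => an0.
exists (fun o => \sum_(0 <= p < n.+1) a n p * B p o); split.
- by apply: bm_sum => p; exact: bmZ.
- move=> o; rewrite ger0_norm; last first.
    by rewrite big_nat; apply: sumr_ge0 => p /andP[_ pn]; rewrite mulr_ge0// a0.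
  rewrite big_nat [leRHS]big_nat; apply: ler_sum => p /andP[_ pn].
  by rewrite ler_wpM2l// a0.
- rewrite (bmI_sum P1); last by move=> p; exact: bmZ.
  apply: le_trans (_ : \sum_(0 <= p < n.+1) (a n p * (e / (2 * (C + 1))) +
      (if (p < N)%N then a n 0%N * c else 0)) <= _).
    rewrite big_nat [leRHS]big_nat; apply: ler_sum => p /andP[_ pn].
    rewrite (bmIZ P1)//.
    have [_ _ hI] := hB' p; have ap : 0 <= a n p by exact: a0.
    apply: le_trans (ler_wpM2l ap hI) _; case: ifP => _; last by rewrite addr0.
    apply: le_trans (_ : a n 0%N * c <= _); last first.
      by rewrite lerDr mulr_ge0// ltW.
    by rewrite ler_wpM2r// an.
  rewrite big_split/= -mulr_suml.
  have h1 : (\sum_(0 <= p < n.+1) a n p) * (e / (2 * (C + 1))) <= e / 2.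
    apply: le_trans (ler_wpM2r (ltW e') (aC n)) _.
    exact: half_share.
  have h2 : \sum_(0 <= i < n.+1) (if (i < N)%N then a n 0%N * c else 0) <= e / 2.
    rewrite -big_mkcond/= -(big_nat_widen 0 N n.+1 xpredT) ?(leq_trans Nn)//.
    rewrite sumr_const_nat subn0 -[leLHS]mulr_natl mulrCA.
    have Nc : 0 <= N%:R * c by rewrite mulr_ge0.
    apply: le_trans (_ : e / (2 * (N%:R * c + 1)) * (N%:R * c) <= _).
      by rewrite ler_wpM2r// (le_trans (ler_norm _) an0).
    by rewrite mulrC; exact: half_share.
  lra.
Qed.

Lemma weights_cvg0 w : weights w -> w n 0%N @[n --> \oo] --> (0 : R).
Proof.
move=> [w0 _ [m [m1 /cvg_series_cvg_0/cvgnP h]] _]; apply/cvgnP => e e0.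
have [N hN] := h (e ^+ m) (exprn_gt0 _ e0); exists N => n /hN.
rewrite !subr0 normrX; have := normr_ge0 (w n 0%N).
by move=> h0; rewrite ler_pXn2r// nnegrE ltW.
Qed.

(** The mean of an initial segment of a nonincreasing sequence is at least the mean of the whole;
    the denominators are multiplied out. *)
Lemma sum_nonincreasing (v : nat -> R) (k n : nat) : (k <= n)%N ->
  (forall p q, (p <= q <= n)%N -> v q <= v p) ->
  (\sum_(0 <= p < n.+1) v p) * k.+1%:R <= (\sum_(0 <= p < k.+1) v p) * n.+1%:R.
Proof.
move=> kn hv.
have h1 m : (k < m <= n.+1)%N ->
    (\sum_(0 <= p < m) v p) <= (\sum_(0 <= p < k.+1) v p) + (m - k.+1)%:R * v k.
  move=> /andP[km mn]; rewrite (@big_cat_nat _ _ _ k.+1)//= lerD2l.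
  apply: le_trans (_ : \sum_(k.+1 <= p < m) v k <= _); last first.
    by rewrite sumr_const_nat mulr_natl.
  rewrite big_nat [leRHS]big_nat; apply: ler_sum => p /andP[kp pm].
  by apply: hv; rewrite (ltnW kp)/= -ltnS (leq_trans pm).
have h2 : k.+1%:R * v k <= \sum_(0 <= p < k.+1) v p.
  rewrite mulr_natl -[in leLHS](subn0 k.+1) -sumr_const_nat.
  rewrite big_nat [leRHS]big_nat; apply: ler_sum => p /andP[_ pk].
  by apply: hv; rewrite -ltnS pk.
have := h1 n.+1; rewrite ltnS kn leqnn => /(_ isT).
move: h2; set S := \sum_(0 <= p < k.+1) _; set T := \sum_(_ <= p < _) _ => h2 h3.
have {}h3 := ler_wpM2r (ler0n R k.+1) h3; apply: le_trans h3 _.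
rewrite mulrDl -mulrA [v k * _]mulrC.
have h4 := ler_wpM2l (ler0n R (n.+1 - k.+1)) h2.
apply: le_trans (lerD (lexx _) h4) _.
rewrite [_%:R * S]mulrC -mulrDr -natrD subnKC//.
Qed.

(** Only the left limit of [varpi] at 1 is given, not its value there. Monotonicity of the weights
    excludes a jump, through [eps * varpi 1 <= varpi eps <= varpi 1]. *)
Lemma weights_sq_cvg w : weights w ->
  \sum_(0 <= p < n.+1) w n p ^+ 2 @[n --> \oo] --> (1 : R).
Proof.
move=> [w0 wn _ [varpi [h1 _ h2]]].
have T : \sum_(0 <= p < n.+1) w n p ^+ 2 @[n --> \oo] --> varpi 1.
  have := h1 1; rewrite ler01 lexx => /(_ isT).
  by under eq_fun do rewrite mul1r natrK.
suff : varpi 1 = 1 by move=> <-.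
have mono (eps : R) : 0 < eps < 1 -> varpi eps <= varpi 1 /\ eps * varpi 1 <= varpi eps.
  move=> /andP[e0 e1]; have e01 : 0 <= eps <= 1 by rewrite (ltW e0) (ltW e1).
  have H := h1 eps e01.
  have tr n : (Num.truncn (eps * n%:R) <= n)%N.
    by rewrite -[X in (_ <= X)%N](@natrK R) le_truncn// ler_piMl// ltW.
  split.
    apply: (ler_cvg_to H T); apply: nearW => n.
    rewrite [leRHS](@big_cat_nat _ _ _ (Num.truncn (eps * n%:R)).+1)//=; last by rewrite ltnS tr.
    by rewrite lerDl; apply: sumr_ge0 => p _; exact: sqr_ge0.
  (* A vanishing correction: the truncated sum has more than [eps * n] terms, whereas the comparison
     of means asks for [eps * (n + 1)]. *)
  have T' : n.+1%:R^-1 * (eps * \sum_(0 <= p < n.+1) w n p ^+ 2)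
      @[n --> \oo] --> 0 * (eps * varpi 1).
    by apply: cvgM; [exact: cvg_invS|apply: cvgM; [exact: cvg_cst|]].
  have H' : (\sum_(0 <= p < (Num.truncn (eps * n%:R)).+1) w n p ^+ 2) +
      n.+1%:R^-1 * (eps * \sum_(0 <= p < n.+1) w n p ^+ 2)
      @[n --> \oo] --> varpi eps + 0 * (eps * varpi 1) by exact: cvgD.
  rewrite mul0r addr0 in H'.
  have T'' : eps * \sum_(0 <= p < n.+1) w n p ^+ 2 @[n --> \oo] --> eps * varpi 1.
    by apply: cvgM; [exact: cvg_cst|].
  apply: (ler_cvg_to T'' H'); apply: nearW => n /=.
  have sq p q : (p <= q <= n)%N -> w n q ^+ 2 <= w n p ^+ 2.
    move=> pqn; have /andP[pq qn] := pqn.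
    by rewrite ler_sqr ?nnegrE ?w0 ?wn// (leq_trans pq).
  have := sum_nonincreasing (tr n) sq.
  set S := \sum_(0 <= p < n.+1) _; set H1 := \sum_(0 <= p < _) _ => h.
  have S0 : 0 <= S by apply: sumr_ge0 => p _; exact: sqr_ge0.
  have n0 : (0 : R) < n.+1%:R by rewrite ltr0n.
  have /andP[_ tg] : (Num.truncn (eps * n%:R))%:R <= eps * n%:R
      < (Num.truncn (eps * n%:R)).+1%:R.
    by apply: truncn_itv; rewrite mulr_ge0// ltW.
  have -> : H1 + n.+1%:R^-1 * (eps * S) = (H1 * n.+1%:R + eps * S) / n.+1%:R.
    by field; rewrite gt_eqF.
  rewrite ler_pdivlMr//; apply: le_trans (lerD h (lexx _)).
  have := ler_wpM2l S0 (ltW tg).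
  have -> : n.+1%:R = n%:R + 1 :> R by rewrite natr1.
  by set k : R := (_.+1)%:R; move: k (n%:R : R) => k m h1'; lra.
have near1 : \forall eps \near (1 : R)^'-, 0 < eps < 1.
  near=> eps; apply/andP; split; near: eps; last exact: nbhs_left_lt.
  exact: nbhs_left_gt.
have h1' : 1 <= varpi 1.
  have h4 : (fun _ : R => varpi 1) eps @[eps --> 1^'-] --> varpi 1.
    exact: cvg_cst.
  apply: (ler_cvg_to h2 h4).
  by apply: filterS near1 => eps /mono[].
apply/eqP; rewrite eq_le h1' andbT.
have h3 : eps * varpi 1 @[eps --> 1^'-] --> 1 * varpi 1.
  apply: cvgM; last exact: cvg_cst.
  by apply: cvg_at_left_filter; exact: cvg_id.
rewrite mul1r in h3.
apply: (ler_cvg_to h3 h2).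
by apply: filterS near1 => eps /mono[].
Unshelve. all: by end_near. Qed.

Lemma cvgn_bounded (u : nat -> R) (l : R) : u n @[n --> \oo] --> l ->
  exists2 c : R, 0 <= c & forall n, `|u n| <= c.
Proof.
move=> /cvgP/cvg_seq_bounded/bounded_fun_bound[c hc].
by exists c => //; exact: le_trans (normr_ge0 _) (hc 0%N).
Qed.

Lemma weights_sq_warray w : weights w ->
  exists C, warray (fun n p => w n p ^+ 2) C.
Proof.
move=> hw; have [C C0 hC] := cvgn_bounded (weights_sq_cvg hw).
have w0 := weights_cvg0 hw; have [w1 wn _ _] := hw.
exists C; split.
- by move=> n p _; exact: sqr_ge0.
- move=> n p q pqn; have /andP[pq qn] := pqn.
  by rewrite ler_sqr ?nnegrE ?w1 ?wn// (leq_trans pq).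
- by move=> n; exact: le_trans (ler_norm _) (hC n).
- rewrite (_ : (fun n => _) = (fun n => w n 0%N * w n 0%N)); last first.
    by apply/funext => n; rewrite expr2.
  by rewrite -[X in _ --> X](mulr0 0); exact: cvgM.
Qed.

(** Comparison with the telescoping terms [1 / p - 1 / (p + 1)]. *)
Lemma sum_inv_sq_tail (k n : nat) :
  \sum_(k.+1 <= p < n) (p.+1%:R : R) ^- 2 <= k.+1%:R^-1.
Proof.
have [nk|/ltnW kn] := leqP n k.+1; first by rewrite big_geq.
apply: le_trans (_ : k.+1%:R^-1 - n%:R^-1 <= _); last first.
  by rewrite gerBl invr_ge0.
elim: n kn => // n IH; rewrite leq_eqVlt => /predU1P[<-|].
  by rewrite big_geq// subrr.
rewrite ltnS => kn; rewrite big_nat_recr//=.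
rewrite (_ : _ - _ = (k.+1%:R^-1 - n%:R^-1) + (n%:R^-1 - n.+1%:R^-1)); last by ring.
rewrite lerD ?IH//.
have n0 : (0 : R) < n%:R by rewrite ltr0n (leq_ltn_trans _ kn).
rewrite -natr1; have n1 : (0 : R) < n%:R + 1 by lra.
rewrite (_ : n%:R^-1 - _ = (n%:R * (n%:R + 1))^-1); last first.
  by field; rewrite !gt_eqF.
rewrite lef_pV2 ?posrE ?mulr_gt0 ?exprn_gt0//.
by rewrite expr2 ler_pM2r//; lra.
Qed.

(** [2 w / (p+1) <= s w^2 + 1 / (s (p+1)^2)]: the second term is summable, and
    the total mass of the first is at most [s C]. *)
Lemma weights_harmonic w : weights w ->
  \sum_(0 <= p < n.+1) w n p / p.+1%:R @[n --> \oo] --> (0 : R).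
Proof.
move=> hw; have [C wC] := weights_sq_warray hw; have C0 := warray_ge0 wC.
have [_ _ hC _] := wC; have [w0 wn _ _] := hw.
apply/cvgnP => e e0.
(* With this [s] the quadratic part is at most [s / 2 * C <= e / 4]; the choice of [K] then brings
   the summable tail below [e / 4], and the first [K + 1] terms are bounded through [w n 0]. *)
pose s := e / (2 * (C + 1)).
have s0 : 0 < s by rewrite divr_gt0// mulr_gt0// ltr_wpDl.
have e2 : 0 < s * e / 2 by rewrite divr_gt0// mulr_gt0.
have /cvgnP/(_ _ e2)[K hK] := @cvg_invS R.
have k0 : (0 : R) < K.+1%:R by rewrite ltr0n.
have e3 : 0 < e / 2 / K.+1%:R by rewrite divr_gt0// divr_gt0.
have /cvgnP/(_ _ e3)[N hN] := weights_cvg0 hw.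
exists (maxn N K.+1) => n; rewrite geq_max => /andP[/hN + Kn].
rewrite !subr0 => wn0.
have pos p : (p <= n)%N -> 0 <= w n p / p.+1%:R.
  by move=> pn; rewrite divr_ge0// w0.
rewrite ger0_norm; last first.
  by rewrite big_nat; apply: sumr_ge0 => p /andP[_ pn]; exact: pos.
rewrite (@big_cat_nat _ _ _ K.+1)//=; last exact: leqW.
have h1 : \sum_(0 <= p < K.+1) w n p / p.+1%:R <= e / 2.
  apply: le_trans (_ : \sum_(0 <= p < K.+1) e / 2 / K.+1%:R <= _).
    rewrite big_nat [leRHS]big_nat; apply: ler_sum => p /andP[_ pK].
    have pn : (p <= n)%N by rewrite (leq_trans _ Kn)// ltnW.
    apply: le_trans (_ : w n 0%N <= _); last exact: le_trans (ler_norm _) wn0.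
    apply: le_trans (_ : w n p <= _); last by rewrite wn.
    by rewrite ler_piMr ?w0// invf_le1 ?ler1n.
  by rewrite sumr_const_nat subn0 -[leLHS]mulr_natr divfK// gt_eqF.
have h2 : \sum_(K.+1 <= p < n.+1) w n p / p.+1%:R <= e / 2.
  apply: le_trans (_ : \sum_(K.+1 <= p < n.+1)
      (s / 2 * w n p ^+ 2 + (2 * s)^-1 * p.+1%:R ^- 2) <= _).
    apply: ler_sum => p _; set y : R := p.+1%:R^-1.
    have -> : p.+1%:R ^- 2 = y ^+ 2 by rewrite /y exprVn.
    move: (w n p) y => z y; rewrite -subr_ge0.
    rewrite (_ : _ - _ = (s * z - y) ^+ 2 / (2 * s)); last first.
      by field; rewrite gt_eqF.
    by rewrite divr_ge0 ?sqr_ge0// mulr_ge0// ltW.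
  rewrite big_split/= -!mulr_sumr.
  have a1 : s / 2 * \sum_(K.+1 <= i < n.+1) w n i ^+ 2 <= e / 4.
    apply: le_trans (_ : s / 2 * C <= _).
      apply: ler_wpM2l; first by rewrite divr_ge0// ltW.
      apply: le_trans (hC n).
      rewrite [leRHS](@big_cat_nat _ _ _ K.+1)//=; last exact: leqW.
      by rewrite lerDr; apply: sumr_ge0 => p _; exact: sqr_ge0.
    have := half_share C0 e0; rewrite -/s => h; lra.
  have a2 : (2 * s)^-1 * \sum_(K.+1 <= i < n.+1) i.+1%:R ^- 2 <= e / 4.
    apply: le_trans (_ : (2 * s)^-1 * (s * e / 2) <= _).
      apply: ler_wpM2l; first by rewrite invr_ge0 mulr_ge0// ltW.
      apply: le_trans (sum_inv_sq_tail _ _) _.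
      have := hK K (leqnn _); rewrite subr0; apply: le_trans; exact: ler_norm.
    rewrite le_eqVlt; apply/orP; left; apply/eqP; field.
    by rewrite gt_eqF.
  by lra.
by lra.
Qed.

End weight_arrays.

(** * Central limit theorem at one level *)

Section level.
Context {dO d} {Omega : measurableType dO} {E : measurableType d} {R : realType}.
Variable P : probability Omega R.
Variable F : nat -> set (set Omega).
Hypothesis F_sigma : forall n, sigma_algebra setT (F n).
Hypothesis FS : forall n, F n `<=` F n.+1.
Hypothesis FM : forall n, F n `<=` measurable.
Variable X : nat -> Omega -> E.
(** The kernel used from time [n] to [n + 1] is random but known at time [n]. In the application it
    is frozen at the occupation measure of the level below, whose whole trajectory is already known
    at time 0. *)
Variable K : nat -> Omega -> R.-pker E ~> E.
Variable phi : nat -> Omega -> probability E R.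

Local Notation OF n := (g_sigma_algebraType (F n)).

Hypothesis mX : forall n, @measurable_fun _ _ (OF n) E setT (X n).
Hypothesis mK : forall n (A : set E), measurable A ->
  @measurable_fun _ _ (OF n * E)%type (\bar R) setT (fun u => K n u.1 u.2 A).
Hypothesis markov : forall n (A : set E) (G : set Omega), measurable A ->
  F n G -> P (G `&` X n.+1 @^-1` A) =
           (\int[P]_(o in G) K n o (X n o) A)%E.
Variables (N : nat) (b : R).
Hypotheses (N0 : (0 < N)%N) (b01 : 0 <= b < 1).
Hypothesis contrK : forall n o, contracts (K n o) N b.
Hypothesis invK : forall n o, invariant_law (phi n o) (K n o).

Let P1 : P setT = 1%E. Proof. exact: probability_setT. Qed.
Let K1 n o x : K n o x setT = 1%E. Proof. exact: prob_kernel. Qed.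
Let phi1 n o : phi n o setT = 1%E. Proof. exact: probability_setT. Qed.

Lemma F_measurable n (A : set Omega) : measurable (A : set (OF n)) = F n A.
Proof. by rewrite /measurable /= sigma_algebra_id. Qed.

Lemma F_le n m : (n <= m)%N -> F n `<=` F m.
Proof.
elim: m => [|m IH]; first by rewrite leqn0 => /eqP ->.
rewrite leq_eqVlt => /predU1P[->//|]; rewrite ltnS => /IH h A /h.
exact: FS.
Qed.

Lemma measurable_OF n d' (T : measurableType d') (g : Omega -> T) :
  @measurable_fun _ _ (OF n) T setT g -> measurable_fun setT g.
Proof.
by move=> mg _ B mB; apply: (FM (n := n)); rewrite -F_measurable; exact: mg.
Qed.

Lemma measurable_OF_le n m d' (T : measurableType d') (g : Omega -> T) :
  (n <= m)%N -> @measurable_fun _ _ (OF n) T setT g ->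
  @measurable_fun _ _ (OF m) T setT g.
Proof.
move=> nm mg _ B mB; rewrite F_measurable; apply: (F_le nm).
by rewrite -F_measurable; exact: mg.
Qed.

Definition bmF n (g : Omega -> R) : Prop := @bm _ (OF n) R g.

Lemma bmF_bm n g : bmF n g -> bm g.
Proof. by move=> [mg hg]; split => //; exact: measurable_OF mg. Qed.

Lemma bmF_le n m g : (n <= m)%N -> bmF n g -> bmF m g.
Proof. by move=> nm [mg hg]; split => //; exact: measurable_OF_le mg. Qed.

(** Conditional expectation of [H(., X (n + 1))] given [F n]. *)
Definition cexp n (H : Omega * E -> R) (o : Omega) : R :=
  \int[K n o (X n o)]_y H (o, y).

Lemma measurable_graph n : @measurable_fun _ _ (OF n) (OF n * E)%type setT
  (fun o => (o, X n o)).
Proof. exact: measurable_fun_pair. Qed.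

Lemma cexp_bm n (H : Omega * E -> R) : @bm _ (OF n * E)%type R H ->
  bmF n (cexp n H).
Proof.
move=> bH; apply: (@bm_kernel_int _ _ (OF n) E R (fun o => K n o (X n o)) H) => //.
move=> A mA.
by have := measurableT_comp (@mK n A mA) (@measurable_graph n).
Qed.

(** The Markov property is a statement about rectangles of a past event and a future set. A monotone
    class argument extends it to all functions of the past and of the next state. *)
Lemma cexp_int n (H : Omega * E -> R) : @bm _ (OF n * E)%type R H ->
  \int[P]_o H (o, X n.+1 o) = \int[P]_o cexp n H o.
Proof.
have mX1 : @measurable_fun _ _ Omega (OF n * E)%type setT (fun o => (o, X n.+1 o)).
  apply: measurable_fun_pair; last exact: measurable_OF (@mX n.+1).
  by move=> _ B; rewrite setTI F_measurable => /FM.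
have bsec (H' : Omega * E -> R) o : @bm _ (OF n * E)%type R H' ->
    bm (fun y => H' (o, y)).
  by move=> bH; apply: (@bm_comp _ _ (OF n * E)%type E R (pair o) H').
have bX (H' : Omega * E -> R) : @bm _ (OF n * E)%type R H' ->
    bm (fun o => H' (o, X n.+1 o)).
  by move=> bH; exact: (@bm_comp _ _ (OF n * E)%type Omega R _ H' mX1 bH).
move: H; apply: (@bm_functional_unique _ (OF n * E)%type R
  (fun H => \int[P]_o H (o, X n.+1 o)) (fun H => \int[P]_o cexp n H o)
  [set A `*` B | A in measurable & B in measurable]).
- split.
  + by move=> f g bf bg; rewrite bmID//; exact: bX.
  + by move=> r f bf; rewrite bmIZ//; exact: bX.
  + move=> h f c bh hf hc; apply: (@bmI_cvg _ _ _ _ _ _ _ c) => //.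
    by move=> m; exact: bX.
- split.
  + move=> f g bf bg; rewrite -bmID//; try exact: bmF_bm (cexp_bm _).
    apply: eq_Rintegral => o _; rewrite /cexp bmID//; exact: bsec.
  + move=> r f bf; rewrite -bmIZ//; last exact: bmF_bm (cexp_bm _).
    apply: eq_Rintegral => o _; rewrite /cexp bmIZ//; exact: bsec.
  + move=> h f c bh hf hc; apply: (@bmI_cvg _ _ _ _ _ _ _ c) => //.
    * by move=> m; exact: bmF_bm (cexp_bm _).
    * move=> o; apply: (@bmI_cvg _ _ _ _ _ _ _ c) => //.
      by move=> m; exact: bsec.
    * move=> m o; apply: bmI_bound => //; exact: bsec.
- exact: measurable_prod_measurableType.
- move=> _ _ [A1 mA1 [B1 mB1 <-]] [A2 mA2 [B2 mB2 <-]].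
  rewrite -setXI; exists (A1 `&` A2); first exact: measurableI.
  by exists (B1 `&` B2) => //; exact: measurableI.
- rewrite bmI_cst// -[LHS](bmI_cst P1 1); apply: eq_Rintegral => o _.
  by rewrite /cexp bmI_cst.
- move=> _ [A mA [B mB <-]].
  have FA : F n A by rewrite -F_measurable.
  have mA' := FM FA.
  have mXB : measurable (X n.+1 @^-1` B).
    by rewrite -[X in measurable X]setTI; apply: (measurable_OF (@mX n.+1)).
  transitivity (fine (P (A `&` X n.+1 @^-1` B))).
    rewrite -Rint_indic; last exact: measurableI.
    by apply: eq_Rintegral => o _; apply: indic_iff.
  rewrite markov// /Rintegral [in LHS]integral_mkcond; congr fine.
  apply: eq_integral => o _; rewrite patchE /cexp.
  have [oA|oA] := boolP (o \in A).
    rewrite (_ : \int[_]_y _ = fine (K n o (X n o) B)) ?fineK//.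
      exact: fin_num_mass1.
    rewrite -Rint_indic//; apply: eq_Rintegral => y _; apply: indic_iff.
    by split=> [[]//|By]; split => //; exact: set_mem.
  rewrite (_ : \int[_]_y _ = 0)//.
  rewrite -[RHS](bmI_cst (K1 n o (X n o)) 0); apply: eq_Rintegral => y _.
  rewrite indicE memNset// => -[Ao _]; move/negP: oA; apply.
  exact: mem_set.
Qed.

Lemma iter_joint n f j : bm f ->
  @bm _ (OF n * E)%type R (fun u => iter j (kop (K n u.1)) f u.2).
Proof.
move=> bf; elim: j => [|j IH] /=.
  exact: (@bm_comp _ _ E (OF n * E)%type R snd f measurable_snd bf).
apply: (@bm_kernel_int _ _ (OF n * E)%type E R (fun u => K n u.1 u.2)
  (fun v => iter j (kop (K n v.1.1)) f v.2)) => //.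
- by move=> A mA; exact: mK.
- apply: (@bm_comp _ _ (OF n * E)%type ((OF n * E) * E)%type R
    (fun v => (v.1.1, v.2)) (fun u => iter j (kop (K n u.1)) f u.2)) => //.
  apply: measurable_fun_pair => //.
  exact: (measurableT_comp (f := fst) measurable_fst measurable_fst).
Qed.

(** Measurability of the invariant law in [o] is inherited from the kernel: the mean of [f] is the
    limit of the iterates of [f] at any fixed point. *)
Lemma phi_bmF n f : bm f -> bmF n (fun o => \int[phi n o]_x f x).
Proof.
move=> bf; have [c c0 hc] := bm_bound bf.
apply: (@bm_lim _ (OF n) R (fun j o => iter j (kop (K n o)) f point) _ c).
- move=> j; apply: bm_meas.
  apply: (@bm_comp _ _ (OF n * E)%type (OF n) R (fun o => (o, point))
    (fun u => iter j (kop (K n u.1)) f u.2)); last exact: iter_joint.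
  exact: (@pair2_measurable _ _ (OF n) E point).
- move=> o; exact: (iter_kop_cvg N0 b01 (contrK n o) (invK n o) _ bf).
- by move=> o; exact: (bmI_bound (phi1 n o) bf hc).
Qed.

(** * Poisson solutions and martingale increments for the random kernels *)

Definition pois n f o : E -> R := resolvent (K n o) (phi n o) f.
Definition kpois n f o : E -> R := kop (K n o) (pois n f o).

Let C : R := N%:R / (1 - b).

Lemma res_const_ge0 : 0 <= C.
Proof. by have /andP[b0 b1] := b01; rewrite divr_ge0// subr_ge0 ltW. Qed.

Lemma osc_bound {T : Type} (f : T -> R) (c : R) : (forall x, `|f x| <= c) ->
  forall x y, `|f x - f y| <= 2 * c.
Proof.
move=> hc x y; rewrite (le_trans (ler_normB _ _))//.
by have := hc x; have := hc y; lra.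
Qed.

Lemma pois_bound n f (c : R) o x : bm f -> (forall x, `|f x| <= c) ->
  `|pois n f o x| <= C * (2 * c).
Proof.
move=> bf hc; apply: resolvent_bound => //.
exact: osc_bound.
Qed.

Lemma pois_joint n f : bm f ->
  @bm _ (OF n * E)%type R (fun u => pois n f u.1 u.2).
Proof.
move=> bf; have [c c0 hc] := bm_bound bf.
apply: (@bm_lim _ (OF n * E)%type R (fun m u =>
  series (fun j => iter j (kop (K n u.1)) f u.2 - \int[phi n u.1]_y f y) m) _
  (C * (2 * c))).
- move=> m; apply: bm_meas; apply: bm_sum => j; apply: bmB.
    exact: iter_joint.
  exact: (@bm_comp _ _ (OF n) (OF n * E)%type R fst _ measurable_fst (phi_bmF n bf)).
- move=> [v x]; exact: (resolvent_cvg N0 b01 (contrK n v) (invK n v) bf).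
- by move=> u; exact: pois_bound.
Qed.

Lemma pois_bm n f o : bm f -> bm (pois n f o).
Proof. by move=> bf; exact: (resolvent_bm N0 b01 (contrK n o) (invK n o) bf). Qed.

Lemma kpois_bound n f (c : R) o x : bm f -> (forall x, `|f x| <= c) ->
  `|kpois n f o x| <= C * (2 * c).
Proof.
move=> bf hc; apply: kop_bound; first exact: pois_bm.
by move=> y; exact: pois_bound.
Qed.

Lemma kpois_cexp n f : (fun o => kpois n f o (X n o)) =
  cexp n (fun u => pois n f u.1 u.2).
Proof. by []. Qed.

Lemma poisE n f o x : bm f ->
  pois n f o x - kpois n f o x = f x - \int[phi n o]_y f y.
Proof. by move=> bf; exact: (resolvent_poisson N0 b01 (contrK n o) (invK n o) x bf). Qed.

Definition mincr n f o : R := pois n f o (X n.+1 o) - kpois n f o (X n o).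
(** The conditional variance of [mincr n f] given [F n]. *)
Definition mvar n f o : R :=
  kop (K n o) (fun y => pois n f o y ^+ 2) (X n o) - kpois n f o (X n o) ^+ 2.

Lemma mincr_bmF n f : bm f -> bmF n.+1 (mincr n f).
Proof.
move=> bf; apply: bmB.
  apply: (@bm_comp _ _ (OF n * E)%type (OF n.+1) R (fun o => (o, X n.+1 o))
    (fun u => pois n f u.1 u.2)); last exact: pois_joint.
  apply: measurable_fun_pair; last exact: mX.
  by apply: (measurable_OF_le (leqnSn n)).
apply: (bmF_le (leqnSn n)); rewrite kpois_cexp; apply: cexp_bm.
exact: pois_joint.
Qed.

Lemma mvar_bmF n f : bm f -> bmF n (mvar n f).
Proof.
move=> bf; apply: bmB.
  apply: (@cexp_bm n (fun u => pois n f u.1 u.2 ^+ 2)).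
  by apply: bmX; exact: pois_joint.
by apply: bmX; rewrite kpois_cexp; apply: cexp_bm; exact: pois_joint.
Qed.

Lemma mincr_bound n f (c : R) o : bm f -> (forall x, `|f x| <= c) ->
  `|mincr n f o| <= C * (4 * c).
Proof.
move=> bf hc; rewrite (le_trans (ler_normB _ _))//.
have := pois_bound n o (X n.+1 o) bf hc; have := kpois_bound n o (X n o) bf hc.
by set u := `| _ |; set v := `| _ |; lra.
Qed.

Let lift_bm n (Y : Omega -> R) : bmF n Y ->
  @bm _ (OF n * E)%type R (fun u => Y u.1).
Proof.
by move=> bY; exact: (@bm_comp _ _ (OF n) (OF n * E)%type R fst _ measurable_fst bY).
Qed.

Lemma mincr_mean n f Y : bm f -> bmF n Y -> \int[P]_o (Y o * mincr n f o) = 0.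
Proof.
move=> bf bY.
have bq : bmF n (fun o => kpois n f o (X n o)).
  by rewrite kpois_cexp; apply: cexp_bm; exact: pois_joint.
have bH : @bm _ (OF n * E)%type R
    (fun u => Y u.1 * (pois n f u.1 u.2 - kpois n f u.1 (X n u.1))).
  apply: bmM; first exact: lift_bm.
  by apply: bmB; [exact: pois_joint|exact: (lift_bm bq)].
rewrite (cexp_int bH) -[RHS](bmI_cst P1 0); apply: eq_Rintegral => o _.
have bp : bm (pois n f o) by exact: pois_bm.
rewrite /cexp/= bmIZ//; last by apply: bmB => //; exact: bm_cst.
by rewrite bmIB ?bmI_cst// ?subrr ?mulr0//; exact: bm_cst.
Qed.

Lemma mvarE n f o : bm f ->
  \int[K n o (X n o)]_y (pois n f o y - kpois n f o (X n o)) ^+ 2 = mvar n f o.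
Proof.
by move=> bf; apply: kop_variance; exact: pois_bm.
Qed.

Lemma mincr_var n f Y : bm f -> bmF n Y ->
  \int[P]_o (Y o * mincr n f o ^+ 2) = \int[P]_o (Y o * mvar n f o).
Proof.
move=> bf bY.
have bq : bmF n (fun o => kpois n f o (X n o)).
  by rewrite kpois_cexp; apply: cexp_bm; exact: pois_joint.
have bH : @bm _ (OF n * E)%type R
    (fun u => Y u.1 * (pois n f u.1 u.2 - kpois n f u.1 (X n u.1)) ^+ 2).
  apply: bmM; first exact: lift_bm.
  by apply: bmX; apply: bmB; [exact: pois_joint|exact: (lift_bm bq)].
rewrite (cexp_int bH); apply: eq_Rintegral => o _.
have bp : bm (pois n f o) by exact: pois_bm.
rewrite /cexp/= bmIZ ?mvarE//.
by apply: bmX; apply: bmB => //; exact: bm_cst.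
Qed.

Lemma mvar_bound n f (c : R) o : bm f -> (forall x, `|f x| <= c) ->
  0 <= mvar n f o <= (C * (4 * c)) ^+ 2.
Proof.
move=> bf hc; have bp : bm (pois n f o) by exact: pois_bm.
rewrite -mvarE//; apply/andP; split.
  by apply: Rintegral_ge0 => y _; exact: sqr_ge0.
rewrite -[leRHS](bmI_cst (K1 n o (X n o))); apply: bmI_le => //.
- by apply: bmX; apply: bmB => //; exact: bm_cst.
- exact: bm_cst.
move=> y; rewrite -real_normK ?num_real//.
have h : `|pois n f o y - kpois n f o (X n o)| <= C * (4 * c).
  rewrite (le_trans (ler_normB _ _))//.
  have := pois_bound n o y bf hc; have := kpois_bound n o (X n o) bf hc.
  by set u := `| _ |; set v := `| _ |; lra.
by rewrite ler_sqr ?nnegrE//; exact: le_trans (normr_ge0 _) h.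
Qed.

(** * Comparison of the kernels with their predecessors and with the limit kernel *)

Variables (Kpi : R.-pker E ~> E) (pi : probability E R).
Hypotheses (contrpi : contracts Kpi N b) (invpi : invariant_law pi Kpi).
Variable L : R.
Hypothesis L0 : 0 <= L.
Hypothesis lipK : forall n o f (c : R), bm f -> (forall x, `|f x| <= c) ->
  forall x, `|kop (K n.+1 o) f x - kop (K n o) f x| <= L * c / n.+1%:R.

Definition kdist f n o : R :=
  sup [set `|kop (K n o) f x - kop Kpi f x| | x in [set: E]].

Hypothesis convK : forall f, bm f -> ocvg0 P (kdist f).

Let pi1 : pi setT = 1%E. Proof. exact: probability_setT. Qed.

Lemma kdist_ub f (c : R) n o x : bm f -> (forall x, `|f x| <= c) ->
  `|kop (K n o) f x - kop Kpi f x| <= 2 * c.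
Proof.
move=> bf hc; rewrite (le_trans (ler_normB _ _))//.
by have := kop_bound (K n o) bf hc x; have := kop_bound Kpi bf hc x; lra.
Qed.

Lemma kdist_le f n o x : bm f ->
  `|kop (K n o) f x - kop Kpi f x| <= kdist f n o.
Proof.
move=> bf; have [c c0 hc] := bm_bound bf.
apply: ub_le_sup; last by exists x.
by exists (2 * c) => _ [y _ <-]; exact: kdist_ub.
Qed.

Lemma kdist_bound f (c : R) n o : bm f -> (forall x, `|f x| <= c) ->
  `|kdist f n o| <= 2 * c.
Proof.
move=> bf hc; rewrite ger0_norm; last first.
  exact: le_trans (normr_ge0 _) (kdist_le n o point bf).
by apply: ge_sup; [exists `|kop (K n o) f point - kop Kpi f point|, point|
  move=> _ [y _ <-]; exact: kdist_ub].
Qed.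

(** The first two terms are the bound of [resolvent_perturbation], the last that of
    [invariant_perturbation], for resolvents bounded by [C * (2 * c)] and
    [C * (2 * (C * (2 * c)))]. *)
Let B1 (c : R) : R :=
  C * (4 * (L * (C * (2 * c)))) + L * (C * (2 * (C * (2 * c)))) +
  L * (C * (2 * c)).

(** By the Poisson equation the increment of [kpois] is that of the resolvent plus that of the mean
    of [f]; the two perturbation estimates make both of order [1 / (n + 1)]. *)
Lemma kpois_step f (c : R) n o x : bm f -> (forall x, `|f x| <= c) ->
  `|kpois n.+1 f o x - kpois n f o x| <= B1 c / n.+1%:R.
Proof.
move=> bf hc.
have bp := pois_bm n o bf.
have hp y := pois_bound n o y bf hc.
have hpp y := pois_bound n o y bp hp.
have bpp := pois_bm n o bp.
have l1 y := lipK n o bp hp y.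
have l2 y := lipK n o bpp hpp y.
have h1 := resolvent_perturbation N0 b01 (contrK n.+1 o) (invK n.+1 o)
  (contrK n o) (invK n o) bf l1 l2 x.
have h2 := invariant_perturbation N0 b01 (invK n.+1 o)
  (contrK n o) (invK n o) bf l1.
have e1 := poisE n.+1 o x bf; have e2 := poisE n o x bf.
rewrite (_ : _ - _ = (pois n.+1 f o x - pois n f o x) +
  (\int[phi n.+1 o]_y f y - \int[phi n o]_y f y)); last first.
  by move: e1 e2; move: (pois n.+1 f o x) (kpois n.+1 f o x) (pois n f o x)
    (kpois n f o x) (f x) (\int[_]_y _) (\int[_]_y _) => *; lra.
rewrite (le_trans (ler_normD _ _))//.
apply: le_trans (lerD h1 h2) _; rewrite /B1 -/C.
by rewrite le_eqVlt; apply/orP; left; apply/eqP; field.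
Qed.

Lemma B1_ge0 (c : R) : 0 <= c -> 0 <= B1 c.
Proof.
move=> c0; have C0 := res_const_ge0; rewrite /B1.
by repeat first [exact: L0|exact: C0|exact: c0|exact: ler0n
  |apply: addr_ge0|apply: mulr_ge0].
Qed.

(** Summation by parts moves the differences from [q] to the nonincreasing [v], whose total
    variation is at most [v 0]. *)
Lemma abel_bound (v q : nat -> R) (c : R) n :
  (forall p p', (p <= p' <= n)%N -> v p' <= v p) ->
  (forall p, (p <= n)%N -> 0 <= v p) ->
  (forall p, `|q p| <= c) ->
  `|\sum_(0 <= p < n) v p.+1 * (q p - q p.+1)| <= 2 * c * v 0%N.
Proof.
move=> vn v0 qc; have c0 : 0 <= c by apply: le_trans (qc 0%N).
(* The boundary term and the variation still available, [- v m], are kept so that the induction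
   closes. *)
have H m : (m <= n)%N ->
    `|\sum_(0 <= p < m) v p.+1 * (q p - q p.+1) + v m * q m|
      <= c * (2 * v 0%N - v m).
  elim: m => [_|m IH mn].
    rewrite big_geq// add0r normrM ger0_norm ?v0// mulrC.
    by rewrite (_ : 2 * v 0%N - v 0%N = v 0%N) ?ler_wpM2r ?v0//; ring.
  rewrite big_nat_recr//= (_ : _ + _ + _ =
    (\sum_(0 <= p < m) v p.+1 * (q p - q p.+1) + v m * q m) -
    (v m - v m.+1) * q m); last by ring.
  rewrite (le_trans (ler_normB _ _))//.
  have h1 := IH (ltnW mn).
  have h2 : `|(v m - v m.+1) * q m| <= (v m - v m.+1) * c.
    have d0 : 0 <= v m - v m.+1 by rewrite subr_ge0 vn// leqnSn.
    by rewrite normrM ger0_norm// ler_wpM2l.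
  by apply: le_trans (lerD h1 h2) _; lra.
have := H n (leqnn n); set S := \sum_(_ <= _ < _) _ => h.
rewrite -(addrK (v n * q n) S) (le_trans (ler_normB _ _))//.
have h2 : `|v n * q n| <= v n * c.
  by rewrite normrM ger0_norm ?v0// ler_wpM2l// v0.
by apply: le_trans (lerD h h2) _; lra.
Qed.

(** * Martingale approximation and weighted law of large numbers *)

Variable nu0 : probability E R.

Definition derr f p o : R :=
  f (X p o) - match p with
              | 0 => \int[nu0]_x f x
              | q.+1 => \int[phi q o]_x f x
              end.

(** The increment from time [p] to [p + 1] carries the weight of time [p + 1], the rank at which it
    enters the field. *)
Definition msum_incr (v : nat -> R) f j o : R :=
  \sum_(0 <= p < j) v p.+1 * mincr p f o.

(** Each local error is a martingale increment, plus a difference of consecutive values of [q], plus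
    the change [r] of [kpois] at a fixed point. The second part is summed by parts against the
    monotone weights, the third is of order [1 / p]. The bound holds for every [o]. *)
Lemma derr_martingale (v : nat -> R) f (c : R) n o :
  bm f -> (forall x, `|f x| <= c) ->
  (forall p p', (p <= p' <= n)%N -> v p' <= v p) ->
  (forall p, (p <= n)%N -> 0 <= v p) ->
  `|\sum_(0 <= p < n.+1) v p * derr f p o - msum_incr v f n o| <=
  (2 * c + 2 * (C * (2 * c))) * v 0%N +
  B1 c * \sum_(0 <= p < n.+1) v p / p.+1%:R.
Proof.
move=> bf hc vn v0; have c0 : 0 <= c by apply: le_trans (hc point).
pose q p := kpois p f o (X p o).
pose r p := kpois p.+1 f o (X p.+1 o) - kpois p f o (X p.+1 o).
have dE p : derr f p.+1 o = mincr p f o + (q p - q p.+1) + r p.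
  have := poisE p o (X p.+1 o) bf; rewrite /derr /mincr /q /r.
  by move: (pois _ _ _ _) (kpois _ _ _ _) (kpois _ _ _ _) (kpois _ _ _ _) => *; lra.
rewrite big_nat_recl//= (_ : _ - _ = v 0%N * derr f 0 o +
  \sum_(0 <= p < n) v p.+1 * (q p - q p.+1) +
  \sum_(0 <= p < n) v p.+1 * r p); last first.
  rewrite /msum_incr -!addrA; congr (_ + _).
  rewrite -sumrN -!big_split/=; apply: eq_bigr => p _; rewrite dE.
  by ring.
have h0 : `|v 0%N * derr f 0 o| <= 2 * c * v 0%N.
  rewrite normrM ger0_norm ?v0// mulrC ler_wpM2r ?v0//.
  rewrite (le_trans (ler_normB _ _))//.
  have := hc (X 0%N o).
  have := bmI_bound (probability_setT nu0) bf hc; lra.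
have h1 := abel_bound vn v0 (fun p => kpois_bound p o (X p o) bf hc).
have h2 : `|\sum_(0 <= p < n) v p.+1 * r p| <=
    B1 c * \sum_(0 <= p < n.+1) v p / p.+1%:R.
  apply: le_trans (ler_norm_sum _ _ _) _.
  rewrite [X in _ * X]big_nat_recr//= mulrDr.
  rewrite -[leLHS]addr0; apply: lerD; last first.
    by rewrite mulr_ge0 ?B1_ge0// divr_ge0// v0.
  rewrite mulr_sumr big_nat [leRHS]big_nat; apply: ler_sum => p /andP[_ pn].
  rewrite normrM ger0_norm ?v0// mulrCA.
  apply: le_trans (_ : v p.+1 * (B1 c / p.+1%:R) <= _).
    by rewrite ler_wpM2l ?v0//; exact: kpois_step.
  rewrite ler_wpM2r//; last by rewrite vn// leqnSn.
  by rewrite divr_ge0// B1_ge0.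
apply: le_trans (ler_normD _ _) _; rewrite lerD//.
apply: le_trans (ler_normD _ _) _; by rewrite mulrDl lerD.
Qed.

Lemma msum_incr_bmF v f j : bm f -> bmF j (msum_incr v f j).
Proof.
move=> bf; rewrite /msum_incr; elim: j => [|j IH].
  by under eq_fun do rewrite big_geq//; exact: bm_cst.
under eq_fun do rewrite big_nat_recr//=.
apply: bmD; first exact: bmF_le (leqnSn j) IH.
by apply: bmZ; exact: mincr_bmF.
Qed.

(** Increments are orthogonal to the past, so that the cross terms drop out. *)
Lemma msum_incr_sq v f (c : R) n : bm f -> (forall x, `|f x| <= c) ->
  \int[P]_o (msum_incr v f n o) ^+ 2 <=
  (C * (4 * c)) ^+ 2 * \sum_(0 <= p < n) v p.+1 ^+ 2.
Proof.
move=> bf hc; elim: n => [|n IH].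
  rewrite big_geq// mulr0 (eq_Rintegral _ (g := fun=> 0)).
    by rewrite bmI_cst.
  by move=> o _; rewrite /msum_incr big_geq// expr0n.
have bS := msum_incr_bmF v n bf; have bS' := bmF_bm bS.
have bm1 := mincr_bmF n bf; have bm1' := bmF_bm bm1.
rewrite (eq_Rintegral _ (g := fun o => (msum_incr v f n o ^+ 2 +
    (2 * v n.+1) * (msum_incr v f n o * mincr n f o)) +
    v n.+1 ^+ 2 * mincr n f o ^+ 2)); last first.
  by move=> o _; rewrite /msum_incr big_nat_recr//=; ring.
have i1 : bm (fun o => msum_incr v f n o ^+ 2) by exact: bmX.
have i2 : bm (fun o => msum_incr v f n o * mincr n f o) by exact: bmM.
have i3 : bm (fun o => mincr n f o ^+ 2) by exact: bmX.
rewrite (bmID P1 (bmD i1 (bmZ _ i2)) (bmZ _ i3)) (bmID P1 i1 (bmZ _ i2)).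
rewrite (bmIZ P1 _ i2) (bmIZ P1 _ i3) mincr_mean// mulr0 addr0.
rewrite big_nat_recr//= mulrDr lerD// mulrC ler_wpM2r ?sqr_ge0//.
rewrite -[leRHS](bmI_cst P1); apply: bmI_le => //; first exact: bm_cst.
move=> o; rewrite -real_normK ?num_real//; have := mincr_bound n o bf hc.
by move=> h; rewrite ler_sqr ?nnegrE//; exact: le_trans (normr_ge0 _) h.
Qed.

Lemma poispi_bm f : bm f -> bm (resolvent Kpi pi f).
Proof. exact: (resolvent_bm N0 b01 contrpi invpi). Qed.

Lemma phi_dist f n o : bm f ->
  `|\int[phi n o]_x f x - \int[pi]_x f x| <= kdist (resolvent Kpi pi f) n o.
Proof.
move=> bf; apply: (invariant_perturbation N0 b01 (invK n o) contrpi invpi bf).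
by move=> x; apply: kdist_le; exact: poispi_bm.
Qed.

Lemma derr_bm f p : bm f -> bm (derr f p).
Proof.
move=> bf; apply: bmB.
  by apply: (bm_comp (u := X p)) => //; exact: measurable_OF (@mX p).
case: p => [|p]; first exact: bm_cst.
exact: bmF_bm (phi_bmF p bf).
Qed.

(** The martingale part has variance of order [A * a n 0]. What remains is a harmonic sum and a
    weighted mean of the distances from the random centerings to [pi], both handled by the Toeplitz
    lemma. *)
Lemma weighted_lln (a : nat -> nat -> R) (A : R) g : warray a A -> bm g ->
  ocvg0 P (fun n o => \sum_(0 <= p < n.+1) a n p * (g (X p o) - \int[pi]_x g x)).
Proof.
move=> wa bg; have [a0 an aA az] := wa; have [c c0 hc] := bm_bound bg.
have A0 := warray_ge0 wa.
have bX p : bm (fun o => g (X p o)).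
  by apply: (bm_comp (u := X p)) => //; exact: measurable_OF (@mX p).
have bRg := poispi_bm bg.
have [cR cR0 hcR] := bm_bound bRg.
pose r n := (2 * c + 2 * (C * (2 * c))) * a n 0%N +
  B1 c * \sum_(0 <= p < n.+1) a n p / p.+1%:R.
have r0 : r n @[n --> \oo] --> (0 : R).
  rewrite -[X in _ --> X](addr0 0) -{1}(mulr0 (2 * c + 2 * (C * (2 * c)))).
  rewrite -[X in _ + X](mulr0 (B1 c)); apply: cvgD.
    by apply: cvgM; [exact: cvg_cst|exact: az].
  apply: cvgM; first exact: cvg_cst.
  have h1 : ocvg0 P (fun n _ => n.+1%:R^-1) by apply: ocvg0_cst; exact: cvg_invS.
  have h2 n (o : Omega) : `|n.+1%:R^-1 : R| <= 1.
    by rewrite ger0_norm ?invr_ge0// invf_le1 ?ler1n.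
  have h3 := toeplitz wa h1 h2.
  have h4 n : bm (fun _ : Omega => \sum_(0 <= p < n.+1) a n p * `|p.+1%:R^-1|).
    exact: bm_cst.
  have := ocvg0_int h4 h3.
  under eq_fun do rewrite (bmI_cst P1).
  apply: cvg_trans; apply: near_eq_cvg; apply: nearW => n.
  rewrite ger0_norm; last first.
    by rewrite big_nat; apply: sumr_ge0 => p /andP[_ pn]; rewrite mulr_ge0// a0.
  by apply: eq_bigr => p _; rewrite ger0_norm ?invr_ge0.
have M0 : ocvg0 P (fun n => msum_incr (a n) g n).
  apply: ocvg0_sq => [n|]; first exact: bmF_bm (msum_incr_bmF _ _ bg).
  apply: (@cvgn_le _ _ (fun n => (C * (4 * c)) ^+ 2 * A * a n 0%N)); last first.
    rewrite -[X in _ --> X](mulr0 ((C * (4 * c)) ^+ 2 * A)).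
    by apply: cvgM; [exact: cvg_cst|exact: az].
  move=> n; rewrite subr0 ger0_norm; last first.
    by apply: Rintegral_ge0 => o _; exact: sqr_ge0.
  apply: le_trans (msum_incr_sq _ _ bg hc) _.
  rewrite -mulrA ler_wpM2l ?sqr_ge0//.
  apply: le_trans (_ : (\sum_(0 <= p < n) a n p.+1) * a n 0%N <= _); last first.
    rewrite ler_wpM2r ?a0//; apply: le_trans (aA n).
    by rewrite big_nat_recl//= lerDr a0.
  rewrite mulr_suml big_nat [leRHS]big_nat; apply: ler_sum => p /andP[_ pn].
  by rewrite expr2 ler_wpM2l ?a0// an.
have D0 := toeplitz wa (convK bRg) (fun n o => kdist_bound n o bRg hcR).
have R0 : ocvg0 P (fun n _ => r n + (2 * c) * a n 0%N).
  apply: ocvg0_cst; rewrite -[X in _ --> X](addr0 0) -{2}(mulr0 (2 * c)).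
  by apply: cvgD => //; apply: cvgM; [exact: cvg_cst|exact: az].
apply: (ocvg0_le (v := fun n o => (`|msum_incr (a n) g n o| + (r n + (2 * c) * a n 0%N)) +
  \sum_(0 <= p < n.+1) a n p * `|kdist (resolvent Kpi pi g) p o|)).
  apply: ocvg0D => //; apply: ocvg0D => //.
  by apply: ocvg0_le M0 _ => n o; rewrite normr_id.
move=> n o.
have an' p p' : (p <= p' <= n)%N -> a n p' <= a n p by exact: an.
have an0 p : (p <= n)%N -> 0 <= a n p by exact: a0.
have h1 := derr_martingale o bg hc an' an0; rewrite -/(r n) in h1.
pose m p := (match p with
              | 0 => \int[nu0]_x g x
              | q.+1 => \int[phi q o]_x g x
              end) - \int[pi]_x g x.
rewrite (eq_bigr (fun p => a n p * derr g p o + a n p * m p)); last first.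
  by move=> [|p] _; rewrite /derr /m; ring.
rewrite big_split/=.
have h2 : `|\sum_(0 <= p < n.+1) a n p * m p| <= (2 * c) * a n 0%N +
    \sum_(0 <= p < n.+1) a n p * `|kdist (resolvent Kpi pi g) p o|.
  apply: le_trans (ler_norm_sum _ _ _) _; rewrite big_nat_recl//=; apply: lerD.
    rewrite normrM ger0_norm ?a0// mulrC ler_wpM2r ?a0//.
    rewrite (le_trans (ler_normB _ _))//.
    have := bmI_bound (probability_setT nu0) bg hc.
    by have := bmI_bound pi1 bg hc; lra.
  rewrite [leRHS]big_nat_recr//= -[leLHS]addr0; apply: lerD; last first.
    by rewrite mulr_ge0// a0.
  rewrite big_nat [leRHS]big_nat; apply: ler_sum => p /andP[_ pn].
  rewrite normrM ger0_norm ?a0//; apply: ler_pM => //; first by rewrite a0.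
    by rewrite an// leqnSn.
  apply: le_trans (phi_dist _ _ bg) _; exact: ler_norm.
move: h1 h2; set S := \sum_(_ <= _ < _) a n _ * derr _ _ _.
set T := \sum_(_ <= _ < _) _; set U := \sum_(_ <= _ < _) _.
set V := msum_incr _ _ _ _ => h1 h2.
apply: le_trans (ler_norm _) ; apply: le_trans (ler_normD _ _) _.
have h3 : `|S| <= `|V| + r n.
  by rewrite -(subrK V S) addrC (le_trans (ler_normD _ _))// lerD.
by lra.
Qed.

(** The diagonal of [local_covariance], expanded as mean of the square minus square of the mean. *)
Definition cov_limit f x : R :=
  kop Kpi (fun y => resolvent Kpi pi f y ^+ 2) x -
  kop Kpi (resolvent Kpi pi f) x ^+ 2.

Definition var_limit f : R := \int[pi]_x cov_limit f x.

Lemma cov_limit_bm f : bm f -> bm (cov_limit f).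
Proof.
move=> bf; have bR := poispi_bm bf; apply: bmB.
  by apply: kop_bm; exact: bmX.
by apply: bmX; exact: kop_bm.
Qed.

Lemma sqr_dist (x y c : R) : `|x| <= c -> `|y| <= c ->
  `|x ^+ 2 - y ^+ 2| <= 2 * c * `|x - y|.
Proof.
move=> hx hy; rewrite subr_sqr normrM mulrC ler_wpM2r//.
by rewrite (le_trans (ler_normD _ _))//; lra.
Qed.

(** Convergence of the kernels only concerns fixed functions. The random Poisson solution is
    therefore first replaced by the limit one, uniformly on the state space, and the kernel
    afterwards. *)
Lemma mvar_cvg f : bm f -> ocvg0 P (fun p o => mvar p f o - cov_limit f (X p o)).
Proof.
move=> bf; have [c c0 hc] := bm_bound bf.
pose B := C * (2 * c); pose r := resolvent Kpi pi f.
have br : bm r by exact: poispi_bm.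
have hr x : `|r x| <= B.
  apply: (resolvent_bound N0 b01 contrpi invpi) => //; exact: osc_bound.
pose rr := resolvent Kpi pi r.
have brr : bm rr by exact: poispi_bm.
have br2 : bm (fun y => r y ^+ 2) by exact: bmX.
pose D p o := C * (4 * kdist r p o) + kdist rr p o.
have hD p o x : `|pois p f o x - r x| <= D p o.
  apply: (resolvent_perturbation N0 b01 (contrK p o) (invK p o) contrpi invpi bf).
    by move=> y; exact: kdist_le.
  by move=> y; exact: kdist_le.
have D0 : ocvg0 P D.
  apply: ocvg0D; last exact: convK.
  by apply: (ocvg0_le (ocvg0Z (C * 4) (convK br))) => n o; rewrite mulrA.
apply: (ocvg0_le (v := fun p o => ((4 * B) * D p o + (2 * B) * kdist r p o) +
   kdist (fun y => r y ^+ 2) p o)).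
  apply: ocvg0D; last exact: convK.
  by apply: ocvg0D; apply: ocvg0Z => //; exact: convK.
move=> p o; set x := X p o.
have bp : bm (pois p f o) by exact: pois_bm.
have hp y : `|pois p f o y| <= B by exact: pois_bound.
have B0 : 0 <= B by exact: le_trans (hp point).
have k1 : `|kop (K p o) (fun y => pois p f o y ^+ 2) x - kop (K p o) (fun y => r y ^+ 2) x|
    <= 2 * B * D p o.
  rewrite -kopB//; last exact: bmX.
  apply: kop_bound; first by apply: bmB => //; exact: bmX.
  move=> y; apply: le_trans (sqr_dist (hp y) (hr y)) _.
  by rewrite ler_wpM2l// mulr_ge0.
have k2 := kdist_le p o x br2.
have k3 : `|kpois p f o x - kop (K p o) r x| <= D p o.
  by rewrite /kpois -kopB//; apply: kop_bound => //; exact: bmB.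
have k4 := kdist_le p o x br.
have k5 : `|kpois p f o x ^+ 2 - kop Kpi r x ^+ 2| <= 2 * B * (D p o + kdist r p o).
  apply: le_trans (sqr_dist (c := B) _ _) _.
  - exact: kpois_bound.
  - exact: kop_bound.
  apply: ler_wpM2l; first exact: mulr_ge0.
  rewrite -(subrKA (kop (K p o) r x)).
  exact: le_trans (ler_normD _ _) (lerD k3 k4).
rewrite [leRHS]ger0_norm; last first.
  have d0 : 0 <= D p o by exact: le_trans (normr_ge0 _) k3.
  have e0 := le_trans (normr_ge0 _) k4; have f0 := le_trans (normr_ge0 _) k2.
  exact: (addr_ge0 (addr_ge0 (mulr_ge0 (mulr_ge0 (ler0n _ 4) B0) d0)
    (mulr_ge0 (mulr_ge0 (ler0n _ 2) B0) e0)) f0).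
rewrite /mvar /cov_limit -/r -/x.
set a1 := kop (K p o) _ x in k1 *; set a2 := kop (K p o) _ x in k1 k2 *.
set a3 := kop Kpi (fun _ => _) x in k2 *.
move: (kpois p f o x ^+ 2) (kop Kpi r x ^+ 2) k5 => a4 a5 k5.
rewrite (_ : _ - _ = (a1 - a2) + (a2 - a3) - (a4 - a5)); last by ring.
apply: le_trans (ler_normB _ _) _.
have k6 := le_trans (ler_normD _ _) (lerD k1 k2).
by apply: le_trans (lerD k6 k5) _; lra.
Qed.

(** * Characteristic function of the weighted martingale *)

Section clt.
Variables (w : nat -> nat -> R) (f : E -> R) (c : R).
Hypotheses (hw : weights w) (bf : bm f) (c0 : 0 <= c).
Hypothesis hc : forall x, `|f x| <= c.

Let B : R := C * (4 * c).

Let B0 : 0 <= B.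
Proof. by rewrite /B mulr_ge0 ?res_const_ge0// mulr_ge0. Qed.

Definition qvar (v : nat -> R) n o : R :=
  \sum_(0 <= p < n) v p.+1 ^+ 2 * mvar p f o.

(** Predictability: the last term of the sum up to [n] is known at time [n - 1]. *)
Lemma qvar_bmF v n m : (n <= m.+1)%N -> bmF m (qvar v n).
Proof.
rewrite /qvar; elim: n => [_|n IH nm].
  by under eq_fun do rewrite big_geq//; exact: bm_cst.
under eq_fun do rewrite big_nat_recr//=.
apply: bmD; first by apply: IH; exact: ltnW.
by apply: bmZ; apply: bmF_le (mvar_bmF n bf); rewrite -ltnS.
Qed.

Lemma qvar_bound v (A : R) n o :
  \sum_(0 <= p < n.+1) v p ^+ 2 <= A -> forall j, (j <= n)%N ->
  0 <= qvar v j o <= B ^+ 2 * A.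
Proof.
move=> hA j jn; apply/andP; split.
  apply: sumr_ge0 => p _; rewrite mulr_ge0 ?sqr_ge0//.
  by have /andP[] := mvar_bound p o bf hc.
rewrite /qvar.
apply: le_trans (_ : \sum_(0 <= p < j) v p.+1 ^+ 2 * B ^+ 2 <= _).
  apply: ler_sum => p _; rewrite ler_wpM2l ?sqr_ge0//.
  by have /andP[] := mvar_bound p o bf hc.
rewrite -mulr_suml mulrC ler_wpM2l ?sqr_ge0//; apply: le_trans hA.
rewrite [leRHS](@big_cat_nat _ _ _ j.+1)//= big_nat_recl//=.
rewrite -[leLHS]add0r -[leLHS]addr0 !lerD ?sqr_ge0//.
by apply: sumr_ge0 => p _; exact: sqr_ge0.
Qed.

(** The Toeplitz lemma replaces [mvar] by [cov_limit] along the chain, the weighted law of large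
    numbers replaces this by its mean, and the squared weights have mass tending to 1. *)
Lemma qvar_cvg : ocvg0 P (fun n o => qvar (w n) n o - var_limit f).
Proof.
have [A wA] := weights_sq_warray hw; have [A1 A2 A3 A4] := wA.
(* The squared weights shifted by one place, as the increments carry them, and cut at [n] to remain
   nonincreasing. The lost term [w n 0 ^+ 2] tends to 0. *)
pose a n p : R := if (p < n)%N then w n p.+1 ^+ 2 else 0.
have sumE n (g : nat -> R) : \sum_(0 <= p < n.+1) a n p * g p =
    \sum_(0 <= p < n) w n p.+1 ^+ 2 * g p.
  rewrite big_nat_recr//= {2}/a ltnn mul0r addr0 big_nat [RHS]big_nat.
  by apply: eq_bigr => p /andP[_ pn]; rewrite /a pn.
have sum1 n : \sum_(0 <= p < n.+1) a n p = \sum_(0 <= p < n) w n p.+1 ^+ 2.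
  have := sumE n (fun=> 1); under eq_bigr do rewrite mulr1.
  by move=> ->; apply: eq_bigr => p _; rewrite mulr1.
have wa : warray a A.
  split.
  - by move=> n p _; rewrite /a; case: ifP => // _; exact: sqr_ge0.
  - move=> n p q /andP[pq qn]; rewrite /a; case: ifPn => [qn'|_].
      by rewrite (leq_ltn_trans pq qn') A2// ltnS pq.
    by case: ifP => // _; exact: sqr_ge0.
  - move=> n; rewrite sum1; apply: le_trans (A3 n).
    by rewrite big_nat_recl//= lerDr sqr_ge0.
  - apply: (cvgn_le _ A4) => n; rewrite subr0 /a; case: ifP => n0.
      by rewrite ger0_norm ?sqr_ge0// A2.
    by rewrite normr0 sqr_ge0.
have bX p : bm (fun o => cov_limit f (X p o)).
  apply: (bm_comp (u := X p)); first exact: measurable_OF (@mX p).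
  exact: cov_limit_bm.
have [cc cc0 hcc] := bm_bound (cov_limit_bm bf).
have h1 := toeplitz wa (mvar_cvg bf) (c := B ^+ 2 + cc) _.
have {}h1 := h1 _.
have h2 := weighted_lln wa (cov_limit_bm bf).
have h3 : ocvg0 P (fun n _ => (\sum_(0 <= p < n.+1) a n p - 1) * var_limit f).
  apply: ocvg0_cst; rewrite -[X in _ --> X](mul0r (var_limit f)).
  apply: cvgM; last exact: cvg_cst.
  rewrite (_ : (fun n => _) = (fun n => (\sum_(0 <= p < n.+1) w n p ^+ 2 - 1) - w n 0%N ^+ 2)).
    rewrite -[X in _ --> X](subr0 0); apply: cvgB => //.
    rewrite -[X in _ --> X](subrr 1); apply: cvgB; last exact: cvg_cst.
    exact: weights_sq_cvg.
  by apply/funext => n; rewrite sum1 [in RHS]big_nat_recl//=; ring.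
apply: (ocvg0_le (v := fun n o => \sum_(0 <= p < n.+1) a n p *
    `|mvar p f o - cov_limit f (X p o)| +
  `|\sum_(0 <= p < n.+1) a n p * (cov_limit f (X p o) - \int[pi]_x cov_limit f x) +
  (\sum_(0 <= p < n.+1) a n p - 1) * var_limit f|)).
  apply: ocvg0D.
    apply: h1 => n o; rewrite (le_trans (ler_normB _ _))// lerD//.
    by rewrite ger0_norm; have /andP[] := mvar_bound n o bf hc.
  have h4 := ocvg0D h2 h3.
  by apply: (ocvg0_le h4) => n o; rewrite normr_id.
move=> n o.
have e : qvar (w n) n o - var_limit f =
  \sum_(0 <= p < n.+1) a n p * (mvar p f o - cov_limit f (X p o)) +
  (\sum_(0 <= p < n.+1) a n p * (cov_limit f (X p o) - \int[pi]_x cov_limit f x) +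
  (\sum_(0 <= p < n.+1) a n p - 1) * var_limit f).
  rewrite /qvar -(sumE n (fun p => mvar p f o)) mulrBl mul1r !addrA; congr (_ - _).
  rewrite mulr_suml -!big_split/=; apply: eq_bigr => p _.
  by rewrite /var_limit; ring.
rewrite e [leRHS]ger0_norm; last first.
  rewrite addr_ge0// big_nat; apply: sumr_ge0 => p /andP[_ pn].
  by rewrite mulr_ge0//; case: wa => + _ _ _; apply.
apply: le_trans (ler_normD _ _) _; rewrite lerD2r.
apply: le_trans (ler_norm_sum _ _ _) _.
rewrite big_nat [leRHS]big_nat; apply: ler_sum => p /andP[_ pn].
by rewrite normrM ger0_norm//; case: wa => + _ _ _; apply.
Qed.

(** One step of the characteristic function: the compensator
    [expR (qvar / 2)] makes [cos (U + martingale)] a martingale up to third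
    order terms. *)
Lemma cos_step (v : nat -> R) (A : R) n (U : Omega -> R) j : (j < n)%N ->
  @measurable_fun _ _ (OF 0%N) R setT U ->
  (forall p, (p <= n)%N -> 0 <= v p) -> v j.+1 * B <= 1 ->
  \sum_(0 <= p < n.+1) v p ^+ 2 <= A ->
  `|\int[P]_o (cos (U o + msum_incr v f j.+1 o) * expR (qvar v j.+1 o / 2)) -
    \int[P]_o (cos (U o + msum_incr v f j o) * expR (qvar v j o / 2))| <=
  expR (B ^+ 2 * A / 2) * (v j.+1 * B) ^+ 3.
Proof.
move=> jn mU v0 vB hA.
set x := v j.+1; have x0 : 0 <= x by exact: v0.
set y := x * B; have y0 : 0 <= y by rewrite mulr_ge0.
pose th o := U o + msum_incr v f j o.
have bS := msum_incr_bmF v j bf.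
have mth : @measurable_fun _ _ (OF j) R setT th.
  apply: measurable_funD; last exact: bm_meas bS.
  exact: (measurable_OF_le (leq0n j) mU).
have q1 o : 0 <= qvar v j.+1 o <= B ^+ 2 * A by apply: (qvar_bound o hA).
have bq1 : bmF j (qvar v j.+1) by exact: qvar_bmF.
have bq0 : bmF j (qvar v j) by exact: qvar_bmF.
pose G o := expR (qvar v j.+1 o / 2).
pose G0 o := expR (qvar v j o / 2).
have bh g : bmF j g -> @measurable_fun _ _ (OF j) R setT (fun o => g o / 2).
  by move=> bg; apply: bm_meas; apply: bmM => //; exact: bm_cst.
have bG : bmF j G.
  apply: (@bm_expR _ (OF j) R _ (B ^+ 2 * A / 2)); first exact: bh.
  by move=> o; have /andP[_] := q1 o; lra.
have bG0 : bmF j G0.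
  apply: (@bm_expR _ (OF j) R _ (B ^+ 2 * A / 2)); first exact: bh.
  by move=> o; have /andP[_] := qvar_bound o hA (ltnW jn); lra.
have Gb o : 0 <= G o <= expR (B ^+ 2 * A / 2).
  rewrite expR_ge0/= ler_expR; have /andP[_] := q1 o; lra.
have bcos : bmF j (fun o => cos (th o)) by apply: (@bm_cos _ (OF j)).
have bsin : bmF j (fun o => sin (th o)) by apply: (@bm_sin _ (OF j)).
pose xi := mincr j f.
have bxi : bm xi by exact: bmF_bm (mincr_bmF j bf).
have hxi o : `|x * xi o| <= y.
  by rewrite normrM (ger0_norm x0) ler_wpM2l//; exact: mincr_bound.
pose rc o := cos (x * xi o) - (1 - (x * xi o) ^+ 2 / 2).
pose rs o := sin (x * xi o) - x * xi o.
have bxxi : bm (fun o => x * xi o) by exact: bmZ.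
have brc : bm rc.
  apply: bmB; first by apply: bm_cos; exact: bm_meas.
  apply: bmB; first exact: bm_cst.
  by apply: bmM; [exact: bmX|exact: bm_cst].
have brs : bm rs by apply: bmB => //; apply: bm_sin; exact: bm_meas.
(* Addition formula and Taylor expansion in [x * xi]. Conditioning on time [j] kills the linear term
   and turns the quadratic one into [mvar]; the last summand collects the remainders. *)
have e1 o : cos (U o + msum_incr v f j.+1 o) * G o =
    ((G o * cos (th o) + (- (x ^+ 2 / 2)) * ((G o * cos (th o)) * xi o ^+ 2)) +
     (- x) * ((G o * sin (th o)) * xi o)) +
    G o * (cos (th o) * rc o - sin (th o) * rs o).
  rewrite (_ : U o + _ = th o + x * xi o); last first.
    by rewrite /th /msum_incr big_nat_recr//= addrA.
  by rewrite cosD /rc /rs; ring.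
have bGc := bmM (bmF_bm bG) (bmF_bm bcos).
have bGs := bmM (bmF_bm bG) (bmF_bm bsin).
have brem : bm (fun o => G o * (cos (th o) * rc o - sin (th o) * rs o)).
  apply: bmM; first exact: bmF_bm bG.
  by apply: bmB; apply: bmM => //; [exact: bmF_bm bcos|exact: bmF_bm bsin].
have b2 : bm (fun o => (G o * cos (th o)) * xi o ^+ 2) by apply: bmM => //; exact: bmX.
have b3 : bm (fun o => (G o * sin (th o)) * xi o) by exact: bmM.
have mv := mincr_var bf (bmM bG bcos).
have mm := mincr_mean bf (bmM bG bsin).
have I1 : \int[P]_o (cos (U o + msum_incr v f j.+1 o) * expR (qvar v j.+1 o / 2)) =
  \int[P]_o ((G o * cos (th o)) * (1 - x ^+ 2 * mvar j f o / 2)) +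
  \int[P]_o (G o * (cos (th o) * rc o - sin (th o) * rs o)).
  under eq_Rintegral do rewrite -/(G _) e1.
  have c1 := bmD bGc (bmZ (- (x ^+ 2 / 2)) b2).
  have c2 := bmD c1 (bmZ (- x) b3).
  rewrite (bmID P1 c2 brem) (bmID P1 c1 (bmZ _ b3)) (bmID P1 bGc (bmZ _ b2)).
  rewrite (bmIZ P1 _ b2) (bmIZ P1 _ b3) mm mv mulr0 addr0; congr (_ + _).
  have b4 : bm (fun o => G o * cos (th o) * mvar j f o).
    by apply: bmM => //; exact: bmF_bm (mvar_bmF j bf).
  rewrite -(bmIZ P1 _ b4) -(bmID P1 bGc (bmZ _ b4)).
  by apply: eq_Rintegral => o _; ring.
have bG0c := bmM (bmF_bm bG0) (bmF_bm bcos).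
have bmv := bmF_bm (mvar_bmF j bf).
have bl : bm (fun o => (G o * cos (th o)) * (1 - x ^+ 2 * mvar j f o / 2)).
  apply: bmM => //; apply: bmB; first exact: bm_cst.
  by apply: bmM; [exact: bmZ|exact: bm_cst].
have bG0c' : bm (fun o => cos (U o + msum_incr v f j o) * expR (qvar v j o / 2)).
  by apply: bmM; [exact: bmF_bm bcos|exact: bmF_bm bG0].
rewrite I1 addrAC -bmIB// -bmID//; last exact: bmB.
rewrite -[leRHS](bmI_cst P1); apply: bmI_norm_le => //.
- by apply: bmD => //; exact: bmB.
- exact: bm_cst.
move=> o; rewrite -/(th o) -/(G0 o).
set t := x ^+ 2 * mvar j f o / 2.
have /andP[mv0 mv1] := mvar_bound j o bf hc.
have y1 : y <= 1 by exact: vB.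
have tb : 0 <= t <= y ^+ 2 / 2.
  rewrite /t divr_ge0 ?mulr_ge0 ?sqr_ge0//= ler_pM2r ?invr_gt0//.
  by rewrite exprMn ler_wpM2l ?sqr_ge0.
have y2 : y ^+ 2 <= 1 by rewrite expr_le1.
have GE : G o = G0 o * expR t.
  rewrite /G /G0 -expRD; congr expR; rewrite /qvar big_nat_recr//= /t.
  by rewrite -/x; field.
have G00 : 0 <= G0 o by exact: expR_ge0.
have G0b : G0 o <= expR (B ^+ 2 * A / 2).
  by rewrite ler_expR; have /andP[_] := qvar_bound o hA (ltnW jn); lra.
have t1 : `|expR t * (1 - t) - 1| <= y ^+ 4 / 4.
  have /andP[t0 ty] := tb.
  have t01 : 0 <= t <= 1 by apply/andP; split => //; lra.
  apply: le_trans (expR_1subt t01) _.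
  rewrite (_ : y ^+ 4 / 4 = (y ^+ 2 / 2) ^+ 2); last by field.
  by rewrite ler_sqr ?nnegrE// divr_ge0 ?sqr_ge0.
have cb : `|cos (th o)| <= 1 by rewrite ler_norml cos_geN1 cos_le1.
have sb : `|sin (th o)| <= 1 by rewrite ler_norml sin_geN1 sin_le1.
have y34 : y ^+ 4 <= y ^+ 3 by rewrite exprS ler_piMl// exprn_ge0.
have rcb : `|rc o| <= y ^+ 3 / 24.
  apply: le_trans (cos_taylor _) _; rewrite ler_pM2r ?invr_gt0//.
  by apply: le_trans y34; rewrite lerXn2r// nnegrE.
have rsb : `|rs o| <= y ^+ 3 / 6.
  apply: le_trans (sin_taylor _) _; rewrite ler_pM2r ?invr_gt0//.
  by rewrite lerXn2r// nnegrE.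
have -> : G o * cos (th o) * (1 - t) - cos (th o) * G0 o +
     G o * (cos (th o) * rc o - sin (th o) * rs o) =
   (G0 o * cos (th o)) * (expR t * (1 - t) - 1) +
   G o * (cos (th o) * rc o - sin (th o) * rs o).
  have ringid (a e c1 z t1' : R) : a * e * c1 * (1 - t1') - c1 * a + a * e * z =
    a * c1 * (e * (1 - t1') - 1) + a * e * z by ring.
  by rewrite GE; exact: ringid.
have /andP[G0' G1'] := Gb o.
have z1 : `|G0 o * cos (th o) * (expR t * (1 - t) - 1)| <=
    expR (B ^+ 2 * A / 2) * (y ^+ 3 / 4).
  rewrite !normrM (ger0_norm G00) -mulrA ler_pM// ?mulr_ge0//.
  rewrite -[leRHS]mul1r ler_pM//; apply: le_trans t1 _; lra.
have z2 : `|G o * (cos (th o) * rc o - sin (th o) * rs o)| <=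
    expR (B ^+ 2 * A / 2) * (y ^+ 3 / 24 + y ^+ 3 / 6).
  rewrite normrM (ger0_norm G0') ler_pM//.
  rewrite (le_trans (ler_normB _ _))// !normrM lerD//.
    by rewrite -[leRHS]mul1r ler_pM.
  by rewrite -[leRHS]mul1r ler_pM.
apply: le_trans (ler_normD _ _) _; apply: le_trans (lerD z1 z2) _.
(* The coefficients of [y ^+ 3] add up to [1/4 + 1/24 + 1/6], which is less than 1. *)
rewrite -mulrDr ler_wpM2l ?expR_ge0//.
have : 0 <= y ^+ 3 by rewrite exprn_ge0.
by move: (y ^+ 3) => z; lra.
Qed.

(** In every cubic error one factor is bounded by [v 0] and the squares of the others sum to at most
    [A]; the total vanishes with the largest weight. *)
Lemma cos_telescope (v : nat -> R) (A : R) n (U : Omega -> R) :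
  @measurable_fun _ _ (OF 0%N) R setT U ->
  (forall p, (p <= n)%N -> 0 <= v p <= v 0%N) -> v 0%N * B <= 1 ->
  \sum_(0 <= p < n.+1) v p ^+ 2 <= A ->
  `|\int[P]_o (cos (U o + msum_incr v f n o) * expR (qvar v n o / 2)) -
    \int[P]_o cos (U o)| <= expR (B ^+ 2 * A / 2) * B ^+ 3 * A * v 0%N.
Proof.
move=> mU hv vB hA.
have v0 p : (p <= n)%N -> 0 <= v p by move=> /hv/andP[].
have v00 : 0 <= v 0%N by exact: v0.
have H j : (j <= n)%N ->
  `|\int[P]_o (cos (U o + msum_incr v f j o) * expR (qvar v j o / 2)) -
    \int[P]_o cos (U o)| <=
  expR (B ^+ 2 * A / 2) * B ^+ 3 * (\sum_(0 <= p < j) v p.+1 ^+ 2) * v 0%N.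
  elim: j => [_|j IH jn].
    rewrite big_geq// mulr0 mul0r (eq_Rintegral _ (g := fun o => cos (U o))).
      by rewrite subrr normr0.
    by move=> o _; rewrite /msum_incr /qvar !big_geq// addr0 mul0r expR0 mulr1.
  have vj1 : v j.+1 * B <= 1.
    by apply: le_trans vB; rewrite ler_wpM2r//; have /andP[] := hv _ jn.
  have h1 := cos_step jn mU v0 vj1 hA.
  have h2 := IH (ltnW jn).
  set a := \int[P]_o _ in h1 *; set b' := \int[P]_o _ in h1 h2.
  rewrite -(subrKA b') (le_trans (ler_normD _ _))//.
  apply: le_trans (lerD h1 h2) _.
  rewrite big_nat_recr//= [in leRHS]mulrDr [in leRHS]mulrDl addrC lerD2l.
  rewrite (_ : _ * v 0%N = expR (B ^+ 2 * A / 2) *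
    (v j.+1 ^+ 2 * v 0%N * B ^+ 3)); last by ring.
  apply: ler_wpM2l; first exact: expR_ge0.
  rewrite exprMn; apply: ler_wpM2r; first exact: exprn_ge0.
  rewrite exprSr; apply: ler_wpM2l; first exact: sqr_ge0.
  by have /andP[] := hv _ jn.
apply: le_trans (H n (leqnn _)) _.
apply: ler_wpM2r => //; apply: ler_wpM2l.
  by apply: mulr_ge0; [exact: expR_ge0|exact: exprn_ge0].
by apply: le_trans hA; rewrite big_nat_recl//= lerDr sqr_ge0.
Qed.
End clt.

Lemma var_limit_ge0 f : bm f -> 0 <= var_limit f.
Proof.
move=> bf; have bR := poispi_bm bf; apply: Rintegral_ge0 => x _.
rewrite /cov_limit -kop_variance//.
by apply: Rintegral_ge0 => y _; exact: sqr_ge0.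
Qed.

(** Stable convergence: [U] ranges over the variables known at time 0, i.e.
    those of the lower levels, uniformly. *)
Theorem level_clt (w : nat -> nat -> R) f : weights w -> bm f ->
  forall e : R, 0 < e -> exists n0, forall n, (n0 <= n)%N ->
  forall U : Omega -> R, @measurable_fun _ _ (OF 0%N) R setT U ->
  `|\int[P]_o cos (U o + \sum_(0 <= p < n.+1) w n p * derr f p o) -
    expR (- (var_limit f / 2)) * \int[P]_o cos (U o)| <= e.
Proof.
move=> hw bf; have [c c0 hc] := bm_bound bf.
have [A wA] := weights_sq_warray hw; have A0 := warray_ge0 wA.
have [_ _ hA _] := wA; have [w0 wn _ _] := hw.
set s := var_limit f; have s0 : 0 <= s by exact: var_limit_ge0.
pose B := C * (4 * c).
have B0 : 0 <= B by rewrite /B mulr_ge0 ?res_const_ge0// mulr_ge0.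
pose r n := (2 * c + 2 * (C * (2 * c))) * w n 0%N +
  B1 c * \sum_(0 <= p < n.+1) w n p / p.+1%:R.
have r0 : r n @[n --> \oo] --> (0 : R).
  rewrite -[X in _ --> X](addr0 0) -{1}(mulr0 (2 * c + 2 * (C * (2 * c)))).
  rewrite -[X in _ + X](mulr0 (B1 c)); apply: cvgD.
    by apply: cvgM; [exact: cvg_cst|exact: weights_cvg0].
  by apply: cvgM; [exact: cvg_cst|exact: weights_harmonic].
(* A common upper bound of [qvar / 2] and [s / 2], both of which are nonnegative, for the Lipschitz
   estimate of the exponential. *)
pose m := (B ^+ 2 * A + s) / 2.
have bqv n : bm (fun o => qvar f (w n) n o - s).
  apply: bmB; last exact: bm_cst.
  by apply: (bmF_bm (n := n)); exact: qvar_bmF.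
have q0 := ocvg0_int bqv (qvar_cvg hw bf hc).
(* The three errors come from replacing the field by its martingale, the conditional variance by its
   limit, and from the third order terms. None of them involves [U]. *)
pose err n := expR (s / 2) * r n +
  expR m / 2 * (\int[P]_o `|qvar f (w n) n o - s|) +
  expR (B ^+ 2 * A / 2) * B ^+ 3 * A * w n 0%N.
have err0 : err n @[n --> \oo] --> (0 : R).
  have h : err n @[n --> \oo] --> expR (s / 2) * 0 + expR m / 2 * 0 +
      expR (B ^+ 2 * A / 2) * B ^+ 3 * A * 0.
    apply: cvgD; last by apply: cvgM; [exact: cvg_cst|exact: weights_cvg0].
    by apply: cvgD; (apply: cvgM; first exact: cvg_cst).
  by rewrite !mulr0 !addr0 in h.
move=> e e0; have /cvgnP/(_ _ e0)[n1 hn1] := err0.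
have B10 : 0 < (B + 1)^-1 by rewrite invr_gt0 ltr_wpDl.
have /cvgnP/(_ _ B10)[n2 hn2] := weights_cvg0 hw.
exists (maxn n1 n2) => n; rewrite geq_max => /andP[/hn1 + /hn2].
rewrite !subr0 => en wn0 U mU.
have w00 : 0 <= w n 0%N by exact: w0.
have hv p : (p <= n)%N -> 0 <= w n p <= w n 0%N.
  by move=> pn; rewrite w0//= wn.
have vB : w n 0%N * B <= 1.
  rewrite (ger0_norm w00) in wn0.
  apply: le_trans (ler_wpM2r B0 wn0) _.
  by rewrite mulrC ler_pdivrMr ?ltr_wpDl// mul1r lerDl.
have h1 := cos_telescope bf c0 hc mU hv vB (hA n); rewrite -/B in h1.
have wnn p p' : (p <= p' <= n)%N -> w n p' <= w n p by exact: wn.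
have h2 o := derr_martingale o bf hc wnn (w0 n); rewrite -/(r n) in h2.
have mU' := measurable_OF mU.
have bS := bmF_bm (msum_incr_bmF (w n) n bf).
have mUS : measurable_fun setT (fun o => U o + msum_incr (w n) f n o).
  by apply: measurable_funD => //; exact: bm_meas.
have bV : bm (fun o => \sum_(0 <= p < n.+1) w n p * derr f p o).
  by apply: bm_sum => p; apply: bmZ; exact: derr_bm.
have mUV : measurable_fun setT (fun o => U o + \sum_(0 <= p < n.+1) w n p * derr f p o).
  by apply: measurable_funD => //; exact: bm_meas.
have bcV := bm_cos mUV; have bcS := bm_cos mUS; have bcU := bm_cos mU'.
have h3 : `|\int[P]_o cos (U o + \sum_(0 <= p < n.+1) w n p * derr f p o) -
    \int[P]_o cos (U o + msum_incr (w n) f n o)| <= r n.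
  apply: bmI_dist => // o; apply: le_trans (cos_lip _ _) _.
  by rewrite opprD addrACA subrr add0r.
have bq : bm (qvar f (w n) n) by apply: (bmF_bm (n := n)); exact: qvar_bmF.
have qb o := qvar_bound bf hc o (hA n) (leqnn n).
have bE : bm (fun o => expR (qvar f (w n) n o / 2)).
  apply: (@bm_expR _ _ _ _ (B ^+ 2 * A / 2)).
    by apply: bm_meas; apply: bmM => //; exact: bm_cst.
  by move=> o; have /andP[_] := qb o; rewrite -/B; lra.
have h4 : `|\int[P]_o (cos (U o + msum_incr (w n) f n o) * expR (qvar f (w n) n o / 2)) -
    expR (s / 2) * \int[P]_o cos (U o + msum_incr (w n) f n o)| <=
    expR m / 2 * (\int[P]_o `|qvar f (w n) n o - s|).
  rewrite -(bmIZ P1 _ bcS) -bmIB//; [|exact: bmM|exact: bmZ].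
  rewrite -(bmIZ P1 _ (bm_norm (bqv n))); apply: bmI_norm_le => //.
  - by apply: bmB; [exact: bmM|exact: bmZ].
  - by apply: bmZ; exact: bm_norm.
  move=> o; rewrite (_ : _ - _ = cos (U o + msum_incr (w n) f n o) *
     (expR (qvar f (w n) n o / 2) - expR (s / 2))); last by ring.
  rewrite normrM; apply: le_trans (_ : 1 * `|expR (qvar f (w n) n o / 2) - expR (s / 2)| <= _).
    by rewrite ler_wpM2r// ler_norml cos_geN1 cos_le1.
  have /andP[q1 q2] := qb o; rewrite -/B in q2.
  rewrite mul1r; apply: le_trans (expR_lip (m := m) _ _) _.
  - by rewrite /m; lra.
  - have : 0 <= B ^+ 2 * A by rewrite mulr_ge0// sqr_ge0.
    by rewrite /m; lra.
  rewrite -mulrBl normrM (ger0_norm (_ : 0 <= 2^-1)) ?invr_ge0//.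
  by rewrite [_ * 2^-1]mulrC mulrA.
move: h1 h3 h4.
set a1 := \int[P]_o cos (U o + \sum_(_ <= _ < _) _).
set a2 := \int[P]_o (_ * _); set a3 := \int[P]_o cos (U o).
set a4 := \int[P]_o cos (U o + msum_incr _ _ _ _) => h1 h3 h4.
have h5 : `|expR (s / 2) * a1 - a3| <= err n.
  rewrite (_ : _ - _ = expR (s / 2) * (a1 - a4) - (a2 - expR (s / 2) * a4) + (a2 - a3)); last by ring.
  apply: le_trans (ler_normD _ _) _; rewrite /err lerD//.
  apply: le_trans (ler_normB _ _) _; rewrite lerD//.
  by rewrite normrM (ger0_norm (expR_ge0 _)) ler_wpM2l// expR_ge0.
have -> : a1 - expR (- (s / 2)) * a3 = expR (- (s / 2)) * (expR (s / 2) * a1 - a3).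
  by rewrite mulrBr mulrA -expRD addNr expR0 mul1r.
rewrite normrM (ger0_norm (expR_ge0 _)).
apply: le_trans (_ : 1 * `|expR (s / 2) * a1 - a3| <= _).
  by rewrite ler_wpM2r// -expR0 ler_expR oppr_le0 divr_ge0.
by rewrite mul1r (le_trans h5)// (le_trans (ler_norm _)).
Qed.

Lemma derr_bmF f p : bm f -> bmF p (derr f p).
Proof.
move=> bf; apply: bmB.
  by apply: (@bm_comp _ _ E (OF p) R (X p) f) => //; exact: mX.
case: p => [|p]; first exact: bm_cst.
by apply: (bmF_le (leqnSn p)); exact: phi_bmF.
Qed.

(** Second moments bounded in [n] serve twice: for the tightness of the fields and for the almost
    sure finiteness of their standard parts. *)
Lemma level_sq (w : nat -> nat -> R) f : weights w -> bm f ->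
  exists A : R, forall n,
    \int[P]_o (\sum_(0 <= p < n.+1) w n p * derr f p o) ^+ 2 <= A.
Proof.
move=> hw bf; have [c c0 hc] := bm_bound bf; have [w0 wn _ _] := hw.
have [A wA] := weights_sq_warray hw; have [_ _ hA _] := wA.
have [r1 r10 hr1] := cvgn_bounded (weights_cvg0 hw).
have [r2 r20 hr2] := cvgn_bounded (weights_harmonic hw).
have C0 := res_const_ge0; have B10 := B1_ge0 c0.
pose r := (2 * c + 2 * (C * (2 * c))) * r1 + B1 c * r2.
have bV n : bm (fun o => \sum_(0 <= p < n.+1) w n p * derr f p o).
  by apply: bm_sum => p; apply: bmZ; exact: derr_bm.
exists (2 * ((C * (4 * c)) ^+ 2 * A) + 2 * r ^+ 2) => n.
have bS := bmF_bm (msum_incr_bmF (w n) n bf).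
apply: (@le_trans _ _ (\int[P]_o (2 * (msum_incr (w n) f n o) ^+ 2 + 2 * r ^+ 2))).
  apply: (bmI_le P1); [exact: bmX|by apply: bmD; [apply: bmZ; exact: bmX|exact: bm_cst]|].
  move=> o; have wnn p p' : (p <= p' <= n)%N -> w n p' <= w n p by exact: wn.
  have := derr_martingale o bf hc wnn (w0 n).
  have hr : (2 * c + 2 * (C * (2 * c))) * w n 0%N +
    B1 c * \sum_(0 <= p < n.+1) w n p / p.+1%:R <= r.
    rewrite /r lerD// ler_wpM2l//.
    - by rewrite addr_ge0// mulr_ge0// mulr_ge0// mulr_ge0.
    - exact: le_trans (ler_norm _) (hr1 n).
    - exact: le_trans (ler_norm _) (hr2 n).
  move=> /le_trans/(_ hr); move: (\sum_(_ <= _ < _) _ * _) (msum_incr _ _ _ _) (r).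
  move=> x y z; rewrite ler_norml => /andP[h1 h2].
  (* Indeed [2 y^2 + 2 z^2 - x^2 = 2 (z^2 - (x - y)^2) + (x - 2 y)^2]. *)
  have : 0 <= (x - y + z) * (z - (x - y)) by apply: mulr_ge0; lra.
  by have := sqr_ge0 (x - 2 * y); lra.
rewrite (bmID P1); [|by apply: bmZ; exact: bmX|exact: bm_cst].
rewrite (bmI_cst P1) (bmIZ P1); last exact: bmX.
rewrite lerD2r ler_wpM2l//; apply: le_trans (msum_incr_sq _ _ bf hc) _.
rewrite ler_wpM2l ?sqr_ge0//; apply: le_trans (hA n).
by rewrite [leRHS]big_nat_recl//= lerDr sqr_ge0.
Qed.
End level.

(** * Induction on the levels *)

Section empirical_theory.
Context {d} {E : measurableType d} {R : realType}.
Implicit Types x y : nat -> E.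

(** The maps [M] take bundled laws as arguments, so that rewriting below them needs equality of the
    bundles and not only of the set functions. The proof components agree by proof irrelevance. *)
Lemma eq_probability (p q : probability E R) :
  (forall A, p A = q A) -> p = q.
Proof.
move=> pq; have e : (p : set E -> \bar R) = q by exact/funext.
case: p q e {pq} => [p pc] [q qc] /= e; subst q; congr Probability.Pack.
case: pc qc => a1 a2 a3 a4 a5 a6 a7 [b1 b2 b3 b4 b5 b6 b7].
have e1 : a1 = b1 by case: a1 b1 {a2 b2} => ? ? [? ?]; f_equal; exact: Prop_irrelevance.
subst b1.
have e2 : a2 = b2 by case: a2 b2 => ? [?]; f_equal; exact: Prop_irrelevance.
subst b2.
have e3 : a3 = b3 by case: a3 b3 => ? [?]; f_equal; exact: Prop_irrelevance.
have e4 : a4 = b4 by case: a4 b4 => ? [?]; f_equal; exact: Prop_irrelevance.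
have e5 : a5 = b5 by case: a5 b5 => ? [?]; f_equal; exact: Prop_irrelevance.
have e6 : a6 = b6 by case: a6 b6 => ? [?]; f_equal; exact: Prop_irrelevance.
have e7 : a7 = b7 by case: a7 b7 => ? [?]; f_equal; exact: Prop_irrelevance.
by subst.
Qed.

Lemma empiricalE x n A : empirical (R := R) x n A =
  ((n.+1%:R^-1)%:E * \sum_(k < n.+1) \d_(x k) A)%E.
Proof. by []. Qed.

Lemma eq_empirical x y n : (forall p, (p <= n)%N -> x p = y p) ->
  empirical x n = empirical y n :> probability E R.
Proof.
move=> xy; apply: eq_probability => A.
suff : empirical (R := R) x n A = empirical y n A by [].
rewrite !empiricalE; congr (_ * _)%E.
by apply: eq_bigr => k _; rewrite xy// -ltnS.
Qed.

Lemma empirical_int x n (f : E -> R) : bm f ->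
  \int[empirical (R := R) x n]_y f y =
  n.+1%:R^-1 * \sum_(0 <= p < n.+1) f (x p).
Proof.
move: f; apply: (bm_functional_unique
  (I := fun f => \int[empirical (R := R) x n]_y f y)
  (J := fun f => n.+1%:R^-1 * \sum_(0 <= p < n.+1) f (x p)) (G := measurable)).
- exact: bm_functional_int (probability_setT _).
- split.
  + by move=> f g _ _; rewrite big_split/= mulrDr.
  + by move=> r f _; rewrite -mulr_sumr mulrCA.
  + move=> h f c _ hf _; apply: cvgM; first exact: cvg_cst.
    elim: (index_iota _ _) => [|p s IH].
      under eq_fun do rewrite big_nil; rewrite big_nil; exact: cvg_cst.
    by under eq_fun do rewrite big_cons; rewrite big_cons; exact: cvgD.
- by rewrite (sigma_algebra_id (@sigma_algebra_measurable _ E)).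
- by move=> A B mA mB; exact: measurableI.
- rewrite (bmI_cst (probability_setT _)) sumr_const_nat subn0.
  by rewrite mulVf// pnatr_eq0.
- move=> A mA; rewrite Rint_indic//.
  rewrite -[X in fine X]/(empirical (R := R) x n A) empiricalE.
  under eq_bigr do rewrite diracE.
  by rewrite sumEFin -EFinM /= big_mkord.
Qed.

(** One more point moves the average of [n + 1] values by its distance to that average divided by
    [n + 2]. *)
Lemma empirical_step x n (f : E -> R) (c : R) :
  bm f -> (forall z, `|f z| <= c) ->
  `|\int[empirical (R := R) x n.+1]_y f y - \int[empirical (R := R) x n]_y f y|
    <= 2 * c / n.+1%:R.
Proof.
move=> bf hc; have c0 : 0 <= c by apply: le_trans (hc point).
rewrite !empirical_int// big_nat_recr//=.
set S := \sum_(_ <= _ < _) _.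
have hS : `|S| <= n.+1%:R * c.
  apply: le_trans (ler_norm_sum _ _ _) _.
  apply: le_trans (ler_sum _ (fun p _ => hc (x p))) _.
  by rewrite sumr_const_nat subn0 mulr_natl.
have n0 : (0 : R) < n.+1%:R by rewrite ltr0n.
have n1 : (0 : R) < n.+2%:R by rewrite ltr0n.
have e : n.+2%:R = n.+1%:R + 1 :> R by rewrite natr1.
have hx := hc (x n.+1).
move: n0 n1 e hS; move: (n.+1%:R : R) (n.+2%:R : R) (f _) S hx.
move=> a b y S hy a0 b0 e hS; subst b.
rewrite (_ : _ - _ = (a * y - S) / (a * (a + 1))); last first.
  by field; rewrite !gt_eqF.
rewrite normrM (ger0_norm (_ : 0 <= (_ * _)^-1)); last first.
  by rewrite invr_ge0 mulr_ge0// ltW.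
rewrite ler_pdivrMr ?mulr_gt0//.
rewrite (_ : 2 * c / _ * _ = 2 * c * (a + 1)); last first.
  by field; rewrite gt_eqF.
apply: le_trans (ler_normB _ _) _; rewrite normrM (ger0_norm (ltW a0)).
by have := ler_wpM2l (ltW a0) hy; lra.
Qed.
End empirical_theory.

(** * Law of large numbers integrated over a measure on test functions *)

Section family_lln.
Context {dO d} {Omega : measurableType dO} {E : measurableType d} {R : realType}.
Variables (P : probability Omega R) (X : nat -> Omega -> E).
Hypothesis mX : forall n, measurable_fun setT (X n).
Variable pi : probability E R.
Variable G : fun_measure E R.

Let T := fm_param G.
Let m : {measure set T -> \bar R} := fm_meas G.
Let g (t : T) : E -> R := fm_fun t.
Let s (t : T) : R := fine (supnorm (g t)).

Hypothesis Goo : (\int[m]_t supnorm (g t) < +oo)%E.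

Let P1 : P setT = 1%E. Proof. exact: probability_setT. Qed.
Let pi1 : pi setT = 1%E. Proof. exact: probability_setT. Qed.

Lemma measurable_fun_empirical_int (H : fun_measure E R) x n :
  measurable_fun setT (fun t : fm_param H => \int[empirical x n]_y fm_fun t y).
Proof.
have -> : (fun t : fm_param H => \int[empirical x n]_y fm_fun t y) =
   (fun t => n.+1%:R^-1 * \sum_(0 <= p < n.+1) fm_fun t (x p)).
  by apply/funext => t; rewrite empirical_int//; exact: bmfun_bm.
apply: measurable_funM => //; apply: measurable_sum => p.
exact: (measurableT_comp (@fm_fun_measurable _ _ _ H)
  (pair2_measurable (T1 := fm_param H) (x p))).
Qed.

Lemma supnorm_ub {U : Type} (f : U -> R) x : (`|f x|%:E <= supnorm f)%E.
Proof. by apply: ereal_sup_ubound; exists x. Qed.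

Lemma supnorm_le {U : Type} (f : U -> R) (c : R) :
  (forall x, `|f x| <= c) -> (supnorm f <= c%:E)%E.
Proof. by move=> hc; apply: ge_ereal_sup => _ [x _ <-]; rewrite lee_fin. Qed.

Let gbm t : bm (g t). Proof. exact: bmfun_bm. Qed.

Let sE t : supnorm (g t) = (s t)%:E.
Proof.
have [c c0 hc] := bm_bound (gbm t).
rewrite /s fineK// fin_numElt; apply/andP; split.
  exact: lt_le_trans (ltNyr _) (supnorm_ub (g t) point).
exact: le_lt_trans (supnorm_le hc) (ltry _).
Qed.

Let gs t x : `|g t x| <= s t.
Proof. by rewrite -lee_fin -sE; exact: supnorm_ub. Qed.

Let s0 t : 0 <= s t. Proof. exact: le_trans (normr_ge0 _) (gs t point). Qed.

Let ms : measurable_fun setT s.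
Proof.
apply: (measurableT_comp (f := fine)) => //; exact: fm_norm_measurable.
Qed.

Let Soo : (\int[m]_t (s t)%:E < +oo)%E.
Proof. by under eq_integral do rewrite -sE. Qed.

Let mg : measurable_fun setT (fun u : T * E => g u.1 u.2).
Proof. exact: fm_fun_measurable. Qed.

Definition fam_dist n (o : Omega) (t : T) : R :=
  `|\int[pi]_x g t x - \int[empirical (fun p => X p o) n]_x g t x|.

Let fam_dist_le n o t : fam_dist n o t <= 2 * s t.
Proof.
rewrite /fam_dist (le_trans (ler_normB _ _))//.
have := bmI_bound pi1 (gbm t) (gs t).
by have := bmI_bound (probability_setT (empirical (R := R) (fun p => X p o) n))
  (gbm t) (gs t); lra.
Qed.

Let mpi : measurable_fun setT (fun t => \int[pi]_x g t x).
Proof.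
(* The functions [g t] have no common bound, hence this truncation at level [k]; it has no effect
   once [k] exceeds [s t]. *)
pose h (k : nat) (u : T * E) : R := Num.max (- k%:R) (Num.min (g u.1 u.2) k%:R).
have hb k u : `|h k u| <= k%:R.
  rewrite /h ler_norml le_max lexx/= ge_max ge_min lexx orbT andbT.
  by rewrite (@le_trans _ _ 0)// oppr_le0.
have bh k : bm (h k).
  apply: (@bmP _ _ _ _ k%:R) => //.
  by apply: measurable_maxr => //; apply: measurable_minr.
apply: (@measurable_fun_cvg _ _ _ setT (fun k t => \int[pi]_x h k (t, x))) => //.
- move=> k; apply: bm_meas.
  by apply: (@bm_kernel_int _ _ T E R (fun=> pi) (h k)).
- move=> t _; apply: cvg_near_cst.
  exists (Num.truncn (s t)).+1 => // k /= tk; apply: eq_Rintegral => x _.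
  have sk : s t <= k%:R.
    have /andP[_ h1] := truncn_itv (s0 t).
    by rewrite (le_trans (ltW h1))// ler_nat.
  have := gs t x; rewrite ler_norml => /andP[h1 h2].
  rewrite /h/= min_l; last by lra.
  by rewrite max_r//; lra.
Qed.

Let mdist n : measurable_fun setT (fun u : Omega * T => fam_dist n u.1 u.2).
Proof.
rewrite /fam_dist; apply: measurableT_comp => //; apply: measurable_funB.
  exact: (measurableT_comp mpi measurable_snd).
have -> : (fun u : Omega * T => \int[empirical (fun p => X p u.1) n]_x g u.2 x) =
   (fun u => n.+1%:R^-1 * \sum_(0 <= p < n.+1) g u.2 (X p u.1)).
  by apply/funext => u; rewrite empirical_int.
apply: measurable_funM => //; apply: measurable_sum => p.
apply: (measurableT_comp (f := fun u : T * E => g u.1 u.2)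
   (g := fun u : Omega * T => (u.2, X p u.1))) => //.
apply: measurable_fun_pair => //.
exact: (measurableT_comp (@mX p) measurable_fst).
Qed.

Hypothesis lln : forall h : E -> R, bm h -> ocvg0 P (fun n o =>
  \sum_(0 <= p < n.+1) n.+1%:R^-1 * (h (X p o) - \int[pi]_x h x)).

Let fam_dist_bm n t : bm (fun o => fam_dist n o t).
Proof.
apply: (@bmP _ _ _ _ (2 * s t)); last first.
  by move=> o; rewrite ger0_norm ?normr_ge0//; exact: fam_dist_le.
have h := measurableT_comp (@mdist n) (pair2_measurable (T1 := Omega) (T2 := T) t).
exact: h.
Qed.

Let fam_dist_cvg t : \int[P]_o fam_dist n o t @[n --> \oo] --> (0 : R).
Proof.
have bX p : bm (fun o => g t (X p o)) by exact: (bm_comp (u := X p)).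
have e n o : fam_dist n o t = `|\sum_(0 <= p < n.+1) n.+1%:R^-1 *
    (g t (X p o) - \int[pi]_x g t x)|.
  rewrite /fam_dist empirical_int// distrC; congr `|_|.
  under [RHS]eq_bigr do rewrite mulrBr.
  rewrite sumrB -mulr_sumr; congr (_ - _).
  rewrite sumr_const_nat subn0 -[RHS]mulr_natl mulrA divff ?mul1r//.
have := @ocvg0_int _ _ _ P (fun n o => \sum_(0 <= p < n.+1) n.+1%:R^-1 *
    (g t (X p o) - \int[pi]_x g t x)) _ (lln (gbm t)).
have h n : bm (fun o => \sum_(0 <= p < n.+1) n.+1%:R^-1 *
    (g t (X p o) - \int[pi]_x g t x)).
  by apply: bm_sum => p; apply: bmZ; apply: bmB => //; exact: bm_cst.
move=> /(_ h); apply: cvg_trans; apply: near_eq_cvg; apply: nearW => n.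
by apply: eq_Rintegral => o _; rewrite e.
Qed.

Let A (j : nat) : set T := [set t | j.+1%:R^-1 <= s t].
Let mA j : measurable (A j). Proof. exact: measurable_superlevel. Qed.

Let Aoo j : (m (A j) < +oo)%E.
Proof.
have j0 : (0 : R) < j.+1%:R^-1 by rewrite invr_gt0 ltr0n.
have h : ((j.+1%:R^-1)%:E * m (A j) <= \int[m]_t (s t)%:E)%E.
  rewrite -integral_cst//.
  apply: (@le_trans _ _ (\int[m]_(t in A j) (s t)%:E)%E).
    apply: ge0_le_integral => //.
    - by move=> t _; rewrite lee_fin ltW.
    - by apply/measurable_EFinP; apply: measurable_funTS.
  apply: ge0_subset_integral => //; first exact/measurable_EFinP.
  by move=> t _; rewrite lee_fin.
have := le_lt_trans h Soo.
have := measure_ge0 m (A j); case: (m (A j)) => [r _ _|_|]//; first exact: ltry.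
by rewrite gt0_muley// lte_fin.
Qed.

Let tail_cvg :
  (\int[m]_(t in ~` A j) (2 * s t)%R%:E @[j --> \oo] --> 0)%E.
Proof.
rewrite (_ : (fun j => _) = (fun j =>
    \int[m]_t (((fun t => (2 * s t)%:E) \_ (~` A j)) t))%E); last first.
  by apply/funext => j; rewrite integral_mkcond.
have int2 : m.-integrable setT (EFin \o (fun t => 2 * s t)).
  apply/integrableP; split.
    by apply/measurable_EFinP; exact: measurable_funM.
  rewrite (eq_integral (fun t => (2%:E * (s t)%:E)%E)); last first.
    by move=> t _ /=; rewrite ger0_norm ?mulr_ge0// EFinM.
  rewrite ge0_integralZl//; last first.
  - by move=> t _; rewrite lee_fin.
  - exact/measurable_EFinP.
  by rewrite lte_mul_pinfty.
have [] := @dominated_convergence _ _ _ m setT measurableT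
  (fun j => (fun t => (2 * s t)%:E) \_ (~` A j)) (cst 0%E)
  (EFin \o (fun t => 2 * s t)) _ _ _ int2 _.
- move=> j; apply/measurable_restrict => //; first exact: measurableC.
  by apply/measurable_funTS/measurable_EFinP; exact: measurable_funM.
- exact: measurable_cst.
- apply: aeW => t _; apply: cvg_near_cst.
  have [st|st] := eqVneq (s t) 0.
    by apply: nearW => j; rewrite patchE st mulr0; case: ifP.
  have st0 : 0 < s t by rewrite lt_neqAle eq_sym st s0.
  have /cvgnP/(_ _ st0)[N hN] := @cvg_invS R.
  exists N => // j /= /hN; rewrite subr0 => hj.
  rewrite patchE memNset//; apply; rewrite /A/=.
  exact: le_trans (ler_norm _) hj.
- apply: aeW => t j _ /=; rewrite patchE; case: ifP => _.
    by rewrite /= ger0_norm// mulr_ge0.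
  by rewrite -[point]/(0%E : \bar R) abse0 lee_fin mulr_ge0.
by move=> _ _; rewrite integral0.
Qed.

(** The parameters of norm at least [1 / (j + 1)] have finite mass, which is
    what Tonelli's theorem needs; the others contribute little to the integral
    of the norm. *)
Lemma family_lln (u : nat -> Omega -> R) :
  (forall n o, (`|u n o|%:E <= \int[m]_t (fam_dist n o t)%:E)%E) ->
  ocvg0 P u.
Proof.
move=> hu e e0; have e2 : 0 < e / 2 by rewrite divr_gt0.
have [j hj] : exists j, (\int[m]_(t in ~` A j) (2 * s t)%R%:E <= (e / 2)%:E)%E.
  have /fine_cvgP[h1 /cvgnP/(_ _ e2)[N hN]] := tail_cvg.
  have [N' _ hN'] := h1; exists (maxn N N').
  have := hN (maxn N N') (leq_maxl _ _); rewrite /= subr0 => h.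
  rewrite -[leLHS]fineK ?lee_fin ?(le_trans (ler_norm _) h)//.
  by apply: hN'; rewrite /= leq_maxr.
pose m' : {finite_measure set T -> \bar R} := mfrestr (mA j) (Aoo j).
pose f n (v : Omega * T) : \bar R := (fam_dist n v.1 v.2 * \1_(A j) v.2)%:E.
have f0 n v : (0 <= f n v)%E.
  by rewrite /f lee_fin mulr_ge0// ?normr_ge0// indicE.
have mf n : measurable_fun setT (f n).
  apply/measurable_EFinP; apply: measurable_funM; first exact: mdist.
  by apply: (measurableT_comp _ measurable_snd); exact: measurable_indic.
have m'E (h : T -> \bar R) : (\int[m']_t (h t * (\1_(A j) t)%:E) =
    \int[m]_(t in A j) h t)%E.
  transitivity (\int[m']_(t in A j) h t)%E.
    by rewrite [RHS]integral_mkcond; apply: eq_integral => t _;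
      rewrite patchE indicE; case: ifP => _; rewrite ?mule1 ?mule0.
  apply: eq_measure_integral => B mB BA.
  by rewrite /= /mfrestr /mrestr setIidl.
have fE n o : (\int[m']_t f n (o, t) = \int[m]_(t in A j) (fam_dist n o t)%:E)%E.
  by rewrite -m'E; apply: eq_integral => t _; rewrite /f EFinM.
have md n o : measurable_fun setT (fun t => (fam_dist n o t)%:E).
  apply/measurable_EFinP.
  have h := measurableT_comp (@mdist n) (pair1_measurable (T1 := Omega) (T2 := T) o).
  exact: h.
have Doo n o : (\int[m]_(t in A j) (fam_dist n o t)%:E <=
    2%:E * \int[m]_t (s t)%:E)%E.
  rewrite -ge0_integralZl//; last first.
  - by move=> t _; rewrite lee_fin.
  - exact/measurable_EFinP.
  apply: (@le_trans _ _ (\int[m]_t (fam_dist n o t)%:E)%E).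
    by apply: ge0_subset_integral => // t _; rewrite lee_fin normr_ge0.
  apply: ge0_le_integral => //.
  - by move=> t _; rewrite lee_fin normr_ge0.
  - by apply/measurable_EFinP; exact: measurable_funM.
  - by move=> t _; rewrite -EFinM lee_fin; exact: fam_dist_le.
have Sfin : (2%:E * \int[m]_t (s t)%:E)%E \is a fin_num.
  rewrite fin_numM// ge0_fin_numE//; apply: integral_ge0 => t _.
  by rewrite lee_fin.
pose S := fine (2%:E * \int[m]_t (s t)%:E)%E.
have ffin n o : (\int[m']_t f n (o, t))%E \is a fin_num.
  rewrite fE ge0_fin_numE; last first.
    by apply: integral_ge0 => t _; rewrite lee_fin normr_ge0.
  apply: le_lt_trans (Doo n o) _.
  by rewrite -ge0_fin_numE// mule_ge0//; apply: integral_ge0 => t _; rewrite lee_fin.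
pose B n o := fine (\int[m']_t f n (o, t))%E.
have B0 n o : 0 <= B n o.
  by apply: fine_ge0; apply: integral_ge0.
have bB n : bm (B n).
  apply: (@bmP _ _ _ _ S).
    apply: (measurableT_comp (f := fine)) => //.
    exact: (measurable_fun_fubini_tonelli_F (f n)).
  move=> o; rewrite ger0_norm// /B /S fine_le//.
  by rewrite fE.
have BP n : (\int[P]_o B n o)%:E = (\int[m]_(t in A j) (\int[P]_o fam_dist n o t)%:E)%E.
  rewrite -(bm_EFin P1 (bB n)).
  under eq_integral do rewrite fineK//.
  rewrite (fubini_tonelli (m2 := m') (f n))// -m'E.
  apply: eq_integral => t _.
  rewrite -(bm_EFin P1 (fam_dist_bm n t)) -ge0_integralZr//.
  - exact/measurable_EFinP/bm_meas/fam_dist_bm.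
  - by move=> o _; rewrite lee_fin normr_ge0.
have B_cvg : (\int[P]_o B n o)%:E @[n --> \oo] --> 0%E.
  rewrite (_ : (fun n => _) = (fun n => \int[m]_(t in A j) (\int[P]_o fam_dist n o t)%:E)%E); last first.
    by apply/funext => n; rewrite BP.
  have mI n : measurable_fun setT (fun t => \int[P]_o fam_dist n o t).
    apply: measurableT_comp => //.
    apply: (measurable_fun_fubini_tonelli_G (m1 := P) (fun v => (fam_dist n v.1 v.2)%:E)).
      exact/measurable_EFinP.
    by move=> v; rewrite lee_fin normr_ge0.
  have [] := @dominated_convergence _ _ _ m (A j) (mA j)
    (fun n t => (\int[P]_o fam_dist n o t)%:E) (cst 0%E)
    (EFin \o (fun t => 2 * s t)) _ _ _ _ _.
  - move=> n; apply: measurable_funTS; exact/measurable_EFinP.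
  - exact: measurable_cst.
  - apply: aeW => t _; apply/fine_cvgP; split; first exact: nearW.
    exact: fam_dist_cvg.
  - apply/integrableP; split.
      by apply: measurable_funTS; apply/measurable_EFinP; exact: measurable_funM.
    apply: (@le_lt_trans _ _ (2%:E * \int[m]_t (s t)%:E)%E); last first.
      by rewrite -ge0_fin_numE// mule_ge0//; apply: integral_ge0 => t _; rewrite lee_fin.
    rewrite -ge0_integralZl//; last first.
    + by move=> t _; rewrite lee_fin.
    + exact/measurable_EFinP.
    rewrite (eq_integral (fun t => (2%:E * (s t)%:E)%E)); last first.
      by move=> t _ /=; rewrite ger0_norm ?mulr_ge0// EFinM.
    apply: ge0_subset_integral => //.
      by apply: measurable_funeM; exact/measurable_EFinP.
    by move=> t _; rewrite -EFinM lee_fin mulr_ge0.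
  - apply: aeW => t n _ /=; rewrite lee_fin.
    by apply: bmI_bound => // o; rewrite ger0_norm ?normr_ge0.
  by move=> _ _; rewrite integral0.
have /fine_cvgP[_ /cvgnP/(_ _ e2)[N hN]] := B_cvg.
exists N => n /hN /=; rewrite subr0 => hB.
exists (fun o => B n o + e / 2); split.
- by apply: bmD => //; exact: bm_cst.
- move=> o; rewrite -lee_fin; apply: le_trans (hu n o) _.
  rewrite -(setvU (A j)) setUC ge0_integral_setU//; last first.
  + by rewrite disj_set2E setICr.
  + by move=> t _; rewrite lee_fin normr_ge0.
  + by rewrite setUCr.
  + exact: measurableC.
  rewrite EFinD leeD//; first by rewrite -fE /B fineK.
  apply: le_trans hj; apply: ge0_le_integral => //.
  + exact: measurableC.
  + by move=> t _; rewrite lee_fin normr_ge0.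
  + exact: measurable_funTS.
  + apply: measurable_funTS; apply/measurable_EFinP; exact: measurable_funM.
  + by move=> t _; rewrite lee_fin; exact: fam_dist_le.
- rewrite (bmID P1)//; last exact: bm_cst.
  rewrite (bmI_cst P1); have := le_trans (ler_norm _) hB; lra.
Qed.
End family_lln.

(** * The levels of the interacting algorithm *)

Section levels.
Context {R : realType} {d : nat -> measure_display}
  {S : forall l, measurableType (d l)}.
Variables (pi nu : forall l, probability (S l) R).
Variable Phi : forall k, probability (S k) R -> probability (S k.+1) R.
Arguments Phi : clear implicits.
Variable M0 : R.-pker (S 0%N) ~> (S 0%N).
Variable M : forall k, probability (S k) R -> R.-pker (S k.+1) ~> (S k.+1).
Arguments M : clear implicits.
Hypothesis Phi_pi : forall k (A : set (S k.+1)), measurable A ->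
  Phi k (pi k) A = pi k.+1 A.
Hypothesis M0_inv : invariant_law (pi 0%N) M0.
Hypothesis M_inv : forall k mu, invariant_law (Phi k mu) (M k mu).
Context {dO : measure_display} {Omega : measurableType dO}.
Variables (P : probability Omega R) (X : forall l, nat -> {RV P >-> S l}).
Hypothesis X_imcmc : is_imcmc X nu M0 M.
Hypotheses (reg2 : R2 M0 M) (reg3 : R3 M).

Let P1 : P setT = 1%E. Proof. exact: probability_setT. Qed.

(** Containing the whole trajectories of the lower levels, it makes the kernels of level [l] known
    at all times and the fields of the lower levels known at time 0. *)
Definition filtration l n : set (set Omega) :=
  sigma_of X (fun l' p => (l' < l)%N \/ (l' = l /\ (p <= n)%N)).

Let K l n o : R.-pker (S l) ~> (S l) := level_M M0 M (occupation X n o) l.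
Let phi l n o : probability (S l) R := level_Phi (pi 0%N) Phi (occupation X n o) l.
Let Kpi l : R.-pker (S l) ~> (S l) := level_M M0 M pi l.
Let phipi l : probability (S l) R := level_Phi (pi 0%N) Phi pi l.

Let F_sigma l n : sigma_algebra setT (filtration l n).
Proof. exact: smallest_sigma_algebra. Qed.

Let FM l n : filtration l n `<=` measurable.
Proof.
apply: smallest_sub; first exact: sigma_algebra_measurable.
move=> _ [l' [p [B [_ mB ->]]]]; rewrite -[_ @^-1` _]setTI.
exact: measurable_funP.
Qed.

Lemma filtration_le l l' n n' : (l < l')%N \/ (l = l' /\ (n <= n')%N) ->
  filtration l n `<=` filtration l' n'.
Proof.
move=> ll; apply: sub_sigma_algebra2 => _ [k [p [B [kp mB ->]]]].
exists k, p, B; split=> //; case: ll kp => [ll|[<- nn']] [kl|[-> pn]].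
- by left; exact: ltn_trans kl ll.
- by left.
- by left.
- by right; split=> //; exact: leq_trans pn nn'.
Qed.

Let FS l n : filtration l n `<=` filtration l n.+1.
Proof. by apply: filtration_le; right. Qed.

Let mX l n : @measurable_fun _ _ (g_sigma_algebraType (filtration l n)) (S l) setT (X l n).
Proof.
move=> _ B mB; rewrite setTI F_measurable//.
by apply: sub_gen_smallest; exists l, n, B; split=> //; right.
Qed.

Let mXlow l k n p : (k < l)%N ->
  @measurable_fun _ _ (g_sigma_algebraType (filtration l n)) (S k) setT (X k p).
Proof.
move=> kl _ B mB; rewrite setTI F_measurable//.
by apply: sub_gen_smallest; exists k, p, B; split=> //; left.
Qed.

Let mK l n (A : set (S l)) : measurable A ->
  @measurable_fun _ _ (g_sigma_algebraType (filtration l n) * S l)%type (\bar R)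
    setT (fun u => K l n u.1 u.2 A).
Proof.
case: l A => [|k] A mA.
  have h : measurable_fun setT (fun x : S 0%N => M0 x A) by exact: measurable_kernel.
  exact: (measurableT_comp h measurable_snd).
have [h _ _] := X_imcmc.
(* Measurability of the transitions is given on tuples of samples, through which the occupation
   measure is made to factor. *)
pose tup (u : g_sigma_algebraType (filtration k.+1 n) * S k.+1) : n.+1.-tuple (S k) :=
  [tuple X k i u.1 | i < n.+1].
have mt : measurable_fun setT (fun u => (tup u, u.2)).
  apply: measurable_fun_pair => //; apply/measurable_fun_tnthP => i.
  have -> : (@tnth _ _)^~ i \o tup = fun u => X k i u.1.
    by apply/funext => u; rewrite /= tnth_mktuple.
  exact: (measurableT_comp (@mXlow k.+1 k n i (ltnSn k)) measurable_fst).
have := measurableT_comp (h k n A mA) mt.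
congr measurable_fun; apply/funext => u /=; rewrite /K /= /occupation.
congr (M _ _ _ _); apply: eq_empirical => p pn.
by have := tnth_mktuple (fun i : 'I_n.+1 => X k i u.1) (Ordinal (pn : (p < n.+1)%N));
  rewrite (tnth_nth point).
Qed.

Let markov l n (A : set (S l)) (G : set Omega) : measurable A ->
  filtration l n G -> P (G `&` X l n.+1 @^-1` A) =
    (\int[P]_(o in G) K l n o (X l n o) A)%E.
Proof. by have [_ _ h] := X_imcmc; exact: h. Qed.

Let invK l n o : invariant_law (phi l n o) (K l n o).
Proof. by case: l => [|k]; [exact: M0_inv|exact: M_inv]. Qed.

Let invpi l : invariant_law (phipi l) (Kpi l).
Proof. by case: l => [|k]; [exact: M0_inv|exact: M_inv]. Qed.

Lemma level_contracts l : exists N b, [/\ (0 < N)%N, 0 <= b < 1,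
  forall n o, contracts (K l n o) N b & contracts (Kpi l) N b].
Proof.
(* A real rate in [0, 1) is extracted from an extended real; nonnegativity is imposed by hand. *)
have bnd (s : \bar R) : (s < 1)%E -> exists b : R, 0 <= b < 1 /\ (s <= b%:E)%E.
  case: s => [r r1| |_] /=.
  - exists (Num.max 0 r); split; last by rewrite lee_fin le_max lexx orbT.
    by rewrite le_max lexx gt_max ltr01 -lte_fin.
  - by rewrite ltNge leey.
  - by exists 0; rewrite lexx ltr01 leNye.
have [[N0 [N01 h0]] hk] := reg2; case: l => [|k].
  have [b [b01 hb]] := bnd _ h0; exists N0, b.
  by split=> // [n o|]; exact: dobrushin_contracts.
have [N [N1 /bnd[b [b01 hb]]]] := hk k.
have hmu mu : contracts (M k mu) N b.
  apply: dobrushin_contracts => //; apply: le_trans hb.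
  by apply: ereal_sup_ubound; exists mu.
by exists N, b; split=> // [n o|]; exact: hmu.
Qed.

(** (R3) at two consecutive occupation measures: each test function moves by at most [2 / (n + 1)]
    times its norm, whence [L = 2 * |Lambda|]. At level 0 the kernel is fixed. *)
Lemma level_lip l : exists2 L : R, 0 <= L &
  forall n o f (c : R), bm f -> (forall x, `|f x| <= c) ->
  forall x, `|kop (K l n.+1 o) f x - kop (K l n o) f x| <= L * c / n.+1%:R.
Proof.
case: l => [|k].
  exists 0 => // n o f c bf hc x; rewrite subrr normr0 mul0r.
  by rewrite mul0r.
have [Lam [Gam [h1 h2]]] := reg3 k.
exists (2 * `|Lam|) => [|n o f c bf hc x]; first by rewrite mulr_ge0.
have [f' fE] := bm_bmfun bf; rewrite -{}fE in bf hc *.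
have c0 : 0 <= c by apply: le_trans (hc point).
pose mu := occupation X n.+1 o k; pose mu' := occupation X n o k.
pose G := Gam mu f'.
have Gle : (\int[fm_meas G]_t supnorm (fm_fun t) <= (`|Lam| * c)%:E)%E.
  apply: (@le_trans _ _ (Lam%:E * supnorm f')%E).
    apply: le_trans (h2 f'); apply: ereal_sup_ubound; by exists mu.
  have sc : (supnorm f' <= c%:E)%E by exact: supnorm_le.
  have s0 : (0 <= supnorm f')%E.
    by apply: le_trans (supnorm_ub f' point); rewrite lee_fin.
  apply: (@le_trans _ _ (`|Lam|%:E * supnorm f')%E).
    by rewrite lee_wpmul2r// lee_fin ler_norm.
  by rewrite EFinM lee_wpmul2l// lee_fin.
rewrite -lee_fin.
apply: (@le_trans _ _ (supnorm (fun x => kop (M k mu) f' x - kop (M k mu') f' x))).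
  exact: (supnorm_ub (fun x => kop (M k mu) f' x - kop (M k mu') f' x)).
apply: le_trans (h1 f' mu mu') _.
have n0 : (0 : R) <= 2 / n.+1%:R by rewrite divr_ge0.
apply: (@le_trans _ _ ((2 / n.+1%:R)%:E * \int[fm_meas G]_t supnorm (fm_fun t))%E).
  rewrite -ge0_integralZl//; [|exact: fm_norm_measurable|]; last first.
    by move=> t _; exact: le_trans (supnorm_ub (fm_fun t) point).
  apply: ge0_le_integral => //.
  - by apply/measurable_EFinP/measurableT_comp => //;
      apply: measurable_funB; exact: measurable_fun_empirical_int.
  - by apply: measurable_funeM; exact: fm_norm_measurable.
  move=> t _; have bg := bmfun_bm (fm_fun t).
  have [s s0 hs] := bm_bound bg.
  have sE : supnorm (fm_fun t) = (fine (supnorm (fm_fun t)))%:E.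
    rewrite fineK// fin_numElt; apply/andP; split.
      exact: lt_le_trans (ltNyr _) (supnorm_ub (fm_fun t) point).
    exact: le_lt_trans (supnorm_le hs) (ltry _).
  rewrite sE -EFinM lee_fin [leRHS]mulrAC.
  apply: empirical_step => // z; rewrite -lee_fin -sE; exact: supnorm_ub.
apply: le_trans (lee_wpmul2l _ Gle) _; first by rewrite lee_fin.
rewrite -EFinM lee_fin le_eqVlt; apply/orP; left; apply/eqP.
by ring.
Qed.

(** [Phi_pi] is an equality on measurable sets only, so that the two laws are exchanged under
    integrals and not as objects. *)
Lemma phipi_int l f : bm f -> \int[phipi l]_x f x = \int[pi l]_x f x.
Proof.
case: l f => [//|k] f bf; rewrite /Rintegral; congr fine.
by apply: eq_measure_integral => A mA _; exact: Phi_pi.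
Qed.

(** Convergence of the kernels of level [k] gives the law of large numbers for that level, tested on
    each function. (R3) integrates it over the test functions and returns convergence of the kernels
    of level [k + 1]. *)
Lemma level_conv l f : bm f -> ocvg0 P (kdist (K l) (Kpi l) f).
Proof.
elim: l f => [|k IH] f bf.
  apply: (@ocvg0_le _ _ _ _ _ (fun _ _ => 0)).
    exact: (ocvg0_cst P (cvg_cst _)).
  move=> n o; rewrite /kdist (_ : [set _ | _ in _] = [set 0]) ?sup1//.
  by apply/seteqP; split=> [_ [x _ <-]|_ ->]; rewrite /K /Kpi /= ?subrr ?normr0//;
    exists point => //; rewrite subrr normr0.
have [N [b [N0 b01 contrK contrpi]]] := level_contracts k.
have [L L0 lipK] := level_lip k.
have lln h : bm h -> ocvg0 P (fun n o =>
    \sum_(0 <= p < n.+1) n.+1%:R^-1 * (h (X k p o) - \int[pi k]_x h x)).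
  move=> bh; have := weighted_lln (F_sigma k) (@FS k) (@FM k) (@mX k) (@mK k)
    (@markov k) N0 b01 contrK (@invK k) contrpi (@invpi k) L0 lipK IH (nu k)
    warray_uniform bh.
  by rewrite phipi_int.
have [Lam [Gam [h1 h2]]] := reg3 k.
have [f' fE] := bm_bmfun bf; rewrite -{}fE in bf *.
(* (R3) is applied with first law [pi k], so that the measure on test functions is deterministic;
   taken at the occupation measure it would be random. *)
pose G := Gam (pi k) f'.
have [c c0 hc] := bm_bound bf.
have Goo : (\int[fm_meas G]_t supnorm (fm_fun t) < +oo)%E.
  apply: (@le_lt_trans _ _ (Lam%:E * supnorm f')%E).
    by apply: le_trans (h2 f'); apply: ereal_sup_ubound; exists (pi k).
  have sc : (supnorm f' <= c%:E)%E by exact: supnorm_le.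
  have s0 : (`|f' point|%:E <= supnorm f')%E by exact: supnorm_ub.
  by case: (supnorm f') sc s0 => [r _ _|//|//]; rewrite -EFinM ltry.
have mX' n : measurable_fun setT (X k n) by exact: measurable_funPT.
apply: (family_lln mX' Goo lln) => n o.
have kd0 : 0 <= kdist (K k.+1) (Kpi k.+1) f' n o.
  exact: le_trans (normr_ge0 _) (kdist_le _ _ _ _ point bf).
rewrite ger0_norm//.
have key x : (`|kop (K k.+1 n o) f' x - kop (Kpi k.+1) f' x|%:E <=
    \int[fm_meas G]_t (fam_dist (fun n => X k n) (pi k) n o t)%:E)%E.
  rewrite distrC.
  have := h1 f' (pi k) (occupation X n o k); apply: le_trans.
  exact: (supnorm_ub (fun x => kop (M k (pi k)) f' x - kop (M k (occupation X n o k)) f' x)).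
case: (\int[_]_t _)%E key => [r||] key; last 2 first.
- exact: leey.
- by have := key point.
rewrite lee_fin; apply: ge_sup => [|_ [x _ <-]].
  by exists `|kop (K k.+1 n o) f' point - kop (Kpi k.+1) f' point|, point.
by rewrite -lee_fin.
Qed.

Variable w : nat -> nat -> nat -> R.
Hypothesis hw : forall l, weights (w l).

Let V n l (f : S l -> R) := weighted_field X nu (pi 0%N) Phi w n f.

Lemma field_bmF l n (f : S l -> R) : bm f -> bmF (filtration l) n (V n f).
Proof.
move=> bf; have [N [b [N0 b01 contrK _]]] := level_contracts l.
rewrite (_ : V n f = fun o =>
    \sum_(p < n.+1) w l n p * derr (X l) (phi l) (nu l) f p o); last first.
  by apply/funext => o; rewrite /V /weighted_field big_mkord.
rewrite /bmF; apply: bm_sum => i; apply: bmZ.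
apply: (bmF_le (F_sigma l) (@FS l) (n := i)); first by rewrite -ltnS.
exact: (derr_bmF (F_sigma l) (@FS l) (@mX l) (@mK l) N0 b01 contrK (@invK l)).
Qed.

Lemma field_bm l n (f : S l -> R) : bm f -> bm (V n f).
Proof. by move=> /(@field_bmF l n); exact: (bmF_bm (F_sigma l) (@FM l)). Qed.

Lemma field_bm_low l l' n (f : S l -> R) : (l < l')%N -> bm f ->
  bmF (filtration l') 0 (V n f).
Proof.
move=> ll /(@field_bmF l n)[mf hf]; split=> // _ B mB.
rewrite (F_measurable (F_sigma l')).
apply: (@filtration_le l l' n); first by left.
by rewrite -(F_measurable (F_sigma l)); exact: mf.
Qed.

Lemma field_sq l (f : S l -> R) : bm f -> exists A : R, forall n,
  \int[P]_o (V n f o) ^+ 2 <= A.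
Proof.
move=> bf; have [N [b [N0 b01 contrK _]]] := level_contracts l.
have [L L0 lipK] := level_lip l.
exact: (level_sq (F_sigma l) (@FS l) (@FM l) (@mX l) (@mK l) (@markov l)
  N0 b01 contrK (@invK l) L0 lipK (nu l) (hw l) bf).
Qed.

Definition level_var l (f : S l -> R) : R := var_limit (Kpi l) (phipi l) f.

Lemma level_var_ge0 l (f : S l -> R) : bm f -> 0 <= level_var f.
Proof.
move=> bf; have [N [b [N0 b01 _ contrpi]]] := level_contracts l.
exact: (var_limit_ge0 N0 b01 contrpi (@invpi l) bf).
Qed.

(** Induction on the number of levels: with [U] the phase plus the fields already treated,
    [level_clt] contributes one Gaussian factor. *)
Lemma field_charf (m : nat) (h : forall l, S l -> R) (a : R) :
  (forall l, bm (h l)) ->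
  \int[P]_o cos (a + \sum_(0 <= l < m) V n (h l) o) @[n --> \oo] -->
  expR (- ((\sum_(0 <= l < m) level_var (h l)) / 2)) * cos a.
Proof.
move=> bh; elim: m => [|m IH].
  rewrite big_geq// mul0r oppr0 expR0 mul1r.
  under eq_fun do under eq_Rintegral do rewrite big_geq// addr0.
  under eq_fun do rewrite (bmI_cst P1); exact: cvg_cst.
have [N [b [N0 b01 contrK contrpi]]] := level_contracts m.
have [L L0 lipK] := level_lip m.
have clt := level_clt (F_sigma m) (@FS m) (@FM m) (@mX m) (@mK m) (@markov m)
  N0 b01 contrK (@invK m) contrpi (@invpi m) L0 lipK (@level_conv m) (nu m)
  (hw m) (bh m).
apply/cvgnP => e e0; have e2 : 0 < e / 2 by rewrite divr_gt0.
have [n1 h1] := clt _ e2.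
move/cvgnP: IH => /(_ _ e2)[n2 h2].
exists (maxn n1 n2) => n; rewrite geq_max => /andP[/h1 {}h1 /h2 {}h2].
pose U o := a + \sum_(0 <= l < m) V n (h l) o.
have mU : @measurable_fun _ _ (g_sigma_algebraType (filtration m 0)) R setT U.
  apply: (@bm_meas _ (g_sigma_algebraType (filtration m 0))).
  apply: bmD; first exact: bm_cst.
  rewrite /U; under eq_fun do rewrite big_mkord.
  by apply: bm_sum => i; exact: field_bm_low.
have := h1 U mU; rewrite big_nat_recr//= mulrDl opprD expRD.
rewrite (eq_Rintegral _ (g := fun o =>
   cos (a + \sum_(0 <= l < m.+1) V n (h l) o))); last first.
  by move=> o _; rewrite [in RHS]big_nat_recr//= addrA.
have v0 := level_var_ge0 (bh m); move: h2.
rewrite -/(level_var (h m)) -/(U _).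
set I0 := \int[P]_o _; set I1 := \int[P]_o _.
set E := expR (- (_ / 2)) => h2; set E' := expR _ => h3.
have E'1 : 0 <= E' <= 1.
  by rewrite expR_ge0 /E' -expR0 ler_expR oppr_le0 divr_ge0.
rewrite (_ : _ - _ = (I1 - E' * I0) + E' * (I0 - E * cos a)); last by ring.
apply: le_trans (ler_normD _ _) _.
rewrite [leRHS]splitr lerD// normrM ger0_norm; last by case/andP: E'1.
apply: le_trans h2; rewrite ler_piMl//; by case/andP: E'1.
Qed.
End levels.

(** * A free ultrafilter on the integers *)

Lemma free_ultrafilter : exists U : set_system nat, UltraFilter U /\ \oo `<=` U.
Proof. exact: ultraFilterLemma. Qed.

Definition ultra : set_system nat := sval (cid free_ultrafilter).

Lemma ultra_ultra : UltraFilter ultra.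
Proof. by rewrite /ultra; case: cid => U []. Qed.

#[local] Instance ultra_properfilter : ProperFilter ultra.
Proof. exact: (@ultra_proper _ _ ultra_ultra). Qed.

Lemma ultraC (A : set nat) : ~ ultra A -> ultra (~` A).
Proof. by case: (in_ultra_setVsetC A ultra_ultra). Qed.

Lemma ultra_eventually (A : set nat) N : (forall n, (N <= n)%N -> A n) -> ultra A.
Proof.
move=> h; rewrite /ultra; case: cid => U [_ /=]; apply.
by exists N => // n /h.
Qed.

Lemma ultra_sub (A B : set nat) : A `<=` B -> ultra A -> ultra B.
Proof. exact: filterS. Qed.

Lemma ultraI (A B : set nat) : ultra A -> ultra B -> ultra (A `&` B).
Proof. exact: filterI. Qed.

Lemma ultra_ex (A : set nat) : ultra A -> exists n, A n.
Proof. exact: filter_ex. Qed.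

(** * Loeb measure *)

Section ultralimit.
Context {R : realType}.
Implicit Types u v : nat -> R.

Definition ucvg u (l : R) : Prop :=
  forall e : R, 0 < e -> ultra [set n | `|u n - l| <= e].

(** The limit is the supremum of the reals that lie below [u n] for almost all [n] in the sense of
    the ultrafilter; maximality of the ultrafilter gives the upper estimate. *)
Lemma ucvg_ex u (c : R) : (forall n, `|u n| <= c) -> exists l, ucvg u l.
Proof.
move=> hc; have hc' n : - c <= u n <= c by rewrite -ler_norml.
pose A : set R := [set x | ultra [set n | x <= u n]].
have Ac : A (- c).
  by apply: (@ultra_eventually _ 0%N) => n _ /=; have /andP[] := hc' n.
have hA : has_sup A.
  split; first by exists (- c).
  exists c => x /ultra_ex[n /= xn].
  by apply: le_trans xn _; have /andP[] := hc' n.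
exists (sup A) => e e0.
have [a Aa ha] := sup_adherent e0 hA.
have nA : ~ A (sup A + e).
  move=> /(ub_le_sup hA.2); rewrite gerDl => e1.
  by have := lt_le_trans e0 e1; rewrite ltxx.
apply: ultra_sub (ultraI Aa (ultraC nA)) => n [/= h1 /negP].
by rewrite -ltNge ler_norml => h2; lra.
Qed.

Lemma ucvg_unique u (l l' : R) : ucvg u l -> ucvg u l' -> l = l'.
Proof.
move=> h h'; apply/eqP; rewrite -subr_eq0 -normr_le0; apply/ler_addgt0Pl => e e0.
rewrite addr0; have e2 : 0 < e / 2 by rewrite divr_gt0.
have [n [/= h1 h2]] := ultra_ex (ultraI (h _ e2) (h' _ e2)).
rewrite (_ : l - l' = (u n - l') - (u n - l)); last by ring.
by apply: le_trans (ler_normB _ _) _; rewrite [leRHS]splitr lerD.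
Qed.

Definition ulim u : R := xget 0 [set l | ucvg u l].

Lemma ulimE u (l : R) : ucvg u l -> ulim u = l.
Proof.
rewrite /ulim => h; case: xgetP => [l' _ /= h'|/(_ l)//].
exact: ucvg_unique h' h.
Qed.

Lemma ulimP u (c : R) : (forall n, `|u n| <= c) -> ucvg u (ulim u).
Proof. by move=> /ucvg_ex[l hl]; rewrite (ulimE hl). Qed.

Lemma cvg_ucvg u (l : R) : u n @[n --> \oo] --> l -> ucvg u l.
Proof.
by move=> /cvgnP h e e0; have [N hN] := h e e0; exact: (ultra_eventually (N := N)).
Qed.

Lemma ucvg_cst (c : R) : ucvg (fun=> c) c.
Proof.
by move=> e e0; apply: (ultra_eventually (N := 0%N)) => n _ /=; rewrite subrr normr0 ltW.
Qed.

Lemma ucvgD u v (l m : R) : ucvg u l -> ucvg v m ->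
  ucvg (fun n => u n + v n) (l + m).
Proof.
move=> h h' e e0; have e2 : 0 < e / 2 by rewrite divr_gt0.
apply: ultra_sub (ultraI (h _ e2) (h' _ e2)) => n [/= h1 h2].
by rewrite opprD addrACA (le_trans (ler_normD _ _))// [leRHS]splitr lerD.
Qed.

Lemma ucvgZ (r : R) u (l : R) : ucvg u l -> ucvg (fun n => r * u n) (r * l).
Proof.
move=> h e e0; have r0 : 0 < `|r| + 1 by rewrite ltr_wpDl.
apply: ultra_sub (h _ (divr_gt0 e0 r0)) => n /= h1.
rewrite -mulrBr normrM; apply: le_trans (ler_wpM2l (normr_ge0 r) h1) _.
rewrite mulrCA -[leRHS]mulr1; apply: ler_wpM2l; first exact: ltW.
by rewrite ler_pdivrMr// mul1r lerDl.
Qed.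

Lemma ucvg_sum (I : Type) (s : seq I) (F : I -> nat -> R) (l : I -> R) :
  (forall i, ucvg (F i) (l i)) ->
  ucvg (fun n => \sum_(i <- s) F i n) (\sum_(i <- s) l i).
Proof.
move=> h; elim: s => [|i s IH].
  by rewrite big_nil; under eq_fun do rewrite big_nil; exact: ucvg_cst.
by rewrite big_cons; under eq_fun do rewrite big_cons; exact: ucvgD.
Qed.

Lemma ucvg_le u v (l m : R) : ucvg u l -> ucvg v m ->
  ultra [set n | u n <= v n] -> l <= m.
Proof.
move=> h h' uv; apply/ler_addgt0Pl => e e0.
have e2 : 0 < e / 2 by rewrite divr_gt0.
have [n [[/= h1 h2] h3]] := ultra_ex (ultraI (ultraI (h _ e2) (h' _ e2)) uv).
by move: h1 h2; rewrite !ler_norml => /andP[? ?] /andP[? ?]; rewrite /= in h3; lra.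
Qed.

Lemma ucvg_ext u v (l : R) : ultra [set n | u n = v n] -> ucvg u l -> ucvg v l.
Proof.
by move=> uv h e e0; apply: ultra_sub (ultraI uv (h e e0)) => n [/= ->].
Qed.

Lemma ucvg_close u v (l m : R) (e : R) : ucvg u l -> ucvg v m ->
  (forall n, `|u n - v n| <= e) -> `|l - m| <= e.
Proof.
move=> h h' uv; rewrite ler_norml; apply/andP; split.
  rewrite lerNl opprB; apply: ucvg_le (ucvg_cst e) _.
    by apply: ucvgD h' _; rewrite -mulN1r; exact: ucvgZ h.
  apply: (ultra_eventually (N := 0%N)) => n _ /=; rewrite mulN1r.
  by have := uv n; rewrite ler_norml => /andP[]; lra.
apply: ucvg_le (ucvg_cst e) _.
  by apply: ucvgD h _; rewrite -mulN1r; exact: ucvgZ h'.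
apply: (ultra_eventually (N := 0%N)) => n _ /=; rewrite mulN1r.
by have := uv n; rewrite ler_norml => /andP[]; lra.
Qed.
End ultralimit.

(** * Internal sets of the ultrapower *)

Section internal_sets.
Context {d} {T : measurableType d}.
Implicit Types A B : nat -> set T.

(** Points are sequences rather than classes modulo the ultrafilter: internal sets do not separate
    equivalent sequences. *)
Definition internal A : set (nat -> T) := [set z | ultra [set n | A n (z n)]].

Lemma internalI A B : internal A `&` internal B = internal (fun n => A n `&` B n).
Proof.
apply/seteqP; split => [z [oA oB]|z oAB]; first exact: ultraI oA oB.
by split; apply: ultra_sub oAB => n [].
Qed.

Lemma internalC A : ~` internal A = internal (fun n => ~` A n).
Proof.
apply/seteqP; split => z; first exact: ultraC.
by move=> h h'; have [n []] := ultra_ex (ultraI h h').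
Qed.

Lemma internal0 : internal (fun=> set0) = set0.
Proof. by apply/seteqP; split=> // z /ultra_ex[]. Qed.

Lemma internalT : internal (fun=> setT) = setT.
Proof. by apply/seteqP; split=> // z _; exact: (ultra_eventually (N := 0%N)). Qed.

Lemma internalU A B : internal A `|` internal B = internal (fun n => A n `|` B n).
Proof.
rewrite -[LHS]setCK setCU !internalC internalI internalC.
by congr internal; apply/funext => n; rewrite setCI !setCK.
Qed.

(** Otherwise counterexamples chosen at almost all [n] would form a point of the first internal set
    outside the second. *)
Lemma internal_sub A B : internal A `<=` internal B ->
  ultra [set n | A n `<=` B n].
Proof.
move=> AB; apply: contrapT => /ultraC h.
have /choice[z ho] : forall n, exists x, ~ A n `<=` B n -> A n x /\ ~ B n x.
  move=> n; have [hn|hn] := pselect (A n `<=` B n); first by exists point.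
  by move/existsNP : (hn) => [x /not_implyP h']; exists x.
have /AB oB : internal A z by apply: ultra_sub h => n /ho[].
by have [n [/ho[_ h1] h2]] := ultra_ex (ultraI h oB).
Qed.

(** Countable saturation: [z n] is chosen outside as many of the first [n]
    sets as possible. *)
Lemma internal_saturation B (A : nat -> nat -> set T) :
  internal B `<=` \bigcup_k internal (A k) ->
  exists K, internal B `<=` \bigcup_(k in `I_K) internal (A k).
Proof.
move=> BA; apply: contrapT => /forallNP nK.
pose C K n := B n `&` [set x | forall k, (k < K)%N -> ~ A k n x].
have CK K : ultra [set n | exists x, C K n x].
  have := nK K => /existsNP[z /not_implyP[oB oA]].
  have h k : (k < K)%N -> ultra [set n | ~ A k n (z n)].
    by move=> kK; apply: ultraC => h; apply: oA; exists k.
  have {}h : ultra [set n | forall k, (k < K)%N -> ~ A k n (z n)].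
    elim: K h {oA} => [_|K IH h]; first exact: (ultra_eventually (N := 0%N)).
    have h1 := IH (fun k kK => h k (ltnW kK)).
    apply: ultra_sub (ultraI h1 (h K (ltnSn K))) => n [/= h2 h3] k.
    by rewrite ltnS leq_eqVlt => /predU1P[->//|]; exact: h2.
  by apply: ultra_sub (ultraI oB h) => n [h1 h2]; exists (z n).
have best n m : exists x, forall K, (K <= m)%N -> (exists y, C K n y) -> C K n x.
  elim: m => [|m [x hx]].
    have [[y hy]|h] := pselect (exists y, C 0%N n y).
      by exists y => K; rewrite leqn0 => /eqP -> _.
    by exists point => K; rewrite leqn0 => /eqP -> /h.
  have [[y [yB yA]]|h] := pselect (exists y, C m.+1 n y).
    by exists y => K Km _; split=> // k kK; apply: yA; exact: leq_trans kK Km.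
  exists x => K; rewrite leq_eqVlt => /predU1P[->/h//|]; rewrite ltnS.
  exact: hx.
have /choice[z ho] := fun n => best n n.
have oC K : ultra [set n | C K n (z n)].
  have h := @ultra_eventually [set n | (K <= n)%N] K (fun n h => h).
  by apply: ultra_sub (ultraI h (CK K)) => n [/= h1 h2]; exact: ho.
have /BA[k _ oA] : internal B z by apply: ultra_sub (oC 0%N) => n [].
have [n [[_ h1] h2]] := ultra_ex (ultraI (oC k.+1) oA).
exact: h1 h2.
Qed.
End internal_sets.

Definition loeb {d} (T : measurableType d) : Type := nat -> T.

Section loeb_algebra.
Context {d} {T : measurableType d}.

Definition internal_measurable : set (set (loeb T)) :=
  [set internal A | A in [set A | forall n, measurable (A n)]].

Let im0 : internal_measurable set0.
Proof. by exists (fun=> set0) => //; exact: internal0. Qed.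

Let imU : setU_closed internal_measurable.
Proof.
move=> _ _ [A mA <-] [B mB <-]; rewrite internalU.
by exists (fun n => A n `|` B n) => // n; exact: measurableU.
Qed.

Let imD : setD_closed internal_measurable.
Proof.
move=> _ _ [A mA <-] [B mB <-]; rewrite setDE internalC internalI.
by exists (fun n => A n `&` ~` B n) => // n; apply: measurableI => //; exact: measurableC.
Qed.

HB.instance Definition _ := Pointed.copy (loeb T) (nat -> T).
HB.instance Definition _ := isRingOfSets.Build default_measure_display (loeb T)
  im0 imU imD.
End loeb_algebra.

Section loeb_measure.
Context {d} {T : measurableType d} {R : realType}.
Variable P : probability T R.
Implicit Types A B : nat -> set T.

Let prob (A : nat -> set T) n : R := fine (P (A n)).

Let Pfin (B : set T) : measurable B -> P B = (fine (P B))%:E.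
Proof. by move=> mB; rewrite fineK// fin_num_measure. Qed.

Let prob01 A : (forall n, measurable (A n)) -> forall n, `|prob A n| <= 1.
Proof.
move=> mA n; rewrite /prob ger0_norm ?fine_ge0//.
by rewrite -lee_fin -Pfin//; exact: probability_le1.
Qed.

(** The infimum over internal covers defines a value for every set, without reference to a chosen
    representation; on internal sets it is the ultralimit of the probabilities. *)
Definition loeb_content (Z : set (loeb T)) : \bar R :=
  ereal_inf [set (ulim (prob A))%:E | A in
    [set A | (forall n, measurable (A n)) /\ Z `<=` internal A]].

Lemma loeb_contentE A : (forall n, measurable (A n)) ->
  loeb_content (internal A) = (ulim (prob A))%:E.
Proof.
move=> mA; apply/eqP; rewrite eq_le; apply/andP; split.
  by apply: ereal_inf_lbound; exists A => //; split.
apply: le_ereal_inf_tmp => _ [B [mB AB] <-]; rewrite lee_fin.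
apply: ucvg_le (ulimP (prob01 mA)) (ulimP (prob01 mB)) _.
apply: ultra_sub (internal_sub AB) => n /= ABn.
by rewrite /prob -lee_fin -!Pfin//; apply: le_measure => //; rewrite inE.
Qed.

Lemma loeb_content0 : loeb_content set0 = 0%E.
Proof.
rewrite -internal0 loeb_contentE//; congr EFin; apply: ulimE.
by rewrite /prob measure0; exact: ucvg_cst.
Qed.

Lemma loeb_content_ge0 Z : (0 <= loeb_content Z)%E.
Proof.
apply: le_ereal_inf_tmp => _ [B [mB _] <-]; rewrite lee_fin.
apply: ucvg_le (ucvg_cst 0) (ulimP (prob01 mB)) _.
by apply: (ultra_eventually (N := 0%N)) => n _ /=; rewrite /prob fine_ge0.
Qed.

Lemma loeb_contentU (Y Z : set (loeb T)) : measurable Y -> measurable Z ->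
  Y `&` Z = set0 -> loeb_content (Y `|` Z) = (loeb_content Y + loeb_content Z)%E.
Proof.
move=> [A mA <-] [B mB <-] AB0; rewrite internalU !loeb_contentE//; last first.
  by move=> n; exact: measurableU.
rewrite -EFinD; congr EFin; apply: ulimE.
have := ucvgD (ulimP (prob01 mA)) (ulimP (prob01 mB)); apply: ucvg_ext.
have : internal (fun n => A n `&` B n) `<=` internal (fun=> set0).
  by rewrite -internalI AB0.
move=> /internal_sub; apply: ultra_sub => n /= h.
have {}h : A n `&` B n = set0 by apply/seteqP.
rewrite /prob -fineD ?fin_num_measure//; congr fine.
by rewrite measureU.
Qed.

(** By saturation, a countable disjoint family of internal sets with internal union has only
    finitely many nonempty members, so that finite additivity suffices. *)
Lemma loeb_content_sigma_additive : semi_sigma_additive loeb_content.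
Proof.
move=> F mF tF mUF.
have [B mB BE] := mUF.
have /choice[A hA] : forall k, exists A, (forall n, measurable (A n)) /\ internal A = F k.
  by move=> k; have [A mA <-] := mF k; exists A.
have mA k n := (hA k).1 n; have AE k := (hA k).2.
have [K hK] : exists K, internal B `<=` \bigcup_(k in `I_K) internal (A k).
  by apply: internal_saturation; rewrite BE => z [k _ Fk]; exists k => //; rewrite AE.
have FK k : (K <= k)%N -> F k = set0.
  move=> Kk; rewrite -subset0 => z Fo.
  have /hK[j /= jK] : internal B z by rewrite BE; exists k.
  rewrite AE => Fj; have := tF k j I I (ex_intro _ z (conj Fo Fj)) => kj.
  by rewrite kj leqNgt jK in Kk.
have sumE n : (\sum_(0 <= i < n) loeb_content (F i))%E =
    loeb_content (\bigcup_(i in `I_n) F i).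
  elim: n => [|n IH]; first by rewrite big_geq// II0 bigcup_set0 loeb_content0.
  rewrite big_nat_recr//= IH -loeb_contentU//.
  - by rewrite [in RHS]bigcup_mkord big_ord_recr/= -bigcup_mkord.
  - by rewrite bigcup_mkord; apply: bigsetU_measurable.
  - rewrite -subset0 => z [[k /= kn Fk] Fn].
    have kn' := tF k n I I (ex_intro _ z (conj Fk Fn)).
    by rewrite kn' ltnn in kn.
apply: cvg_near_cst; exists K => // n /= Kn; rewrite sumE.
congr loeb_content; apply/seteqP; split=> [z [k _ Fk]|z [k _ Fk]]; first by exists k.
exists k => //=; rewrite ltnNge; apply/negP => nk.
by move: Fk; rewrite FK// (leq_trans Kn).
Qed.

HB.instance Definition _ := isMeasure.Build _ _ _ loeb_content
  loeb_content0 loeb_content_ge0 loeb_content_sigma_additive.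

Definition loeb_measure := measure_extension loeb_content.
HB.instance Definition _ := Measure.on loeb_measure.

Lemma loeb_measureE A : (forall n, measurable (A n)) ->
  loeb_measure (internal A) = (ulim (prob A))%:E.
Proof.
move=> mA; rewrite -loeb_contentE// /loeb_measure /measure_extension.
by apply: measurable_mu_extE; exists A.
Qed.

Let loeb_setT : loeb_measure setT = 1%E.
Proof.
rewrite -internalT loeb_measureE//; congr EFin; apply: ulimE.
by rewrite /prob probability_setT; exact: ucvg_cst.
Qed.

HB.instance Definition _ := Measure_isProbability.Build _ _ _ loeb_measure loeb_setT.

End loeb_measure.

(** * Integrals of standard parts *)

Section loeb_integral.
Context {d} {T : measurableType d} {R : realType}.
Variable P : probability T R.

Let P1 : P setT = 1%E. Proof. exact: probability_setT. Qed.
Let L1 : loeb_measure P setT = 1%E. Proof. exact: probability_setT. Qed.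

Local Notation loeb_type := (g_sigma_algebraType (@measurable _ (loeb T))).

Definition standard_part (f : nat -> T -> R) (z : loeb_type) : R :=
  ulim (fun n => f n (z n)).

Lemma standard_partP (f : nat -> T -> R) (c : R) z : (forall n x, `|f n x| <= c) ->
  ucvg (fun n => f n (z n)) (standard_part f z).
Proof. by move=> hc; apply: (ulimP (c := c)) => n. Qed.

(** For indicators of level sets the identity is the value of the Loeb measure on internal sets. The
    layer-cake error is uniform in [n] and in the point, hence survives the ultralimit. *)
Let lift01 (f : nat -> T -> R) : (forall n, measurable_fun setT (f n)) ->
  (forall n x, 0 <= f n x <= 1) ->
  bm (standard_part f) /\
  \int[loeb_measure P]_z standard_part f z = ulim (fun n => \int[P]_x f n x).
Proof.
move=> mf f01.
have fb n x : `|f n x| <= 1.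
  by have /andP[h0 h1] := f01 n x; rewrite ger0_norm.
have bf n : bm (f n) by exact: bmP (mf n) (fb n).
pose lev k j n : set T := [set x | j.+1%:R / k.+1%:R <= f n x].
have mlev k j n : measurable (lev k j n) by exact: measurable_superlevel.
pose s k n x : R := k.+1%:R^-1 * \sum_(j < k.+1) \1_(lev k j n) x.
pose S k (z : loeb_type) : R := k.+1%:R^-1 * \sum_(j < k.+1) \1_(internal (lev k j)) z.
have sE k n x : `|f n x - s k n x| <= k.+1%:R^-1.
  rewrite /s; under eq_bigr do rewrite indicE mem_setE.
  exact: layer_cake.
have bs k n : bm (s k n).
  by apply: bmZ; apply: bm_sum => j; exact: bm_indic.
have bS k : bm (S k).
  apply: bmZ; apply: bm_sum => j; apply: bm_indic.
  by apply: sub_sigma_algebra; exists (lev k j).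
have ind k j z : ucvg (fun n => \1_(lev k j n) (z n) : R) (\1_(internal (lev k j)) z).
  have [h|h] := pselect (internal (lev k j) z).
    rewrite indicE mem_set//; apply: ucvg_ext (ucvg_cst _).
    by apply: ultra_sub h => n /= h; rewrite indicE mem_set.
  rewrite indicE memNset//; apply: ucvg_ext (ucvg_cst _).
  by apply: ultra_sub (ultraC h) => n /= h'; rewrite indicE memNset.
have SE k z : `|standard_part f z - S k z| <= k.+1%:R^-1.
  apply: (ucvg_close (standard_partP z fb)) => [|n]; last exact: sE k n (z n).
  by apply: ucvgZ; apply: ucvg_sum => j; exact: ind.
have mst : measurable_fun setT (standard_part f).
  apply: (@measurable_fun_cvg _ _ _ setT S) => [k|z _]; first exact: bm_meas.
  apply/cvgnP => e e0; have /cvgnP/(_ _ e0)[N hN] := @cvg_invS R.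
  exists N => k /hN; rewrite subr0 distrC => h.
  exact: le_trans (SE k z) (le_trans (ler_norm _) h).
have st01 z : `|standard_part f z| <= 1.
  rewrite ger0_norm; first apply: ucvg_le (standard_partP z fb) (ucvg_cst 1) _.
    by apply: (ultra_eventually (N := 0%N)) => n _ /=; have /andP[] := f01 n (z n).
  apply: ucvg_le (ucvg_cst 0) (standard_partP z fb) _.
  by apply: (ultra_eventually (N := 0%N)) => n _ /=; have /andP[] := f01 n (z n).
have bst : bm (standard_part f) by exact: bmP mst st01.
split=> //.
have Ib n : `|\int[P]_x f n x| <= 1 by exact: bmI_bound.
have IS k : ucvg (fun n => \int[P]_x s k n x) (\int[loeb_measure P]_z S k z).
  rewrite /S (bmIZ L1) ?(bmI_sum L1); last 2 first.
  - by move=> j; apply: bm_indic; apply: sub_sigma_algebra; exists (lev k j).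
  - by apply: bm_sum => j; apply: bm_indic; apply: sub_sigma_algebra; exists (lev k j).
  have -> : (fun n => \int[P]_x s k n x) =
      (fun n => k.+1%:R^-1 * \sum_(j < k.+1) \int[P]_x \1_(lev k j n) x).
    apply/funext => n; rewrite /s (bmIZ P1) ?(bmI_sum P1)//.
    - by move=> j; exact: bm_indic.
    - by apply: bm_sum => j; exact: bm_indic.
  apply: ucvgZ; apply: ucvg_sum => j.
  have e1 : \int[loeb_measure P]_z \1_(internal (lev k j)) z =
      ulim (fun n => fine (P (lev k j n))).
    rewrite Rint_indic; first exact: (congr1 fine (loeb_measureE P (mlev k j))).
    by apply: sub_sigma_algebra; exists (lev k j).
  have e2 : (fun n => \int[P]_x \1_(lev k j n) x) =
      (fun n => fine (P (lev k j n))).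
    by apply/funext => n; rewrite Rint_indic.
  rewrite e1 e2; apply: (@ulimP _ _ 1) => n.
  rewrite ger0_norm ?fine_ge0// -lee_fin fineK ?fin_num_measure//.
  exact: probability_le1.
apply/eqP; rewrite -subr_eq0 -normr_le0; apply/ler_addgt0Pl => e e0; rewrite addr0.
have e2 : 0 < e / 2 by rewrite divr_gt0.
have /cvgnP/(_ _ e2)[k hk] := @cvg_invS R.
have {}hk : k.+1%:R^-1 <= e / 2.
  by have := hk k (leqnn k); rewrite subr0; exact: le_trans (ler_norm _).
have h1 : `|\int[loeb_measure P]_z standard_part f z - \int[loeb_measure P]_z S k z|
    <= e / 2.
  by apply: bmI_dist => // z; exact: le_trans (SE k z) hk.
have h2 : `|ulim (fun n => \int[P]_x f n x) - \int[loeb_measure P]_z S k z| <= e / 2.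
  apply: ucvg_close (ulimP Ib) (IS k) _ => n.
  by apply: bmI_dist => // x; exact: le_trans (sE k n x) hk.
move: h1 h2; move: (\int[_]_z _) (\int[_]_z _) (ulim _) => x y z.
by rewrite !ler_norml => /andP[? ?] /andP[? ?]; apply/andP; split; lra.
Qed.

Lemma loeb_lift (f : nat -> T -> R) (c : R) : (forall n, measurable_fun setT (f n)) ->
  (forall n x, `|f n x| <= c) ->
  bm (standard_part f) /\
  \int[loeb_measure P]_z standard_part f z = ulim (fun n => \int[P]_x f n x).
Proof.
move=> mf hc; pose a := c + 1.
have a0 : 0 < a by rewrite ltr_wpDl// (le_trans (normr_ge0 _) (hc 0%N point)).
pose g n x := (2 * a)^-1 * f n x + 2^-1.
have fb n x : - a <= f n x <= a by rewrite -ler_norml (le_trans (hc n x))// /a lerDl.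
have bf n : bm (f n) by exact: bmP (mf n) (hc n).
have mg n : measurable_fun setT (g n).
  by apply: bm_meas; apply: bmD; [exact: bmZ|exact: bm_cst].
have fE n x : f n x = 2 * a * g n x + - a.
  by rewrite /g; field; rewrite gt_eqF.
have g01 n x : 0 <= g n x <= 1.
  have := fb n x; rewrite fE; move: (g n x) a0 => y a0 /andP[h1 h2].
  have a2 : 0 < 2 * a by rewrite mulr_gt0.
  apply/andP; split.
    by rewrite -(pmulr_rge0 _ a2); lra.
  by rewrite -(ler_pM2l a2); lra.
have gb n x : `|g n x| <= 1 by have /andP[h0 h1] := g01 n x; rewrite ger0_norm.
have bg n : bm (g n) by exact: bmP (mg n) (gb n).
have [bst Ist] := lift01 mg g01.
have stE : standard_part f = fun z => 2 * a * standard_part g z + - a.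
  apply/funext => z; apply: ulimE.
  under eq_fun do rewrite fE.
  by apply: ucvgD (ucvg_cst _); apply: ucvgZ; exact: standard_partP gb.
rewrite stE; split; first by apply: bmD; [exact: bmZ|exact: bm_cst].
rewrite (bmID L1) ?(bmIZ L1) ?(bmI_cst L1)//; [|exact: bmZ|exact: bm_cst].
rewrite Ist; apply/esym/ulimE.
rewrite (_ : (fun n => _) = fun n => 2 * a * (\int[P]_x g n x) + - a); last first.
  apply/funext => n; rewrite (eq_Rintegral _ (g := fun x => 2 * a * g n x + - a)).
    rewrite (bmID P1) ?(bmIZ P1) ?(bmI_cst P1)//; [exact: bmZ|exact: bm_cst].
  by move=> x _; exact: fE.
apply: ucvgD (ucvg_cst _); apply: ucvgZ; apply: (@ulimP _ _ 1) => n.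
exact: bmI_bound.
Qed.
End loeb_integral.

(** * Fourier uniqueness *)

Section averaging.
Context {R : realType}.
Implicit Types (h g : nat -> R) (s : R).

(** Expectation of [h] at the number of successes of [n] independent trials of
    success probability [s]. *)
Fixpoint binom_mean n s h : R :=
  match n with
  | 0 => h 0%N
  | n'.+1 => s * binom_mean n' s (fun j => h j.+1) + (1 - s) * binom_mean n' s h
  end.

Lemma binom_mean_le n s h g : 0 <= s <= 1 -> (forall j, h j <= g j) ->
  binom_mean n s h <= binom_mean n s g.
Proof.
move=> /andP[s0 s1]; elim: n h g => [|n IH] h g hg //=.
by apply: lerD; apply: ler_wpM2l; rewrite ?subr_ge0//; apply: IH => j.
Qed.

Lemma binom_meanD n s h g :
  binom_mean n s (fun j => h j + g j) = binom_mean n s h + binom_mean n s g.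
Proof. by elim: n h g => [|n IH] h g //=; rewrite !IH; ring. Qed.

Lemma binom_meanZ n s (r : R) h :
  binom_mean n s (fun j => r * h j) = r * binom_mean n s h.
Proof. by elim: n h => [|n IH] h //=; rewrite !IH; ring. Qed.

Lemma binom_mean_cst n s (r : R) : binom_mean n s (fun=> r) = r.
Proof. by elim: n => [|n IH] //=; rewrite IH; ring. Qed.

Lemma binom_mean_norm n s h (c : R) : 0 <= s <= 1 -> (forall j, `|h j| <= c) ->
  `|binom_mean n s h| <= c.
Proof.
move=> s01 hc; rewrite ler_norml -{1}(binom_mean_cst n s (- c)).
rewrite -{2}(binom_mean_cst n s c); apply/andP; split.
  by apply: binom_mean_le => // j; have := hc j; rewrite ler_norml => /andP[].
by apply: binom_mean_le => // j; have := hc j; rewrite ler_norml => /andP[].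
Qed.

(** The shift [a] is there for the induction, in which a success adds 1 to it. *)
Lemma binom_mean_sq n s (a : R) :
  binom_mean n s (fun j => (j%:R + a) ^+ 2) = n%:R * s * (1 - s) + (n%:R * s + a) ^+ 2.
Proof.
elim: n a => [|n IH] a /=; first by ring.
rewrite (_ : (fun j => _) = fun j : nat => (j%:R + (1 + a)) ^+ 2); last first.
  by apply/funext => j; rewrite -natr1 addrA.
by rewrite !IH -natr1; ring.
Qed.

Lemma binom_mean_var n s : 0 <= s <= 1 ->
  binom_mean n.+1 s (fun j => (j%:R / n.+1%:R - s) ^+ 2) <= n.+1%:R^-1.
Proof.
move=> /andP[s0 s1]; have n0 : (n.+1%:R : R) != 0 by rewrite pnatr_eq0.
have -> : (fun j : nat => (j%:R / n.+1%:R - s) ^+ 2) =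
    (fun j => n.+1%:R^-1 ^+ 2 * (j%:R + - (n.+1%:R * s)) ^+ 2).
  by apply/funext => j; rewrite -exprMn; congr (_ ^+ 2); field.
rewrite binom_meanZ binom_mean_sq subrr expr0n/= addr0.
rewrite (_ : _ * _ = n.+1%:R^-1 * (s * (1 - s))); last by field.
rewrite ler_piMr ?invr_ge0// (le_trans (_ : _ <= s * 1))//.
  by rewrite ler_wpM2l// lerBlDr lerDl.
by rewrite mulr1.
Qed.
End averaging.

Section sine.
Context {R : realType}.

(** Product formula for [sin u - sin v]: on [-1, 1] the cosine factor is at least 1/2 and the sine
    factor at least 5/6 of its argument. *)
Lemma sin_expansive (u v : R) : `|u| <= 1 -> `|v| <= 1 ->
  `|u - v| <= 3 * `|sin u - sin v|.
Proof.
wlog uv : u v / v <= u => [hw|].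
  have [/hw//|/ltW/hw h] := leP v u => hu hv.
  by rewrite distrC [`|sin u - _|]distrC; exact: h.
move=> /ler_normlP[u1 u2] /ler_normlP[v1 v2].
have -> : sin u - sin v = 2 * (sin ((u - v) / 2) * cos ((u + v) / 2)).
  have e1 : sin u = sin ((u + v) / 2 + (u - v) / 2) by congr sin; field.
  have e2 : sin v = sin ((u + v) / 2 - (u - v) / 2) by congr sin; field.
  by rewrite e1 e2 sinD sinB; ring.
have w0 : 0 <= (u - v) / 2 by lra.
have w1 : (u - v) / 2 <= 1 by lra.
have hs := sin_ge_cubic w0.
have z0 : 0 <= `|(u + v) / 2| by [].
have hc := cos_ge_quad z0; rewrite cos_norm in hc.
have z1 : `|(u + v) / 2| ^+ 2 <= 1.
  by rewrite expr_le1//; apply/ler_normlP; split; lra.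
have w3 : ((u - v) / 2) ^+ 3 <= (u - v) / 2.
  by rewrite exprSr ler_piMl// expr_le1.
have hs' : 5 / 6 * ((u - v) / 2) <= sin ((u - v) / 2) by lra.
have hc' : 1 / 2 <= cos ((u + v) / 2) by lra.
have hsc : 5 / 6 * ((u - v) / 2) * (1 / 2) <= sin ((u - v) / 2) * cos ((u + v) / 2).
  by apply: ler_pM => //; lra.
rewrite ger0_norm ?subr_ge0// ger0_norm; lra.
Qed.

(** A trigonometric coordinate with values in [0, 1] and a Lipschitz inverse on [[- K, K]]. Used as
    a success probability, it makes Bernstein polynomials trigonometric ones. *)
Definition sgauge (K x : R) : R := (1 + sin (x / K)) / 2.

Lemma sgauge01 (K x : R) : 0 <= sgauge K x <= 1.
Proof.
by rewrite /sgauge; have := sin_geN1 (x / K); have := sin_le1 (x / K);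
  move=> *; apply/andP; split; lra.
Qed.

Lemma sgauge_expansive (K x y : R) : 0 < K -> `|x| <= K -> `|y| <= K ->
  `|x - y| <= 6 * K * `|sgauge K x - sgauge K y|.
Proof.
move=> K0 xK yK.
have d (z : R) : `|z| <= K -> `|z / K| <= 1.
  by move=> zK; rewrite normrM normfV (gtr0_norm K0) ler_pdivrMr// mul1r.
have := sin_expansive (d _ xK) (d _ yK).
rewrite -mulrBl normrM normfV (gtr0_norm K0) ler_pdivrMr// => /le_trans; apply.
rewrite (_ : sgauge K x - sgauge K y = (sin (x / K) - sin (y / K)) / 2); last first.
  by rewrite /sgauge; field.
rewrite normrM (ger0_norm (_ : 0 <= 2^-1)) ?invr_ge0//.
by move: (`|_|) => z; rewrite le_eqVlt; apply/orP; left; apply/eqP; field.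
Qed.
End sine.

(** * Approximation by trigonometric polynomials in several variables *)

Section trigonometric.
Context {R : realType} {m : nat}.
Implicit Types (x : 'I_m -> R) (T : ('I_m -> R) -> R).

(** The free phase includes the sines, so that cosines alone generate the whole space, and products
    are reduced to sums. *)
Inductive trigpoly : (('I_m -> R) -> R) -> Prop :=
| trig_cos a t : trigpoly (fun x => cos (a + \sum_(i < m) t i * x i))
| trigD T1 T2 : trigpoly T1 -> trigpoly T2 -> trigpoly (fun x => T1 x + T2 x)
| trigZ (r : R) T : trigpoly T -> trigpoly (fun x => r * T x).

Lemma trig_cst (c : R) : trigpoly (fun=> c).
Proof.
have := trigZ c (trig_cos 0 (fun=> 0)); congr trigpoly; apply/funext => x.
rewrite big1 ?addr0 ?cos0 ?mulr1// => i _; exact: mul0r.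
Qed.

Lemma trigM T1 T2 : trigpoly T1 -> trigpoly T2 -> trigpoly (fun x => T1 x * T2 x).
Proof.
elim=> {T1} [a t|T1 T1' _ IH1 _ IH1'|r T1 _ IH] h2.
- elim: h2 => {T2} [b u|T2 T2' _ IH2 _ IH2'|r T2 _ IH].
  + have := trigZ 2^-1 (trigD (trig_cos (a + b) (fun i => t i + u i))
      (trig_cos (a - b) (fun i => t i - u i))).
    congr trigpoly; apply/funext => x.
    rewrite (_ : \sum_(i < m) (t i + u i) * x i =
      \sum_(i < m) t i * x i + \sum_(i < m) u i * x i); last first.
      by rewrite -big_split; apply: eq_bigr => i _; rewrite mulrDl.
    rewrite (_ : \sum_(i < m) (t i - u i) * x i =
      \sum_(i < m) t i * x i - \sum_(i < m) u i * x i); last first.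
      by rewrite -sumrB; apply: eq_bigr => i _; rewrite mulrBl.
    move: (\sum_(i < m) t i * x i) (\sum_(i < m) u i * x i) => y z.
    rewrite (_ : a + b + (y + z) = (a + y) + (b + z)); last by ring.
    rewrite (_ : a - b + (y - z) = (a + y) - (b + z)); last by ring.
    by rewrite cosD cosB; field.
  + by have := trigD IH2 IH2'; congr trigpoly; apply/funext => x; rewrite mulrDr.
  + by have := trigZ r IH; congr trigpoly; apply/funext => x; rewrite mulrCA.
- by have := trigD (IH1 h2) (IH1' h2); congr trigpoly; apply/funext => x; rewrite mulrDl.
- by have := trigZ r (IH h2); congr trigpoly; apply/funext => x; rewrite mulrA.
Qed.

Lemma trig_sgauge (K : R) i : trigpoly (fun x => sgauge K (x i)).
Proof.
have := trigD (trig_cst 2^-1)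
  (trigZ 2^-1 (trig_cos (- (pi / 2)) (fun j => (j == i)%:R / K))).
congr trigpoly; apply/funext => x.
rewrite (bigD1 i)//= eqxx big1 ?addr0; last first.
  by move=> j /negbTE ->; rewrite mul0r mul0r.
rewrite (addrC (- (pi / 2))) cosBpihalf mul1r [K^-1 * _]mulrC.
by rewrite /sgauge; field.
Qed.

Lemma trig_binom_mean n (s : ('I_m -> R) -> R) (h : nat -> ('I_m -> R) -> R) :
  trigpoly s -> (forall j, trigpoly (h j)) ->
  trigpoly (fun x => binom_mean n (s x) (fun j => h j x)).
Proof.
move=> ts; elim: n h => [|n IH] h th /=; first exact: th.
apply: trigD; first by apply: trigM => //; apply: IH => j.
apply: trigM; last exact: IH.
have := trigD (trig_cst 1) (trigZ (-1) ts); congr trigpoly; apply/funext => x.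
by rewrite mulN1r.
Qed.
End trigonometric.

Section approximation.
Context {R : realType} {m : nat}.
Implicit Types (x y : 'I_m -> R) (phi : ('I_m -> R) -> R).

Definition in_box (K : R) x : Prop := forall i, `|x i| <= K.

Definition upd x i (u : R) : 'I_m -> R := fun k => if k == i then u else x k.

Definition repl y (l : seq 'I_m) x : 'I_m -> R :=
  fun k => if k \in l then x k else y k.

Variables (K : R) (node : nat -> R) (n : nat).

(** The Bernstein operator applied to one coordinate after the other; [y] records the nodes already
    drawn. *)
Fixpoint multi_mean (l : seq 'I_m) phi y x : R :=
  match l with
  | [::] => phi y
  | i :: l' => binom_mean n (sgauge K (x i))
      (fun j => multi_mean l' phi (upd y i (node j)) x)
  end.

Lemma multi_mean_trig l phi y : trigpoly (multi_mean l phi y).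
Proof.
elim: l y => [|i l IH] y /=; first exact: trig_cst.
by apply: trig_binom_mean => [|j]; [exact: trig_sgauge|exact: IH].
Qed.

Lemma multi_mean_bound l phi y x (C : R) : (forall z, `|phi z| <= C) ->
  `|multi_mean l phi y x| <= C.
Proof.
move=> hC; elim: l y => [|i l IH] y //=.
by apply: binom_mean_norm => [|j]; [exact: sgauge01|exact: IH].
Qed.

Hypothesis nodeK : forall j, `|node j| <= K.

(** Binomial means do not amplify errors, so that the errors add up to one [e] per coordinate. *)
Lemma multi_mean_close l phi y x (e : R) : in_box K x -> in_box K y ->
  (forall z i, in_box K z -> `|binom_mean n (sgauge K (x i))
     (fun j => phi (upd z i (node j))) - phi (upd z i (x i))| <= e) ->
  `|multi_mean l phi y x - phi (repl y l x)| <= (size l)%:R * e.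
Proof.
move=> xK + he; elim: l y => [|i l IH] y yK /=.
  by rewrite (_ : repl y [::] x = y) ?subrr ?normr0 ?mul0r//; apply/funext => k.
have updK u : `|u| <= K -> in_box K (upd y i u).
  by move=> uK k; rewrite /upd; case: ifP.
pose B h := binom_mean n (sgauge K (x i)) h.
pose z := repl y l x.
have zK : in_box K z by move=> k; rewrite /z /repl; case: ifP.
have h1 : `|B (fun j => multi_mean l phi (upd y i (node j)) x) -
    B (fun j => phi (repl (upd y i (node j)) l x))| <= (size l)%:R * e.
  rewrite /B -mulN1r -binom_meanZ -binom_meanD.
  apply: binom_mean_norm => [|j]; first exact: sgauge01.
  by rewrite mulN1r; apply: IH; exact: updK.
have h2 : `|B (fun j => phi (repl (upd y i (node j)) l x)) -
    phi (repl y (i :: l) x)| <= e.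
  (* A coordinate that occurs again in [l] is overwritten by [repl], and averaging over it changes
     nothing. *)
  have [il|il] := boolP (i \in l).
    have E u : repl (upd y i u) l x = repl y (i :: l) x.
      apply/funext => k; rewrite /repl /upd inE.
      by case: eqVneq => [->|_]; rewrite ?il.
    rewrite /B (_ : (fun j => _) = fun=> phi (repl y (i :: l) x)); last first.
      by apply/funext => j; rewrite E.
    have e0 := le_trans (normr_ge0 _) (he y i yK).
    by rewrite binom_mean_cst subrr normr0.
  have E u : repl (upd y i u) l x = upd z i u.
    apply/funext => k; rewrite /z /repl /upd.
    by case: eqVneq => [->|_]; rewrite ?(negbTE il).
  have E' : repl y (i :: l) x = upd z i (x i).
    apply/funext => k; rewrite /z /repl /upd inE.
    by case: eqVneq => [->|_].
  rewrite E' /B (_ : (fun j => _) = fun j => phi (upd z i (node j))); last first.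
    by apply/funext => j; rewrite E.
  exact: he.
rewrite -[X in X%:R * _]addn1 natrD mulrDl mul1r -/(B _).
apply: le_trans (lerD h1 h2); apply: le_trans (ler_normD _ _).
by rewrite addrA subrK.
Qed.
End approximation.

(** Bernstein's proof of the Weierstrass theorem in the coordinates [sgauge K (x i)]. Being averages
    of values of [phi], the approximations keep the bound [C] on the whole space and not only in the
    box. *)
Lemma trig_approx {R : realType} {m : nat} (phi : ('I_m -> R) -> R) (C K e : R) :
  (forall x, `|phi x| <= C) -> 0 < K -> 0 < e ->
  (forall e, 0 < e -> exists2 eta : R, 0 < eta & forall x y,
     in_box K x -> in_box K y -> (forall i, `|x i - y i| <= eta) ->
     `|phi x - phi y| <= e) ->
  exists T, [/\ trigpoly T, forall x, `|T x| <= C &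
    forall x, in_box K x -> `|T x - phi x| <= e].
Proof.
move=> hC K0 e0 hu; have C0 : 0 <= C by exact: le_trans (normr_ge0 _) (hC (fun=> 0)).
pose e1 := e / (2 * m.+1%:R).
have e10 : 0 < e1 by rewrite divr_gt0// mulr_gt0.
have [eta eta0 heta] := hu e1 e10.
(* Both the node and the point are within [del] of the frequency in the gauge, and the inverse gauge
   expands by at most [6 * K]: in all [12 * K * del = eta]. *)
pose del := eta / (12 * K).
have del0 : 0 < del by rewrite divr_gt0// mulr_gt0.
(* Chebyshev: where the frequency is off by more than [del], the trivial bound [2 * C] is at most
   [s] times the squared deviation. *)
pose s := 2 * C / del ^+ 2.
have s0 : 0 <= s by rewrite divr_ge0 ?sqr_ge0// mulr_ge0.
have s1 : 0 < s + 1 by rewrite ltr_wpDl.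
have e2 : 0 < e1 / (s + 1) by rewrite divr_gt0.
have /cvgnP/(_ _ e2)[n hn] := @cvg_invS R.
have {hn} := hn n (leqnn n); rewrite subr0 => /(le_trans (ler_norm _)) hn.
(* A frequency need not be a value of the gauge on the box; its node is a point whose gauge is
   [del]-close if there is one, and 0 otherwise. *)
have /choice[node hnode] : forall j : nat, exists u : R, `|u| <= K /\
    forall v, `|v| <= K -> `|j%:R / n.+1%:R - sgauge K v| <= del ->
    `|j%:R / n.+1%:R - sgauge K u| <= del.
  move=> j; have [[u [u1 u2]]|h] := pselect (exists u : R, `|u| <= K /\
      `|j%:R / n.+1%:R - sgauge K u| <= del).
    by exists u.
  exists 0; split; first by rewrite normr0 ltW.
  by move=> v v1 v2; case: h; exists v.
have nodeK j : `|node j| <= K by have [] := hnode j.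
exists (multi_mean K node n.+1 (enum 'I_m) phi (fun=> 0)); split.
- exact: multi_mean_trig.
- by move=> x; exact: multi_mean_bound.
move=> x xK.
have x0 : in_box K (fun _ : 'I_m => 0) by move=> i; rewrite normr0 ltW.
have step z i : in_box K z -> `|binom_mean n.+1 (sgauge K (x i))
    (fun j => phi (upd z i (node j))) - phi (upd z i (x i))| <= 2 * e1.
  move=> zK; have s01 := sgauge01 K (x i).
  rewrite -[phi _](binom_mean_cst n.+1 (sgauge K (x i))) -mulN1r -binom_meanZ -binom_meanD.
  pose r (j : nat) : R := e1 + s * (j%:R / n.+1%:R - sgauge K (x i)) ^+ 2.
  have hr j : `|phi (upd z i (node j)) + -1 * phi (upd z i (x i))| <= r j.
    rewrite mulN1r /r.
    have [hd|hd] := leP `|j%:R / n.+1%:R - sgauge K (x i)| del.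
      rewrite -[leLHS]addr0 lerD//; last by rewrite mulr_ge0// sqr_ge0.
      have [_ /(_ _ (xK i) hd) hd'] := hnode j.
      apply: heta.
      - by move=> k; rewrite /upd; case: ifP.
      - by move=> k; rewrite /upd; case: ifP.
      move=> k; rewrite /upd; case: ifP => _; last by rewrite subrr normr0 ltW.
      apply: le_trans (sgauge_expansive K0 (nodeK j) (xK i)) _.
      have : `|sgauge K (node j) - sgauge K (x i)| <= 2 * del.
        rewrite (_ : _ - _ = (j%:R / n.+1%:R - sgauge K (x i)) -
          (j%:R / n.+1%:R - sgauge K (node j))); last by ring.
        by apply: le_trans (ler_normB _ _) _; move: hd hd'; lra.
      move=> /(ler_wpM2l (_ : 0 <= 6 * K)) -/(_ (mulr_ge0 _ (ltW K0))) h.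
      apply: le_trans (h _) _ => //; rewrite /del le_eqVlt; apply/orP; left.
      by apply/eqP; field; rewrite gt_eqF.
    apply: (@le_trans _ _ (2 * C)).
      apply: le_trans (ler_normB _ _) _; have := hC (upd z i (node j)).
      by have := hC (upd z i (x i)); lra.
    rewrite -[leLHS]add0r; apply: lerD; first exact: ltW.
    rewrite /s -mulrA -[leLHS]mulr1 ler_wpM2l ?mulr_ge0// mulrC ler_pdivlMr ?exprn_gt0//.
    rewrite mul1r -[leRHS]real_normK ?num_real//.
    by apply: lerXn2r (ltW hd); rewrite nnegrE// ltW.
  apply: (@le_trans _ _ (binom_mean n.+1 (sgauge K (x i)) r)).
    rewrite ler_norml; apply/andP; split.
      rewrite -[leLHS]mulN1r -binom_meanZ; apply: binom_mean_le => // j.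
      by rewrite [leLHS]mulN1r; have := hr j; rewrite ler_norml => /andP[].
    apply: binom_mean_le => // j.
    by have := hr j; rewrite ler_norml => /andP[].
  rewrite /r binom_meanD binom_mean_cst binom_meanZ mulr_natl mulr2n lerD2l.
  apply: le_trans (ler_wpM2l s0 (le_trans (binom_mean_var n s01) hn)) _.
  rewrite mulrCA -[leRHS]mulr1; apply: ler_wpM2l; first exact: ltW.
  by rewrite ler_pdivrMr// mul1r lerDl.
have := multi_mean_close nodeK (enum 'I_m) xK x0 step.
rewrite (_ : repl _ _ x = x); last first.
  by apply/funext => k; rewrite /repl mem_enum.
move=> /le_trans; apply; rewrite size_enum_ord /e1.
rewrite (_ : _ * _ = e * (m%:R / m.+1%:R)); last first.
  have m1 : (m.+1%:R : R) != 0 by rewrite pnatr_eq0.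
  by move: (m.+1%:R : R) m1 (m%:R : R) => a a0 b; field.
rewrite -[leRHS]mulr1; apply: ler_wpM2l; first exact: ltW.
by rewrite ler_pdivrMr// mul1r ler_nat.
Qed.

(** Uniform continuity from compactness of the box, with only [x] confined to it. *)
Lemma continuous_box_uniform {R : realType} {m : nat} (phi : 'rV[R]_m -> R) (K e : R) :
  continuous phi -> 0 < e -> exists2 eta : R, 0 < eta & forall x y : 'rV[R]_m,
     in_box K (x ord0) -> (forall i, `|x ord0 i - y ord0 i| <= eta) ->
     `|phi x - phi y| <= e.
Proof.
move=> cphi e0.
have cK : compact [set x : 'rV[R]_m | forall i, (`[- K, K]%classic : set R) (x ord0 i)].
  apply: (@rV_compact _ _ (fun=> `[- K, K]%classic)) => _.
  exact: segment_compact.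
pose Q (eta : R) (x : 'rV[R]_m) := forall y : 'rV[R]_m,
  (forall i, `|x ord0 i - y ord0 i| <= eta) -> `|phi x - phi y| <= e.
have := (compact_near_coveringP _).1 cK _ (0^'+ : set_system R) Q _.
have loc x : [set x : 'rV[R]_m | forall i, (`[- K, K]%classic : set R) (x ord0 i)] x ->
    \forall x' \near x & eta \near (0^'+ : set_system R), Q eta x'.
  move=> _; have e2 : 0 < e / 2 by rewrite divr_gt0.
  have /cvgrPdist_le/(_ _ e2) := cphi x.
  move=> /nbhs_ballP[r /= r0 hr].
  have r2 : 0 < r / 2 by rewrite divr_gt0.
  exists (ball x (r / 2), [set eta : R | 0 < eta < r / 2]) => /=.
    split; first exact: nbhsx_ballx.
    near=> eta; apply/andP; split => //; near: eta; exact: nbhs_right_lt.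
  move=> [x' eta] /= [bx /andP[eta0 etar]] y hy.
  have h1 : `|phi x - phi x'| <= e / 2.
    by apply: hr; apply: le_ball bx; move: r0; lra.
  have h2 : `|phi x - phi y| <= e / 2.
    apply: hr; split=> // i j; have [_ /(_ i j)] := bx; rewrite /ball/= ord1 => h.
    rewrite (_ : x ord0 j - y ord0 j = (x ord0 j - x' ord0 j) + (x' ord0 j - y ord0 j)); last by ring.
    rewrite (le_lt_trans (ler_normD _ _))// [ltRHS]splitr ltr_leD//.
    exact: le_trans (hy j) (ltW etar).
  rewrite (_ : phi x' - phi y = (phi x - phi y) - (phi x - phi x')); last by ring.
  by apply: le_trans (ler_normB _ _) _; rewrite [leRHS]splitr lerD.
move=> /(_ _ loc) h.
have [eta [eta0 heta]] : exists eta : R, 0 < eta /\ 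
   forall x, [set x : 'rV[R]_m | forall i, (`[- K, K]%classic : set R) (x ord0 i)] x -> Q eta x.
  have h0 : \forall eta \near (0^'+ : set_system R), 0 < eta by exact: nbhs_right_gt.
  have [eta [h1 h2]] := filter_ex (filterI h0 h).
  by exists eta.
exists eta => // x y xK xy; apply: heta => // i.
by rewrite /= in_itv/= -ler_norml; exact: xK.
Unshelve. all: by end_near. Qed.

Lemma measurable_forall_ord {d} {T : measurableType d} m (A : 'I_m -> set T) :
  (forall i, measurable (A i)) -> measurable [set o | forall i, A i o].
Proof.
move=> mA; rewrite (_ : [set o | _] = \bigcap_(i in [set: 'I_m]) A i).
  by apply: fin_bigcap_measurable => // i _; exact: mA.
by apply/seteqP; split=> o h i //; exact: h.
Qed.

Lemma measurable_ray {d} {T : measurableType d} {R : realType} (f : T -> R) (c : R) :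
  measurable_fun setT f -> measurable [set o | c < f o].
Proof.
move=> mf; have := mf measurableT `]c, +oo[%classic (measurable_itv _).
by rewrite setTI preimage_itvoy.
Qed.

(** * Convergence and uniqueness of laws from characteristic functions *)

Section fourier.
Context {R : realType} {m : nat}.

Section one_vector.
Context {d} {T : measurableType d}.
Variable mu : {measure set T -> \bar R}.
Hypothesis mu1 : mu setT = 1%E.
Variable Y : 'I_m -> T -> R.
Hypothesis mY : forall i, measurable_fun setT (Y i).

Let vec (o : T) : 'I_m -> R := fun i => Y i o.

Lemma trigpoly_bm (F : ('I_m -> R) -> R) : trigpoly F -> bm (fun o => F (vec o)).
Proof.
elim=> {F} [a t|F F' _ IH _ IH'|r F _ IH]; [|exact: bmD|exact: bmZ].
apply: bm_cos; apply: measurable_funD => //; apply: measurable_sum => i.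
by apply: measurable_funM => //; exact: mY.
Qed.

Variable phi : 'rV[R]_m -> R.
Hypothesis cphi : continuous phi.
Variable C : R.
Hypothesis hC : forall x, `|phi x| <= C.

Let psi (x : 'I_m -> R) := phi (\row_i x i).

Lemma vector_uniform (K e : R) : 0 < e -> exists2 eta : R, 0 < eta & forall x y,
  in_box K x -> in_box K y -> (forall i, `|x i - y i| <= eta) ->
  `|psi x - psi y| <= e.
Proof.
move=> e0; have [eta eta0 h] := continuous_box_uniform K cphi e0.
by exists eta => // x y xK yK xy; apply: h => i; rewrite ?mxE.
Qed.

(** Measurability is obtained from pointwise approximation by trigonometric polynomials on growing
    boxes, without a sigma-algebra on row vectors. *)
Lemma vector_bm : bm (fun o => phi (\row_i Y i o)).
Proof.
have /choice[F hF] : forall k : nat, exists F, [/\ trigpoly F, forall x, `|F x| <= C &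
    forall x, in_box (k.+1%:R : R) x -> `|F x - psi x| <= k.+1%:R^-1].
  move=> k; apply: trig_approx.
  - by move=> x; exact: hC.
  - by rewrite ltr0n.
  - by rewrite invr_gt0.
  - by move=> e; exact: vector_uniform.
apply: (@bm_lim _ _ _ (fun k o => F k (vec o)) _ C).
- by move=> k; have [h _ _] := hF k; exact: bm_meas (trigpoly_bm h).
- move=> o; apply/cvgnP => e e0.
  have /cvgnP/(_ _ e0)[N hN] := @cvg_invS R.
  pose B := \sum_(i < m) `|Y i o|.
  have B0 : 0 <= B by apply: sumr_ge0 => i _.
  exists (maxn N (Num.truncn B)) => n; rewrite geq_max => /andP[Nn Bn].
  have [_ _ h] := hF n; apply: le_trans (h _ _) _.
    move=> i; apply: (@le_trans _ _ B).
      by rewrite /B (bigD1 i)//= lerDl; apply: sumr_ge0.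
    have /andP[_ hB] := truncn_itv B0; apply: le_trans (ltW hB) _.
    by rewrite ler_nat ltnS.
  by have := hN n Nn; rewrite subr0; exact: le_trans (ler_norm _).
- by move=> o; exact: hC.
Qed.

Definition out_of_box (K : R) : set T := [set o | ~ in_box K (vec o)].

Lemma measurable_out_of_box (K : R) : measurable (out_of_box K).
Proof.
apply: measurableC.
suff : measurable [set o | forall i, [set o | - K <= - `|Y i o|] o].
  by congr measurable; apply/seteqP; split=> o h i; have := h i; rewrite /= lerN2.
apply: measurable_forall_ord => i; apply: measurable_superlevel.
by apply: measurableT_comp => //; exact: measurableT_comp.
Qed.

(** Outside the box both functions are bounded by [C]. *)
Lemma trig_integral_close (F : ('I_m -> R) -> R) (K e : R) : 0 <= e -> trigpoly F ->
  (forall x, `|F x| <= C) -> (forall x, in_box K x -> `|F x - psi x| <= e) ->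
  `|\int[mu]_o phi (\row_i Y i o) - \int[mu]_o F (vec o)| <=
  e + 2 * C * \int[mu]_o \1_(out_of_box K) o.
Proof.
move=> e0 tF FC Fe; have C0 : 0 <= C by exact: le_trans (normr_ge0 _) (hC 0).
have bF := trigpoly_bm tF; have bO := bm_indic (measurable_out_of_box K).
rewrite -(bmIZ mu1)// -[e in leRHS](bmI_cst mu1) -(bmID mu1); [|exact: bm_cst|exact: bmZ].
rewrite -(bmIB mu1)//; last exact: vector_bm.
apply: (bmI_norm_le mu1).
- by apply: bmB => //; exact: vector_bm.
- by apply: bmD; [exact: bm_cst|exact: bmZ].
move=> o; have [h|h] := pselect (in_box K (vec o)).
  rewrite indicE memNset; last by apply.
  by rewrite mulr0 addr0 distrC; exact: Fe.
rewrite indicE mem_set// mulr1; apply: le_trans (ler_normB _ _) _.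
by have := hC (\row_i Y i o); have := FC (vec o); lra.
Qed.

Lemma box_tight (e : R) : 0 < e -> exists2 K : R, 0 < K &
  \int[mu]_o \1_(out_of_box K) o <= e.
Proof.
move=> e0.
have h : \int[mu]_o \1_(out_of_box n.+1%:R) o @[n --> \oo] --> \int[mu]_o (fun=> 0 : R) o.
  apply: (bmI_cvg mu1 (c := 1)).
  - by move=> n; apply: bm_indic; exact: measurable_out_of_box.
  - move=> o; apply: cvg_near_cst.
    pose B := \sum_(i < m) `|Y i o|.
    have B0 : 0 <= B by apply: sumr_ge0 => i _.
    exists (Num.truncn B) => // n /= Bn; rewrite indicE memNset//; apply => i.
    apply: (@le_trans _ _ B).
      by rewrite /B (bigD1 i)//= lerDl; apply: sumr_ge0.
    have /andP[_ hB] := truncn_itv B0; apply: le_trans (ltW hB) _.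
    by rewrite ler_nat ltnS.
  - by move=> n o; rewrite indicE; case: (_ \in _); rewrite ?normr1 ?normr0.
rewrite (bmI_cst mu1) in h; have /cvgnP/(_ _ e0)[N hN] := h.
exists N.+1%:R => //; have := hN N (leqnn N); rewrite subr0.
exact: le_trans (ler_norm _).
Qed.

Lemma out_of_box_le (K K' : R) : K <= K' ->
  \int[mu]_o \1_(out_of_box K') o <= \int[mu]_o \1_(out_of_box K) o.
Proof.
move=> KK'; apply: (bmI_le mu1); try by apply: bm_indic; exact: measurable_out_of_box.
move=> o; rewrite !indicE; have [h|h] := pselect (out_of_box K' o).
  rewrite !mem_set//= => h'; apply: h => i; exact: le_trans (h' i) KK'.
by rewrite memNset// ler0n.
Qed.

(** Chebyshev's inequality for the sum of the squared coordinates. *)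
Lemma out_of_box_sq (K A : R) : 0 < K -> (forall i, bm (Y i)) ->
  (forall i, \int[mu]_o (Y i o) ^+ 2 <= A) ->
  \int[mu]_o \1_(out_of_box K) o <= m%:R * A / K ^+ 2.
Proof.
move=> K0 bY hA; have K2 : 0 < K ^+ 2 by rewrite exprn_gt0.
have bS : bm (fun o => \sum_(i < m) (Y i o) ^+ 2).
  by apply: bm_sum => i; exact: bmX.
apply: (@le_trans _ _ (\int[mu]_o ((K ^+ 2)^-1 * \sum_(i < m) (Y i o) ^+ 2))).
  apply: (bmI_le mu1); [by apply: bm_indic; exact: measurable_out_of_box|exact: bmZ|].
  move=> o; have S0 : 0 <= \sum_(i < m) (Y i o) ^+ 2.
    by apply: sumr_ge0 => i _; exact: sqr_ge0.
  rewrite indicE; have [h|h] := pselect (out_of_box K o); last first.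
    by rewrite memNset// mulr_ge0// invr_ge0 ltW.
  rewrite mem_set//= mulrC ler_pdivlMr// mul1r.
  move: h => /existsNP[i /negP]; rewrite -ltNge => h.
  rewrite (bigD1 i)//= -[leLHS]addr0 lerD//; last first.
    by apply: sumr_ge0 => j _; exact: sqr_ge0.
  rewrite -[leRHS]real_normK ?num_real//.
  by apply: lerXn2r (ltW h); rewrite nnegrE// ltW.
rewrite (bmIZ mu1)// (bmI_sum mu1); last by move=> i; exact: bmX.
rewrite mulrC; apply: ler_wpM2r; first by rewrite invr_ge0 ltW.
apply: le_trans (ler_sum _ (fun i _ => hA i)) _.
by rewrite sumr_const card_ord mulr_natl.
Qed.
End one_vector.

(** Tightness being given, one trigonometric polynomial close to [phi] on a box common to all the
    laws transfers the convergence of cosines to [phi]. *)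
Lemma fourier_cvg {d d'} {T : measurableType d} {T' : measurableType d'}
    (mu : {measure set T -> \bar R}) (mu' : {measure set T' -> \bar R})
    (Y : nat -> 'I_m -> T -> R) (Z : 'I_m -> T' -> R) (phi : 'rV[R]_m -> R) (C : R) :
  mu setT = 1%E -> mu' setT = 1%E ->
  (forall n i, measurable_fun setT (Y n i)) -> (forall i, measurable_fun setT (Z i)) ->
  (forall e : R, 0 < e -> exists K : R, forall n,
     \int[mu]_o \1_(out_of_box (Y n) K) o <= e) ->
  (forall a t, \int[mu]_o cos (a + \sum_(i < m) t i * Y n i o) @[n --> \oo] -->
     \int[mu']_o cos (a + \sum_(i < m) t i * Z i o)) ->
  continuous phi -> (forall x, `|phi x| <= C) ->
  \int[mu]_o phi (\row_i Y n i o) @[n --> \oo] --> \int[mu']_o phi (\row_i Z i o).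
Proof.
move=> mu1 mu'1 mY mZ tight hcos cphi hC.
have C0 : 0 <= C by exact: le_trans (normr_ge0 _) (hC 0).
apply/cvgnP => e e0.
(* Chosen so that the error in the box plus [2 * C] times the mass outside is [e / 3]. *)
pose e1 := e / (3 * (1 + 2 * C)).
have C1 : 0 < 1 + 2 * C by rewrite ltr_pwDl// mulr_ge0.
have e10 : 0 < e1 by rewrite divr_gt0// mulr_gt0.
have [K1 hK1] := tight _ e10.
have [K2 K20 hK2] := box_tight mu'1 mZ e10.
pose K := Num.max K1 K2.
have K0 : 0 < K by rewrite lt_max K20 orbT.
have [F [tF FC Fe]] : exists F, [/\ trigpoly F, forall x, `|F x| <= C &
    forall x, in_box K x -> `|F x - phi (\row_i x i)| <= e1].
  apply: (trig_approx _ K0 e10); first by move=> x; exact: hC.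
  by move=> e' e'0; exact: vector_uniform.
have cvgF : \int[mu]_o F (fun i => Y n i o) @[n --> \oo] -->
    \int[mu']_o F (fun i => Z i o).
  elim: tF {FC Fe} => {F} [a t|F F' tF IH tF' IH'|r F tF IH]; first exact: hcos.
  - rewrite (bmID mu'1); try exact: trigpoly_bm.
    rewrite (_ : (fun n => _) = fun n => \int[mu]_o F (fun i => Y n i o) +
      \int[mu]_o F' (fun i => Y n i o)); first exact: cvgD.
    by apply/funext => n; rewrite (bmID mu1)//; exact: trigpoly_bm.
  - rewrite (bmIZ mu'1); last exact: trigpoly_bm.
    rewrite (_ : (fun n => _) = fun n => r * \int[mu]_o F (fun i => Y n i o)).
      by apply: cvgM => //; exact: cvg_cst.
    by apply/funext => n; rewrite (bmIZ mu1)//; exact: trigpoly_bm.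
have e30 : 0 < e / 3 by rewrite divr_gt0.
move/cvgnP: cvgF => /(_ _ e30)[N hN].
have e1E : e1 + 2 * C * e1 = e / 3.
  by rewrite /e1; field; rewrite gt_eqF.
have hC2 : 0 <= 2 * C by rewrite mulr_ge0.
exists N => n /hN h3.
have h1 := trig_integral_close mu1 (mY n) cphi hC (ltW e10) tF FC Fe.
have h2 := trig_integral_close mu'1 mZ cphi hC (ltW e10) tF FC Fe.
have h1' : \int[mu]_o \1_(out_of_box (Y n) K) o <= e1.
  apply: le_trans (hK1 n); apply: out_of_box_le => //.
  by rewrite le_max lexx.
have h2' : \int[mu']_o \1_(out_of_box Z K) o <= e1.
  apply: le_trans hK2; apply: out_of_box_le => //.
  by rewrite le_max lexx orbT.
have {h1' }h1 := le_trans h1 (lerD (lexx _) (ler_wpM2l hC2 h1')).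
have {h2' }h2 := le_trans h2 (lerD (lexx _) (ler_wpM2l hC2 h2')).
rewrite e1E in h1; rewrite e1E in h2.
move: h1 h2 h3; set a := \int[mu]_o phi _; set b := \int[mu]_o F _.
set a' := \int[mu']_o phi _; set b' := \int[mu']_o F _.
rewrite !ler_norml => /andP[? ?] /andP[? ?] /andP[? ?].
by apply/andP; split; lra.
Qed.

(** The indicator of an open orthant is a limit of products of continuous ramps; for each of these,
    [fourier_cvg] is applied to a constant sequence of laws. *)
Lemma ray_unique {d d'} {T : measurableType d} {T' : measurableType d'}
    (mu : {measure set T -> \bar R}) (mu' : {measure set T' -> \bar R})
    (Y : 'I_m -> T -> R) (Z : 'I_m -> T' -> R) (c : 'I_m -> R) :
  mu setT = 1%E -> mu' setT = 1%E ->
  (forall i, measurable_fun setT (Y i)) -> (forall i, measurable_fun setT (Z i)) ->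
  (forall a t, \int[mu]_o cos (a + \sum_(i < m) t i * Y i o) =
     \int[mu']_o cos (a + \sum_(i < m) t i * Z i o)) ->
  mu [set o | forall i, c i < Y i o] = mu' [set o | forall i, c i < Z i o].
Proof.
move=> mu1 mu'1 mY mZ hcos.
have mR d0 (T0 : measurableType d0) (W : 'I_m -> T0 -> R) :
    (forall i, measurable_fun setT (W i)) -> measurable [set o | forall i, c i < W i o].
  move=> mW; apply: measurable_forall_ord => i.
  exact: measurable_ray.
pose chi (k : nat) (i : 'I_m) (x : R) : R :=
  Num.min 1 (Num.max 0 (k%:R * (x - c i))).
have chi01 k i x : 0 <= chi k i x <= 1.
  by rewrite /chi le_min ler01 le_max lexx/= ge_min lexx.
have cchi k i : continuous (chi k i).
  have lip (a b : R) : `|Num.min 1 (Num.max 0 a) - Num.min 1 (Num.max 0 b)| <= `|a - b|.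
    wlog ab : a b / b <= a => [hw|].
      have [/hw//|/ltW/hw] := leP b a.
      by rewrite distrC [`|b - a|]distrC.
    rewrite [leRHS]ger0_norm ?subr_ge0// ler_norml.
    rewrite !minEle !maxEle; do !case: ifPn; rewrite -?ltNge => *; apply/andP; split; lra.
  move=> x; apply/cvgrPdist_le => e e0; near=> y.
  apply: le_trans (lip _ _) _; rewrite -mulrBr opprB addrA subrK normrM.
  rewrite (ger0_norm (ler0n _ k)).
  apply: (@le_trans _ _ (k.+1%:R * (e / k.+1%:R))); last first.
    by rewrite mulrC divfK// pnatr_eq0.
  apply: ler_pM => //; first by rewrite ler_nat.
  near: y; apply: cvgr_dist_le; first exact: cvg_id.
  by rewrite divr_gt0.
pose phi k (x : 'rV[R]_m) := \prod_(i < m) chi k i (x ord0 i).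
have phi1 k x : `|phi k x| <= 1.
  rewrite ger0_norm; first by apply: prodr_ile1 => i _; exact: chi01.
  by apply: prodr_ge0 => i _; have /andP[] := chi01 k i (x ord0 i).
have cphi k : continuous (phi k).
  rewrite /phi; elim: (index_enum _) => [|i s IH].
    by under eq_fun do rewrite big_nil; exact: cst_continuous.
  under eq_fun do rewrite big_cons.
  have h : continuous (fun x : 'rV[R]_m => chi k i (x ord0 i)).
    move=> x; apply: (@continuous_comp _ _ _ (fun x : 'rV[R]_m => x ord0 i) (chi k i)).
      exact: coord_continuous.
    exact: cchi.
  by move=> x; exact: (continuousM (h x) (IH x)).
have eqI k : \int[mu]_o phi k (\row_i Y i o) = \int[mu']_o phi k (\row_i Z i o).
  have tight e : 0 < e -> exists K : R, forall n : nat,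
      \int[mu]_o \1_(out_of_box Y K) o <= e.
    by move=> /(box_tight mu1 mY)[K _ hK]; exists K.
  have hc a t : \int[mu]_o cos (a + \sum_(i < m) t i * Y i o) @[n --> \oo] -->
      \int[mu']_o cos (a + \sum_(i < m) t i * Z i o).
    by rewrite hcos; exact: cvg_cst.
  have := fourier_cvg mu1 mu'1 (fun=> mY) mZ tight hc (cphi k) (phi1 k).
  by move=> /(cvg_unique _ (cvg_cst _)) ->.
have chi_cvg i x : chi k i x @[k --> \oo] --> ((c i < x)%R%:R : R).
  have [cx|xc] := ltP (c i) x.
    have x0 : 0 < x - c i by rewrite subr_gt0.
    apply: cvg_near_cst; exists (Num.truncn (x - c i)^-1).+1 => // k /= hk.
    rewrite /chi min_l// le_max; apply/orP; right.
    rewrite -ler_pdivrMr// mul1r.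
    have i0 : 0 <= (x - c i)^-1 by rewrite invr_ge0 ltW.
    have /andP[_ h] := truncn_itv i0; apply: le_trans (ltW h) _.
    by rewrite ler_nat.
  apply: cvg_near_cst; apply: nearW => k.
  rewrite /chi max_l; first by rewrite min_r.
  by rewrite mulr_ge0_le0// subr_le0.
have lim d0 (T0 : measurableType d0) (nu : {measure set T0 -> \bar R})
    (W : 'I_m -> T0 -> R) : nu setT = 1%E -> (forall i, measurable_fun setT (W i)) ->
    \int[nu]_o phi k (\row_i W i o) @[k --> \oo] -->
    fine (nu [set o | forall i, c i < W i o]).
  move=> nu1 mW; rewrite -Rint_indic; last exact: mR.
  apply: (bmI_cvg nu1 (c := 1)).
  - by move=> k; exact: (vector_bm mW (cphi k) (phi1 k)).
  - move=> o; rewrite (_ : \1_ _ o = \prod_(i < m) ((c i < W i o)%R%:R : R)); last first.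
      rewrite indicE; have [h|h] := pselect (forall i, c i < W i o).
        by rewrite mem_set// big1// => i _; rewrite h.
      rewrite memNset//; move: h => /existsNP[i /negP h].
      by rewrite (bigD1 i)//= (negbTE h) mul0r.
    rewrite /phi; elim: (index_enum _) => [|i s IH].
      under eq_fun do rewrite big_nil; rewrite big_nil; exact: cvg_cst.
    under eq_fun do rewrite big_cons mxE; rewrite big_cons.
    by apply: cvgM; [exact: chi_cvg|exact: IH].
  - by move=> k o; exact: phi1.
have := lim _ _ mu Y mu1 mY; under eq_fun do rewrite eqI.
move=> /(cvg_unique _ (lim _ _ mu' Z mu'1 mZ)) h.
have finR d0 (T0 : measurableType d0) (nu : {measure set T0 -> \bar R}) A :
    nu setT = 1%E -> measurable A -> nu A \is a fin_num.
  by move=> nu1 mA; exact: fin_num_mass1.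
rewrite -[LHS]fineK ?finR//; last exact: mR.
by rewrite -[RHS]fineK ?finR//; [rewrite h|exact: mR].
Unshelve. all: by end_near. Qed.
End fourier.

(** Open half-lines form a pi-system generating the Borel sets, and on them [ray_unique] applies
    with one coordinate. *)
Lemma law_unique {R : realType} {d d'} {T : measurableType d} {T' : measurableType d'}
    (mu : {measure set T -> \bar R}) (mu' : {measure set T' -> \bar R})
    (Y : T -> R) (Z : T' -> R) :
  mu setT = 1%E -> mu' setT = 1%E ->
  measurable_fun setT Y -> measurable_fun setT Z ->
  (forall a t : R, \int[mu]_o cos (a + t * Y o) = \int[mu']_o cos (a + t * Z o)) ->
  forall A, measurable A -> mu (Y @^-1` A) = mu' (Z @^-1` A).
Proof.
move=> mu1 mu'1 mY mZ hcos A mA.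
have bfun d0 (T0 : measurableType d0) (nu : {measure set T0 -> \bar R}) (W : T0 -> R) :
    nu setT = 1%E -> measurable_fun setT W ->
    bm_functional (fun f : R -> R => \int[nu]_o f (W o)).
  move=> nu1 mW; have bW f : bm f -> bm (fun o => f (W o)).
    by move=> bf; exact: (bm_comp (u := W)).
  split.
  - by move=> f g bf bg; rewrite (bmID nu1)//; exact: bW.
  - by move=> r f bf; rewrite (bmIZ nu1)//; exact: bW.
  - move=> h f c bh hf hc; apply: (bmI_cvg nu1 (c := c)) => [n|o|n o].
    + exact: bW.
    + exact: hf.
    + exact: hc.
have ind d0 (T0 : measurableType d0) (nu : {measure set T0 -> \bar R}) (W : T0 -> R)
    (B : set R) : measurable_fun setT W -> measurable B ->
    \int[nu]_o \1_B (W o) = fine (nu (W @^-1` B)).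
  move=> mW mB; rewrite -Rint_indic; last by rewrite -[X in measurable X]setTI; exact: mW.
  by apply: eq_Rintegral => o _; rewrite !indicE; congr (_%:R); apply/idP/idP; rewrite !inE.
have fin d0 (T0 : measurableType d0) (nu : {measure set T0 -> \bar R}) (W : T0 -> R) B :
    nu setT = 1%E -> measurable_fun setT W -> measurable B -> nu (W @^-1` B) \is a fin_num.
  move=> nu1 mW mB; apply: fin_num_mass1 => //.
  by rewrite -[X in measurable X]setTI; exact: mW.
rewrite -[LHS]fineK ?fin// -[RHS]fineK ?fin//; congr EFin.
rewrite -!ind//.
move: (bm_indic mA : bm (\1_A : R -> R)); move: (\1_A : R -> R) => f.
move: f; apply: (bm_functional_unique (I := fun f : R -> R => \int[mu]_o f (Y o))
  (J := fun f : R -> R => \int[mu']_o f (Z o)) (G := @RGenOInfty.G R)).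
- exact: bfun.
- exact: bfun.
- exact: (RGenOInfty.measurableE R).
- move=> _ _ [x ->] [y ->]; exists (Num.max x y).
  apply/seteqP; split=> z /=; rewrite !in_itv/= !andbT gt_max.
    by move=> [-> ->].
  by move=> /andP[].
- by rewrite (bmI_cst mu1) (bmI_cst mu'1).
move=> _ [x ->]; rewrite !ind//.
have := @ray_unique R 1 _ _ _ _ mu mu' (fun=> Y) (fun=> Z) (fun=> x) mu1 mu'1
  (fun=> mY) (fun=> mZ).
have h a (t : 'I_1 -> R) : \int[mu]_o cos (a + \sum_(i < 1) t i * Y o) =
    \int[mu']_o cos (a + \sum_(i < 1) t i * Z o).
  under eq_Rintegral do rewrite big_ord1.
  by under [RHS]eq_Rintegral do rewrite big_ord1.
move=> /(_ h) e; congr fine.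
have E U (W : U -> R) : W @^-1` `]x, +oo[%classic = [set o | 'I_1 -> x < W o].
  apply/seteqP; split=> o /=; rewrite in_itv/= andbT; first by move=> ?.
  by apply; exact: ord0.
by rewrite !E.
Qed.

(** With one event [B] fixed, the finite measures given by [P (A & B)] and [P A * P B] agree on a
    pi-system; this is done for each factor in turn. *)
Lemma independent_pi {R : realType} {d} {T : measurableType d} (P : probability T R)
    (G1 G2 : set (set T)) :
  G1 `<=` measurable -> G2 `<=` measurable -> setI_closed G1 -> setI_closed G2 ->
  G1 setT -> G2 setT ->
  (forall A B, G1 A -> G2 B -> P (A `&` B) = (P A * P B)%E) ->
  forall A B, <<s G1 >> A -> <<s G2 >> B -> P (A `&` B) = (P A * P B)%E.
Proof.
move=> m1 m2 I1 I2 T1 T2 h.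
have step (G : set (set T)) (B : set T) : G `<=` measurable -> setI_closed G ->
    G setT -> measurable B -> (forall A, G A -> P (A `&` B) = (P A * P B)%E) ->
    forall A, <<s G >> A -> P (A `&` B) = (P A * P B)%E.
  move=> mG IG GT mB hG A sA.
  have b0 : 0 <= fine (P B) by exact: fine_ge0.
  pose nu : {measure set T -> \bar R} := mscale (NngNum b0) P.
  pose nu' : {measure set T -> \bar R} := mrestr P mB.
  have fB : P B \is a fin_num by exact: fin_num_measure.
  have nuE C : nu C = (P C * P B)%E.
    by transitivity ((fine (P B))%:E * P C)%E => //; rewrite fineK// muleC.
  have nuE' C : nu' C = P (C `&` B) by [].
  rewrite -nuE -nuE'.
  apply: (@g_sigma_algebra_measure_unique_trace _ R T G setT measurableT _ _ nu' nu) => //.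
  - by move=> C [/mG].
  - by move=> C D [GC _] [GD _]; split=> //; exact: IG.
  - by rewrite nuE' nuE hG.
  - by move=> C [GC _]; rewrite nuE' nuE hG.
  - by rewrite nuE' setTI ltey_eq fB.
  - by move: A sA; apply: sub_sigma_algebra2 => C GC; split.
have mB B : <<s G2 >> B -> measurable B.
  by move: B; apply: smallest_sub => //; exact: sigma_algebra_measurable.
have h2 A B : G1 A -> <<s G2 >> B -> P (A `&` B) = (P A * P B)%E.
  move=> GA sB; rewrite setIC muleC.
  by apply: (step G2 A) sB => // [|C GC]; [exact: m1|rewrite setIC muleC; exact: h].
move=> A B sA sB; apply: (step G1 B) sA => //; first exact: mB.
by move=> C GC; exact: h2.
Qed.

Lemma split_lshift m n (i : 'I_m) : fintype.split (lshift n i) = inl i.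
Proof. exact: (unsplitK (inl i)). Qed.

Lemma split_rshift m n (j : 'I_n) : fintype.split (rshift m j) = inr j.
Proof. exact: (unsplitK (inr j)). Qed.

(** * Independence of two blocks of a family of variables *)

Section gaussian_family.
Context {d} {Omega : measurableType d} {R : realType}.
Variables (P : probability Omega R) (I : Type) (W : I -> Omega -> R).
Hypothesis mW : forall i, measurable_fun setT (W i).

Let P1 : P setT = 1%E. Proof. exact: probability_setT. Qed.

(** A pi-system, by concatenation of the index families, that generates the sigma-algebra of the
    variables indexed by [J]. *)
Definition ray_sets (J : I -> Prop) : set (set Omega) :=
  [set A | exists m (F : 'I_m -> I) (c : 'I_m -> R), (forall i, J (F i)) /\
     A = [set o | forall i, c i < W (F i) o]].

Let m_ray J : ray_sets J `<=` measurable.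
Proof.
move=> _ [m [F [c [_ ->]]]]; apply: measurable_forall_ord => i.
exact: measurable_ray.
Qed.

Let ray_setI J : setI_closed (ray_sets J).
Proof.
move=> _ _ [m [F [c [JF ->]]]] [n [G [e [JG ->]]]].
exists (m + n)%N, (fun k => match fintype.split k with inl i => F i | inr j => G j end),
  (fun k => match fintype.split k with inl i => c i | inr j => e j end); split.
  by move=> k; case: fintype.split.
apply/seteqP; split=> o /=; first by move=> [h1 h2] k; case: fintype.split.
move=> h; split=> i; [have := h (lshift n i)|have := h (rshift m i)].
  by rewrite split_lshift.
by rewrite split_rshift.
Qed.

Let ray_setT J : ray_sets J setT.
Proof.
exists 0%N, (fun i : 'I_0 => False_rect _ (notF (ltn_ord i))), (fun=> 0).
split; first by case.
by apply/seteqP; split=> // o _ [].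
Qed.

Lemma preimage_ray_sets (J : I -> Prop) i (B : set R) : J i -> measurable B ->
  <<s ray_sets J >> (W i @^-1` B).
Proof.
move=> Ji mB.
have mWi : @measurable_fun _ _ (g_sigma_algebraType (ray_sets J)) R setT (W i).
  apply: (measurability _ (RGenOInfty.measurableE R)) => _ [_ [x ->] <-].
  apply: sub_gen_smallest.
  exists 1%N, (fun=> i), (fun=> x); split=> //.
  apply/seteqP; split=> o /=; first by move=> [_]; rewrite in_itv/= andbT.
  by move=> h; split=> //; rewrite in_itv/= andbT; exact: h ord0.
by have := mWi measurableT B mB; rewrite setTI.
Qed.

Variables J1 J2 : I -> Prop.

(** The joint law of two blocks is compared with the law of the same blocks on
    the product space. *)
Lemma independent_blocks :
  (forall m n (F : 'I_m -> I) (G : 'I_n -> I) t u, (forall i, J1 (F i)) ->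
     (forall i, J2 (G i)) -> exists q1 q2 : R, forall a,
     [/\ \int[P]_o cos (a + (\sum_(i < m) t i * W (F i) o +
           \sum_(j < n) u j * W (G j) o)) = q1 * q2 * cos a,
         \int[P]_o cos (a + \sum_(i < m) t i * W (F i) o) = q1 * cos a &
         \int[P]_o cos (a + \sum_(j < n) u j * W (G j) o) = q2 * cos a]) ->
  forall A B, <<s ray_sets J1 >> A -> <<s ray_sets J2 >> B ->
  P (A `&` B) = (P A * P B)%E.
Proof.
move=> hq; apply: independent_pi => //.
move=> _ _ [m [F [c [JF ->]]]] [n [G [e [JG ->]]]].
pose PP := (P \x P)%E.
have mray k (H : 'I_k -> I) (b : 'I_k -> R) : measurable [set o | forall i, b i < W (H i) o].
  by apply: (@m_ray (fun=> True)); exists k, H, b.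
rewrite -product_measure1E//.
pose Y (k : 'I_(m + n)) (o : Omega) : R :=
  match fintype.split k with inl i => W (F i) o | inr j => W (G j) o end.
pose Z (k : 'I_(m + n)) (v : Omega * Omega) : R :=
  match fintype.split k with inl i => W (F i) v.1 | inr j => W (G j) v.2 end.
pose b (k : 'I_(m + n)) : R := match fintype.split k with inl i => c i | inr j => e j end.
have E1 : [set o | forall i, c i < W (F i) o] `&` [set o | forall i, e i < W (G i) o] =
    [set o | forall k, b k < Y k o].
  apply/seteqP; split=> o /=; rewrite /b /Y.
    by move=> [h1 h2] k; case: fintype.split.
  move=> h; split=> i; [have := h (lshift n i)|have := h (rshift m i)].
    by rewrite split_lshift.
  by rewrite split_rshift.
have E2 : [set o | forall i, c i < W (F i) o] `*` [set o | forall i, e i < W (G i) o] =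
    [set o | forall k, b k < Z k o].
  apply/seteqP; split=> o /=; rewrite /b /Z.
    by move=> [h1 h2] k; case: fintype.split.
  move=> h; split=> i; [have := h (lshift n i)|have := h (rshift m i)].
    by rewrite split_lshift.
  by rewrite split_rshift.
have PP1 : PP setT = 1%E.
  rewrite -setXTT; transitivity (P setT * P setT)%E; first exact: product_measure1E.
  by rewrite P1 mul1e.
rewrite E1 E2; apply: (ray_unique (mu := P) (mu' := PP) b P1 PP1).
- by move=> k; rewrite /Y; case: fintype.split => i; exact: mW.
- move=> k; rewrite /Z; case: fintype.split => i.
    exact: (measurableT_comp (mW (F i)) measurable_fst).
  exact: (measurableT_comp (mW (G i)) measurable_snd).
move=> a t.
pose X1 o := \sum_(i < m) t (lshift n i) * W (F i) o.
pose X2 o := \sum_(j < n) t (rshift m j) * W (G j) o.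
have YE o : \sum_(k < m + n) t k * Y k o = X1 o + X2 o.
  rewrite big_split_ord/=; congr (_ + _); apply: eq_bigr => i _; rewrite /Y.
    by rewrite split_lshift.
  by rewrite split_rshift.
have ZE v : \sum_(k < m + n) t k * Z k v = X1 v.1 + X2 v.2.
  rewrite big_split_ord/=; congr (_ + _); apply: eq_bigr => i _; rewrite /Z.
    by rewrite split_lshift.
  by rewrite split_rshift.
under eq_Rintegral do rewrite YE.
under [RHS]eq_Rintegral do rewrite ZE.
have [q1 [q2 hqq]] := hq m n F G (fun i => t (lshift n i)) (fun j => t (rshift m j)) JF JG.
have [-> _ _] := hqq a.
have mX1 : measurable_fun setT X1.
  by apply: measurable_sum => i; apply: measurable_funM => //; exact: mW.
have mX2 : measurable_fun setT X2.
  by apply: measurable_sum => i; apply: measurable_funM => //; exact: mW.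
have mX1' : measurable_fun setT (fun v : Omega * Omega => X1 v.1).
  exact: (measurableT_comp mX1 measurable_fst).
have mX2' : measurable_fun setT (fun v : Omega * Omega => X2 v.2).
  exact: (measurableT_comp mX2 measurable_snd).
pose f (v : Omega * Omega) := cos (a + (X1 v.1 + X2 v.2)).
have bf : bm f.
  by apply: bm_cos; apply: measurable_funD => //; exact: measurable_funD.
(* Adding 1 makes the cosine nonnegative, as Tonelli's theorem requires. *)
have bf1 : bm (fun v => f v + 1) by apply: bmD => //; exact: bm_cst.
have tonelli : (\int[PP]_v (f v + 1)%:E = \int[P]_o \int[P]_o' (f (o, o') + 1)%:E)%E.
  rewrite /PP (fubini_tonelli1 (m1 := P) (m2 := P) (fun v => (f v + 1)%:E))//.
    by apply/measurable_EFinP; exact: bm_meas bf1.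
  by move=> v; rewrite lee_fin; have := cos_geN1 (a + (X1 v.1 + X2 v.2)); rewrite /f; lra.
have inner o : (\int[P]_o' (f (o, o') + 1)%:E = (q2 * cos (a + X1 o) + 1)%:E)%E.
  have bo : bm (fun o' => f (o, o')).
    by rewrite /f/=; apply: bm_cos; apply: measurable_funD => //; exact: measurable_funD.
  rewrite (bm_EFin P1); last by apply: bmD => //; exact: bm_cst.
  rewrite (bmID P1)//; last exact: bm_cst.
  rewrite (bmI_cst P1); congr ((_ + _)%:E).
  have [_ _ <-] := hqq (a + X1 o).
  by apply: eq_Rintegral => o' _; rewrite /f/= addrA.
have outer : (\int[P]_o (q2 * cos (a + X1 o) + 1)%:E = (q1 * q2 * cos a + 1)%:E)%E.
  have bo : bm (fun o => cos (a + X1 o)).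
    by apply: bm_cos; exact: measurable_funD.
  rewrite (bm_EFin P1); last by apply: bmD; [exact: bmZ|exact: bm_cst].
  rewrite (bmID P1)//; [|exact: bmZ|exact: bm_cst].
  rewrite (bmI_cst P1) (bmIZ P1)//; congr ((_ + _)%:E).
  by have [_ -> _] := hqq a; rewrite mulrA [q2 * _]mulrC.
have : (\int[PP]_v (f v + 1)%:E = (q1 * q2 * cos a + 1)%:E)%E.
  by rewrite tonelli -outer; apply: eq_integral => o _; exact: inner.
rewrite (bm_EFin PP1 bf1) (bmID PP1)//; last exact: bm_cst.
by rewrite (bmI_cst PP1) => -[] /addIr <-.
Qed.
End gaussian_family.

(** A remainder of second order identifies the derivative. It is used to differentiate an integral
    in its parameter directly from Taylor bounds on the integrand. *)
Lemma is_derive_quad {R : realType} (f : R -> R) (x l c r : R) : 0 < r -> 0 <= c ->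
  (forall h, `|h| <= r -> `|f (x + h) - f x - h * l| <= c * h ^+ 2) ->
  is_derive x 1 f l.
Proof.
move=> r0 c0 hf.
have h : (h^-1 *: (f (h *: 1 + x) - f x)) @[h --> 0^'] --> l.
  apply/cvgrPdist_le => e e0; near=> h.
  have h0 : h != 0 by near: h; exact: nbhs_dnbhs_neq.
  have hr : `|h| <= Num.min r (e / (c + 1)).
    near: h; apply/nbhs_ballP; exists (Num.min r (e / (c + 1))) => /=.
      by rewrite lt_min r0 divr_gt0// ltr_wpDl.
    by move=> h; rewrite /ball/= sub0r normrN => /ltW.
  move: hr; rewrite le_min => /andP[hr he].
  rewrite /GRing.scale/= mulr1 [h + x]addrC distrC.
  rewrite (_ : h^-1 * _ - l = h^-1 * (f (x + h) - f x - h * l)); last by field.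
  rewrite normrM normfV mulrC ler_pdivrMr ?normr_gt0//.
  apply: le_trans (hf h hr) _; rewrite -[h ^+ 2]real_normK ?num_real// expr2 mulrA.
  apply: ler_wpM2r => //; apply: le_trans (ler_wpM2l c0 he) _.
  rewrite mulrCA -[leRHS]mulr1; apply: ler_wpM2l; first exact: ltW.
  by rewrite ler_pdivrMr ?ltr_wpDl// mul1r lerDl.
split; first by apply/cvg_ex; exists l.
exact: cvg_lim h.
Unshelve. all: by end_near. Qed.

(** * Gaussian laws *)

Section normal_law.
Context {R : realType}.
Variable s : R.
Hypothesis s0 : s != 0.

Let N := normal_prob 0 s.
Let lam := @lebesgue_measure R.
Let p := normal_pdf 0 s.

Let N1 : N setT = 1%E. Proof. exact: probability_setT. Qed.

Let pE x : p x = normal_peak s * expR (- (x ^+ 2 / (s ^+ 2 * 2))).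
Proof.
by rewrite /p normal_pdfE// /normal_pdf/= /normal_fun subr0 mulNr -mulr_natr.
Qed.

Let fp_integrable (f : R -> R) : bm f -> lam.-integrable setT (EFin \o (fun x => f x * p x)).
Proof.
move=> bf; have [c c0 hc] := bm_bound bf.
have h : lam.-integrable setT (EFin \o (fun x => c * p x)).
  have := integrableZl measurableT c (integrable_normal_pdf 0 s).
  by apply: eq_integrable => // x _.
apply: le_integrable h => //.
  apply/measurable_EFinP/measurable_funM; first exact: bm_meas.
  exact: measurable_normal_pdf.
move=> x _ /=; rewrite lee_fin !normrM ler_wpM2r// (le_trans (hc x))//.
exact: ler_norm.
Qed.

Lemma normal_int (f : R -> R) : bm f ->
  \int[N]_x f x = \int[lam]_x (f x * p x).
Proof.
move: f; apply: (bm_functional_unique (I := fun f => \int[N]_x f x)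
  (J := fun f : R -> R => \int[lam]_x (f x * p x)) (G := measurable)).
- exact: bm_functional_int N1.
- split.
  + move=> f g bf bg; under eq_Rintegral do rewrite mulrDl.
    by rewrite RintegralD//; exact: fp_integrable.
  + move=> r f bf; under eq_Rintegral do rewrite -mulrA.
    by rewrite RintegralZl//; exact: fp_integrable.
  + move=> h f c bh hf hc.
    have c0 : 0 <= c by exact: le_trans (normr_ge0 _) (hc 0%N 0).
    have bf : bm f by apply: (@bm_lim _ _ _ h f c) => // [n|x]; [exact: bm_meas|];
      apply: cvgn_norm_le (hf x) _ => n; exact: hc.
    have ic : lam.-integrable setT (EFin \o (fun x => c * p x)).
      have := integrableZl measurableT c (integrable_normal_pdf 0 s).
      by apply: eq_integrable => // x _.
    have [] := @dominated_convergence _ _ _ lam setT measurableT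
      (fun n => EFin \o (fun x => h n x * p x)) (EFin \o (fun x => f x * p x))
      (EFin \o (fun x => c * p x)) _ _ _ ic _.
    * move=> n; apply/measurable_EFinP/measurable_funM; first exact: bm_meas.
      exact: measurable_normal_pdf.
    * apply/measurable_EFinP/measurable_funM; first exact: bm_meas.
      exact: measurable_normal_pdf.
    * apply: aeW => x _; apply/fine_cvgP; split; first exact: nearW.
      by apply: cvgM; [exact: hf|exact: cvg_cst].
    * apply: aeW => x n _ /=; rewrite lee_fin normrM (ger0_norm (normal_pdf_ge0 _ _ _)).
      by rewrite ler_wpM2r// normal_pdf_ge0.
    move=> _ _ h1; apply: fine_cvg; rewrite fineK//.
    by apply: integrable_fin_num => //; exact: fp_integrable.
- by rewrite (sigma_algebra_id (@sigma_algebra_measurable _ _)).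
- by move=> A B mA mB; exact: measurableI.
- rewrite (bmI_cst N1) /Rintegral; under eq_integral do rewrite mul1r.
  by rewrite integral_normal_pdf.
- move=> A mA; rewrite Rint_indic// /Rintegral; congr fine.
  transitivity (\int[lam]_(x in A) (p x)%:E)%E; first by [].
  rewrite [LHS]integral_mkcond; apply: eq_integral => x _.
  by rewrite patchE indicE; case: ifP; rewrite ?mul1r ?mul0r.
Qed.

Let p0 x : 0 <= p x. Proof. exact: normal_pdf_ge0. Qed.

Let cp : continuous p. Proof. exact: continuous_normal_pdf. Qed.

Let dp (x : R) : is_derive x 1 p (- (x / s ^+ 2) * p x).
Proof.
have -> : p = fun x => normal_peak s * expR (- (x ^+ 2 / (s ^+ 2 * 2))).
  by apply/funext => y; exact: pE.
apply: is_derive_eq; rewrite /GRing.scale/=; field.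
by rewrite s0.
Qed.

Variable a : R.

Let box n : set R := `[- n.+1%:R, n.+1%:R]%classic.

(** Cutting to a box keeps the integrand of the derivative, which contains the factor [x],
    bounded. *)
Let G n t := \int[N]_x (\1_(box n) x * cos (a + t * x)).

Let mbox n : measurable (box n). Proof. exact: measurable_itv. Qed.

Let boxP n (x : R) : (\1_(box n) x = 1 :> R /\ `|x| <= n.+1%:R) \/ \1_(box n) x = 0 :> R.
Proof.
rewrite indicE; have [h|h] := boolP (x \in box n); last by right.
by left; split=> //; move: h; rewrite inE /box/= in_itv/= -ler_norml.
Qed.

Let bcos n t : bm (fun x => \1_(box n) x * cos (a + t * x)).
Proof.
apply: bmM; first exact: bm_indic.
by apply: bm_cos; apply: measurable_funD => //; exact: measurable_funM.
Qed.

Let bxsin n t : bm (fun x => \1_(box n) x * (x * sin (a + t * x))).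
Proof.
apply: (@bmP _ _ _ _ n.+1%:R).
  apply: measurable_funM => //; apply: measurable_funM => //.
  apply: bm_meas; by apply: bm_sin; apply: measurable_funD => //.
move=> x; have [[-> hx]|->] := boxP n x; last by rewrite mul0r normr0.
rewrite mul1r normrM; apply: (@le_trans _ _ (n.+1%:R * 1)); last by rewrite mulr1.
by apply: ler_pM => //; rewrite ler_norml sin_geN1 sin_le1.
Qed.

(** Integration by parts with [p' = - (x / s ^+ 2) * p]. The cut leaves a boundary term proportional
    to the density at [n + 1]. *)
Let stein n t : \int[N]_x (\1_(box n) x * (x * sin (a + t * x))) =
  s ^+ 2 * (t * G n t) - s ^+ 2 * ((sin (a + t * n.+1%:R) - sin (a - t * n.+1%:R)) * p n.+1%:R).
Proof.
have bc := bcos n t; have bs := bxsin n t.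
suff : s ^+ 2 * (t * G n t) - \int[N]_x (\1_(box n) x * (x * sin (a + t * x))) =
    s ^+ 2 * ((sin (a + t * n.+1%:R) - sin (a - t * n.+1%:R)) * p n.+1%:R).
  by move=> <-; ring.
rewrite /G -(bmIZ N1)// -(bmIZ N1) -?(bmIB N1)//; try by do ?apply: bmZ.
rewrite normal_int; last by apply: bmB => //; do 2 apply: bmZ.
pose F x := s ^+ 2 * (sin (a + t * x) * p x).
pose f x := s ^+ 2 * (t * cos (a + t * x) * p x - sin (a + t * x) * (x / s ^+ 2 * p x)).
have dF (x : R) : is_derive x 1 F (f x).
  have d1 : is_derive x 1 (fun x => a + t * x) t.
    by apply: is_derive_eq; rewrite /GRing.scale/=; ring.
  have d2 := @is_derive1_comp _ sin _ x _ _ (is_derive_sin _) d1.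
  have d3 := is_deriveZ (s ^+ 2) (is_deriveM d2 (dp x)).
  by apply: is_derive_eq d3 _; rewrite /GRing.scale/= /f; ring.
have cf : continuous f.
  have csin : continuous (fun x => sin (a + t * x)).
    move=> x; apply: (@continuous_comp _ _ _ (fun x => a + t * x) sin).
      by apply: cvgD; [exact: cvg_cst|apply: cvgM; [exact: cvg_cst|exact: cvg_id]].
    exact: continuous_sin.
  have ccos : continuous (fun x => cos (a + t * x)).
    move=> x; apply: (@continuous_comp _ _ _ (fun x => a + t * x) cos).
      by apply: cvgD; [exact: cvg_cst|apply: cvgM; [exact: cvg_cst|exact: cvg_id]].
    exact: continuous_cos.
  move=> x; apply: cvgM; first exact: cvg_cst.
  apply: cvgB.
    apply: cvgM; last exact: cp.
    by apply: cvgM; [exact: cvg_cst|exact: ccos].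
  apply: cvgM; first exact: csin.
  apply: cvgM; last exact: cp.
  by apply: cvgM; [exact: cvg_id|exact: cvg_cst].
have n0 : - n.+1%:R < n.+1%:R :> R by rewrite gtrN// ltr0n.
have := continuous_FTC2 n0 (f := f) (F := F) _ _ _.
move=> /(_ (continuous_subspaceT cf)).
have dFo : derivable_oo_LRcontinuous F (- n.+1%:R) n.+1%:R.
  have cF : continuous F.
    by move=> x; apply: differentiable_continuous; apply/derivable1_diffP; have [] := dF x.
  split.
  - by move=> x _; have [] := dF x.
  - by apply: cvg_at_right_filter; exact: cF.
  - by apply: cvg_at_left_filter; exact: cF.
move=> /(_ dFo) ftc.
have {}ftc := ftc (fun x _ => etrans (derive1E _ _) (@derive_val _ _ _ _ _ _ _ (dF x))).
transitivity (fine (\int[lam]_(x in `[(- n.+1%:R)%R, n.+1%:R%R]) (f x)%:E)%E).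
  rewrite /Rintegral [in RHS]integral_mkcond; congr fine; apply: eq_integral => x _.
  rewrite patchE indicE /box /f; case: ifP => _ /=; last first.
    by rewrite !mul0r !mulr0 subrr mul0r.
  by congr EFin; field; rewrite s0.
rewrite ftc /= /F mulrN !pE sqrrN; ring.
Qed.

Let dG n (t : R) : is_derive t 1 (G n) (- (s ^+ 2 * t * G n t) +
  s ^+ 2 * ((sin (a + t * n.+1%:R) - sin (a - t * n.+1%:R)) * p n.+1%:R)).
Proof.
have -> : - (s ^+ 2 * t * G n t) +
  s ^+ 2 * ((sin (a + t * n.+1%:R) - sin (a - t * n.+1%:R)) * p n.+1%:R) =
  - \int[N]_x (\1_(box n) x * (x * sin (a + t * x))).
  by rewrite stein; ring.
have n0 : (0 : R) < n.+1%:R by rewrite ltr0n.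
apply: (@is_derive_quad _ _ _ _ (n.+1%:R ^+ 2) n.+1%:R^-1).
- by rewrite invr_gt0.
- exact: sqr_ge0.
move=> h hr; have bc := bcos n t; have bch := bcos n (t + h); have bs := bxsin n t.
rewrite mulrN opprK /G -(bmIZ N1)// -(bmIB N1)// -(bmID N1)//; [|exact: bmB|exact: bmZ].
apply: (bmI_bound N1); first by apply: bmD; [exact: bmB|exact: bmZ].
move=> x; have [[-> hx]|->] := boxP n x; last first.
  by rewrite !mul0r mulr0 subrr add0r normr0 mulr_ge0// sqr_ge0.
rewrite !mul1r mulrDl addrA; set A := a + t * x.
have -> : cos (A + h * x) - cos A + h * (x * sin A) =
    cos A * (cos (h * x) - 1) - sin A * (sin (h * x) - h * x).
  by rewrite cosD; ring.
have hB : `|h * x| <= 1.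
  rewrite normrM; apply: le_trans (ler_pM _ _ hr hx) _ => //.
  by rewrite mulVf// gt_eqF.
have h1 := cos_taylor (h * x); have h2 := sin_taylor (h * x).
have B0 : 0 <= `|h * x| by [].
have B2 : `|h * x| ^+ 2 <= n.+1%:R ^+ 2 * h ^+ 2.
  rewrite normrM exprMn mulrC -[h ^+ 2]real_normK ?num_real//.
  apply: ler_wpM2r; first exact: sqr_ge0.
  by apply: lerXn2r hx; rewrite nnegrE// ltW.
apply: le_trans B2.
have c1 : `|cos (h * x) - 1| <= `|h * x| ^+ 2 / 2 + `|h * x| ^+ 4 / 24.
  rewrite (_ : cos (h * x) - 1 = (cos (h * x) - (1 - (h * x) ^+ 2 / 2)) - (h * x) ^+ 2 / 2); last by ring.
  apply: le_trans (ler_normB _ _) _; rewrite addrC lerD//.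
  by rewrite normrM normrX (ger0_norm (_ : 0 <= 2^-1))// invr_ge0.
have cA : `|cos A| <= 1 by rewrite ler_norml cos_geN1 cos_le1.
have sA : `|sin A| <= 1 by rewrite ler_norml sin_geN1 sin_le1.
apply: le_trans (ler_normB _ _) _; rewrite !normrM.
apply: le_trans (lerD (ler_pM _ _ cA c1) (ler_pM _ _ sA h2)) _ => //.
have B3 : `|h * x| ^+ 3 <= `|h * x| ^+ 2 by rewrite exprSr ler_piMr// sqr_ge0.
have B4 : `|h * x| ^+ 4 <= `|h * x| ^+ 2.
  by rewrite (_ : 4 = 2 + 2)%N// exprD ler_piMr ?sqr_ge0// expr_le1.
have : 0 <= `|h * x| ^+ 2 by exact: sqr_ge0.
by rewrite -[`|h| * `|x|]normrM !mul1r; move: (`|h * x|) B3 B4 => *; lra.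
Qed.

(** Up to the boundary term [G n] solves the linear equation [G' = - s^2 t G]; the integrating
    factor turns the source into an increment bounded by the density at [n + 1]. *)
Let growth n (t : R) : 0 <= t -> `|expR (s ^+ 2 * t ^+ 2 / 2) * G n t - G n 0| <=
  2 * s ^+ 2 * p n.+1%:R * (t * expR (s ^+ 2 * t ^+ 2 / 2)).
Proof.
move=> t0; pose k := 2 * s ^+ 2 * p n.+1%:R.
have k0 : 0 <= k by apply: mulr_ge0 => //; apply: mulr_ge0 => //; exact: sqr_ge0.
pose E (u : R) := expR (s ^+ 2 * u ^+ 2 / 2).
pose r (u : R) := s ^+ 2 * ((sin (a + u * n.+1%:R) - sin (a - u * n.+1%:R)) * p n.+1%:R).
have dE (u : R) : is_derive u 1 E (E u * (s ^+ 2 * u)).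
  by apply: is_derive_eq; rewrite /GRing.scale/= /E; field.
have rk u : `|r u| <= k.
  rewrite /r /k normrM (ger0_norm (sqr_ge0 s)).
  rewrite (_ : 2 * s ^+ 2 * p n.+1%:R = s ^+ 2 * (2 * p n.+1%:R)); last by ring.
  apply: ler_wpM2l; first exact: sqr_ge0.
  rewrite normrM (ger0_norm (p0 _)); apply: ler_wpM2r => //.
  have := sin_geN1 (a + u * n.+1%:R); have := sin_le1 (a + u * n.+1%:R).
  have := sin_geN1 (a - u * n.+1%:R); have := sin_le1 (a - u * n.+1%:R).
  by rewrite ler_norml => *; apply/andP; split; lra.
have E0 u : 0 < E u by exact: expR_gt0.
(* This function is nondecreasing for [e = 1] and for [e = -1], which gives the two sides of the
   absolute value. *)
have dH (e u : R) : is_derive u 1 (fun u => k * (u * E u) + e * (E u * G n u))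
    (k * (E u + u * (E u * (s ^+ 2 * u))) + e * (E u * r u)).
  have h1 := is_deriveZ k (is_deriveM (is_derive_id u 1) (dE u)).
  have h2 := is_deriveZ e (is_deriveM (dE u) (dG n u)).
  apply: is_derive_eq (is_deriveD h1 h2) _; rewrite /GRing.scale/= -/(r u).
  by move: (E u) (G n u) (r u) (k) => x y z v; ring.
have pos (e u : R) : `|e| <= 1 -> 0 <= u ->
    0 <= k * (E u + u * (E u * (s ^+ 2 * u))) + e * (E u * r u).
  move=> e1 u0.
  have h1 : 0 <= k * (u * (E u * (s ^+ 2 * u))).
    apply: mulr_ge0 => //; apply: mulr_ge0 => //; apply: mulr_ge0; first exact: ltW.
    by apply: mulr_ge0 => //; exact: sqr_ge0.
  have h2 : - (k * E u) <= e * (E u * r u).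
    rewrite lerNl -mulrN (le_trans (ler_norm _))// normrM normrN normrM.
    rewrite (gtr0_norm (E0 u)) -[leRHS]mul1r; apply: ler_pM => //.
      by rewrite mulr_ge0// ltW.
    by rewrite mulrC ler_wpM2r// ltW.
  by rewrite mulrDr; lra.
have E00 : E 0 = 1 by rewrite /E expr0n/= mulr0 mul0r expR0.
have := derive_ge0_le (dH 1) (fun u u0 => pos 1 u (_ : `|1| <= 1) u0) t0.
have := derive_ge0_le (dH (- 1)) (fun u u0 => pos (- 1) u (_ : `|- 1| <= 1) u0) t0.
rewrite normrN normr1 E00 !mul0r !mulr0 !add0r -/k -/(E t) => /(_ (lexx _)) h1 /(_ (lexx _)) h2.
by rewrite ler_norml; apply/andP; split; lra.
Qed.

Let p_cvg0 : p n.+1%:R @[n --> \oo] --> (0 : R).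
Proof.
pose c := normal_peak s * (s ^+ 2 * 2).
have s2 : 0 < s ^+ 2 by rewrite exprn_even_gt0.
have c0 : 0 <= c by rewrite mulr_ge0 ?normal_peak_ge0// mulr_ge0// ltW.
have h : c * n.+1%:R^-1 @[n --> \oo] --> c * 0.
  by apply: cvgM; [exact: cvg_cst|exact: cvg_invS].
rewrite mulr0 in h; apply/cvgnP => e e0.
move/cvgnP: h => /(_ _ e0)[M hM]; exists M => n /hM; rewrite !subr0.
move=> /(le_trans (ler_norm _)); apply: le_trans.
rewrite ger0_norm ?p0// pE /c -mulrA ler_wpM2l ?normal_peak_ge0//.
have n1 : (1 : R) <= n.+1%:R by rewrite ler1n.
have D0 : 0 < s ^+ 2 * 2 by rewrite mulr_gt0.
rewrite expRN; move: (s ^+ 2 * 2) (n.+1%:R : R) D0 n1 => D y D0 y1.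
have y0 : 0 < y by exact: lt_le_trans y1.
rewrite -[leRHS]invrK lef_pV2 ?posrE ?expR_gt0 ?invr_gt0 ?divr_gt0// invf_div.
apply: le_trans (expR_ge1Dx _); rewrite -[leLHS]add0r lerD//.
by rewrite ler_wpM2r ?invr_ge0 ?(ltW D0)// expr2 ler_peMl// ltW.
Qed.

Lemma normal_charf_ge0 (t : R) : 0 <= t ->
  \int[N]_x cos (a + t * x) = expR (- (s ^+ 2 * t ^+ 2 / 2)) * cos a.
Proof.
move=> t0.
have GT u : G n u @[n --> \oo] --> \int[N]_x cos (a + u * x).
  apply: (bmI_cvg N1 (c := 1)) => [n|x|n x]; first exact: bcos.
  - apply: cvg_near_cst; exists (Num.truncn `|x|) => // n /= xn.
    rewrite indicE mem_set ?mul1r// /box/= in_itv/= -ler_norml.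
    have /andP[_ h] := truncn_itv (normr_ge0 x); apply: le_trans (ltW h) _.
    by rewrite ler_nat ltnS.
  - rewrite normrM -[leRHS]mulr1; apply: ler_pM => //.
      by rewrite indicE; case: (_ \in _); rewrite ?normr1 ?normr0.
    by rewrite ler_norml cos_geN1 cos_le1.
have h0 : \int[N]_x cos (a + 0 * x) = cos a.
  by under eq_Rintegral do rewrite mul0r addr0; rewrite (bmI_cst N1).
have h1 : (expR (s ^+ 2 * t ^+ 2 / 2) * G n t - G n 0) @[n --> \oo] -->
    expR (s ^+ 2 * t ^+ 2 / 2) * \int[N]_x cos (a + t * x) - cos a.
  rewrite -{1}h0; apply: cvgB; last exact: GT.
  by apply: cvgM; [exact: cvg_cst|exact: GT].
have h2 : (expR (s ^+ 2 * t ^+ 2 / 2) * G n t - G n 0) @[n --> \oo] --> (0 : R).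
  have h : 2 * s ^+ 2 * p n.+1%:R * (t * expR (s ^+ 2 * t ^+ 2 / 2)) @[n --> \oo] -->
      2 * s ^+ 2 * 0 * (t * expR (s ^+ 2 * t ^+ 2 / 2)).
    apply: cvgM; last exact: cvg_cst.
    by apply: cvgM => //; exact: cvg_cst.
  rewrite mulr0 mul0r in h; apply/cvgnP => e e0.
  move/cvgnP: h => /(_ _ e0)[M hM]; exists M => n /hM; rewrite !subr0.
  by move=> /(le_trans (ler_norm _)); apply: le_trans; exact: growth.
have h3 : expR (s ^+ 2 * t ^+ 2 / 2) * \int[N]_x cos (a + t * x) - cos a = 0.
  exact: (cvg_unique _ h1 h2).
move/subr0_eq: h3 => <-.
by rewrite mulrA -expRD addNr expR0 mul1r.
Qed.
End normal_law.

Lemma normal_charf {R : realType} (s a t : R) : s != 0 ->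
  \int[normal_prob 0 s]_x cos (a + t * x) = expR (- (s ^+ 2 * t ^+ 2 / 2)) * cos a.
Proof.
move=> s0; have [t0|/ltW t0] := leP 0 t; first exact: normal_charf_ge0.
rewrite -[cos a]cosN -[t ^+ 2]sqrrN -normal_charf_ge0// ?oppr_ge0//.
by apply: eq_Rintegral => x _; rewrite -cosN; congr cos; ring.
Qed.

(** * Law and moments of a variable with Gaussian characteristic function *)

Section gaussian_charf.
Context {d} {T : measurableType d} {R : realType}.
Variable P : probability T R.

Let P1 : P setT = 1%E. Proof. exact: probability_setT. Qed.

(** Because of the phase [a], this real identity is equivalent to the complex characteristic
    function being [expR (- (v * t ^+ 2 / 2))]. *)
Definition gaussian_charf (Y : T -> R) (v : R) : Prop :=
  forall a t : R, \int[P]_o cos (a + t * Y o) = expR (- (v * t ^+ 2 / 2)) * cos a.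

Lemma gaussian_charf_law (Y : T -> R) (v : R) : 0 <= v -> measurable_fun setT Y ->
  gaussian_charf Y v -> gaussian_rv P Y.
Proof.
move=> v0 mY hY; exists 0, (Num.sqrt v) => A mA.
have [s0|s0] := eqVneq (Num.sqrt v) 0.
  have {}v0 : v = 0 by rewrite -(sqr_sqrtr v0) s0 expr0n.
  have d1 : \d_(0 : R) [set: R] = 1%E :> \bar R by rewrite diracT.
  have mid : measurable_fun setT (@id R) by exact: measurable_id.
  apply: (law_unique P1 d1 mY mid) => // a t.
  rewrite hY v0 mul0r mul0r oppr0 expR0 mul1r.
  have mc : measurable_fun [set: R] (fun x => (cos (a + t * x))%:E).
    apply/measurable_EFinP; apply: bm_meas; apply: bm_cos.
    by apply: measurable_funD => //; exact: measurable_funM.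
  by rewrite /Rintegral integral_dirac// diracT mul1e/= mulr0 addr0.
have N1 : normal_prob 0 (Num.sqrt v) setT = 1%E by exact: probability_setT.
have mid : measurable_fun setT (@id R) by exact: measurable_id.
apply: (law_unique P1 N1 mY mid) => // a t.
by rewrite hY normal_charf// sqr_sqrtr.
Qed.

(** The functions [f k] increase to the square, since duplication gives
    [f k.+1 - f k = 4 * 4 ^+ k * (1 - c) ^+ 2]. Their means are known from the characteristic
    function, and monotone convergence needs no prior integrability of the square. *)
Lemma gaussian_charf_sq (Y : T -> R) (v : R) : 0 <= v -> measurable_fun setT Y ->
  gaussian_charf Y v -> (\int[P]_o ((Y o) ^+ 2)%:E = v%:E)%E.
Proof.
move=> v0 mY hY.
pose f (k : nat) (x : R) : R := 2 * 4 ^+ k * (1 - cos (x / 2 ^+ k)).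
have p2 (k : nat) : (0 : R) < 2 ^+ k by exact: exprn_gt0.
have p4 (k : nat) : (0 : R) < 4 ^+ k by exact: exprn_gt0.
have e4 (k : nat) : (4 : R) ^+ k = (2 ^+ k) ^+ 2.
  by rewrite -exprM mulnC exprM; congr (_ ^+ _); ring.
have f0 k x : 0 <= f k x.
  by rewrite /f !mulr_ge0 ?exprn_ge0// subr_ge0 cos_le1.
have fS k x : f k x <= f k.+1 x.
  rewrite /f !exprS; set c := cos (x / (2 * 2 ^+ k)).
  have -> : cos (x / 2 ^+ k) = c ^+ 2 *+ 2 - 1.
    by rewrite /c -cos_mulr2n; congr cos; rewrite -mulr_natr; field; rewrite gt_eqF.
  have c1 : c <= 1 by exact: cos_le1.
  have c2 : - 1 <= c by exact: cos_geN1.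
  rewrite -subr_ge0 -mulr_natr (_ : _ - _ = 4 * 4 ^+ k * ((1 - c) * (1 - c))).
    apply: mulr_ge0; first by apply: mulr_ge0 => //; exact: ltW.
    exact: sqr_ge0.
  by ring.
have g4 : (4^-1 : R) ^+ k @[k --> \oo] --> (0 : R).
  by apply: cvg_expr; rewrite ger0_norm ?invr_ge0// invf_lt1// ltr1n.
have f_cvg x : f k x @[k --> \oo] --> x ^+ 2.
  have h : `|x| ^+ 4 / 12 * 4^-1 ^+ k @[k --> \oo] --> `|x| ^+ 4 / 12 * 0.
    by apply: cvgM => //; exact: cvg_cst.
  rewrite mulr0 in h; apply/cvgnP => e e0; move/cvgnP: h => /(_ _ e0)[N hN].
  exists N => k /hN; rewrite subr0 => /(le_trans (ler_norm _)); apply: le_trans.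
  have h1 := cos_taylor (x / 2 ^+ k).
  rewrite (_ : f k x - x ^+ 2 = - (2 * 4 ^+ k * (cos (x / 2 ^+ k) - (1 - (x / 2 ^+ k) ^+ 2 / 2)))); last first.
    by rewrite /f e4; field; rewrite gt_eqF.
  have k0 : 0 < 2 * 4 ^+ k :> R by rewrite mulr_gt0.
  rewrite normrN normrM (gtr0_norm k0); apply: le_trans (ler_wpM2l (ltW k0) h1) _.
  rewrite normrM normfV (gtr0_norm (p2 k)) exprVn e4 le_eqVlt; apply/orP; left.
  by apply/eqP; move: (`|x|) (2 ^+ k : R) (p2 k) => y z z0; field; rewrite gt_eqF.
have bf k : bm (fun o => f k (Y o)).
  apply: bmZ; apply: bmB; first exact: bm_cst.
  by apply: bm_cos; exact: measurable_funM.
have fI k : \int[P]_o f k (Y o) = 2 * 4 ^+ k * (1 - expR (- (v / (2 * 4 ^+ k)))).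
  have bc : bm (fun o => cos (Y o / 2 ^+ k)) by apply: bm_cos; exact: measurable_funM.
  rewrite /f (bmIZ P1); last by apply: bmB => //; exact: bm_cst.
  rewrite (bmIB P1)//; last exact: bm_cst.
  rewrite (bmI_cst P1); congr (_ * (_ - _)).
  have := hY 0 (2 ^+ k)^-1; rewrite cos0 mulr1.
  under eq_Rintegral do rewrite add0r mulrC.
  move=> ->; congr (expR (- _)); rewrite e4; field; by rewrite gt_eqF.
have fI_cvg : \int[P]_o f k (Y o) @[k --> \oo] --> v.
  have h : v ^+ 2 / 2 * 4^-1 ^+ k @[k --> \oo] --> v ^+ 2 / 2 * 0.
    by apply: cvgM => //; exact: cvg_cst.
  rewrite mulr0 in h; apply/cvgnP => e e0; move/cvgnP: h => /(_ _ e0)[N hN].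
  exists N => k /hN; rewrite subr0 => /(le_trans (ler_norm _)); apply: le_trans.
  rewrite fI; pose u := v / (2 * 4 ^+ k).
  have k0 : 0 < 2 * 4 ^+ k :> R by rewrite mulr_gt0.
  have u0 : 0 <= u by rewrite divr_ge0// ltW.
  have h1 : 1 - u <= expR (- u) by exact: expR_ge1Dx.
  have h2 : expR (- u) <= 1 - u + u ^+ 2.
    have h3 : expR (- u) * (1 + u) <= 1.
      rewrite -[leRHS](expR0 R) -(addNr u) expRD ler_wpM2l ?expR_ge0//.
      exact: expR_ge1Dx.
    rewrite -(ler_pM2r (_ : 0 < 1 + u)); last by rewrite ltr_pwDl.
    have : 0 <= u ^+ 3 by rewrite exprn_ge0.
    by lra.
  rewrite -/u (_ : v = 2 * 4 ^+ k * u); last by rewrite /u; field; rewrite gt_eqF.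
  rewrite -mulrBr normrM (gtr0_norm k0).
  apply: (@le_trans _ _ (2 * 4 ^+ k * u ^+ 2)).
    by apply: ler_wpM2l; [exact: ltW|rewrite ler_norml; apply/andP; split; lra].
  rewrite exprVn /u le_eqVlt; apply/orP; left; apply/eqP.
  by move: (4 ^+ k : R) (p4 k) => z z0; field; rewrite gt_eqF.
have mono := @cvg_monotone_convergence _ _ _ P setT measurableT
  (fun k o => (f k (Y o))%:E).
have /mono {}mono : forall k, measurable_fun setT (fun o => (f k (Y o))%:E).
  by move=> k; apply/measurable_EFinP; exact: bm_meas.
have /mono {}mono : forall k o, setT o -> (0 <= (f k (Y o))%:E)%E.
  by move=> k o _; rewrite lee_fin.
have /mono {}mono : forall o, setT o -> nondecreasing_seq (fun k => (f k (Y o))%:E).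
  by move=> o _; apply/nondecreasing_seqP => k; rewrite lee_fin.
have limE o : limn (fun k => (f k (Y o))%:E) = ((Y o) ^+ 2)%:E.
  by apply: cvg_lim => //; apply/fine_cvgP; split; [exact: nearW|exact: f_cvg].
have h2 : (\int[P]_o (f k (Y o))%:E)%E @[k --> \oo] --> v%:E.
  rewrite (_ : (fun k => _) = fun k => (\int[P]_o f k (Y o))%:E); last first.
    by apply/funext => k; rewrite (bm_EFin P1).
  by apply/fine_cvgP; split; [exact: nearW|exact: fI_cvg].
transitivity (\int[P]_o limn (fun k => (f k (Y o))%:E))%E.
  by apply: eq_integral => o _; rewrite limE.
exact: (cvg_unique _ mono h2).
Qed.

Lemma gaussian_charf_sq_integrable (Y : T -> R) (v : R) : 0 <= v ->
  measurable_fun setT Y -> gaussian_charf Y v ->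
  P.-integrable setT (EFin \o (fun o => (Y o) ^+ 2)).
Proof.
move=> v0 mY hY; apply/integrableP; split.
  by apply/measurable_EFinP; exact: measurable_funX.
rewrite (eq_integral (fun o => ((Y o) ^+ 2)%:E)); last first.
  by move=> o _ /=; rewrite ger0_norm// sqr_ge0.
by rewrite (gaussian_charf_sq v0)// ltry.
Qed.

(** [n * sin (x / n)] tends to [x] and is dominated by [|x|]. With the phase [- pi / 2] the
    characteristic function says that sines have mean 0. *)
Lemma gaussian_charf_mean (Y : T -> R) (v : R) : 0 <= v -> measurable_fun setT Y ->
  gaussian_charf Y v -> (\int[P]_o (Y o)%:E = 0)%E.
Proof.
move=> v0 mY hY.
have iY : P.-integrable setT (EFin \o (fun o => `|Y o|)).
  have i1 : P.-integrable setT (EFin \o (fun o => 1 + (Y o) ^+ 2)).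
    have := integrableD measurableT (bm_integrable P1 (bm_cst 1))
      (gaussian_charf_sq_integrable v0 mY hY).
    by apply: eq_integrable => // o _ /=; rewrite EFinD.
  apply: le_integrable i1 => //.
    by apply/measurable_EFinP; exact: measurableT_comp.
  move=> o _ /=; rewrite lee_fin normr_id [leRHS]ger0_norm; last first.
    by rewrite addr_ge0// sqr_ge0.
  rewrite -[_ ^+ 2]real_normK ?num_real//; move: (`|Y o|) => y.
  have := sqr_ge0 (y - 1); have := sqr_ge0 (y + 1); lra.
pose g (n : nat) (x : R) : R := n.+1%:R * sin (x / n.+1%:R).
have n0 (n : nat) : (0 : R) < n.+1%:R by rewrite ltr0n.
have gle n x : `|g n x| <= `|x|.
  rewrite /g normrM (gtr0_norm (n0 n)).
  apply: le_trans (ler_wpM2l (ltW (n0 n)) (norm_sin_le _)) _.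
  by rewrite normrM normfV (gtr0_norm (n0 n)) mulrCA divff ?mulr1// gt_eqF.
have g_cvg x : g n x @[n --> \oo] --> x.
  have h : `|x| ^+ 3 / 6 * n.+1%:R^-1 @[n --> \oo] --> `|x| ^+ 3 / 6 * 0.
    by apply: cvgM; [exact: cvg_cst|exact: cvg_invS].
  rewrite mulr0 in h; apply/cvgnP => e e0; move/cvgnP: h => /(_ _ e0)[N hN].
  exists N => n /hN; rewrite subr0 => /(le_trans (ler_norm _)); apply: le_trans.
  have h1 := sin_taylor (x / n.+1%:R).
  rewrite (_ : g n x - x = n.+1%:R * (sin (x / n.+1%:R) - x / n.+1%:R)); last first.
    by rewrite /g; move: (n.+1%:R : R) (n0 n) => y y0; field; rewrite gt_eqF.
  rewrite normrM (gtr0_norm (n0 n)); apply: le_trans (ler_wpM2l (ltW (n0 n)) h1) _.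
  rewrite normrM normfV (gtr0_norm (n0 n)).
  have n1 : (1 : R) <= n.+1%:R by rewrite ler1n.
  move: (n.+1%:R : R) (n0 n) n1 (`|x|) (normr_ge0 x) => y y0 y1 z z0.
  rewrite (_ : y * _ = z ^+ 3 / 6 * y^-1 * y^-1); last by field; rewrite gt_eqF.
  rewrite ler_piMr ?mulr_ge0 ?exprn_ge0 ?invr_ge0 ?(ltW y0)//.
  by rewrite invf_le1.
have bs (n : nat) : bm (fun o => sin (Y o / n.+1%:R)).
  by apply: bm_sin; exact: measurable_funM.
have gI n : (\int[P]_o (g n (Y o))%:E = 0)%E.
  rewrite (bm_EFin P1); last exact: bmZ.
  rewrite (bmIZ P1)//.
  have := hY (- (pi / 2)) n.+1%:R^-1.
  rewrite cosN cos_pihalf mulr0 => h.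
  rewrite (eq_Rintegral _ (g := fun o => cos (- (pi / 2) + n.+1%:R^-1 * Y o))).
    by rewrite h mulr0.
  by move=> o _; rewrite addrC cosBpihalf mulrC.
have mYE : measurable_fun setT (fun o => (Y o)%:E) by exact/measurable_EFinP.
have [] := @dominated_convergence _ _ _ P setT measurableT
  (fun n o => (g n (Y o))%:E) (fun o => (Y o)%:E) (EFin \o (fun o => `|Y o|)) _ mYE _ iY _.
- by move=> n; apply/measurable_EFinP; apply: bm_meas; exact: bmZ.
- apply: aeW => o _; apply/fine_cvgP; split; first exact: nearW.
  exact: g_cvg.
- by apply: aeW => o n _ /=; rewrite lee_fin.
move=> _ _ h; apply: (cvg_unique _ h) => //=.
by under eq_fun do rewrite gI; exact: cvg_cst.
Qed.

Lemma gaussian_charf_cov (Y Z : T -> R) (v1 v2 : R) : 0 <= v1 -> 0 <= v2 ->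
  measurable_fun setT Y -> measurable_fun setT Z ->
  gaussian_charf (fun o => Y o + Z o) v1 -> gaussian_charf (fun o => Y o - Z o) v2 ->
  (\int[P]_o (Y o * Z o)%:E = ((v1 - v2) / 4)%:E)%E.
Proof.
move=> v10 v20 mY mZ h1 h2.
have mD := measurable_funD mY mZ; have mB := measurable_funB mY mZ.
have i1 := gaussian_charf_sq_integrable v10 mD h1.
have i2 := gaussian_charf_sq_integrable v20 mB h2.
have e1 := gaussian_charf_sq v10 mD h1; have e2 := gaussian_charf_sq v20 mB h2.
have j1 := integrableZl measurableT 4^-1 i1.
have j2 := integrableZl measurableT 4^-1 i2.
rewrite (eq_integral (fun o => (4^-1)%:E * ((Y o + Z o) ^+ 2)%:E -
   (4^-1)%:E * ((Y o - Z o) ^+ 2)%:E)%E); last first.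
  by move=> o _; rewrite -!EFinM -EFinB; congr EFin; field.
by rewrite integralB//= !integralZl//= e1 e2 -!EFinM -EFinB; congr EFin; field.
Qed.
End gaussian_charf.

(** A limit of continuous functions that is correct at 0 as well, where the inverse is 0 by
    convention. *)
Lemma measurable_inv (R : realType) : measurable_fun setT (fun x : R => x^-1).
Proof.
pose h (k : nat) (x : R) := x * (x ^+ 2 + k.+1%:R^-1)^-1.
have d0 k (x : R) : 0 < x ^+ 2 + k.+1%:R^-1 by rewrite ltr_wpDl ?sqr_ge0.
apply: (@measurable_fun_cvg _ _ _ setT h) => [k|x _].
  apply: continuous_measurable_fun => x.
  apply: cvgM; first exact: cvg_id.
  apply: cvgV; first by rewrite gt_eqF.
  by apply: cvgD; [exact: exprn_continuous|exact: cvg_cst].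
have [->|x0] := eqVneq x 0.
  by rewrite invr0; under eq_fun do rewrite /h mul0r; exact: cvg_cst.
rewrite (_ : x^-1 = x * (x ^+ 2 + 0)^-1); last by field.
apply: cvgM; first exact: cvg_cst.
apply: cvgV; first by rewrite addr0 sqrf_eq0.
by apply: cvgD; [exact: cvg_cst|exact: cvg_invS].
Qed.

(** * Standard parts of sequences of unbounded variables *)

Section loeb_field.
Context {d} {T : measurableType d} {R : realType}.
Variables (P : probability T R) (I : Type) (X : nat -> I -> T -> R).
Hypothesis bX : forall n i, bm (X n i).
Hypothesis sqX : forall i, exists A : R, forall n, \int[P]_o (X n i o) ^+ 2 <= A.

Let P1 : P setT = 1%E. Proof. exact: probability_setT. Qed.
Let L1 : loeb_measure P setT = 1%E. Proof. exact: probability_setT. Qed.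

Local Notation loeb_type := (g_sigma_algebraType (@measurable _ (loeb T))).

(** A homeomorphism of the line onto (-1, 1) with inverse [unsquash]: it makes the variables
    bounded, so that their ultralimits exist and [loeb_lift] applies. *)
Let squash (v : R) : R := v / (1 + `|v|).
Let unsquash (y : R) : R := y / (1 - `|y|).

Let den (v : R) : 0 < 1 + `|v|. Proof. by rewrite ltr_pwDl. Qed.

Let norm_squash v : `|squash v| = 1 - (1 + `|v|)^-1.
Proof.
rewrite /squash normrM normfV (gtr0_norm (den v)).
by have := den v; move: (`|v|) => y y0; field; rewrite gt_eqF.
Qed.

Let squash_lt1 v : `|squash v| < 1.
Proof. by rewrite norm_squash ltrBlDr ltrDl invr_gt0 den. Qed.

Let squashK v : unsquash (squash v) = v.
Proof.
rewrite /unsquash norm_squash /squash (_ : 1 - (1 - _) = (1 + `|v|)^-1); last by ring.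
by rewrite invrK divfK// gt_eqF// den.
Qed.

Let squash_ge (K v : R) : 0 <= K -> 1 - (1 + K)^-1 <= `|squash v| -> K <= `|v|.
Proof.
move=> K0; rewrite norm_squash lerD2l lerN2 lef_pV2 ?posrE ?den//.
  by rewrite lerD2l.
by rewrite ltr_pwDl.
Qed.

Let unsquash_dist (x y : R) : `|y| < 1 -> `|x - y| <= (1 - `|y|) / 2 ->
  `|unsquash x - unsquash y| <= 2 / (1 - `|y|) ^+ 2 * `|x - y|.
Proof.
move=> y1 xy; have D0 : 0 < 1 - `|y| by rewrite subr_gt0.
have xy' : `|x| - `|y| <= `|x - y| by exact: lerB_dist.
have E0 : (1 - `|y|) / 2 <= 1 - `|x| by lra.
have E1 : 0 < 1 - `|x| by apply: lt_le_trans E0; rewrite divr_gt0.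
have -> : unsquash x - unsquash y =
    ((x - y) * (1 - `|y|) + y * (`|x| - `|y|)) / ((1 - `|x|) * (1 - `|y|)).
  by rewrite /unsquash; move: E1 D0; move: (`|x|) (`|y|) => u v u0 v0; field;
    rewrite !gt_eqF.
rewrite normrM normfV (gtr0_norm (mulr_gt0 E1 D0)) ler_pdivrMr ?mulr_gt0//.
have h1 : `|(x - y) * (1 - `|y|) + y * (`|x| - `|y|)| <= `|x - y|.
  apply: le_trans (ler_normD _ _) _; rewrite !normrM (gtr0_norm D0).
  apply: (@le_trans _ _ (`|x - y| * (1 - `|y|) + `|y| * `|x - y|)); last by lra.
  by rewrite lerD2l ler_wpM2l// ler_dist_dist.
apply: le_trans h1 _.
have h2 : 1 <= 2 / (1 - `|y|) ^+ 2 * ((1 - `|x|) * (1 - `|y|)).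
  apply: (@le_trans _ _ (2 / (1 - `|y|) ^+ 2 * ((1 - `|y|) / 2 * (1 - `|y|)))).
    by rewrite le_eqVlt; apply/orP; left; apply/eqP; field; rewrite gt_eqF.
  apply: ler_wpM2l; first by rewrite divr_ge0// sqr_ge0.
  by apply: ler_wpM2r => //; exact: ltW.
by rewrite mulrAC -[leLHS]mul1r ler_wpM2r.
Qed.

Let Y i : loeb_type -> R := standard_part (fun n o => squash (X n i o)).

Definition loeb_limit i (z : loeb_type) : R := unsquash (Y i z).

Let msquash n i : measurable_fun setT (fun o => squash (X n i o)).
Proof.
have mX := bm_meas (bX n i).
have ms : measurable_fun setT squash.
  apply: continuous_measurable_fun => x.
  apply: cvgM; first exact: cvg_id.
  apply: cvgV; first by rewrite gt_eqF// den.
  by apply: cvgD; [exact: cvg_cst|exact: norm_continuous].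
exact: (measurableT_comp ms mX).
Qed.

Let squash1 n i o : `|squash (X n i o)| <= 1. Proof. exact: ltW. Qed.

Let bY i : bm (Y i).
Proof. by have [] := loeb_lift P (fun n => msquash n i) (fun n => squash1 n i). Qed.

Lemma loeb_limit_measurable i : measurable_fun setT (loeb_limit i).
Proof.
have mY := bm_meas (bY i).
have md : measurable_fun setT (fun z => 1 - `|Y i z|).
  by apply: measurable_funB => //; exact: measurableT_comp.
have h := measurable_funM mY (measurableT_comp (@measurable_inv R) md).
exact: h.
Qed.

(** The points at which the sequence escapes to infinity along the ultrafilter. There [unsquash]
    divides by 0 and the limit takes the default value 0. *)
Let bad i : set loeb_type := [set z | 1 <= `|Y i z|].

Let mbad i : measurable (bad i).
Proof.
apply: measurable_superlevel; apply: measurableT_comp => //.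
exact: bm_meas (bY i).
Qed.

(** Chebyshev's inequality passed to the Loeb space, with the quotient cut at 1 to stay bounded. *)
Let bad0 i : \int[loeb_measure P]_z \1_(bad i) z = 0.
Proof.
have [A hA] := sqX i.
have A0 : 0 <= A.
  by apply: le_trans (hA 0%N); rewrite Rintegral_ge0// => o _; exact: sqr_ge0.
have key (K : R) : 0 < K -> \int[loeb_measure P]_z \1_(bad i) z <= A / K ^+ 2.
  move=> K0; have K2 : 0 < K ^+ 2 by exact: exprn_gt0.
  pose h n o : R := Num.min 1 (X n i o ^+ 2 / K ^+ 2).
  have h01 n o : 0 <= h n o <= 1.
    by rewrite /h le_min ler01 ge_min lexx/= andbT divr_ge0 ?sqr_ge0// ltW.
  have hb n o : `|h n o| <= 1 by have /andP[? ?] := h01 n o; rewrite ger0_norm.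
  have mh n : measurable_fun setT (h n).
    apply: measurable_minr => //; apply: measurable_funM => //.
    by apply: measurable_funX; exact: bm_meas.
  have [bst Ist] := loeb_lift P mh hb.
  have bh n : bm (h n) by exact: bmP (mh n) (hb n).
  apply: (@le_trans _ _ (\int[loeb_measure P]_z standard_part h z)).
    apply: (bmI_le L1) => //; first exact: bm_indic.
    move=> z; have hz := standard_partP z hb.
    rewrite indicE; have [zb|zb] := pselect (bad i z); last first.
      rewrite memNset//; apply: ucvg_le (ucvg_cst 0) hz _.
      by apply: (ultra_eventually (N := 0%N)) => n _ /=; have /andP[] := h01 n (z n).
    rewrite mem_set//=; apply: ucvg_le (ucvg_cst 1) hz _.
    have e0 : 0 < (1 + K)^-1 by rewrite invr_gt0 ltr_pwDl// ltW.
    have := standard_partP z (fun n => squash1 n i) e0.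
    apply: ultra_sub => n /= hn; rewrite /h le_min lexx/=.
    rewrite ler_pdivlMr// mul1r -[leRHS]real_normK ?num_real//.
    apply: lerXn2r; rewrite ?nnegrE ?normr_ge0 ?(ltW K0)//.
    apply: squash_ge; first exact: ltW.
    have : `|Y i z| - `|squash (X n i (z n))| <= `|Y i z - squash (X n i (z n))|.
      exact: lerB_dist.
    rewrite distrC => /le_trans/(_ hn); move: zb; rewrite /bad /=; lra.
  have Ib n : `|\int[P]_o h n o| <= 1 by exact: bmI_bound.
  rewrite Ist; apply: ucvg_le (ulimP Ib) (ucvg_cst _) _.
  apply: (ultra_eventually (N := 0%N)) => n _ /=.
  apply: (@le_trans _ _ (\int[P]_o ((K ^+ 2)^-1 * X n i o ^+ 2))).
    apply: (bmI_le P1) => //; first by apply: bmZ; exact: bmX.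
    by move=> o; rewrite /h mulrC ge_min lexx orbT.
  rewrite (bmIZ P1); last exact: bmX.
  by rewrite mulrC ler_wpM2r// invr_ge0 ltW.
apply/eqP; rewrite eq_le; apply/andP; split; last first.
  by apply: Rintegral_ge0 => z _; rewrite indicE ler0n.
apply/ler_addgt0Pl => e e0; rewrite addr0.
(* With this choice [A <= e * K <= e * K ^+ 2], since [K >= 1]. *)
pose K := 1 + A / e.
have Ae : 0 <= A / e by rewrite divr_ge0// ltW.
have K1 : 1 <= K by rewrite lerDl.
have K0 : 0 < K by exact: lt_le_trans K1.
apply: le_trans (key K K0) _; rewrite ler_pdivrMr ?exprn_gt0//.
apply: (@le_trans _ _ (e * K)).
  by rewrite /K mulrDr mulr1 mulrCA divff ?gt_eqF// mulr1 lerDr ltW.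
by apply: ler_wpM2l; [exact: ltW|rewrite expr2 ler_peMl// ltW].
Qed.

Let limitP i z : ~ bad i z -> ucvg (fun n => X n i (z n)) (loeb_limit i z).
Proof.
move=> zb; have y1 : `|Y i z| < 1 by rewrite ltNge; apply/negP.
have D0 : 0 < 1 - `|Y i z| by rewrite subr_gt0.
move=> e e0; pose c := 2 / (1 - `|Y i z|) ^+ 2.
have c0 : 0 < c by rewrite divr_gt0// exprn_gt0.
pose del := Num.min ((1 - `|Y i z|) / 2) (e / c).
have del0 : 0 < del by rewrite lt_min (divr_gt0 D0)// divr_gt0.
have := standard_partP z (fun n => squash1 n i) del0.
apply: ultra_sub => n /=; rewrite le_min => /andP[h1 h2].
rewrite -[X n i (z n)]squashK; apply: le_trans (unsquash_dist y1 h1) _.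
by rewrite -/c mulrC -ler_pdivlMr.
Qed.

(** Off the null sets [bad] the cosine of the limits is the standard part of the cosines; its Loeb
    integral is the ultralimit of the integrals, equal to the ordinary limit when there is one. *)
Lemma loeb_limit_charf m (F : 'I_m -> I) (t : 'I_m -> R) (a l : R) :
  \int[P]_o cos (a + \sum_(i < m) t i * X n (F i) o) @[n --> \oo] --> l ->
  \int[loeb_measure P]_z cos (a + \sum_(i < m) t i * loeb_limit (F i) z) = l.
Proof.
move=> hl; pose f n o : R := cos (a + \sum_(i < m) t i * X n (F i) o).
have mf n : measurable_fun setT (f n).
  apply: bm_meas; apply: bm_cos; apply: measurable_funD => //.
  by apply: measurable_sum => i; apply: measurable_funM => //; exact: bm_meas.
have fb n o : `|f n o| <= 1 by rewrite ler_norml cos_geN1 cos_le1.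
have [bst Ist] := loeb_lift P mf fb.
have bc : bm (fun z => cos (a + \sum_(i < m) t i * loeb_limit (F i) z)).
  apply: bm_cos; apply: measurable_funD => //; apply: measurable_sum => i.
  by apply: measurable_funM => //; exact: loeb_limit_measurable.
rewrite -(ulimE (cvg_ucvg hl)) -Ist.
apply/eqP; rewrite -subr_eq0 -normr_le0 -(bmIB L1)//.
apply: (@le_trans _ _ (\int[loeb_measure P]_z (2 * \sum_(i < m) \1_(bad (F i)) z))).
  apply: (bmI_norm_le L1); first exact: bmB.
    by apply: bmZ; apply: bm_sum => i; exact: bm_indic.
  move=> z; have [h|h] := pselect (forall i, ~ bad (F i) z).
    rewrite [X in _ - X](_ : _ = cos (a + \sum_(i < m) t i * loeb_limit (F i) z)).
      rewrite subrr normr0 mulr_ge0//; apply: sumr_ge0 => i _.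
      by rewrite indicE ler0n.
    apply: ulimE => e e0.
    have hs : ucvg (fun n => \sum_(i < m) t i * X n (F i) (z n))
        (\sum_(i < m) t i * loeb_limit (F i) z).
      by apply: ucvg_sum => i; apply: ucvgZ; apply: limitP; exact: h.
    apply: ultra_sub (hs _ e0) => n /= hn; apply: le_trans (cos_lip _ _) _.
    by rewrite opprD addrACA subrr add0r.
  move: h => /existsNP[i /contrapT h].
  apply: (@le_trans _ _ (2 * 1)).
    apply: le_trans (ler_normB _ _) _; rewrite mulr1.
    have h1 : `|cos (a + \sum_(i < m) t i * loeb_limit (F i) z)| <= 1.
      by rewrite ler_norml cos_geN1 cos_le1.
    have h2 : `|standard_part f z| <= 1.
      rewrite ler_norml; have hz := standard_partP z fb; apply/andP; split.
        apply: ucvg_le (ucvg_cst (-1)) hz _.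
        by apply: (ultra_eventually (N := 0%N)) => n _ /=; exact: cos_geN1.
      apply: ucvg_le hz (ucvg_cst 1) _.
      by apply: (ultra_eventually (N := 0%N)) => n _ /=; exact: cos_le1.
    lra.
  rewrite ler_wpM2l// (bigD1 i)//= indicE mem_set//= lerDl; apply: sumr_ge0 => j _.
  by rewrite indicE ler0n.
rewrite (bmIZ L1); last by apply: bm_sum => i; exact: bm_indic.
rewrite (bmI_sum L1); last by move=> i; exact: bm_indic.
by rewrite big1 ?mulr0// => i _; exact: bad0.
Qed.
End loeb_field.

(** * Quadratic structure of the limiting variance *)

Section limit_covariance.
Context {d} {E : measurableType d} {R : realType}.
Variables (K : R.-pker E ~> E) (mu : probability E R) (N : nat) (b : R).
Hypotheses (N0 : (0 < N)%N) (b01 : 0 <= b < 1).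
Hypotheses (contrK : contracts K N b) (invK : invariant_law mu K).

Let mu1 : mu setT = 1%E. Proof. exact: probability_setT. Qed.
Let K1 x : K x setT = 1%E. Proof. exact: prob_kernel. Qed.

Let rcvg f x : bm f ->
  series (fun n => iter n (kop K) f x - \int[mu]_y f y) n @[n --> \oo]
    --> resolvent K mu f x.
Proof. exact: (resolvent_cvg N0 b01 contrK invK). Qed.

Lemma resolventB f g x : bm f -> bm g ->
  resolvent K mu (fun y => f y - g y) x = resolvent K mu f x - resolvent K mu g x.
Proof.
move=> bf bg.
pose u f n := series (fun n => iter n (kop K) f x - \int[mu]_y f y) n.
have h : u f n - u g n @[n --> \oo] --> resolvent K mu f x - resolvent K mu g x.
  by apply: cvgB; exact: rcvg.
have h3 : u (fun y => f y - g y) n @[n --> \oo] --> resolvent K mu (fun y => f y - g y) x.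
  by apply: rcvg; exact: bmB.
suff e n : u (fun y => f y - g y) n = u f n - u g n.
  have h' : u (fun y => f y - g y) n @[n --> \oo] -->
      resolvent K mu f x - resolvent K mu g x.
    by apply: cvg_trans h; apply: near_eq_cvg; apply: nearW => n; rewrite e.
  exact: (cvg_unique _ h3 h').
rewrite /u /series/= -sumrB; apply: eq_bigr => i _.
by rewrite iter_kopB// (bmIB mu1)//; ring.
Qed.

Lemma resolventZ (r : R) f x : bm f ->
  resolvent K mu (fun y => r * f y) x = r * resolvent K mu f x.
Proof.
move=> bf.
pose u f n := series (fun n => iter n (kop K) f x - \int[mu]_y f y) n.
have h : r * u f n @[n --> \oo] --> r * resolvent K mu f x.
  by apply: cvgM; [exact: cvg_cst|exact: rcvg].
have h3 : u (fun y => r * f y) n @[n --> \oo] --> resolvent K mu (fun y => r * f y) x.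
  by apply: rcvg; exact: bmZ.
suff e n : u (fun y => r * f y) n = r * u f n.
  have h' : u (fun y => r * f y) n @[n --> \oo] --> r * resolvent K mu f x.
    by apply: cvg_trans h; apply: near_eq_cvg; apply: nearW => n; rewrite e.
  exact: (cvg_unique _ h3 h').
rewrite /u /series/= mulr_sumr; apply: eq_bigr => i _.
by rewrite iter_kopZ// (bmIZ mu1)//; ring.
Qed.

Lemma resolventD f g x : bm f -> bm g ->
  resolvent K mu (fun y => f y + g y) x = resolvent K mu f x + resolvent K mu g x.
Proof.
move=> bf bg; rewrite (_ : (fun y => _) = fun y => f y - (-1) * g y); last first.
  by apply/funext => y; ring.
by rewrite resolventB ?resolventZ//; [ring|exact: bmZ].
Qed.

Let Rf f := resolvent K mu f.

Let Rbm f : bm f -> bm (Rf f).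
Proof. exact: (resolvent_bm N0 b01 contrK invK). Qed.

Lemma local_covarianceE f g x : bm f -> bm g ->
  local_covariance K mu f g x =
  kop K (fun y => Rf f y * Rf g y) x - kop K (Rf f) x * kop K (Rf g) x.
Proof.
move=> bf bg; have bF := Rbm bf; have bG := Rbm bg.
rewrite /local_covariance -/(Rf f) -/(Rf g).
set p := kop K (Rf f) x; set q := kop K (Rf g) x.
transitivity (kop K (fun y => (Rf f y * Rf g y + (- q) * Rf f y) +
    ((- p) * Rf g y + p * q)) x).
  by congr kop; apply/funext => y; ring.
rewrite kopD; [|by apply: bmD; [exact: bmM|exact: bmZ]|
  by apply: bmD; [exact: bmZ|exact: bm_cst]].
rewrite kopD; [|exact: bmM|exact: bmZ].
rewrite kopD; [|exact: bmZ|exact: bm_cst].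
have kopZ (r : R) h : bm h -> kop K (fun y => r * h y) x = r * kop K h x.
  by move=> bh; exact: (bmIZ (K1 x)).
by rewrite (kopZ (- q) (Rf f))// (kopZ (- p) (Rf g))// kop_cst -/p -/q; ring.
Qed.

Lemma local_covariance_bm f g : bm f -> bm g -> bm (local_covariance K mu f g).
Proof.
move=> bf bg; have bF := Rbm bf; have bG := Rbm bg.
rewrite (_ : local_covariance K mu f g = fun x =>
  kop K (fun y => Rf f y * Rf g y) x - kop K (Rf f) x * kop K (Rf g) x); last first.
  by apply/funext => x; rewrite local_covarianceE.
apply: bmB; first by apply: kop_bm; exact: bmM.
by apply: bmM; exact: kop_bm.
Qed.

Lemma var_limitZ (r : R) f : bm f ->
  var_limit K mu (fun y => r * f y) = r ^+ 2 * var_limit K mu f.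
Proof.
move=> bf; rewrite /var_limit -(bmIZ mu1); last exact: (cov_limit_bm N0 b01 contrK invK).
apply: eq_Rintegral => x _; rewrite /cov_limit.
have -> : resolvent K mu (fun y => r * f y) = fun y => r * Rf f y.
  by apply/funext => y; rewrite resolventZ.
have bF := Rbm bf.
have kopZ (s : R) h : bm h -> kop K (fun y => s * h y) x = s * kop K h x.
  by move=> bh; exact: (bmIZ (K1 x)).
rewrite (_ : (fun y => _) = fun y => r ^+ 2 * Rf f y ^+ 2); last first.
  by apply/funext => y; rewrite exprMn.
by rewrite !kopZ//; [rewrite -/(Rf f); ring|exact: bmX].
Qed.

Lemma var_limit_polarization f g : bm f -> bm g ->
  var_limit K mu (fun y => f y + g y) - var_limit K mu (fun y => f y - g y) =
  4 * \int[mu]_x local_covariance K mu f g x.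
Proof.
move=> bf bg; have bF := Rbm bf; have bG := Rbm bg.
rewrite /var_limit -(bmIB mu1); [|by apply: (cov_limit_bm N0 b01 contrK invK); exact: bmD|
  by apply: (cov_limit_bm N0 b01 contrK invK); exact: bmB].
rewrite -(bmIZ mu1); last exact: local_covariance_bm.
apply: eq_Rintegral => x _; rewrite /cov_limit local_covarianceE//.
have -> : resolvent K mu (fun y => f y + g y) = fun y => Rf f y + Rf g y.
  by apply/funext => y; rewrite resolventD.
have -> : resolvent K mu (fun y => f y - g y) = fun y => Rf f y - Rf g y.
  by apply/funext => y; rewrite resolventB.
rewrite kopD// kopB//.
have h : kop K (fun y => (Rf f y + Rf g y) ^+ 2) x -
    kop K (fun y => (Rf f y - Rf g y) ^+ 2) x = 4 * kop K (fun y => Rf f y * Rf g y) x.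
  rewrite -kopB; [|by apply: bmX; exact: bmD|by apply: bmX; exact: bmB].
  rewrite {2}/kop -(bmIZ (K1 x)); last exact: bmM.
  by apply: eq_Rintegral => y _; ring.
rewrite mulrBr -h; move: (kop _ _ _) (kop _ _ _) (kop _ _ _) (kop _ _ _) => y1 y2 y3 y4.
ring.
Qed.
End limit_covariance.

Lemma expectationE {R : realType} {d} {T : measurableType d} (mu : probability T R)
    (f : T -> R) : 'E_mu[f]%E = (\int[mu]_x (f x)%:E)%E.
Proof. by rewrite unlock. Qed.

(** * Limit fields *)

Section limit_fields.
Context {R : realType} {d : nat -> measure_display}
  {S : forall l, measurableType (d l)}.
Variables (pi nu : forall l, probability (S l) R).
Variable Phi : forall k, probability (S k) R -> probability (S k.+1) R.
Arguments Phi : clear implicits.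
Variable M0 : R.-pker (S 0%N) ~> (S 0%N).
Variable M : forall k, probability (S k) R -> R.-pker (S k.+1) ~> (S k.+1).
Arguments M : clear implicits.
Hypothesis Phi_pi : forall k (A : set (S k.+1)), measurable A ->
  Phi k (pi k) A = pi k.+1 A.
Hypothesis M0_inv : invariant_law (pi 0%N) M0.
Hypothesis M_inv : forall k mu, invariant_law (Phi k mu) (M k mu).
Context {dO : measure_display} {Omega : measurableType dO}.
Variables (P : probability Omega R) (X : forall l, nat -> {RV P >-> S l}).
Hypothesis X_imcmc : is_imcmc X nu M0 M.
Hypotheses (reg2 : R2 M0 M) (reg3 : R3 M).
Variable w : nat -> nat -> nat -> R.
Hypothesis hw : forall l, weights (w l).

Let P1 : P setT = 1%E. Proof. exact: probability_setT. Qed.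

Let I : Type := {l & bmfun (S l) R}.

Let field n l (f : S l -> R) := weighted_field X nu (pi 0%N) Phi w n f.
Let Vn n (i : I) : Omega -> R := field n (projT2 i).
Let var l (f : S l -> R) : R := level_var pi Phi M0 M f.

(** Indices carry their level, so that the function must be transported to read it at a given [l].
    The value 0 at other levels lets a mixed family be treated level by level. *)
Definition at_level l (i : {l & bmfun (S l) R}) : S l -> R :=
  match pselect (projT1 i = l) with
  | left e => eq_rect (projT1 i) (fun k => S k -> R) (projT2 i) l e
  | right _ => fun=> 0
  end.

Arguments at_level : clear implicits.

Lemma at_level_same (i : I) : at_level (projT1 i) i = projT2 i.
Proof.
rewrite /at_level; case: pselect => // e.
by rewrite (eq_irrelevance e erefl).
Qed.

Lemma at_level_neq l (i : I) : projT1 i <> l -> at_level l i = fun=> 0.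
Proof. by rewrite /at_level; case: pselect. Qed.

Lemma at_level_bm l (i : I) : bm (at_level l i).
Proof.
have [<-|/at_level_neq ->] := pselect (projT1 i = l); last exact: bm_cst.
by rewrite at_level_same; exact: bmfun_bm.
Qed.

Lemma field_linear n l m (t : 'I_m -> R) (f : 'I_m -> S l -> R) o :
  (forall i, bm (f i)) ->
  field n (fun x => \sum_(i < m) t i * f i x) o = \sum_(i < m) t i * field n (f i) o.
Proof.
move=> bf; rewrite /field /weighted_field.
under [RHS]eq_bigr do rewrite mulr_sumr.
rewrite exchange_big; apply: eq_bigr => p _ /=.
under [RHS]eq_bigr do rewrite mulrCA.
rewrite -mulr_sumr; congr (_ * _); rewrite /local_error.
have Isum (mu : probability (S l) R) :
    \int[mu]_x (\sum_(i < m) t i * f i x) = \sum_(i < m) t i * \int[mu]_x f i x.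
  have mu1 : mu setT = 1%E by exact: probability_setT.
  rewrite (bmI_sum mu1); last by move=> i; exact: bmZ.
  by apply: eq_bigr => i _; rewrite (bmIZ mu1).
by case: p => [|p]; rewrite Isum -sumrB; apply: eq_bigr => i _; rewrite mulrBr.
Qed.

Lemma field0 n l o : field n (fun _ : S l => 0 : R) o = 0.
Proof.
rewrite /field /weighted_field big1// => p _; rewrite /local_error.
have I0 (mu : probability (S l) R) : \int[mu]_x (0 : R) = 0.
  by rewrite bmI_cst//; exact: probability_setT.
by case: p => [|p]; rewrite I0 subrr mulr0.
Qed.

Section family.
Variables (m : nat) (F : 'I_m -> I).

Let comb (t : 'I_m -> R) l : S l -> R := fun x => \sum_(i < m) t i * at_level l (F i) x.

Arguments comb : clear implicits.

Let comb_bm t l : bm (comb t l).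
Proof. by apply: bm_sum => i; apply: bmZ; exact: at_level_bm. Qed.

(** Linearity of the fields collects a combination over mixed levels into one test function per
    level, the form in which [field_charf] applies. *)
Lemma family_field (L : nat) (t : 'I_m -> R) n o : (forall i, (projT1 (F i) < L)%N) ->
  \sum_(i < m) t i * Vn n (F i) o = \sum_(0 <= l < L) field n (comb t l) o.
Proof.
move=> FL; rewrite big_mkord.
under [RHS]eq_bigr => l _.
  rewrite field_linear; last by move=> i; exact: at_level_bm.
  over.
rewrite exchange_big; apply: eq_bigr => i _ /=; rewrite -mulr_sumr; congr (_ * _).
rewrite (bigD1 (Ordinal (FL i)))//= at_level_same big1 ?addr0// => l lF.
rewrite at_level_neq ?field0// => e.
by move/eqP: lF; apply; apply: val_inj; rewrite /= e.
Qed.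

Definition family_var (L : nat) (t : 'I_m -> R) : R := \sum_(0 <= l < L) var (comb t l).

Lemma family_charf (L : nat) (t : 'I_m -> R) (a : R) : (forall i, (projT1 (F i) < L)%N) ->
  \int[P]_o cos (a + \sum_(i < m) t i * Vn n (F i) o) @[n --> \oo] -->
  expR (- (family_var L t / 2)) * cos a.
Proof.
move=> FL.
have h := field_charf Phi_pi M0_inv M_inv X_imcmc reg2 reg3 hw (m := L) (a := a)
  (fun l => comb_bm t l).
apply: cvg_trans h; apply: near_eq_cvg; apply: nearW => n /=.
by apply: eq_Rintegral => o _; rewrite (family_field t n o FL).
Qed.
End family.

Let Vn_bm n i : bm (Vn n i).
Proof. exact: (field_bm M0_inv M_inv X_imcmc reg2 w n (bmfun_bm (projT2 i))). Qed.

Let Vn_sq i : exists A : R, forall n, \int[P]_o (Vn n i o) ^+ 2 <= A.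
Proof. exact: (field_sq M0_inv M_inv X_imcmc reg2 reg3 hw (bmfun_bm (projT2 i))). Qed.

Let Q := loeb_measure P.
Let V (i : I) := loeb_limit Vn i.

Let Q1 : Q setT = 1%E. Proof. exact: probability_setT. Qed.

Let mV i : measurable_fun setT (V i).
Proof. exact: loeb_limit_measurable. Qed.

Lemma limit_charf m (F : 'I_m -> I) (L : nat) (t : 'I_m -> R) (a : R) :
  (forall i, (projT1 (F i) < L)%N) ->
  \int[Q]_z cos (a + \sum_(i < m) t i * V (F i) z) =
  expR (- (family_var F L t / 2)) * cos a.
Proof.
by move=> FL; apply: loeb_limit_charf => //; exact: family_charf.
Qed.

Let var0 l : var (fun _ : S l => 0) = 0.
Proof.
have [N [b [N0 b01 _ contrpi]]] := level_contracts pi X reg2 l.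
have invpi : invariant_law (level_Phi (pi 0%N) Phi pi l) (level_M M0 M pi l).
  by case: l {contrpi} => [|k]; [exact: M0_inv|exact: M_inv].
have := var_limitZ N0 b01 contrpi invpi 0 (bm_cst (1 : R)).
by rewrite expr2 !mul0r.
Qed.

Lemma level_charf l m (f : 'I_m -> bmfun (S l) R) (t : 'I_m -> R) (a : R) :
  \int[Q]_z cos (a + \sum_(i < m) t i * V (existT _ l (f i)) z) =
  expR (- (var (fun x => \sum_(i < m) t i * f i x) / 2)) * cos a.
Proof.
rewrite (@limit_charf m (fun i => existT _ l (f i)) l.+1)//.
congr (expR (- (_ / 2)) * _); rewrite /family_var big_nat_recr//= big_nat big1 ?add0r.
  congr var; apply/funext => x; apply: eq_bigr => i _.
  by have -> := at_level_same (existT _ l (f i)).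
move=> k /andP[_ kl]; apply: etrans (var0 k); congr var; apply/funext => x.
rewrite big1// => i _; rewrite at_level_neq ?mulr0//= => lk.
by rewrite lk ltnn in kl.
Qed.

Let contrpi l := level_contracts pi X reg2 l.

Let invpi l : invariant_law (level_Phi (pi 0%N) Phi pi l) (level_M M0 M pi l).
Proof. by case: l => [|k]; [exact: M0_inv|exact: M_inv]. Qed.

Let varZ l (r : R) (f : S l -> R) : bm f -> var (fun x => r * f x) = r ^+ 2 * var f.
Proof.
move=> bf; have [N [b [N0 b01 _ ct]]] := contrpi l.
exact: (var_limitZ N0 b01 ct (@invpi l) r bf).
Qed.

Let var_ge0 l (f : S l -> R) : bm f -> 0 <= var f.
Proof. by move=> bf; apply: (level_var_ge0 _ _ X) => //. Qed.

Lemma level_gaussian_charf l m (f : 'I_m -> bmfun (S l) R) (t : 'I_m -> R) :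
  gaussian_charf Q (fun z => \sum_(i < m) t i * V (existT _ l (f i)) z)
    (var (fun x => \sum_(i < m) t i * f i x)).
Proof.
move=> a s; have := @level_charf l m f (fun i => s * t i) a.
under eq_Rintegral do under eq_bigr do rewrite -mulrA.
under eq_Rintegral do rewrite -mulr_sumr.
move=> ->; congr (expR (- (_ / 2)) * _).
rewrite mulrC -varZ; last by apply: bm_sum => i; apply: bmZ; exact: bmfun_bm.
congr var; apply/funext => x; rewrite mulr_sumr.
by apply: eq_bigr => i _; rewrite mulrA.
Qed.

Lemma limit_gaussian l m (f : 'I_m -> bmfun (S l) R) (t : 'I_m -> R) :
  gaussian_rv Q (fun z => \sum_(i < m) t i * V (existT _ l (f i)) z).
Proof.
apply: gaussian_charf_law (level_gaussian_charf f t).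
  by apply: var_ge0; apply: bm_sum => i; apply: bmZ; exact: bmfun_bm.
by apply: measurable_sum => i; apply: measurable_funM => //; exact: mV.
Qed.

Lemma limit_mean i : (\int[Q]_z (V i z)%:E = 0)%E.
Proof.
case: i => l f.
have h : gaussian_charf Q (V (existT _ l f)) (var f).
  have := @level_gaussian_charf l 1 (fun=> f) (fun=> 1).
  under [X in gaussian_charf _ X _]eq_fun do rewrite big_ord1 mul1r.
  by under [X in var X]eq_fun do rewrite big_ord1 mul1r.
by apply: gaussian_charf_mean h => //; apply: var_ge0; exact: bmfun_bm.
Qed.

Lemma limit_covariance l (f g : bmfun (S l) R) :
  (\int[Q]_z (V (existT _ l f) z * V (existT _ l g) z)%:E =
   (\int[pi l]_x local_covariance (level_M M0 M pi l)
      (level_Phi (pi 0%N) Phi pi l) f g x)%:E)%E.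
Proof.
have bf := bmfun_bm f; have bg := bmfun_bm g.
have [N [b [N0 b01 _ ct]]] := contrpi l.
(* The values [c = 1] and [c = -1] supply the sum and the difference for polarization. *)
have h (c : R) : gaussian_charf Q
    (fun z => V (existT _ l f) z + c * V (existT _ l g) z) (var (fun x => f x + c * g x)).
  pose fg (i : 'I_2) := if i == ord0 then f else g.
  pose t (i : 'I_2) : R := if i == ord0 then 1 else c.
  have := @level_gaussian_charf l 2 fg t.
  under [X in gaussian_charf _ X _]eq_fun do rewrite !big_ord_recl big_ord0 /fg /t /= mul1r addr0.
  by under [X in var X]eq_fun do rewrite !big_ord_recl big_ord0 /fg /t /= mul1r addr0.
have h1 := h 1; have h2 := h (-1).
have e1 : gaussian_charf Q (fun z => V (existT _ l f) z + V (existT _ l g) z)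
    (var (fun x => f x + g x)).
  move: h1; under [X in gaussian_charf _ X _]eq_fun do rewrite mul1r.
  by under [X in var X]eq_fun do rewrite mul1r.
have e2 : gaussian_charf Q (fun z => V (existT _ l f) z - V (existT _ l g) z)
    (var (fun x => f x - g x)).
  move: h2; under [X in gaussian_charf _ X _]eq_fun do rewrite mulN1r.
  by under [X in var X]eq_fun do rewrite mulN1r.
rewrite (gaussian_charf_cov _ _ _ _ e1 e2)//; [|by apply: var_ge0; exact: bmD|
  by apply: var_ge0; exact: bmB].
congr EFin; rewrite /var /level_var (var_limit_polarization N0 b01 ct (@invpi l))//.
rewrite mulrC mulKf// phipi_int//.
exact: (local_covariance_bm N0 b01 ct (@invpi l)).
Qed.

(** The levels below [n] are separated from level [n] one [n] at a time. The two blocks share no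
    level and the exponent is a sum over levels, so that the characteristic function factors. *)
Lemma limit_independent n (A : nat -> set (g_sigma_algebraType (@measurable _ (loeb Omega)))) :
  (forall l, (l < n)%N ->
     <<s [set G | exists (f : bmfun (S l) R) (B : set R),
            measurable B /\ G = V (existT _ l f) @^-1` B] >> (A l)) ->
  Q (\bigcap_(l in [set l | (l < n)%N]) A l) = (\prod_(l < n) Q (A l))%E.
Proof.
pose J k (i : I) := (projT1 i < k)%N.
have sub l (J' : I -> Prop) B : (forall i, projT1 i = l -> J' i) ->
    <<s [set G | exists (f : bmfun (S l) R) (B : set R),
            measurable B /\ G = V (existT _ l f) @^-1` B] >> B ->
    <<s ray_sets V J' >> B.
  move=> lJ; move: B; apply: smallest_sub; first exact: smallest_sigma_algebra.
  move=> _ [f [B [mB ->]]]; apply: preimage_ray_sets => //.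
  exact: lJ.
elim: n A => [|n IH] A hA.
  rewrite big_ord0 (_ : \bigcap_(l in _) _ = setT) ?Q1//.
  by apply/seteqP; split=> // z _ l.
rewrite big_ord_recr/= -IH; last by move=> l ln; apply: hA; exact: ltnW.
rewrite (_ : \bigcap_(l in [set l | (l < n.+1)%N]) A l =
  \bigcap_(l in [set l | (l < n)%N]) A l `&` A n); last first.
  apply/seteqP; split=> [z h|z [h1 h2] l /=].
    by split=> [l /= ln|]; apply: h => /=; [exact: ltnW|exact: ltnSn].
  by rewrite ltnS leq_eqVlt => /predU1P[->//|]; exact: h1.
apply: (independent_blocks mV (J1 := J n) (J2 := fun i => projT1 i = n)); last 2 first.
- have mA l : (l < n)%N ->
      measurable (A l : set (g_sigma_algebraType (ray_sets V (J n)))).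
    move=> ln; apply: (sub l); first by move=> i; rewrite /J => ->.
    by apply: hA; exact: ltnW.
  exact: (@fin_bigcap_measurable _ (g_sigma_algebraType (ray_sets V (J n))) _
    [set l | (l < n)%N] A (finite_II n) mA).
- by apply: (sub n) => //; apply: hA.
move=> m1 m2 F G t u JF JG.
have FL i : (projT1 (F i) < n.+1)%N by apply: ltnW; exact: JF.
have GL i : (projT1 (G i) < n.+1)%N by rewrite JG.
exists (expR (- (family_var F n.+1 t / 2))), (expR (- (family_var G n.+1 u / 2))) => a.
split; [|exact: limit_charf|exact: limit_charf].
pose H (k : 'I_(m1 + m2)) : I := match fintype.split k with inl i => F i | inr j => G j end.
pose v (k : 'I_(m1 + m2)) : R := match fintype.split k with inl i => t i | inr j => u j end.
have HL k : (projT1 (H k) < n.+1)%N by rewrite /H; case: fintype.split.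
have sumE (W : I -> R) : \sum_(k < m1 + m2) v k * W (H k) =
    \sum_(i < m1) t i * W (F i) + \sum_(j < m2) u j * W (G j).
  rewrite big_split_ord/=; congr (_ + _); apply: eq_bigr => i _; rewrite /v /H.
    by rewrite split_lshift.
  by rewrite split_rshift.
transitivity (expR (- (family_var H n.+1 v / 2)) * cos a).
  rewrite -(limit_charf v a HL); apply: eq_Rintegral => z _.
  by rewrite (sumE (fun i => V i z)).
congr (_ * _); rewrite -expRD; congr expR; rewrite -opprD -mulrDl; congr (- (_ / _)).
rewrite /family_var -big_split; apply: eq_big_nat => l /andP[_ ln] /=.
have combE : (fun x => \sum_(k < m1 + m2) v k * at_level l (H k) x) =
    (fun x => \sum_(i < m1) t i * at_level l (F i) x + \sum_(j < m2) u j * at_level l (G j) x).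
  by apply/funext => x; rewrite (sumE (fun i => at_level l i x)).
rewrite combE; have [ln'|ln'] := ltnP l n.
  have G0 x : \sum_(j < m2) u j * at_level l (G j) x = 0.
    rewrite big1// => j _; rewrite at_level_neq ?mulr0// JG => e.
    by rewrite e ltnn in ln'.
  under [X in var X + _]eq_fun do idtac.
  rewrite (_ : (fun x => _ + _) = fun x => \sum_(i < m1) t i * at_level l (F i) x); last first.
    by apply/funext => x; rewrite G0 addr0.
  rewrite [X in _ + var X](_ : _ = fun=> 0) ?var0 ?addr0//.
  by apply/funext => x; rewrite G0.
have {ln ln'} -> : l = n by apply/eqP; rewrite eqn_leq ln' -ltnS ln.
have F0 x : \sum_(i < m1) t i * at_level n (F i) x = 0.
  rewrite big1// => i _; rewrite at_level_neq ?mulr0// => e.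
  by have := JF i; rewrite /J e ltnn.
rewrite (_ : (fun x => _ + _) = fun x => \sum_(j < m2) u j * at_level n (G j) x); last first.
  by apply/funext => x; rewrite F0 add0r.
rewrite [X in var X + _](_ : _ = fun=> 0) ?var0 ?add0r//.
by apply/funext => x; rewrite F0.
Qed.

(** The cosine transforms converge by the level induction, with limits realized on the Loeb space;
    second moments give tightness for [fourier_cvg]. *)
Lemma limit_fdd : fdd_cvg P Vn Q V.
Proof.
move=> m F phi cphi bphi; have [C hC] := bounded_fun_bound bphi.
have mVn n i : measurable_fun setT (Vn n (F i)) by exact: bm_meas.
pose L := (\max_(i < m) projT1 (F i)).+1.
have FL i : (projT1 (F i) < L)%N by rewrite ltnS; exact: (leq_bigmax (F := fun i => projT1 (F i)) i).
have tight (e : R) : 0 < e -> exists K : R, forall n,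
    \int[P]_o \1_(out_of_box (fun i => Vn n (F i)) K) o <= e.
  move=> e0; have /choice[A hA] := fun i => Vn_sq (F i).
  pose B := \sum_(i < m) `|A i|.
  have B0 : 0 <= B by exact: sumr_ge0.
  have hB n i : \int[P]_o (Vn n (F i) o) ^+ 2 <= B.
    apply: le_trans (hA i n) _; apply: le_trans (ler_norm _) _.
    by rewrite /B (bigD1 i)//= lerDl; exact: sumr_ge0.
  have mB : 0 <= m%:R * B / e by rewrite divr_ge0 ?mulr_ge0// ltW.
  (* With [K] this value, [m * B <= e * K <= e * K ^+ 2], so that the mass outside the box is at
     most [e]. *)
  exists (1 + m%:R * B / e) => n.
  have K1 : 1 <= 1 + m%:R * B / e by rewrite lerDl.
  have K0 : 0 < 1 + m%:R * B / e by exact: lt_le_trans K1.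
  apply: le_trans (out_of_box_sq P1 _ K0 (fun i => Vn_bm n (F i)) (hB n)) _.
    exact: mVn.
  rewrite ler_pdivrMr ?exprn_gt0//.
  apply: (@le_trans _ _ (e * (1 + m%:R * B / e))).
    by rewrite mulrDr mulr1 mulrCA divff ?gt_eqF// mulr1 lerDr ltW.
  by apply: ler_wpM2l; [exact: ltW|rewrite expr2 ler_peMl// ltW].
have hcos a t : \int[P]_o cos (a + \sum_(i < m) t i * Vn n (F i) o) @[n --> \oo] -->
    \int[Q]_z cos (a + \sum_(i < m) t i * V (F i) z).
  by rewrite (limit_charf t a FL); exact: family_charf.
have := fourier_cvg P1 Q1 mVn (fun i => mV (F i)) tight hcos cphi hC.
have EQ : 'E_Q[fun z => phi (\row_i V (F i) z)]%E =
    (\int[Q]_z phi (\row_i V (F i) z))%:E.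
  rewrite expectationE (bm_EFin Q1)//.
  exact: (vector_bm (fun i => mV (F i)) cphi hC).
have EP n : 'E_P[fun o => phi (\row_i Vn n (F i) o)]%E =
    (\int[P]_o phi (\row_i Vn n (F i) o))%:E.
  rewrite expectationE (bm_EFin P1)//.
  exact: (vector_bm (mVn n) cphi hC).
move=> h; rewrite EQ; under eq_cvg do rewrite EP.
by apply/fine_cvgP; split; [exact: nearW|exact: h].
Qed.
End limit_fields.

Lemma measurable_mfun {R : realType} {d} {T : measurableType d} (f : T -> R) :
  measurable_fun setT f -> exists g : {mfun T >-> R}, g = f :> (T -> R).
Proof.
move=> mf; pose m := isMeasurableFun.Build _ _ _ _ f mf.
by pose g : {mfun T >-> R} := HB.pack f m; exists g.
Qed.

Theorem theorem4p2 (R : realType) (d : nat -> measure_display)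
  (S : forall l, measurableType (d l))
  (pi nu : forall l, probability (S l) R)
  (Phi : forall k, probability (S k) R -> probability (S k.+1) R)
  (M0 : R.-pker (S 0%N) ~> (S 0%N))
  (M : forall k, probability (S k) R -> R.-pker (S k.+1) ~> (S k.+1))
  (Phi_pi : forall k (A : set (S k.+1)), measurable A ->
     Phi k (pi k) A = pi k.+1 A)
  (M0_inv : invariant_law (pi 0%N) M0)
  (M_inv : forall k mu, invariant_law (Phi k mu) (M k mu))
  (dO : measure_display) (Omega : measurableType dO) (P : probability Omega R)
  (X : forall l, nat -> {RV P >-> S l})
  (X_imcmc : is_imcmc X nu M0 M)
  (reg1 : R1 Phi) (reg2 : R2 M0 M) (reg3 : R3 M)
  (w : nat -> nat -> nat -> R) (hw : forall l, weights (w l)) :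
  exists (d' : measure_display) (Omega' : measurableType d')
    (P' : probability Omega' R)
    (V : forall l, bmfun (S l) R -> {RV P' >-> R}),
  [/\ independent_fields V,
      forall l, centered_gaussian_field (V l),
      forall l (f g : bmfun (S l) R),
        'E_P'[fun omega => (V l f omega * V l g omega)%R]%E =
        (\int[pi l]_x local_covariance (level_M M0 M pi l)
                        (level_Phi (pi 0%N) Phi pi l) f g x)%:E
    & fdd_cvg P (fun n (i : {l & bmfun (S l) R}) =>
                   weighted_field X nu (pi 0%N) Phi w n (projT2 i))
              P' (fun i => V (projT1 i) (projT2 i))].
Proof.
pose Vn n (i : {l & bmfun (S l) R}) := weighted_field X nu (pi 0%N) Phi w n (projT2 i).
pose Q := loeb_measure P.
have bV n i : bm (Vn n i).
  exact: (field_bm M0_inv M_inv X_imcmc reg2 w n (bmfun_bm (projT2 i))).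
have sqV i : exists A : R, forall n, \int[P]_o (Vn n i o) ^+ 2 <= A.
  exact: (field_sq M0_inv M_inv X_imcmc reg2 reg3 hw (bmfun_bm (projT2 i))).
have hV i : measurable_fun setT (loeb_limit Vn i) by exact: loeb_limit_measurable.
have mV i := measurable_mfun (hV i).
(* The limits are bare functions and have to be bundled as random variables; [VE] recovers them. *)
pose V l (f : bmfun (S l) R) : {RV Q >-> R} := projT1 (cid (mV (existT _ l f))).
have VE l (f : bmfun (S l) R) : (V l f : _ -> R) = loeb_limit Vn (existT _ l f).
  exact: (projT2 (cid (mV (existT _ l f)))).
exists _, _, Q, V; split.
- move=> n A hA.
  apply: (limit_independent Phi_pi M0_inv M_inv X_imcmc reg2 reg3 hw) => l ln.
  have := hA l ln; congr (<<s _ >> _); apply/seteqP.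
  by split=> G [f [B [mB ->]]]; exists f, B; rewrite VE.
- move=> l; split=> [n a f|f].
    have := limit_gaussian Phi_pi M0_inv M_inv X_imcmc reg2 reg3 hw f a.
    by under eq_fun do under eq_bigr do rewrite -VE.
  rewrite expectationE VE.
  exact: (limit_mean Phi_pi M0_inv M_inv X_imcmc reg2 reg3 hw).
- move=> l f g; rewrite expectationE.
  have h := limit_covariance Phi_pi M0_inv M_inv X_imcmc reg2 reg3 hw f g.
  by move: h; rewrite -(VE l f) -(VE l g).
- have := limit_fdd Phi_pi M0_inv M_inv X_imcmc reg2 reg3 hw.
  rewrite (_ : (fun i => V (projT1 i) (projT2 i) : _ -> R) = loeb_limit Vn)//.
  by apply/funext => -[l f]; exact: VE.
Qed.
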